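(* Let $\lambda\in\mathbb{C}^*$, $a_1,a_2\in\mathbb{C}$ with $\Re(a_1+a_2)>0$, $c\in v\,\mathbb{C}\{v\}$, and $$Y_{\mathrm{norm}}=x^2\frac{\partial}{\partial x}+(-\lambda+a_1x-c(y_1y_2))y_1\frac{\partial}{\partial y_1}+(\lambda+a_2x+c(y_1y_2))y_2\frac{\partial}{\partial y_2}.$$ For $\psi_{\pm\lambda}\in\Lambda_{\pm\lambda}(Y_{\mathrm{norm}})$ write $\mathcal H_{\pm\lambda}\circ\psi_{\pm\lambda}\circ\mathcal H_{\pm\lambda}^{-1}(x,\mathbf h)=(x,\Psi_{1,\pm\lambda}(\mathbf h),\Psi_{2,\pm\lambda}(\mathbf h))$, with $$\Psi_{1,\lambda}=h_1+\sum_{n\ge2}\Psi_{1,\lambda,n}(h_1h_2)h_1^n,\quad \Psi_{2,\lambda}=h_2+\sum_{n\ge0}\Psi_{2,\lambda,n}(h_1h_2)h_1^n,$$ $$\Psi_{1,-\lambda}=h_1+\sum_{n\ge0}\Psi_{1,-\lambda,n}(h_1h_2)h_2^n,\quad \Psi_{2,-\lambda}=h_2+\sum_{n\ge2}\Psi_{2,-\lambda,n}(h_1h_2)h_2^n,$$ where the $\Psi_{j,\pm\lambda,n}$ are entire functions, and identify $\Psi_{j,\pm\lambda}$ with the sequence $(\Psi_{j,\pm\lambda,n})_n$. Then the maps $$\Lambda_\lambda(Y_{\mathrm{norm}})\to\mathcal E_{1,\lambda}(Y_{\mathrm{norm}})\times\mathcal E_{2,\lambda}(Y_{\mathrm{norm}}),\quad\psi_\lambda\mapsto(\Psi_{1,\lambda},\Psi_{2,\lambda}),$$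 $$\Lambda_{-\lambda}(Y_{\mathrm{norm}})\to\mathcal E_{1,-\lambda}(Y_{\mathrm{norm}})\times\mathcal E_{2,-\lambda}(Y_{\mathrm{norm}}),\quad\psi_{-\lambda}\mapsto(\Psi_{1,-\lambda},\Psi_{2,-\lambda})$$ are bijections.
   Context: Coordinates on $\mathbb{C}^3$ are $(x,\mathbf y)=(x,y_1,y_2)$; $(\mathbb{C}^2,0)$ denotes an arbitrarily small neighborhood of $0$. Fibered means of the form $(x,\mathbf y)\mapsto(x,\phi(x,\mathbf y))$; $\Phi_*(Y)=(\mathrm D\Phi\cdot Y)\circ\Phi^{-1}$. $\mathcal{AS}_{\theta,\eta}$ is the set of open $S\subset\mathbb{C}$ such that for every $\eta'\in[0,\eta[$, $S$ contains some $\{0<|x|<r,\ |\arg x-\theta|<\frac{\eta'}2+\epsilon\}$ with $r,\epsilon>0$. $\Lambda_{\pm\lambda}(Y_{\mathrm{norm}})$ is the group of germs of sectorial fibered diffeomorphisms $\psi$ (holomorphic, biholomorphic onto their image) in domains $S_{\pm\lambda}\times(\mathbb{C}^2,0)$, $S_{\pm\lambda}\in\mathcal{AS}_{\arg(\pm\lambda),\pi}$, tangent to the identity ($\psi(x,\mathbf y)-(x,\mathbf y)=O(\|(x,\mathbf y)\|^2)$ as $(x,\mathbf y)\to 0$), with $\psi_*(Y_{\mathrm{norm}})=Y_{\mathrm{norm}}$, and admitting the identity as Gevrey-1 asymptotic expansion. ($f$ has $\sum f_k(\mathbf y)x^k$ as Gevrey-1 expansion on $S\times\mathbf D(\mathbf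 0,\mathbf r)$ if the $f_k$ are analytic on $\mathbf D(\mathbf 0,\mathbf r)$ and on every closed subsector $|f-\sum_{k<N}f_kx^k|\le AC^NN!|x|^N$ for all $N$, uniformly in $\mathbf y\in\mathbf D(\mathbf 0,\mathbf r)$.) Let $a=a_1+a_2$, $m=1/a$, $c(v)=\sum_{k\ge1}c_kv^k$, with $c_m:=0$ if $m\notin\mathbb{N}_{>0}$, and $\tilde c(v)=m\sum_{k\neq m}\frac{c_k}{k-m}v^k$. Fix a branch of $\log$ on $S_{\pm\lambda}$ and put $x^b=\exp(b\log x)$. Define $$f_1(x,w)=\exp\Big(\frac\lambda x-c_mw^m\log x-\frac{\tilde c(wx^a)}{x}\Big)x^{a_1},\quad f_2(x,w)=\exp\Big(-\frac\lambda x+c_mw^m\log x+\frac{\tilde c(wx^a)}{x}\Big)x^{a_2}.$$ The functions $h_j(x,\mathbf y)=y_j/f_j\big(x,\tfrac{y_1y_2}{x^a}\big)$, $j=1,2$, are first integrals of $Y_{\mathrm{norm}}$ in $S_{\pm\lambda}\times(\mathbb{C}^2,0)$, with $h_1h_2=y_1y_2/x^a$, and $\mathcal H_{\pm\lambda}(x,\mathbf y)=(x,h_1(x,\mathbf y),h_2(x,\mathbf y))$ is a fibered biholomorphism onto its image. For $\psi_{\pm\lambda}\in\Lambda_{\pm\lambda}(Y_{\mathrm{norm}})$ the last two components of $\mathcal H_{\pm\lambda}\circ\psi_{\pm\lambda}\circ\mathcal H_{\pm\lambda}^{-1}$ depend only on $\mathbf h=(h_1,h_2)$ and have expansions of the form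 displayed in the claim. The sets $\mathcal E_{j,\pm\lambda}(Y_{\mathrm{norm}})$ consist of sequences $(\psi_n)$ of entire functions on $\mathbb{C}$, indexed by $n\ge2$ for $\mathcal E_{1,\lambda}$ and $\mathcal E_{2,-\lambda}$ and by $n\ge0$ for $\mathcal E_{2,\lambda}$ and $\mathcal E_{1,-\lambda}$, such that: there exist an open polydisc $\mathbf D(\mathbf 0,\mathbf r)$, $\mathbf r=(r_1,r_2)$, and $S_{\pm\lambda}\in\mathcal{AS}_{\arg(\pm\lambda),\pi}$ such that for all $\tilde r_1,\tilde r_2,\delta>0$ with $\tilde r_i+\delta<r_i$ ($i=1,2$) there is $C>0$ such that for all $x\in S_{\pm\lambda}$ (sign as in $\mathcal E_{j,\pm\lambda}$) and all $w\in\mathbb{C}$ with $|wx^a|\le\tilde r_1\tilde r_2$, for all indices $n$: $|\psi_n(w)|<C\frac{|f_1(x,w)|^{n-1}}{(\tilde r_1+\delta)^n}$ for $\mathcal E_{1,\lambda}$; $|\psi_n(w)|<\frac{C}{|x^a|}\frac{|f_1(x,w)|^{n+1}}{(\tilde r_1+\delta)^n}$ for $\mathcal E_{2,\lambda}$; $|\psi_n(w)|<\frac{C}{|x^a|}\frac{|f_2(x,w)|^{n+1}}{(\tilde r_2+\delta)^n}$ for $\mathcal E_{1,-\lambda}$; $|\psi_n(w)|<C\frac{|f_2(x,w)|^{n-1}}{(\tilde r_2+\delta)^n}$ for $\mathcal E_{2,-\lambda}$. *)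

(* Defs.v *)
From Stdlib Require Import Reals Factorial ClassicalEpsilon.
From Coquelicot Require Import Coquelicot.

Open Scope R_scope.

Definition C2 : NormedModule C_AbsRing :=
  prod_NormedModule C_AbsRing C_NormedModule C_NormedModule.
Definition C3 : NormedModule C_AbsRing :=
  prod_NormedModule C_AbsRing C_NormedModule C2.

(** * Elementary complex analysis *)

Definition Cexp (z : C) : C :=
  (exp (Re z) * cos (Im z), exp (Re z) * sin (Im z)).

Definition CSeries (u : nat -> C) : C :=
  (Series (fun k => Re (u k)), Series (fun k => Im (u k))).

Definition C_CV_radius (c : nat -> C) : Rbar := CV_radius (fun k => Cmod (c k)).

Definition CPSeries (c : nat -> C) (v : C) : C :=
  CSeries (fun k => (c k * v ^ k)%C).

Fixpoint sum_below {V : NormedModule C_AbsRing} (u : nat -> V) (N : nat) : V :=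
  match N with
  | O => zero
  | S n => plus (sum_below u n) (u n)
  end.

(** Differentials are linear over [C_AbsRing], so this is complex
    differentiability (jointly in all variables). *)
Definition holomorphic_on {U V : NormedModule C_AbsRing}
    (D : U -> Prop) (f : U -> V) : Prop :=
  forall p, D p -> ex_filterdiff f (locally p).

Definition entire (f : C -> C) : Prop :=
  forall z : C, ex_derive (K := C_AbsRing) (V := C_NormedModule) f z.

Definition image {U V : Type} (D : U -> Prop) (f : U -> V) (q : V) : Prop :=
  exists p, D p /\ f p = q.

Definition biholomorphic_onto_image {U V : NormedModule C_AbsRing}
    (D : U -> Prop) (f : U -> V) : Prop :=
  holomorphic_on D f /\ open (image D f) /\
  exists g : V -> U,
    holomorphic_on (image D f) g /\ forall p, D p -> g (f p) = p.

(** * Sectors and germs *)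

Definition is_arg (t : R) (z : C) : Prop :=
  z <> 0%C /\ z = (Cmod z * cos t, Cmod z * sin t).

Definition AS (theta eta : R) (S : C -> Prop) : Prop :=
  open S /\
  forall eta' : R, 0 <= eta' < eta ->
    exists r eps : R, 0 < r /\ 0 < eps /\
      forall (x : C) (t : R),
        is_arg t x -> Rabs (t - theta) < eta' / 2 + eps -> Cmod x < r -> S x.

Definition closed_sector (alpha beta rho : R) (x : C) : Prop :=
  Cmod x <= rho /\ exists t, is_arg t x /\ alpha <= t <= beta.

Definition polydisc (r1 r2 : R) (y : C2) : Prop :=
  Cmod (fst y) < r1 /\ Cmod (snd y) < r2.

Definition sector_polydisc (S : C -> Prop) (r1 r2 : R) (p : C3) : Prop :=
  S (fst p) /\ polydisc r1 r2 (snd p).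

(** A germ on a domain [S x (C^2,0)] is represented by any total function
    extending a representative; values off the domain are irrelevant. *)
Definition germ_eq (theta : R) (psi psi' : C3 -> C3) : Prop :=
  exists (S : C -> Prop) (r1 r2 : R),
    AS theta PI S /\ 0 < r1 /\ 0 < r2 /\
    forall p, sector_polydisc S r1 r2 p -> psi p = psi' p.

Definition Gevrey1_expansion {V : NormedModule C_AbsRing}
    (S : C -> Prop) (r1 r2 : R) (f : C3 -> V) (fk : nat -> C2 -> V) : Prop :=
  (forall k, holomorphic_on (polydisc r1 r2) (fk k)) /\
  forall alpha beta rho : R, 0 < rho ->
    (forall x, closed_sector alpha beta rho x -> S x) ->
    exists A B : R, 0 < A /\ 0 < B /\
      forall (N : nat) (x : C) (y : C2),
        closed_sector alpha beta rho x -> polydisc r1 r2 y ->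
        norm (minus (f (x, y))
                (sum_below (fun k => scal (x ^ k : C)%C (fk k y)) N))
        <= A * B ^ N * INR (fact N) * Cmod x ^ N.

(** Coefficients of [(x, y) = (0, y) + (1, 0) x]. *)
Definition identity_coeff (k : nat) (y : C2) : C3 :=
  match k with
  | O => ((RtoC 0, y) : C3)
  | 1%nat => ((RtoC 1, zero) : C3)
  | _ => zero
  end.

Definition fibered_on (D : C3 -> Prop) (psi : C3 -> C3) : Prop :=
  forall p, D p -> fst (psi p) = fst p.

Definition tangent_to_identity_on (D : C3 -> Prop) (psi : C3 -> C3) : Prop :=
  exists K delta : R, 0 < K /\ 0 < delta /\
    forall p : C3, D p -> norm p < delta -> norm (minus (psi p) p) <= K * norm p ^ 2.

(** * The normal form and its sectorial isotropies *)

(** The power series [c] is represented by its coefficients. *)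
Definition Ynorm (lambda a1 a2 : C) (c : nat -> C) (p : C3) : C3 :=
  let x := fst p in
  let y1 := fst (snd p) in
  let y2 := snd (snd p) in
  let cv := CPSeries c (y1 * y2)%C in
  ((x ^ 2, ((- lambda + a1 * x - cv) * y1, (lambda + a2 * x + cv) * y2))%C : C3).

Definition Ynorm_domain (c : nat -> C) (p : C3) : Prop :=
  Rbar_lt (Cmod (fst (snd p) * snd (snd p))%C) (C_CV_radius c).

(** [psi_* Y = Z] on [psi(D)], where [psi_* Y = (D psi . Y) o psi^-1]. *)
Definition pushforward_eq (D : C3 -> Prop) (psi Y Z : C3 -> C3) : Prop :=
  forall p, D p ->
    exists dpsi : C3 -> C3, filterdiff psi (locally p) dpsi /\
      dpsi (Y p) = Z (psi p).

Definition Lambda (theta : R) (lambda a1 a2 : C) (c : nat -> C)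
    (psi : C3 -> C3) : Prop :=
  exists (S : C -> Prop) (r1 r2 : R),
    AS theta PI S /\ 0 < r1 /\ 0 < r2 /\
    let D := sector_polydisc S r1 r2 in
    (forall p, D p -> Ynorm_domain c p /\ Ynorm_domain c (psi p)) /\
    biholomorphic_onto_image D psi /\
    fibered_on D psi /\
    tangent_to_identity_on D psi /\
    pushforward_eq D psi (Ynorm lambda a1 a2 c) (Ynorm lambda a1 a2 c) /\
    Gevrey1_expansion S r1 r2 psi identity_coeff.

(** * First integrals *)

Definition log_branch (S : C -> Prop) (L : C -> C) : Prop :=
  forall x : C, S x -> continuous L x /\ Cexp (L x) = x.

Definition xpow (L : C -> C) (x b : C) : C := Cexp (b * L x)%C.

(** [c_m w^m], to be read as [0] unless [m] is a positive natural number. *)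
Definition resonant_term (c : nat -> C) (m w : C) : C :=
  match excluded_middle_informative
          (exists k : nat, (0 < k)%nat /\ m = RtoC (INR k)) with
  | left H =>
      let k := proj1_sig (constructive_indefinite_description _ H) in
      (c k * w ^ k)%C
  | right _ => 0%C
  end.

Definition tilde_coeff (c : nat -> C) (m : C) (k : nat) : C :=
  match k with
  | O => 0%C
  | _ => if Ceq_dec (RtoC (INR k)) m then 0%C
         else (m * (c k / (RtoC (INR k) - m)))%C
  end.

Definition f_exponent (lambda a1 a2 : C) (c : nat -> C) (L : C -> C)
    (x w : C) : C :=
  let a := (a1 + a2)%C in
  let m := (/ a)%C in
  (lambda / x - resonant_term c m w * L x
   - CPSeries (tilde_coeff c m) (w * xpow L x a) / x)%C.

Definition f1 (lambda a1 a2 : C) (c : nat -> C) (L : C -> C) (x w : C) : C :=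
  (Cexp (f_exponent lambda a1 a2 c L x w) * xpow L x a1)%C.

Definition f2 (lambda a1 a2 : C) (c : nat -> C) (L : C -> C) (x w : C) : C :=
  (Cexp (- f_exponent lambda a1 a2 c L x w) * xpow L x a2)%C.

Definition Hmap (lambda a1 a2 : C) (c : nat -> C) (L : C -> C) (p : C3) : C3 :=
  let x := fst p in
  let y1 := fst (snd p) in
  let y2 := snd (snd p) in
  let w := (y1 * y2 / xpow L x (a1 + a2))%C in
  ((x, (y1 / f1 lambda a1 a2 c L x w, y2 / f2 lambda a1 a2 c L x w))%C : C3).

(** * Sequences of entire functions *)

(** A sequence [(psi_n)] indexed by [n >= n0] is stored as
    [fun k => psi_(n0 + k)]. *)
Definition eseq : Type := nat -> C -> C.

(** [bound x w rt1 rt2 delta n] is the right-hand side without the factor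
    [C]; [S0] is the domain of the branch [L] of the logarithm. *)
Definition Eset (theta : R) (a : C) (c : nat -> C) (S0 : C -> Prop)
    (L : C -> C) (n0 : nat)
    (bound : C -> C -> R -> R -> R -> nat -> R) (psi : eseq) : Prop :=
  (forall k, entire (psi k)) /\
  exists (r1 r2 : R) (S : C -> Prop),
    0 < r1 /\ 0 < r2 /\ Rbar_lt (r1 * r2) (C_CV_radius c) /\
    AS theta PI S /\ (forall x, S x -> S0 x) /\
    forall rt1 rt2 delta : R,
      0 < rt1 -> 0 < rt2 -> 0 < delta -> rt1 + delta < r1 -> rt2 + delta < r2 ->
      exists K : R, 0 < K /\
        forall x w : C, S x -> Cmod (w * xpow L x a)%C <= rt1 * rt2 ->
        forall k : nat,
          Cmod (psi k w) < K * bound x w rt1 rt2 delta (n0 + k)%nat.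

Definition E1_plus (theta : R) (lambda a1 a2 : C) (c : nat -> C)
    (S0 : C -> Prop) (L : C -> C) : eseq -> Prop :=
  Eset theta (a1 + a2)%C c S0 L 2 (fun x w rt1 rt2 delta n =>
    Cmod (f1 lambda a1 a2 c L x w) ^ (n - 1) / (rt1 + delta) ^ n).

Definition E2_plus (theta : R) (lambda a1 a2 : C) (c : nat -> C)
    (S0 : C -> Prop) (L : C -> C) : eseq -> Prop :=
  Eset theta (a1 + a2)%C c S0 L 0 (fun x w rt1 rt2 delta n =>
    / Cmod (xpow L x (a1 + a2)%C)
    * (Cmod (f1 lambda a1 a2 c L x w) ^ (n + 1) / (rt1 + delta) ^ n)).

Definition E1_minus (theta : R) (lambda a1 a2 : C) (c : nat -> C)
    (S0 : C -> Prop) (L : C -> C) : eseq -> Prop :=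
  Eset theta (a1 + a2)%C c S0 L 0 (fun x w rt1 rt2 delta n =>
    / Cmod (xpow L x (a1 + a2)%C)
    * (Cmod (f2 lambda a1 a2 c L x w) ^ (n + 1) / (rt2 + delta) ^ n)).

Definition E2_minus (theta : R) (lambda a1 a2 : C) (c : nat -> C)
    (S0 : C -> Prop) (L : C -> C) : eseq -> Prop :=
  Eset theta (a1 + a2)%C c S0 L 2 (fun x w rt1 rt2 delta n =>
    Cmod (f2 lambda a1 a2 c L x w) ^ (n - 1) / (rt2 + delta) ^ n).

(** * The conjugate of an isotropy by the first integrals *)

(** [z = base + sum_(n >= n0) P_n(w) u^n]. *)
Definition is_expansion (n0 : nat) (P : eseq) (base w u z : C) : Prop :=
  is_series (K := C_AbsRing) (V := C_NormedModule)
    (fun k => (P k w * u ^ (n0 + k))%C) (z - base)%C.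

(** [Psi h z] means [z = (Psi_1(h), Psi_2(h))]. The germ identity
    [H o psi o H^-1 (x, h) = (x, Psi_1(h), Psi_2(h))] is required at every
    [(x, h)] in the image by [H] of some [S x D(0, r)]. *)
Definition conjugate_is (theta : R) (lambda a1 a2 : C) (c : nat -> C)
    (S0 : C -> Prop) (L : C -> C) (psi : C3 -> C3) (Psi : C2 -> C2 -> Prop)
    : Prop :=
  exists (S : C -> Prop) (r1 r2 : R),
    AS theta PI S /\ (forall x, S x -> S0 x) /\ 0 < r1 /\ 0 < r2 /\
    forall p : C3, sector_polydisc S r1 r2 p ->
      Ynorm_domain c p /\ Ynorm_domain c (psi p) /\
      forall (x : C) (h : C2), Hmap lambda a1 a2 c L p = (x, h) ->
        exists z : C2, Psi h z /\ Hmap lambda a1 a2 c L (psi p) = (x, z).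

Definition Psi_plus (P : eseq * eseq) (h z : C2) : Prop :=
  let h1 : C := fst h in
  let h2 : C := snd h in
  is_expansion 2 (fst P) h1 (h1 * h2)%C h1 (fst z) /\
  is_expansion 0 (snd P) h2 (h1 * h2)%C h1 (snd z).

Definition Psi_minus (P : eseq * eseq) (h z : C2) : Prop :=
  let h1 : C := fst h in
  let h2 : C := snd h in
  is_expansion 0 (fst P) h1 (h1 * h2)%C h2 (fst z) /\
  is_expansion 2 (snd P) h2 (h1 * h2)%C h2 (snd z).

Definition expansion_of (Psi : eseq * eseq -> C2 -> C2 -> Prop)
    (theta : R) (lambda a1 a2 : C) (c : nat -> C)
    (S0 : C -> Prop) (L : C -> C) (psi : C3 -> C3) (P : eseq * eseq) : Prop :=
  (forall k, entire (fst P k)) /\ (forall k, entire (snd P k)) /\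
  conjugate_is theta lambda a1 a2 c S0 L psi (Psi P).

(** [graph] is, on [X], the graph of a well-defined map, and this map induces
    a bijection from [X] modulo [eqX] onto [Y]. *)
Definition induces_bijection {A B : Type} (eqX : A -> A -> Prop)
    (X : A -> Prop) (Y : B -> Prop) (graph : A -> B -> Prop) : Prop :=
  exists F : A -> B,
    (forall x, X x -> forall y, graph x y <-> y = F x) /\
    (forall x, X x -> Y (F x)) /\
    (forall x x', X x -> X x' -> (F x = F x' <-> eqX x x')) /\
    (forall y, Y y -> exists x, X x /\ F x = y).

(* Main.v *)
Require Import Defs.
From Stdlib Require Import Reals Lra Lia Psatz ClassicalEpsilon FunctionalExtensionality.
From Coquelicot Require Import Coquelicot.
Open Scope R_scope.

(** The functions [h_1], [h_2] are first integrals, so in these coordinates an isotropy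
    [psi] does not depend on [x]. The difference [(h_1 o psi - h_1) f_1] is holomorphic on
    [S x D(0, r)] and, by Gevrey flatness, [O(|x|^N)] on subsectors. Its Laurent coefficients
    on the circles [|h_1| = q / |f_1(x, w)|], [w = h_1 h_2] fixed, depend neither on [q]
    (Cauchy) nor on [x] (first integral). Letting [x -> 0] in the direction of [lambda],
    where [f_1] is exponentially large, kills the coefficients of low order, and Cauchy's
    estimate at every [x] is exactly the bound that defines [E_1]; likewise for [E_2].

    Conversely, these bounds hold at every [x'], hence at the [x'] with
    [lambda / x' = lambda / x - s |lambda / x|], where [|f_1(x', w)|] is smaller than
    [|f_1(x, w)|] by a factor [exp (- kappa / |x|)]. The series therefore converge near [x]
    and define a map exponentially close to the identity, whose inverse is the limit of
    holomorphic Picard iterates.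

    Exchanging [y_1] and [y_2] turns [(lambda, a_1, a_2, c)] into [(- lambda, a_2, a_1, - c)]
    and deduces the case of [- lambda] from that of [lambda]. *)

(** * Complex differentiation *)

(** The coefficients are entire because [x] is free: as [Re (a1 + a2) > 0], every [w] satisfies
    [|w x^a| < r^2] once [x] is small, so every [w] is attained in the polydisc, and independence of
    [x] makes the local definitions agree. The first obstacle is that [h_1] and [h_2] live on
    exponential scales. Multiplied by [f_j], an increment of [h_j] becomes a displacement of [y_j],
    up to the exponential of a difference of exponents. That difference costs a factor
    [(1 + |log x|) / |x|], which flatness beats: powers of [x] in one direction,
    [exp (- kappa / |x|)] in the other. The second is the shape of the domains: a member of [AS]
    contains sectors of every half-opening below [PI / 2], but with radii that depend on the
    opening. They are replaced by unions of convex cones with prescribed radii, and uniform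
    estimates are made cone by cone. In each cone [Re (lambda / x)] is at least a fixed multiple of
    [|lambda / x|], so a proportional step of [lambda / x] in the direction of decay ends in a wider
    cone; the exponential gain rests on this. *)

Ltac cring := match goal with |- ?a = ?b => change (@eq C a b) end; cbv beta; ring.

Ltac cfield := match goal with |- ?a = ?b => change (@eq C a b) end; cbv beta; field.

(** The definition of [filterdiff] quantifies over all limits of the filter and over uniform balls;
    here the only limit is [p], and the balls are those of the norm. *)
Lemma filterdiff_eps {U V : NormedModule C_AbsRing} (f : U -> V) (p : U) (l : U -> V) :
  filterdiff f (locally p) l <->
  is_linear l /\ forall eps, 0 < eps -> exists d, 0 < d /\ forall q, norm (minus q p) < d ->
    norm (minus (minus (f q) (f p)) (l (minus q p))) <= eps * norm (minus q p).
Proof.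
  split; intros [Hl H]; split; trivial.
  - intros eps He.
    assert (Hp : is_filter_lim (locally p) p) by (intros P HP; exact HP).
    specialize (H p Hp (mkposreal eps He)). simpl in H.
    apply locally_norm_le_locally in H. destruct H as [d Hd].
    exists d; split; [apply cond_pos|]. intros q Hq. apply Hd. exact Hq.
  - intros x Hx eps.
    assert (x = p) by (symmetry; apply is_filter_lim_locally_unique, Hx). subst x.
    destruct (H eps (cond_pos eps)) as [d [Hd Hq]].
    apply locally_le_locally_norm. exists (mkposreal d Hd). intros q. apply Hq.
Qed.

Lemma norm_Cmod (z : C) : norm (K := C_AbsRing) (V := C_NormedModule) z = Cmod z.
Proof. reflexivity. Qed.

Notation cseries := (is_series (K := C_AbsRing) (V := C_NormedModule)).
Notation csum := (sum_n (G := C_AbelianMonoid)).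
Notation cfd f p l := (filterdiff (K := C_AbsRing) (V := C_NormedModule) f (locally p) l).
Notation hol f p := (ex_filterdiff (K := C_AbsRing) (V := C_NormedModule) f (locally p)).

Lemma cfd_ext_l {U : NormedModule C_AbsRing} (f : U -> C) p (l m : U -> C) :
  (forall k, l k = m k) -> cfd f p l -> cfd f p m.
Proof. intros H Hf. apply (filterdiff_ext_lin f l m); assumption. Qed.

Lemma cfd_plus {U : NormedModule C_AbsRing} (f g : U -> C) p (l m : U -> C) :
  cfd f p l -> cfd g p m -> cfd (fun q => f q + g q)%C p (fun k => l k + m k)%C.
Proof. intros Hf Hg. exact (filterdiff_plus_fct (V := C_NormedModule) f g l m Hf Hg). Qed.

Lemma cfd_mult {U : NormedModule C_AbsRing} (f g : U -> C) p (l m : U -> C) :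
  cfd f p l -> cfd g p m ->
  cfd (fun q => f q * g q)%C p (fun k => l k * g p + f p * m k)%C.
Proof.
  intros Hf Hg. apply filterdiff_eps in Hf. apply filterdiff_eps in Hg.
  destruct Hf as [Ll Hf]; destruct Hg as [Lm Hg].
  destruct (linear_norm _ Ll) as [A [HA HlA]]. destruct (linear_norm _ Lm) as [B [HB HmB]].
  apply filterdiff_eps. split.
  - split.
    + intros x y. rewrite (linear_plus _ Ll), (linear_plus _ Lm).
      change (((l x + l y) * g p + f p * (m x + m y))%C = (l x * g p + f p * m x + (l y * g p + f p * m y))%C).
      ring.
    + intros k x. rewrite (linear_scal _ Ll), (linear_scal _ Lm).
      change (((k * l x) * g p + f p * (k * m x))%C = (k * (l x * g p + f p * m x))%C). ring.
    + exists (A * Cmod (g p) + Cmod (f p) * B + 1). split.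
      * generalize (Cmod_ge_0 (g p)) (Cmod_ge_0 (f p)); intros. nra.
      * intros x. rewrite norm_Cmod. eapply Rle_trans; [apply Cmod_triangle|].
        rewrite !Cmod_mult. specialize (HlA x). specialize (HmB x). rewrite norm_Cmod in HlA, HmB.
        generalize (Cmod_ge_0 (g p)) (Cmod_ge_0 (f p)) (norm_ge_0 x); intros. nra.
  - intros eps He.
    set (G := Cmod (g p)). set (F := Cmod (f p)).
    assert (HG : 0 <= G) by apply Cmod_ge_0. assert (HF : 0 <= F) by apply Cmod_ge_0.
    destruct (Hf (Rmin 1 (eps / (4 * (G + 1)))))  as [d1 [Hd1 H1]].
    { apply Rmin_pos; [lra|]. apply Rdiv_lt_0_compat; lra. }
    destruct (Hg (Rmin 1 (eps / (4 * (F + 1)))))  as [d2 [Hd2 H2]].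
    { apply Rmin_pos; [lra|]. apply Rdiv_lt_0_compat; lra. }
    (* Within this radius the product of the two increments, at most [(A + 1) (B + 1) n^2], is at
       most [eps / 4 * n]. *)
    set (d3 := eps / (4 * ((A + 1) * (B + 1)))).
    assert (Hd3 : 0 < d3). { apply Rdiv_lt_0_compat; nra. }
    exists (Rmin (Rmin d1 d2) d3). split; [repeat apply Rmin_pos; assumption|].
    intros q Hq.
    assert (Hq1 : norm (minus q p) < d1).
    { eapply Rlt_le_trans; [exact Hq|]. eapply Rle_trans; apply Rmin_l. }
    assert (Hq2 : norm (minus q p) < d2).
    { eapply Rlt_le_trans; [exact Hq|]. eapply Rle_trans; [apply Rmin_l|apply Rmin_r]. }
    assert (Hq3 : norm (minus q p) < d3).
    { eapply Rlt_le_trans; [exact Hq|]. apply Rmin_r. }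
    specialize (H1 q Hq1). specialize (H2 q Hq2).
    set (k := minus q p) in *. set (n := norm k) in *.
    assert (Hn : 0 <= n) by apply norm_ge_0.
    specialize (HlA k). specialize (HmB k).
    set (rf := (f q - f p - l k)%C). set (rg := (g q - g p - m k)%C).
    change (norm (minus (minus (f q) (f p)) (l k))) with (Cmod rf) in H1.
    change (norm (minus (minus (g q) (g p)) (m k))) with (Cmod rg) in H2.
    rewrite norm_Cmod in HlA, HmB. fold n in HlA, HmB.
    change (Cmod (f q * g q - f p * g p - (l k * g p + f p * m k))%C <= eps * n).
    replace (f q * g q - f p * g p - (l k * g p + f p * m k))%C
      with (rf * g p + f p * rg + (l k + rf) * (m k + rg))%C by (unfold rf, rg; ring).
    assert (E1 : Cmod rf <= eps / (4 * (G + 1)) * n).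
    { eapply Rle_trans; [exact H1|]. apply Rmult_le_compat_r; [exact Hn|apply Rmin_r]. }
    assert (E1' : Cmod rf <= 1 * n).
    { eapply Rle_trans; [exact H1|]. apply Rmult_le_compat_r; [exact Hn|apply Rmin_l]. }
    assert (E2 : Cmod rg <= eps / (4 * (F + 1)) * n).
    { eapply Rle_trans; [exact H2|]. apply Rmult_le_compat_r; [exact Hn|apply Rmin_r]. }
    assert (E2' : Cmod rg <= 1 * n).
    { eapply Rle_trans; [exact H2|]. apply Rmult_le_compat_r; [exact Hn|apply Rmin_l]. }
    eapply Rle_trans; [apply Cmod_triangle|].
    eapply Rle_trans; [apply Rplus_le_compat_r, Cmod_triangle|].
    rewrite !Cmod_mult. fold G F.
    assert (T1 : Cmod rf * G <= eps / 4 * n).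
    { apply Rle_trans with (eps / (4 * (G + 1)) * n * G); [apply Rmult_le_compat_r; assumption|].
      replace (eps / 4 * n) with (eps / (4 * (G + 1)) * n * (G + 1)) by (field; lra).
      apply Rmult_le_compat_l; [|lra]. apply Rmult_le_pos; [|exact Hn].
      apply Rlt_le, Rdiv_lt_0_compat; lra. }
    assert (T2 : F * Cmod rg <= eps / 4 * n).
    { rewrite Rmult_comm.
      apply Rle_trans with (eps / (4 * (F + 1)) * n * F); [apply Rmult_le_compat_r; assumption|].
      replace (eps / 4 * n) with (eps / (4 * (F + 1)) * n * (F + 1)) by (field; lra).
      apply Rmult_le_compat_l; [|lra]. apply Rmult_le_pos; [|exact Hn].
      apply Rlt_le, Rdiv_lt_0_compat; lra. }
    assert (T3 : Cmod (l k + rf) * Cmod (m k + rg) <= eps / 4 * n).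
    { apply Rle_trans with (((A + 1) * n) * ((B + 1) * n)).
      - apply Rmult_le_compat; try apply Cmod_ge_0.
        + eapply Rle_trans; [apply Cmod_triangle|]. lra.
        + eapply Rle_trans; [apply Cmod_triangle|]. lra.
      - replace (eps / 4 * n) with ((A+1)*(B+1)*d3*n) by (unfold d3; field; lra).
        replace (((A + 1) * n) * ((B + 1) * n)) with ((A+1)*(B+1)*n*n) by ring.
        apply Rmult_le_compat_r; [exact Hn|]. apply Rmult_le_compat_l; [nra|]. lra. }
    nra.
Qed.

Lemma cfd_const {U : NormedModule C_AbsRing} (z : C) (p : U) : cfd (fun _ : U => z) p (fun _ : U => RtoC 0).
Proof. exact (filterdiff_const (V := C_NormedModule) z). Qed.

Lemma cfd_ext_loc {U : NormedModule C_AbsRing} (f g : U -> C) p l :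
  locally p (fun q => f q = g q) -> cfd f p l -> cfd g p l.
Proof.
  intros H Hf. apply (filterdiff_ext_locally (V := C_NormedModule) f g p l); [|exact Hf].
  exact H.
Qed.

Lemma pair_filterdiff {T U V : NormedModule C_AbsRing} (f : T -> U) (g : T -> V) p l m :
  filterdiff f (locally p) l -> filterdiff g (locally p) m ->
  filterdiff (V := prod_NormedModule C_AbsRing U V) (fun q => (f q, g q)) (locally p) (fun k => (l k, m k)).
Proof.
  intros Hf Hg.
  apply (filterdiff_comp_2 (W := prod_NormedModule C_AbsRing U V) f g (fun a b => (a, b)) l m (fun a b => (a, b)) Hf Hg).
  apply filterdiff_ext_lin with (fun t : prod_NormedModule C_AbsRing U V => t).
  - apply (filterdiff_ext (fun t : prod_NormedModule C_AbsRing U V => t)).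
    + intros [a b]; reflexivity.
    + apply filterdiff_linear. apply is_linear_id.
  - intros [a b]; reflexivity.
Qed.

(** The value of the derivative is part of the predicate, so that being a first integral can be
    stated as [cderiv f z 0]. *)
Definition cderiv (f : C -> C) (z d : C) : Prop :=
  forall eps, 0 < eps -> exists del, 0 < del /\ forall w, Cmod (w - z) < del ->
    Cmod (f w - f z - d * (w - z)) <= eps * Cmod (w - z).

Lemma is_linear_Cmult (d : C) : is_linear (U := C_NormedModule) (V := C_NormedModule) (fun k : C => d * k)%C.
Proof.
  split.
  - intros x y. change ((d * (x + y))%C = (d * x + d * y)%C). ring.
  - intros k x. change ((d * (k * x))%C = (k * (d * x))%C). ring.
  - exists (Cmod d + 1). split; [generalize (Cmod_ge_0 d); lra|].
    intros x. change (Cmod (d * x)%C <= (Cmod d + 1) * Cmod x). rewrite Cmod_mult.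
    generalize (Cmod_ge_0 x); nra.
Qed.

Lemma cderiv_cfd (f : C -> C) (z d : C) : cderiv f z d <-> filterdiff (U := C_NormedModule) (V := C_NormedModule) f (locally (T := C_NormedModule) z) (fun k : C => d * k)%C.
Proof.
  rewrite filterdiff_eps. split.
  - intros H; split; [apply is_linear_Cmult|exact H].
  - intros [_ H]; exact H.
Qed.

Lemma cderiv_is_derive (f : C -> C) (z d : C) :
  cderiv f z d <-> is_derive (K := C_AbsRing) (V := C_NormedModule) f z d.
Proof.
  split.
  - intros H. split.
    + apply is_linear_scal_l.
    + intros x Hx.
      assert (x = z) by (symmetry; apply is_filter_lim_locally_unique, Hx). subst x.
      intros eps. destruct (H eps (cond_pos eps)) as [del [Hd Hw]].
      exists (mkposreal del Hd). intros w Hwz.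
      change (Cmod (f w - f z - (w - z) * d)%C <= eps * Cmod (w - z)%C).
      rewrite (Cmult_comm _ d). apply Hw. exact Hwz.
  - intros [_ H] eps He.
    assert (Hp : is_filter_lim (locally (T := AbsRing_UniformSpace C_AbsRing) z) z) by (intros P HP; exact HP).
    specialize (H z Hp (mkposreal eps He)). destruct H as [del Hd].
    exists del; split; [apply cond_pos|]. intros w Hw.
    specialize (Hd w Hw). rewrite (Cmult_comm d). exact Hd.
Qed.

Lemma cderiv_ext f g z d : (forall w, f w = g w) -> cderiv f z d -> cderiv g z d.
Proof.
  intros H Hf eps He. destruct (Hf eps He) as [del [Hd Hw]]. exists del; split; trivial.
  intros w. rewrite <- !H. apply Hw.
Qed.

Lemma cderiv_ext_loc f g z d r : 0 < r -> (forall w, Cmod (w - z) < r -> f w = g w) -> cderiv f z d -> cderiv g z d.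
Proof.
  intros Hr H Hf eps He. destruct (Hf eps He) as [del [Hd Hw]]. exists (Rmin r del); split.
  - now apply Rmin_pos.
  - intros w Hwz. rewrite <- !H.
    + apply Hw. eapply Rlt_le_trans; [exact Hwz|apply Rmin_r].
    + replace (z - z)%C with (RtoC 0) by ring. now rewrite Cmod_0.
    + eapply Rlt_le_trans; [exact Hwz|apply Rmin_l].
Qed.

Lemma cderiv_eq (f : C -> C) (z d d' : C) : d = d' -> cderiv f z d -> cderiv f z d'.
Proof. now intros ->. Qed.

Lemma cderiv_const (a z : C) : cderiv (fun _ => a) z 0%C.
Proof.
  intros eps He. exists 1. split; [lra|]. intros w _.
  replace (a - a - 0 * (w - z))%C with (RtoC 0) by ring.
  rewrite Cmod_0. generalize (Cmod_ge_0 (w - z)); nra.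
Qed.

Lemma cderiv_id (z : C) : cderiv (fun w => w) z 1%C.
Proof.
  intros eps He. exists 1. split; [lra|]. intros w _.
  replace (w - z - 1 * (w - z))%C with (RtoC 0) by ring.
  rewrite Cmod_0. generalize (Cmod_ge_0 (w - z)); nra.
Qed.

Lemma cderiv_plus (f g : C -> C) (z d e : C) : cderiv f z d -> cderiv g z e -> cderiv (fun w => f w + g w)%C z (d + e)%C.
Proof.
  rewrite !cderiv_cfd. intros Hf Hg. eapply cfd_ext_l; [|apply cfd_plus; eassumption].
  intros k; cring.
Qed.

Lemma cderiv_mult (f g : C -> C) (z d e : C) :
  cderiv f z d -> cderiv g z e -> cderiv (fun w => f w * g w)%C z (d * g z + f z * e)%C.
Proof.
  rewrite !cderiv_cfd. intros Hf Hg.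
  eapply cfd_ext_l; [|apply cfd_mult; eassumption].
  intros k; cring.
Qed.

Lemma cderiv_opp (f : C -> C) (z d : C) : cderiv f z d -> cderiv (fun w => - f w)%C z (- d)%C.
Proof.
  intros Hf. apply (cderiv_ext (fun w => (- (1)) * f w)%C); [intros; ring|].
  eapply cderiv_eq; [|apply cderiv_mult; [apply cderiv_const|exact Hf]]. cring.
Qed.

Lemma cderiv_minus (f g : C -> C) (z d e : C) : cderiv f z d -> cderiv g z e -> cderiv (fun w => f w - g w)%C z (d - e)%C.
Proof. intros Hf Hg. apply cderiv_plus; [exact Hf|now apply cderiv_opp]. Qed.

Lemma cfd_comp {U : NormedModule C_AbsRing} (g : C -> C) (f : U -> C) p l d :
  cfd f p l -> cderiv g (f p) d -> cfd (fun q => g (f q)) p (fun k => d * l k)%C.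
Proof.
  intros Hf Hg. apply cderiv_cfd in Hg.
  exact (filterdiff_comp' (V := C_NormedModule) (W := C_NormedModule) f g p l _ Hf Hg).
Qed.

Lemma cderiv_comp (f g : C -> C) (z d e : C) :
  cderiv f z d -> cderiv g (f z) e -> cderiv (fun w => g (f w)) z (e * d)%C.
Proof.
  intros Hf Hg. apply cderiv_cfd. apply cderiv_cfd in Hf.
  eapply cfd_ext_l; [|apply cfd_comp; eassumption]. intros k; cring.
Qed.

Lemma cderiv_continuous (f : C -> C) (z d : C) : cderiv f z d ->
  forall eps, 0 < eps -> exists del, 0 < del /\ forall w, Cmod (w - z) < del -> Cmod (f w - f z) < eps.
Proof.
  intros H eps He. destruct (H 1 Rlt_0_1) as [del [Hd Hw]].
  set (K := Cmod d + 1). assert (HK : 0 < K + 1) by (unfold K; generalize (Cmod_ge_0 d); lra).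
  exists (Rmin del (eps / (K + 1))). split.
  - apply Rmin_pos; [lra|]. apply Rdiv_lt_0_compat; lra.
  - intros w Hwz. assert (H1 : Cmod (w - z) < del) by (eapply Rlt_le_trans; [exact Hwz|apply Rmin_l]).
    assert (H2 : Cmod (w - z) < eps / (K + 1)) by (eapply Rlt_le_trans; [exact Hwz|apply Rmin_r]).
    specialize (Hw w H1).
    replace (f w - f z)%C with ((f w - f z - d * (w - z)) + d * (w - z))%C by ring.
    eapply Rle_lt_trans; [apply Cmod_triangle|]. rewrite Cmod_mult.
    apply Rle_lt_trans with (K * Cmod (w - z)); [unfold K; lra|].
    apply Rmult_lt_compat_r with (r := K + 1) in H2; [|lra].
    replace (eps / (K + 1) * (K + 1)) with eps in H2 by (field; lra).
    generalize (Cmod_ge_0 (w - z)); lra.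
Qed.

Lemma cderiv_inv (z : C) : z <> 0%C -> cderiv Cinv z (- / (z * z))%C.
Proof.
  intros Hz eps He.
  assert (Hm : 0 < Cmod z) by (apply Cmod_gt_0; assumption).
  set (m := Cmod z) in *.
  exists (Rmin (m / 2) (eps * m ^ 3 / 2)). split.
  { apply Rmin_pos; [lra|]. assert (0 < m^3) by now apply pow_lt. nra. }
  intros w Hw.
  assert (H1 : Cmod (w - z) < m / 2) by (eapply Rlt_le_trans; [exact Hw|apply Rmin_l]).
  assert (H2 : Cmod (w - z) < eps * m ^ 3 / 2) by (eapply Rlt_le_trans; [exact Hw|apply Rmin_r]).
  assert (Hw0 : m / 2 < Cmod w).
  { assert (m <= Cmod w + Cmod (w - z)); [|lra].
    unfold m. replace z with (w + - (w - z))%C at 1 by ring.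
    eapply Rle_trans; [apply Cmod_triangle|]. rewrite Cmod_opp. lra. }
  assert (Hw00 : w <> 0%C) by (apply Cmod_gt_0; lra).
  replace (/ w - / z - - / (z * z) * (w - z))%C with ((w - z) * (w - z) / (w * (z * z)))%C
    by (field; split; assumption).
  unfold Cdiv. rewrite !Cmod_mult, Cmod_inv, !Cmod_mult by (repeat apply Cmult_neq_0; assumption). fold m.
  rewrite Rmult_comm, <- Rmult_assoc. apply Rmult_le_compat_r; [apply Cmod_ge_0|].
  apply Rmult_le_reg_l with (Cmod w * (m * m)); [repeat apply Rmult_lt_0_compat; lra|].
  replace (Cmod w * (m * m) * (/ (Cmod w * (m * m)) * Cmod (w - z))) with (Cmod (w - z)) by (field; lra).
  simpl in H2.
  apply Rle_trans with (eps * m ^ 3 / 2); [simpl; lra|].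
  replace (eps * m ^ 3 / 2) with (m / 2 * (m * m * eps)) by (simpl; field).
  replace (Cmod w * (m * m) * eps) with (Cmod w * (m * m * eps)) by ring.
  apply Rmult_le_compat_r; [|lra]. assert (0 < m * m) by nra. nra.
Qed.

Lemma cderiv_Cinv (f : C -> C) (z d : C) : f z <> 0%C -> cderiv f z d -> cderiv (fun w => / f w)%C z (- d / (f z * f z))%C.
Proof.
  intros Hz Hf. eapply cderiv_eq; [|apply (cderiv_comp f Cinv z d); [exact Hf|apply cderiv_inv, Hz]].
  cfield. exact Hz.
Qed.

Lemma cderiv_div (f g : C -> C) (z d e : C) : g z <> 0%C -> cderiv f z d -> cderiv g z e ->
  cderiv (fun w => f w / g w)%C z ((d * g z - f z * e) / (g z * g z))%C.
Proof.
  intros Hz Hf Hg. eapply cderiv_eq; [|apply cderiv_mult; [exact Hf|apply cderiv_Cinv; eassumption]].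
  cfield. exact Hz.
Qed.

Lemma cderiv_pow (n : nat) (z : C) : cderiv (fun w => w ^ n)%C z (INR n * z ^ (n - 1))%C.
Proof.
  induction n as [|n IH].
  - apply (cderiv_ext (fun _ => RtoC 1)); [intros; reflexivity|].
    eapply cderiv_eq; [|apply cderiv_const]. simpl. cring.
  - eapply cderiv_ext; [|eapply cderiv_eq; [|apply cderiv_mult; [apply cderiv_id|exact IH]]].
    + intros w; reflexivity.
    + rewrite S_INR, RtoC_plus. replace (S n - 1)%nat with n by lia.
      destruct n as [|n]; simpl.
      * ring.
      * replace (n - 0)%nat with n by lia. ring.
Qed.

Lemma RtoC_neq0 x : x <> 0 -> RtoC x <> 0%C.
Proof. intros H E. apply H. now apply RtoC_inj. Qed.

(** * The complex exponential and the mean value inequality *)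

Lemma Cexp_plus (u v : C) : Cexp (u + v) = (Cexp u * Cexp v)%C.
Proof.
  destruct u as [a b], v as [c d]. unfold Cexp, Cmult, Cplus; simpl.
  rewrite exp_plus, cos_plus, sin_plus. f_equal; ring.
Qed.

Lemma Cexp_0 : Cexp 0 = 1%C.
Proof. unfold Cexp, RtoC; simpl. rewrite exp_0, cos_0, sin_0. f_equal; ring. Qed.

Lemma Cmod_Cexp (z : C) : Cmod (Cexp z) = exp (Re z).
Proof.
  unfold Cmod, Cexp; simpl. set (e := exp (Re z)).
  replace (e * cos (Im z) * (e * cos (Im z) * 1) + e * sin (Im z) * (e * sin (Im z) * 1))
    with (e * e * (Rsqr (sin (Im z)) + Rsqr (cos (Im z)))) by (unfold Rsqr; ring).
  rewrite sin2_cos2, Rmult_1_r. apply sqrt_square. apply Rlt_le, exp_pos.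
Qed.

Lemma Cexp_neq0 (z : C) : Cexp z <> 0%C.
Proof. apply Cmod_gt_0. rewrite Cmod_Cexp. apply exp_pos. Qed.

Lemma Cexp_opp (z : C) : Cexp (- z) = (/ Cexp z)%C.
Proof.
  assert (H : (Cexp (- z) * Cexp z = 1)%C) by (rewrite <- Cexp_plus, <- Cexp_0; f_equal; ring).
  replace (/ Cexp z)%C with ((Cexp (- z) * Cexp z) * / Cexp z)%C by (rewrite H; ring).
  field. apply Cexp_neq0.
Qed.

Lemma Cexp_minus (u v : C) : Cexp (u - v) = (Cexp u / Cexp v)%C.
Proof. unfold Cminus, Cdiv. now rewrite Cexp_plus, Cexp_opp. Qed.

Lemma Cexp_nat (n : nat) (z : C) : Cexp (INR n * z) = (Cexp z ^ n)%C.
Proof.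
  induction n as [|n IH].
  - simpl. rewrite <- Cexp_0. f_equal. ring.
  - rewrite S_INR, RtoC_plus. simpl. rewrite <- IH, <- Cexp_plus. f_equal. ring.
Qed.

Lemma Re_le_Cmod' (z : C) : Rabs (Re z) <= Cmod z.
Proof. apply Rle_trans with (Rmax (Rabs (fst z)) (Rabs (snd z))); [apply Rmax_l|apply Rmax_Cmod]. Qed.

Lemma Im_le_Cmod' (z : C) : Rabs (Im z) <= Cmod z.
Proof. apply Rle_trans with (Rmax (Rabs (fst z)) (Rabs (snd z))); [apply Rmax_r|apply Rmax_Cmod]. Qed.

Lemma Cmod_le_ReIm (z : C) : Cmod z <= Rabs (Re z) + Rabs (Im z).
Proof.
  destruct z as [x y]; simpl.
  replace (x, y) with (RtoC x + (0, 1) * RtoC y)%C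
    by (unfold RtoC, Cplus, Cmult; simpl; f_equal; ring).
  eapply Rle_trans; [apply Cmod_triangle|]. rewrite Cmod_mult, !Cmod_R.
  replace (Cmod (0, 1)) with 1; [lra|].
  unfold Cmod; simpl. replace (0 * (0 * 1) + 1 * (1 * 1)) with 1 by ring. now rewrite sqrt_1.
Qed.

Lemma exp_taylor2 x : Rabs x <= / 2 -> 0 <= exp x - 1 - x <= 2 * x ^ 2.
Proof.
  intros Hx. apply Rabs_le_between in Hx. split.
  - generalize (exp_ineq1_le x). lra.
  (* The upper bound comes from [1 - x <= exp (- x)], that is [exp x <= 1 / (1 - x)]. *)
  - assert (H := exp_ineq1_le (- x)). rewrite exp_Ropp in H.
    assert (He := exp_pos x).
    assert (H1 : (1 + - x) * exp x <= 1).
    { apply Rmult_le_compat_r with (r := exp x) in H; [|lra]. rewrite Rinv_l in H; lra. }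
    assert (exp x * (1 - x) <= (1 + x + 2 * x ^ 2) * (1 - x)).
    { replace ((1 + x + 2 * x ^ 2) * (1 - x)) with (1 + x * x * (1 - 2 * x)) by ring.
      assert (0 <= x * x * (1 - 2 * x)); [|lra]. apply Rmult_le_pos; [apply Rle_0_sqr|lra]. }
    apply Rmult_le_reg_r in H0; lra.
Qed.

Lemma sin_taylor1 y : Rabs (sin y - y) <= Rabs y ^ 3.
Proof.
  replace (sin y - y) with ((sin y - y) - (sin 0 - 0)) by (rewrite sin_0; ring).
  replace (Rabs y ^ 3) with (y ^ 2 * Rabs (y - 0)) by (rewrite Rminus_0_r, <- (pow2_abs y); ring).
  apply (bounded_variation (fun y => sin y - y) (fun y => cos y - 1)).
  intros t Ht. rewrite !Rminus_0_r in Ht. split.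
  - auto_derive; [trivial|ring].
  - apply Rle_trans with (t ^ 2).
    + replace (cos t) with (cos (2 * (t / 2))) by (f_equal; field).
      rewrite cos_2a_sin.
      replace (1 - 2 * sin (t / 2) * sin (t / 2) - 1) with (- (2 * (sin (t / 2)) ^ 2)) by ring.
      rewrite Rabs_Ropp, Rabs_pos_eq; [|generalize (pow2_ge_0 (sin (t / 2))); lra].
      assert (Hs : Rabs (sin (t / 2)) <= Rabs (t / 2)).
      { replace (sin (t/2)) with (sin (t / 2) - sin 0) by (rewrite sin_0; ring).
        replace (t / 2) with (t / 2 - 0) at 2 by ring.
        rewrite <- (Rmult_1_l (Rabs (t / 2 - 0))).
        apply (bounded_variation sin cos). intros s _. split; [apply is_derive_Reals, derivable_pt_lim_sin|].
        apply Rabs_le, COS_bound. }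
      rewrite <- (pow2_abs (sin (t / 2))), <- (pow2_abs t).
      rewrite Rabs_div in Hs by lra. rewrite (Rabs_pos_eq 2) in Hs by lra.
      generalize (Rabs_pos (sin (t / 2))) (Rabs_pos t). nra.
    + rewrite <- (pow2_abs t), <- (pow2_abs y). generalize (Rabs_pos t). nra.
Qed.

Lemma cos_taylor1 y : Rabs (cos y - 1) <= y ^ 2.
Proof.
  replace (cos y) with (cos (2 * (y / 2))) by (f_equal; field).
  rewrite cos_2a_sin.
  replace (1 - 2 * sin (y / 2) * sin (y / 2) - 1) with (- (2 * (sin (y / 2)) ^ 2)) by ring.
  rewrite Rabs_Ropp, Rabs_pos_eq; [|generalize (pow2_ge_0 (sin (y / 2))); lra].
  assert (Hs : Rabs (sin (y / 2)) <= Rabs (y / 2)).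
  { replace (sin (y/2)) with (sin (y / 2) - sin 0) by (rewrite sin_0; ring).
    replace (y / 2) with (y / 2 - 0) at 2 by ring.
    rewrite <- (Rmult_1_l (Rabs (y / 2 - 0))).
    apply (bounded_variation sin cos). intros s _. split; [apply is_derive_Reals, derivable_pt_lim_sin|].
    apply Rabs_le, COS_bound. }
  rewrite <- (pow2_abs (sin (y / 2))), <- (pow2_abs y).
  rewrite Rabs_div in Hs by lra. rewrite (Rabs_pos_eq 2) in Hs by lra.
  generalize (Rabs_pos (sin (y / 2))) (Rabs_pos y). nra.
Qed.

Lemma Cexp_taylor2 (k : C) : Cmod k <= / 2 -> Cmod (Cexp k - 1 - k) <= 12 * Cmod k ^ 2.
Proof.
  intros Hk.
  assert (Hx := Re_le_Cmod' k). assert (Hy := Im_le_Cmod' k).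
  destruct k as [x y]; simpl in Hx, Hy. set (r := Cmod (x, y)) in *.
  eapply Rle_trans; [apply Cmod_le_ReIm|]. unfold Cexp; simpl.
  assert (Hr : 0 <= r) by apply Cmod_ge_0.
  assert (Ex := exp_taylor2 x ltac:(lra)). assert (Cy := cos_taylor1 y). assert (Sy := sin_taylor1 y).
  assert (Hxx : x ^ 2 <= r ^ 2) by (rewrite <- (pow2_abs x); generalize (Rabs_pos x); nra).
  assert (Hyy : y ^ 2 <= r ^ 2) by (rewrite <- (pow2_abs y); generalize (Rabs_pos y); nra).
  assert (Hex : 0 < exp x <= 2).
  { split; [apply exp_pos|]. apply Rabs_le_between in Hx. nra. }
  assert (Hex1 : Rabs (exp x - 1) <= 2 * r).
  { apply Rabs_le. apply Rabs_le_between in Hx. nra. }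
  replace (exp x * cos y - 1 - x) with (exp x * (cos y - 1) + (exp x - 1 - x)) by ring.
  replace (exp x * sin y + - 0 + - y) with (exp x * (sin y - y) + y * (exp x - 1)) by ring.
  replace (exp x * cos y + - (1) + - x) with (exp x * (cos y - 1) + (exp x - 1 - x)) by ring.
  assert (A1 : Rabs (exp x * (cos y - 1) + (exp x - 1 - x)) <= 4 * r ^ 2).
  { eapply Rle_trans; [apply Rabs_triang|]. rewrite Rabs_mult.
    rewrite (Rabs_pos_eq (exp x)) by lra. rewrite (Rabs_pos_eq (exp x - 1 - x)) by lra.
    generalize (Rabs_pos (cos y - 1)). nra. }
  assert (A2 : Rabs (exp x * (sin y - y) + y * (exp x - 1)) <= 4 * r ^ 2).
  { eapply Rle_trans; [apply Rabs_triang|]. rewrite !Rabs_mult.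
    rewrite (Rabs_pos_eq (exp x)) by lra.
    assert (Rabs y ^ 3 <= r ^ 2 * / 2).
    { simpl. generalize (Rabs_pos y); intro.
      assert (Rabs y * Rabs y <= r * r) by nra. nra. }
    assert (Rabs y * Rabs (exp x - 1) <= r * (2 * r)) by (apply Rmult_le_compat; auto using Rabs_pos).
    generalize (Rabs_pos (sin y - y)). nra. }
  nra.
Qed.

Lemma cderiv_exp (z : C) : cderiv Cexp z (Cexp z).
Proof.
  intros eps He. set (E := Cmod (Cexp z)). assert (HE : 0 < E) by (apply Cmod_gt_0, Cexp_neq0).
  exists (Rmin (/ 2) (eps / (12 * E))). split.
  { apply Rmin_pos; [lra|]. apply Rdiv_lt_0_compat; lra. }
  intros w Hw.
  assert (H1 : Cmod (w - z) < / 2) by (eapply Rlt_le_trans; [exact Hw|apply Rmin_l]).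
  assert (H2 : Cmod (w - z) < eps / (12 * E)) by (eapply Rlt_le_trans; [exact Hw|apply Rmin_r]).
  replace (Cexp w) with (Cexp z * Cexp (w - z))%C by (rewrite <- Cexp_plus; f_equal; ring).
  replace (Cexp z * Cexp (w - z) - Cexp z - Cexp z * (w - z))%C
    with (Cexp z * (Cexp (w - z) - 1 - (w - z)))%C by ring.
  rewrite Cmod_mult. fold E.
  assert (H := Cexp_taylor2 (w - z) ltac:(lra)).
  apply Rle_trans with (E * (12 * Cmod (w - z) ^ 2)); [apply Rmult_le_compat_l; lra|].
  replace eps with (E * 12 * (eps / (12 * E))) by (field; lra).
  generalize (Cmod_ge_0 (w - z)); intro. simpl.
  replace (E * (12 * (Cmod (w - z) * (Cmod (w - z) * 1)))) with (E * 12 * Cmod (w - z) * Cmod (w - z)) by ring.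
  apply Rmult_le_compat_r; [lra|]. apply Rmult_le_compat_l; lra.
Qed.

Lemma cderiv_Cexp (f : C -> C) (z d : C) : cderiv f z d -> cderiv (fun w => Cexp (f w)) z (Cexp (f z) * d)%C.
Proof. intros H. apply (cderiv_comp f Cexp); [exact H|apply cderiv_exp]. Qed.

Lemma cderiv_unique (f : C -> C) (z d d' : C) : cderiv f z d -> cderiv f z d' -> d = d'.
Proof.
  intros H H'. destruct (Ceq_dec d d') as [E|N]; [exact E|exfalso].
  assert (Hm : 0 < Cmod (d - d')). { apply Cmod_gt_0. intro E. apply N.
    replace d with (d - d' + d')%C by ring. rewrite E. ring. }
  destruct (H (Cmod (d - d') / 4) ltac:(lra)) as [e1 [He1 H1]].
  destruct (H' (Cmod (d - d') / 4) ltac:(lra)) as [e2 [He2 H2]].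
  set (r := Rmin e1 e2 / 2). assert (Hr : 0 < r) by (unfold r; generalize (Rmin_pos _ _ He1 He2); lra).
  assert (Hr1 : r < e1) by (unfold r in *; generalize (Rmin_l e1 e2); lra).
  assert (Hr2 : r < e2) by (unfold r in *; generalize (Rmin_r e1 e2); lra).
  assert (E : (z + r - z = r)%C) by ring.
  specialize (H1 (z + r)%C). specialize (H2 (z + r)%C). rewrite E in H1, H2.
  rewrite Cmod_R, Rabs_pos_eq in H1, H2 by lra.
  specialize (H1 Hr1). specialize (H2 Hr2).
  assert (Cmod ((d - d') * r) <= Cmod (d - d') / 2 * r).
  { replace ((d - d') * r)%C with ((f (z + r)%C - f z - d' * r) + - (f (z + r)%C - f z - d * r))%C by ring.
    eapply Rle_trans; [apply Cmod_triangle|]. rewrite Cmod_opp. lra. }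
  rewrite Cmod_mult, Cmod_R, Rabs_pos_eq in H0 by lra. nra.
Qed.

(** The rotation by [conj u] turns the increment into a positive real, so the
    real mean value theorem applies to its real part. *)
Lemma cmvt (F dF : C -> C) (p q : C) (M : R) :
  (forall s, 0 <= s <= 1 -> cderiv F (p + s * (q - p)) (dF (p + s * (q - p))%C)
      /\ Cmod (dF (p + s * (q - p))%C) <= M) ->
  Cmod (F q - F p) <= M * Cmod (q - p).
Proof.
  intros H.
  destruct (Ceq_dec (F q - F p) 0) as [E|N].
  { rewrite E, Cmod_0. destruct (H 0 ltac:(lra)) as [_ H0].
    generalize (Cmod_ge_0 (dF (p + 0 * (q - p))%C)) (Cmod_ge_0 (q - p)). nra. }
  set (A := Cmod (F q - F p)). assert (HA : 0 < A) by (apply Cmod_gt_0; assumption).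
  set (u := (Cconj (F q - F p) / A)%C).
  assert (Hu : Cmod u = 1).
  { unfold u. rewrite Cmod_div by (apply RtoC_neq0; lra).
    rewrite Cmod_conj, Cmod_R. fold A. rewrite Rabs_pos_eq by lra. field. lra. }
  assert (HuF : (u * (F q - F p))%C = RtoC A).
  { unfold u. replace (Cconj (F q - F p) / A * (F q - F p))%C
      with (((F q - F p) * Cconj (F q - F p)) / A)%C by (field; apply RtoC_neq0; lra).
    rewrite <- Cmod2_conj. fold A. rewrite <- RtoC_div by lra. f_equal. field. lra. }
  set (g := fun s : R => Re (u * F (p + s * (q - p)))%C).
  assert (Hg : forall s, 0 <= s <= 1 -> is_derive g s (Re (u * (dF (p + s * (q - p)) * (q - p))))%C).
  { intros s Hs. destruct (H s Hs) as [Hd _].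
    apply is_derive_Reals. intros eps He.
    set (K := Cmod (q - p) + 1). assert (HK : 0 < K) by (unfold K; generalize (Cmod_ge_0 (q - p)); lra).
    destruct (Hd (eps / (2 * K))) as [del [Hdel Hw]]; [apply Rdiv_lt_0_compat; lra|].
    assert (Hdk : 0 < del / K) by now apply Rdiv_lt_0_compat.
    exists (mkposreal _ Hdk). intros h Hh0 Hh. simpl in Hh.
    set (z := (p + s * (q - p))%C) in *.
    assert (Hz : (p + (s + h)%R * (q - p) = z + h * (q - p))%C) by (unfold z; rewrite RtoC_plus; ring).
    unfold g. rewrite Hz. fold z.
    specialize (Hw (z + h * (q - p))%C).
    replace (z + h * (q - p) - z)%C with (h * (q - p))%C in Hw by ring.
    rewrite Cmod_mult, Cmod_R in Hw.
    assert (Hlt : Rabs h * Cmod (q - p) < del).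
    { apply Rmult_lt_compat_r with (r := K) in Hh; [|lra].
      replace (del / K * K) with del in Hh by (field; lra).
      apply Rle_lt_trans with (Rabs h * K); [|exact Hh].
      apply Rmult_le_compat_l; [apply Rabs_pos|unfold K; lra]. }
    specialize (Hw Hlt).
    set (e := (F (z + h * (q - p)) - F z - dF z * (h * (q - p)))%C) in *.
    assert (Hr : (Re (u * F (z + h * (q - p)))%C - Re (u * F z)%C) / h - Re (u * (dF z * (q - p)))%C
       = Re (u * e)%C / h).
    { assert (Hre : Re (u * e)%C = Re (u * F (z + h * (q - p)))%C - Re (u * F z)%C - h * Re (u * (dF z * (q - p)))%C).
      { unfold e. destruct u, (F (z + h * (q - p))%C), (F z), (dF z), (q - p)%C. simpl. ring. }
      rewrite Hre. field. exact Hh0. }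
    rewrite Hr, Rabs_div by exact Hh0.
    assert (Hh1 : 0 < Rabs h) by now apply Rabs_pos_lt.
    apply Rmult_lt_reg_r with (Rabs h); [exact Hh1|].
    unfold Rdiv. rewrite Rmult_assoc, Rinv_l, Rmult_1_r by lra.
    eapply Rle_lt_trans; [apply Re_le_Cmod'|]. rewrite Cmod_mult, Hu, Rmult_1_l.
    eapply Rle_lt_trans; [exact Hw|].
    replace (eps / (2 * K) * (Rabs h * Cmod (q - p))) with (eps * Rabs h * (Cmod (q - p) / (2 * K))) by (field; lra).
    rewrite <- (Rmult_1_r (eps * Rabs h)) at 2. apply Rmult_lt_compat_l; [nra|].
    apply Rmult_lt_reg_r with (2 * K); [lra|]. unfold Rdiv. rewrite Rmult_assoc, Rinv_l by lra.
    unfold K. generalize (Cmod_ge_0 (q - p)). lra. }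
  destruct (MVT_gen g 0 1 (fun s => Re (u * (dF (p + s * (q - p)) * (q - p))))%C) as [s [Hs E]].
  { intros x Hx. rewrite Rmin_left, Rmax_right in Hx by lra. apply Hg. lra. }
  { intros x Hx. rewrite Rmin_left, Rmax_right in Hx by lra.
    apply continuity_pt_filterlim. apply (ex_derive_continuous (V := R_NormedModule)). eexists. apply Hg. lra. }
  rewrite Rmin_left, Rmax_right in Hs by lra.
  assert (Hg01 : g 1 - g 0 = A).
  { unfold g. replace (p + 1%R * (q - p))%C with q by ring. replace (p + 0%R * (q - p))%C with p by ring.
    replace (Re (u * F q)%C - Re (u * F p)%C) with (Re (u * (F q - F p))%C).
    - rewrite HuF. reflexivity.
    - destruct u, (F q), (F p); simpl; ring. }
  rewrite Hg01 in E. rewrite E, Rminus_0_r, Rmult_1_r.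
  eapply Rle_trans; [apply Rle_abs|]. eapply Rle_trans; [apply Re_le_Cmod'|].
  rewrite !Cmod_mult, Hu, Rmult_1_l. apply Rmult_le_compat_r; [apply Cmod_ge_0|]. now apply H.
Qed.

(** Independence of [x] is always propagated through this lemma, along explicit segments; no
    connectedness argument is needed. *)
Lemma constant_on_segment (F : C -> C) (p q : C) :
  (forall s, 0 <= s <= 1 -> cderiv F (p + s * (q - p)) 0) -> F q = F p.
Proof.
  intros H. assert (E := cmvt F (fun _ => RtoC 0) p q 0).
  assert (E' : Cmod (F q - F p) <= 0 * Cmod (q - p)).
  { apply E. intros s Hs. split; [now apply H|rewrite Cmod_0; lra]. }
  rewrite Rmult_0_l in E'.
  assert (E0 : (F q - F p = 0)%C) by (apply Cmod_eq_0; generalize (Cmod_ge_0 (F q - F p)); lra).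
  replace (F q) with (F q - F p + F p)%C by ring. rewrite E0. ring.
Qed.

(** * Goursat's theorem *)

Definition cis (t : R) : C := (cos t, sin t).

Definition ccont (f : R -> C) (t : R) : Prop :=
  continuous (fun s => Re (f s)) t /\ continuous (fun s => Im (f s)) t.

Definition CC (g : C -> C) (z : C) : Prop :=
  forall eps, 0 < eps -> exists del, 0 < del /\ forall w, Cmod (w - z) < del -> Cmod (g w - g z) < eps.

Definition exCI (f : R -> C) (a b : R) : Prop :=
  ex_RInt (fun t => Re (f t)) a b /\ ex_RInt (fun t => Im (f t)) a b.

Definition CI (f : R -> C) (a b : R) : C :=
  (RInt (fun t => Re (f t)) a b, RInt (fun t => Im (f t)) a b).

Lemma C_ext (u v : C) : Re u = Re v -> Im u = Im v -> u = v.
Proof. destruct u, v; simpl; now intros -> ->. Qed.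

Lemma ccont_eps (f : R -> C) t :
  (forall eps, 0 < eps -> exists del, 0 < del /\ forall s, Rabs (s - t) < del -> Cmod (f s - f t) < eps) -> ccont f t.
Proof.
  intros H; split; intros P [eps HP]; destruct (H eps (cond_pos eps)) as [del [Hd Hs]];
    exists (mkposreal del Hd); intros s Hst; apply HP; specialize (Hs s Hst);
    eapply Rle_lt_trans; [|exact Hs| |exact Hs].
  - eapply Rle_trans; [|apply Re_le_Cmod']. apply Req_le. reflexivity.
  - eapply Rle_trans; [|apply Im_le_Cmod']. apply Req_le. reflexivity.
Qed.

Lemma cis_cont_eps t : forall eps, 0 < eps -> exists del, 0 < del /\ forall s, Rabs (s - t) < del -> Cmod (cis s - cis t) < eps.
Proof.
  intros eps He. exists (eps / 2). split; [lra|]. intros s Hs.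
  eapply Rle_lt_trans; [apply Cmod_le_ReIm|]. unfold cis; simpl.
  assert (H1 : Rabs (cos s - cos t) <= 1 * Rabs (s - t)).
  { apply (bounded_variation cos (fun t => - sin t)). intros x _. split; [auto_derive; trivial; ring|].
    rewrite Rabs_Ropp. apply Rabs_le, SIN_bound. }
  assert (H2 : Rabs (sin s - sin t) <= 1 * Rabs (s - t)).
  { apply (bounded_variation sin cos). intros x _. split; [auto_derive; trivial; ring|].
    apply Rabs_le, COS_bound. }
  unfold Rminus in *. lra.
Qed.

Lemma ccont_comp (g : C -> C) (h : R -> C) t : CC g (h t) ->
  (forall eps, 0 < eps -> exists del, 0 < del /\ forall s, Rabs (s - t) < del -> Cmod (h s - h t) < eps) ->
  ccont (fun s => g (h s)) t.
Proof.
  intros Hg Hh. apply ccont_eps. intros eps He. destruct (Hg eps He) as [d [Hd H]].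
  destruct (Hh d Hd) as [d' [Hd' H']]. exists d'; split; trivial. intros s Hs. now apply H, H'.
Qed.

Lemma Cmod_cis t : Cmod (cis t) = 1.
Proof.
  unfold Cmod, cis; simpl.
  replace (cos t * (cos t * 1) + sin t * (sin t * 1)) with 1; [apply sqrt_1|].
  transitivity (Rsqr (sin t) + Rsqr (cos t)); [symmetry; apply sin2_cos2|unfold Rsqr; ring].
Qed.

Lemma cis_neq0 t : cis t <> 0%C.
Proof. apply Cmod_gt_0. rewrite Cmod_cis. lra. Qed.

Lemma cis_plus s t : cis (s + t) = (cis s * cis t)%C.
Proof. unfold cis, Cmult; simpl. rewrite cos_plus, sin_plus. f_equal; ring. Qed.

Lemma cis_2PI t : cis (t + 2 * PI) = cis t.
Proof. unfold cis. rewrite cos_plus, sin_plus, cos_2PI, sin_2PI. f_equal; ring. Qed.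

Lemma exCI_cont (f : R -> C) a b : a <= b -> (forall t, a <= t <= b -> ccont f t) -> exCI f a b.
Proof.
  intros Hab H. split; apply (ex_RInt_continuous (V := R_CompleteNormedModule)); intros z Hz;
    rewrite Rmin_left, Rmax_right in Hz by lra; apply H; exact Hz.
Qed.

Lemma CI_ext (f g : R -> C) a b : a <= b -> (forall t, a <= t <= b -> f t = g t) -> CI f a b = CI g a b.
Proof.
  intros Hab H. unfold CI. f_equal; apply RInt_ext; intros x Hx; rewrite Rmin_left, Rmax_right in Hx by lra;
    rewrite (H x) by lra; reflexivity.
Qed.

Lemma exCI_ext (f g : R -> C) a b : a <= b -> (forall t, a <= t <= b -> f t = g t) -> exCI f a b -> exCI g a b.
Proof.
  intros Hab H [H1 H2]. split; [revert H1|revert H2]; apply ex_RInt_ext;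
    intros x Hx; rewrite Rmin_left, Rmax_right in Hx by lra; rewrite (H x) by lra; reflexivity.
Qed.

Lemma exCI_plus (f g : R -> C) a b : exCI f a b -> exCI g a b -> exCI (fun t => f t + g t)%C a b.
Proof.
  intros [F1 F2] [G1 G2]. split.
  - exact (ex_RInt_plus (V := R_CompleteNormedModule) _ _ _ _ F1 G1).
  - exact (ex_RInt_plus (V := R_CompleteNormedModule) _ _ _ _ F2 G2).
Qed.

Lemma CI_plus (f g : R -> C) a b : exCI f a b -> exCI g a b ->
  CI (fun t => f t + g t)%C a b = (CI f a b + CI g a b)%C.
Proof.
  intros [F1 F2] [G1 G2]. unfold CI, Cplus; simpl. f_equal.
  - exact (RInt_plus (V := R_CompleteNormedModule) _ _ _ _ F1 G1).
  - exact (RInt_plus (V := R_CompleteNormedModule) _ _ _ _ F2 G2).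
Qed.

Lemma exCI_scal (k : C) (f : R -> C) a b : exCI f a b -> exCI (fun t => k * f t)%C a b.
Proof.
  intros [F1 F2]. destruct k as [x y]. split; simpl.
  - exact (ex_RInt_minus (V := R_CompleteNormedModule) _ _ _ _
      (ex_RInt_scal (V := R_CompleteNormedModule) _ a b x F1)
      (ex_RInt_scal (V := R_CompleteNormedModule) _ a b y F2)).
  - exact (ex_RInt_plus (V := R_CompleteNormedModule) _ _ _ _
      (ex_RInt_scal (V := R_CompleteNormedModule) _ a b x F2)
      (ex_RInt_scal (V := R_CompleteNormedModule) _ a b y F1)).
Qed.

Lemma CI_scal (k : C) (f : R -> C) a b : exCI f a b -> CI (fun t => k * f t)%C a b = (k * CI f a b)%C.
Proof.
  intros [F1 F2]. destruct k as [x y]. unfold CI.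
  assert (A1 := RInt_scal (V := R_CompleteNormedModule) _ a b x F1).
  assert (A2 := RInt_scal (V := R_CompleteNormedModule) _ a b y F2).
  assert (A3 := RInt_scal (V := R_CompleteNormedModule) _ a b x F2).
  assert (A4 := RInt_scal (V := R_CompleteNormedModule) _ a b y F1).
  apply C_ext; simpl.
  - exact (eq_trans (RInt_minus (V := R_CompleteNormedModule) _ _ _ _
      (ex_RInt_scal (V := R_CompleteNormedModule) _ a b x F1)
      (ex_RInt_scal (V := R_CompleteNormedModule) _ a b y F2)) (f_equal2 Rminus A1 A2)).
  - exact (eq_trans (RInt_plus (V := R_CompleteNormedModule) _ _ _ _
      (ex_RInt_scal (V := R_CompleteNormedModule) _ a b x F2)
      (ex_RInt_scal (V := R_CompleteNormedModule) _ a b y F1)) (f_equal2 Rplus A3 A4)).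
Qed.

Lemma exCI_minus (f g : R -> C) a b : exCI f a b -> exCI g a b -> exCI (fun t => f t - g t)%C a b.
Proof.
  intros F G. destruct (exCI_plus f (fun t => RtoC (-1) * g t)%C a b F (exCI_scal (RtoC (-1)) g a b G)) as [A B].
  split; [revert A|revert B]; apply ex_RInt_ext; intros; simpl; ring.
Qed.

Lemma CI_minus (f g : R -> C) a b : a <= b -> exCI f a b -> exCI g a b ->
  CI (fun t => f t - g t)%C a b = (CI f a b - CI g a b)%C.
Proof.
  intros Hab F G. replace (CI f a b - CI g a b)%C with (CI f a b + (RtoC (-1) * CI g a b))%C
    by (apply C_ext; simpl; ring).
  rewrite <- CI_scal, <- CI_plus; trivial.
  - apply CI_ext; trivial. intros t _. apply C_ext; simpl; ring.
  - now apply exCI_scal.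
Qed.

Lemma CI_Chasles (f : R -> C) a b c : exCI f a b -> exCI f b c -> CI f a c = (CI f a b + CI f b c)%C.
Proof.
  intros [F1 F2] [G1 G2]. unfold CI, Cplus; simpl. f_equal; symmetry.
  - exact (RInt_Chasles (V := R_CompleteNormedModule) _ a b c F1 G1).
  - exact (RInt_Chasles (V := R_CompleteNormedModule) _ a b c F2 G2).
Qed.

Lemma CI_shift (f : R -> C) v a b : exCI f (a + v) (b + v) -> CI (fun t => f (t + v)) a b = CI f (a + v) (b + v).
Proof.
  intros [F1 F2].
  assert (E : forall (h : R -> R), ex_RInt h (a + v) (b + v) -> RInt (fun t => h (t + v)) a b = RInt h (a + v) (b + v)).
  { intros h Hh. assert (H := RInt_comp_lin (V := R_CompleteNormedModule) h 1 v a b).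
    rewrite !Rmult_1_l in H. specialize (H Hh). rewrite <- H. apply RInt_ext. intros x _.
    change (h (x + v) = 1 * h (1 * x + v)). rewrite !Rmult_1_l. reflexivity. }
  unfold CI. f_equal.
  - exact (E (fun t => Re (f t)) F1).
  - exact (E (fun t => Im (f t)) F2).
Qed.

(** The integral is rotated onto the positive real axis by a unit factor; bounding real and
    imaginary parts separately would lose a constant. *)
Lemma CI_bound (f : R -> C) a b M : a <= b -> exCI f a b -> (forall t, a <= t <= b -> Cmod (f t) <= M) ->
  Cmod (CI f a b) <= M * (b - a).
Proof.
  intros Hab F H.
  destruct (Ceq_dec (CI f a b) 0) as [E|N].
  { rewrite E, Cmod_0. specialize (H a ltac:(lra)). generalize (Cmod_ge_0 (f a)). nra. }
  set (A := Cmod (CI f a b)). assert (HA : 0 < A) by (apply Cmod_gt_0; exact N).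
  set (u := (Cconj (CI f a b) / A)%C).
  assert (Hu : Cmod u = 1).
  { unfold u. rewrite Cmod_div by (apply RtoC_neq0; lra).
    rewrite Cmod_conj, Cmod_R. fold A. rewrite Rabs_pos_eq by lra. field. lra. }
  assert (HuF : (u * CI f a b)%C = RtoC A).
  { unfold u. replace (Cconj (CI f a b) / A * CI f a b)%C
      with ((CI f a b * Cconj (CI f a b)) / A)%C by (field; apply RtoC_neq0; lra).
    rewrite <- Cmod2_conj. fold A. rewrite <- RtoC_div by lra. f_equal. field. lra. }
  rewrite <- CI_scal in HuF by exact F.
  assert (HR : RInt (fun t => Re (u * f t)%C) a b = A) by (apply (f_equal Re) in HuF; exact HuF).
  rewrite <- HR.
  destruct (exCI_scal u f a b F) as [E1 _].
  apply Rle_trans with (RInt (fun _ => M) a b).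
  - apply RInt_le; [exact Hab|exact E1|apply ex_RInt_const|].
    intros x Hx. eapply Rle_trans; [apply Rle_abs|]. eapply Rle_trans; [apply Re_le_Cmod'|].
    rewrite Cmod_mult, Hu, Rmult_1_l. apply H. lra.
  - rewrite RInt_const. apply Req_le. change ((b - a) * M = M * (b - a)). ring.
Qed.

Lemma RInt_affine u v a b : is_RInt (fun s => v + u * s) a b (v * (b - a) + u * (b ^ 2 - a ^ 2) / 2).
Proof.
  replace (v * (b - a) + u * (b ^ 2 - a ^ 2) / 2)
    with (minus ((fun s => v * s + u * s ^ 2 / 2) b) ((fun s => v * s + u * s ^ 2 / 2) a))
    by (unfold minus, plus, opp; simpl; field).
  apply (is_RInt_derive (fun s => v * s + u * s ^ 2 / 2)).
  - intros x _. auto_derive; [trivial|]. field.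
  - intros x _. apply (ex_derive_continuous (V := R_NormedModule)). auto_derive. trivial.
Qed.

Lemma CI_affine (A B : C) a b :
  exCI (fun s => A + B * RtoC s)%C a b /\
  CI (fun s => A + B * RtoC s)%C a b = (A * RtoC (b - a) + B * RtoC ((b ^ 2 - a ^ 2) / 2))%C.
Proof.
  assert (E1 : is_RInt (fun s => Re (A + B * RtoC s)%C) a b (Re A * (b - a) + Re B * (b ^ 2 - a ^ 2) / 2)).
  { eapply is_RInt_ext; [|apply RInt_affine]. intros x _. destruct A, B; simpl. ring. }
  assert (E2 : is_RInt (fun s => Im (A + B * RtoC s)%C) a b (Im A * (b - a) + Im B * (b ^ 2 - a ^ 2) / 2)).
  { eapply is_RInt_ext; [|apply RInt_affine]. intros x _. destruct A, B; simpl. ring. }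
  split; [split; eexists; eassumption|].
  unfold CI. apply C_ext.
  - change (RInt (fun s => Re (A + B * RtoC s)%C) a b = Re (A * RtoC (b - a) + B * RtoC ((b ^ 2 - a ^ 2) / 2))%C).
    erewrite is_RInt_unique by exact E1. destruct A, B; simpl. field.
  - change (RInt (fun s => Im (A + B * RtoC s)%C) a b = Im (A * RtoC (b - a) + B * RtoC ((b ^ 2 - a ^ 2) / 2))%C).
    erewrite is_RInt_unique by exact E2. destruct A, B; simpl. field.
Qed.

(** * Integrals over boundaries of rectangles *)

Definition hor (g : C -> C) (a b y : R) : C := CI (fun s => g (s, y)) a b.
Definition ver (g : C -> C) (x c d : R) : C := CI (fun t => g (x, t)) c d.
(** The contour is run counterclockwise; the factor [Ci] is [dz / dt] on the vertical sides. *)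
Definition bd (g : C -> C) (a b c d : R) : C :=
  (hor g a b c + Ci * ver g b c d - hor g a b d - Ci * ver g a c d)%C.

Definition in_rect (a b c d : R) (z : C) : Prop := a <= Re z <= b /\ c <= Im z <= d.
Definition CC_rect (g : C -> C) (a b c d : R) : Prop := forall z, in_rect a b c d z -> CC g z.

Lemma hor_ex g a b c d y : a <= b -> CC_rect g a b c d -> c <= y <= d -> exCI (fun s => g (s, y)) a b.
Proof.
  intros Hab H Hy. apply exCI_cont; [exact Hab|]. intros t Ht.
  apply (ccont_comp g (fun s => (s, y))); [apply H; split; simpl; lra|].
  intros eps He. exists eps; split; [exact He|]. intros s Hs.
  replace ((s, y) - (t, y))%C with (RtoC (s - t)); [now rewrite Cmod_R|].
  apply C_ext; simpl; ring.
Qed.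

Lemma ver_ex g a b c d x : c <= d -> CC_rect g a b c d -> a <= x <= b -> exCI (fun t => g (x, t)) c d.
Proof.
  intros Hab H Hy. apply exCI_cont; [exact Hab|]. intros t Ht.
  apply (ccont_comp g (fun t => (x, t))); [apply H; split; simpl; lra|].
  intros eps He. exists eps; split; [exact He|]. intros s Hs.
  replace ((x, s) - (x, t))%C with (Ci * RtoC (s - t))%C.
  - rewrite Cmod_mult, Cmod_R. replace (Cmod Ci) with 1; [lra|].
    unfold Cmod; simpl. replace (0 * (0 * 1) + 1 * (1 * 1)) with 1 by ring. now rewrite sqrt_1.
  - apply C_ext; simpl; ring.
Qed.

Lemma CC_rect_sub g a b c d a' b' c' d' : CC_rect g a b c d -> a <= a' -> b' <= b -> c <= c' -> d' <= d ->
  CC_rect g a' b' c' d'.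
Proof. intros H ? ? ? ? z [Hz1 Hz2]. apply H. split; lra. Qed.

Lemma bd_split_x g a m b c d : a <= m <= b -> c <= d -> CC_rect g a b c d ->
  bd g a b c d = (bd g a m c d + bd g m b c d)%C.
Proof.
  intros Hm Hcd H. unfold bd, hor.
  rewrite (CI_Chasles (fun s => g (s, c)) a m b), (CI_Chasles (fun s => g (s, d)) a m b); [ring|..].
  all: eapply hor_ex with (c := c) (d := d); [lra| |lra]; eapply CC_rect_sub; [exact H|lra..].
Qed.

Lemma bd_split_y g a b c m d : a <= b -> c <= m <= d -> CC_rect g a b c d ->
  bd g a b c d = (bd g a b c m + bd g a b m d)%C.
Proof.
  intros Hm Hcd H. unfold bd, ver.
  rewrite (CI_Chasles (fun s => g (a, s)) c m d), (CI_Chasles (fun s => g (b, s)) c m d); [ring|..].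
  all: eapply ver_ex with (a := a) (b := b); [lra| |lra]; eapply CC_rect_sub; [exact H|lra..].
Qed.

Lemma Cmod_Ci : Cmod Ci = 1.
Proof. unfold Cmod; simpl. replace (0 * (0 * 1) + 1 * (1 * 1)) with 1 by ring. now rewrite sqrt_1. Qed.

Lemma bd_bound g a b c d M : a <= b -> c <= d -> CC_rect g a b c d ->
  (forall z, in_rect a b c d z -> Cmod (g z) <= M) ->
  Cmod (bd g a b c d) <= 2 * M * ((b - a) + (d - c)).
Proof.
  intros Hab Hcd H HM. unfold bd.
  assert (H1 : Cmod (hor g a b c) <= M * (b - a)).
  { apply CI_bound; [exact Hab|eapply hor_ex; [exact Hab|exact H|lra]|]. intros t Ht. apply HM. split; simpl; lra. }
  assert (H2 : Cmod (hor g a b d) <= M * (b - a)).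
  { apply CI_bound; [exact Hab|eapply hor_ex; [exact Hab|exact H|lra]|]. intros t Ht. apply HM. split; simpl; lra. }
  assert (H3 : Cmod (ver g a c d) <= M * (d - c)).
  { apply CI_bound; [exact Hcd|eapply ver_ex; [exact Hcd|exact H|lra]|]. intros t Ht. apply HM. split; simpl; lra. }
  assert (H4 : Cmod (ver g b c d) <= M * (d - c)).
  { apply CI_bound; [exact Hcd|eapply ver_ex; [exact Hcd|exact H|lra]|]. intros t Ht. apply HM. split; simpl; lra. }
  unfold Cminus.
  eapply Rle_trans; [apply Cmod_triangle|]. rewrite Cmod_opp, Cmod_mult, Cmod_Ci.
  eapply Rle_trans; [apply Rplus_le_compat_r, Cmod_triangle|]. rewrite Cmod_opp.
  eapply Rle_trans; [apply Rplus_le_compat_r, Rplus_le_compat_r, Cmod_triangle|]. rewrite Cmod_mult, Cmod_Ci.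
  lra.
Qed.

Lemma cderiv_CC (f : C -> C) (z d : C) : cderiv f z d -> CC f z.
Proof. intros H eps He. exact (cderiv_continuous f z d H eps He). Qed.

Lemma CC_affine (A B : C) z : CC (fun w => A + B * w)%C z.
Proof.
  apply (cderiv_CC (fun w => A + B * w)%C z (0 + (0 * z + B * 1))%C).
  apply cderiv_plus; [apply cderiv_const|]. apply cderiv_mult; [apply cderiv_const|apply cderiv_id].
Qed.

(** In the bisection argument the affine approximation of [g] can be subtracted at no cost, which
    leaves only the remainder of the differentiability. *)
Lemma bd_affine (A B : C) a b c d : a <= b -> c <= d -> bd (fun z => A + B * z)%C a b c d = 0%C.
Proof.
  intros Hab Hcd.
  assert (Hh : forall y, hor (fun z => A + B * z)%C a b y
    = ((A + B * (0, y)) * RtoC (b - a) + B * RtoC ((b ^ 2 - a ^ 2) / 2))%C).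
  { intros y. rewrite <- (proj2 (CI_affine (A + B * (0, y))%C B a b)). apply CI_ext; [exact Hab|].
    intros t _. apply C_ext; simpl; ring. }
  assert (Hv : forall x, ver (fun z => A + B * z)%C x c d
    = ((A + B * RtoC x) * RtoC (d - c) + (B * Ci) * RtoC ((d ^ 2 - c ^ 2) / 2))%C).
  { intros x. rewrite <- (proj2 (CI_affine (A + B * RtoC x)%C (B * Ci)%C c d)). apply CI_ext; [exact Hcd|].
    intros t _. apply C_ext; simpl; ring. }
  unfold bd. rewrite !Hh, !Hv. destruct A, B. apply C_ext; simpl; field.
Qed.

Lemma CC_minus f g z : CC f z -> CC g z -> CC (fun w => f w - g w)%C z.
Proof.
  intros Hf Hg eps He. destruct (Hf (eps / 2)) as [d1 [Hd1 H1]]; [lra|]. destruct (Hg (eps / 2)) as [d2 [Hd2 H2]]; [lra|].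
  exists (Rmin d1 d2); split; [now apply Rmin_pos|]. intros w Hw.
  specialize (H1 w (Rlt_le_trans _ _ _ Hw (Rmin_l _ _))). specialize (H2 w (Rlt_le_trans _ _ _ Hw (Rmin_r _ _))).
  replace (f w - g w - (f z - g z))%C with ((f w - f z) + - (g w - g z))%C by ring.
  eapply Rle_lt_trans; [apply Cmod_triangle|]. rewrite Cmod_opp. lra.
Qed.

Lemma bd_minus f g a b c d : a <= b -> c <= d -> CC_rect f a b c d -> CC_rect g a b c d ->
  bd (fun z => f z - g z)%C a b c d = (bd f a b c d - bd g a b c d)%C.
Proof.
  intros Hab Hcd Hf Hg.
  assert (Hh : forall y, c <= y <= d -> hor (fun z => f z - g z)%C a b y = (hor f a b y - hor g a b y)%C).
  { intros y Hy. apply (CI_minus (fun s => f (s, y)) (fun s => g (s, y))); [exact Hab|..].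
    - eapply hor_ex; [exact Hab|exact Hf|lra].
    - eapply hor_ex; [exact Hab|exact Hg|lra]. }
  assert (Hv : forall x, a <= x <= b -> ver (fun z => f z - g z)%C x c d = (ver f x c d - ver g x c d)%C).
  { intros x Hx. apply (CI_minus (fun s => f (x, s)) (fun s => g (x, s))); [exact Hcd|..].
    - eapply ver_ex; [exact Hcd|exact Hf|lra].
    - eapply ver_ex; [exact Hcd|exact Hg|lra]. }
  unfold bd. rewrite !Hh, !Hv by lra. ring.
Qed.

Lemma nested_limit (u w : nat -> R) :
  (forall n, 0 <= w n) -> (forall n, u n <= u (S n)) -> (forall n, u (S n) + w (S n) <= u n + w n) ->
  exists l, forall n, u n <= l <= u n + w n.
Proof.
  intros Hw Hu Huw.
  assert (M1 : forall n k, u n <= u (n + k)%nat).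
  { intros n k. induction k as [|k IH]; [rewrite Nat.add_0_r; lra|]. rewrite Nat.add_succ_r. specialize (Hu (n + k)%nat). lra. }
  assert (M2 : forall n k, u (n + k)%nat + w (n + k)%nat <= u n + w n).
  { intros n k. induction k as [|k IH]; [rewrite Nat.add_0_r; lra|]. rewrite Nat.add_succ_r. specialize (Huw (n + k)%nat). lra. }
  assert (M : forall m n, u m <= u n + w n).
  { intros m n. destruct (Nat.le_ge_cases m n) as [H|H].
    - replace n with (m + (n - m))%nat by lia. generalize (M1 m (n - m)%nat) (Hw (m + (n - m))%nat). lra.
    - replace m with (n + (m - n))%nat by lia. generalize (M2 n (m - n)%nat) (Hw (n + (m - n))%nat). lra. }
  destruct (completeness (fun x => exists n, x = u n)) as [l [Hl1 Hl2]].
  - exists (u 0%nat + w 0%nat). intros x [n ->]. apply M.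
  - exists (u 0%nat). now exists 0%nat.
  - exists l. intros n. split.
    + apply Hl1. now exists n.
    + apply Hl2. intros x [m ->]. apply M.
Qed.

(** If the boundary integral exceeds [eps (W + H)^2], then at every stage one of the four quarters
    exceeds [eps D^2], with [D] its own half-perimeter. At the common point of these rectangles,
    differentiability with tolerance [eps / 2] bounds the integral by [2 (eps / 2 * D) D], a
    contradiction. *)
Lemma goursat (g : C -> C) a b c d : a <= b -> c <= d ->
  (forall z, in_rect a b c d z -> exists e, cderiv g z e) -> bd g a b c d = 0%C.
Proof.
  intros Hab Hcd Hg.
  assert (HC : CC_rect g a b c d).
  { intros z Hz. destruct (Hg z Hz) as [e He]. intros eps. exact (cderiv_continuous g z e He eps). }
  set (W := b - a). set (H := d - c).
  assert (HW : 0 <= W) by (unfold W; lra). assert (HH : 0 <= H) by (unfold H; lra).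
  set (D := fun n => (W + H) / 2 ^ n).
  assert (H2n : forall n, 0 < 2 ^ n) by (intros; apply pow_lt; lra).
  assert (HDS : forall n, D n = 2 * D (S n)).
  { intros n. unfold D. simpl. field. generalize (H2n n); lra. }
  assert (HD0 : forall n, 0 <= D n).
  { intros n. unfold D. apply Rdiv_le_0_compat; [lra|apply H2n]. }
  assert (Key : forall eps, 0 < eps -> Cmod (bd g a b c d) <= eps * (W + H) ^ 2).
  { intros eps He. destruct (Rle_lt_dec (Cmod (bd g a b c d)) (eps * (W + H) ^ 2)) as [L|Bad]; [exact L|exfalso].
    set (w := fun n => W / 2 ^ n). set (h := fun n => H / 2 ^ n).
    assert (HwS : forall n, w n = 2 * w (S n)) by (intros n; unfold w; simpl; field; generalize (H2n n); lra).
    assert (HhS : forall n, h n = 2 * h (S n)) by (intros n; unfold h; simpl; field; generalize (H2n n); lra).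
    assert (Hw0 : forall n, 0 <= w n) by (intros n; apply Rdiv_le_0_compat; [lra|apply H2n]).
    assert (Hh0 : forall n, 0 <= h n) by (intros n; apply Rdiv_le_0_compat; [lra|apply H2n]).
    set (bad := fun n (p : R * R) => (a <= fst p /\ fst p + w n <= b /\ c <= snd p /\ snd p + h n <= d) /\
      eps * D n ^ 2 < Cmod (bd g (fst p) (fst p + w n) (snd p) (snd p + h n))).
    set (nxt := fun n (p q : R * R) => fst p <= fst q /\ fst q + w (S n) <= fst p + w n /\
      snd p <= snd q /\ snd q + h (S n) <= snd p + h n).
    assert (step : forall n p, bad n p -> exists q, bad (S n) q /\ nxt n p q).
    { intros n [x y] [Hin Hb]. simpl in Hin, Hb.
      assert (Hq : forall q, nxt n (x, y) q -> ~ bad (S n) q ->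
        Cmod (bd g (fst q) (fst q + w (S n)) (snd q) (snd q + h (S n))) <= eps * D (S n) ^ 2).
      { intros q Hq Hnb. apply Rnot_lt_le. intros Hlt. apply Hnb. split; [|exact Hlt].
        unfold nxt in Hq; simpl in Hq. lra. }
      destruct (Classical_Prop.classic (exists q, bad (S n) q /\ nxt n (x, y) q)) as [E|N]; [exact E|exfalso].
      assert (N' : forall q, nxt n (x, y) q -> ~ bad (S n) q) by (intros q Hq' Hb'; apply N; exists q; auto).
      assert (Q := fun q Hn => Hq q Hn (N' q Hn)).
      pose proof (HwS n) as Ew. pose proof (HhS n) as Eh. pose proof (Hw0 (S n)) as Hws. pose proof (Hh0 (S n)) as Hhs.
      assert (Q1 := Q (x, y)). assert (Q2 := Q (x + w (S n), y)). assert (Q3 := Q (x, y + h (S n))).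
      assert (Q4 := Q (x + w (S n), y + h (S n))).
      unfold nxt in Q1, Q2, Q3, Q4; simpl in Q1, Q2, Q3, Q4.
      specialize (Q1 ltac:(lra)). specialize (Q2 ltac:(lra)). specialize (Q3 ltac:(lra)). specialize (Q4 ltac:(lra)).
      assert (HC' : CC_rect g x (x + w n) y (y + h n)) by (eapply CC_rect_sub; [exact HC|lra..]).
      rewrite (bd_split_x g x (x + w (S n)) (x + w n)) in Hb; [|lra|lra|exact HC'].
      rewrite (bd_split_y g x (x + w (S n)) y (y + h (S n))) in Hb; [|lra|lra|eapply CC_rect_sub; [exact HC'|lra..]].
      rewrite (bd_split_y g (x + w (S n)) (x + w n) y (y + h (S n))) in Hb; [|lra|lra|eapply CC_rect_sub; [exact HC'|lra..]].
      replace (x + w (S n) + w (S n)) with (x + w n) in * by lra.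
      replace (y + h (S n) + h (S n)) with (y + h n) in * by lra.
      apply (Rlt_not_le _ _ Hb).
      eapply Rle_trans; [apply Cmod_triangle|].
      eapply Rle_trans; [apply Rplus_le_compat; apply Cmod_triangle|].
      rewrite (HDS n). simpl in *. lra. }
    assert (B0 : bad 0%nat (a, c)).
    { split; simpl.
      - unfold w, h, W, H; simpl. lra.
      - unfold w, h, D; simpl. unfold W, H in *.
        replace (a + (b - a) / 1) with b by field. replace (c + (d - c) / 1) with d by field.
        replace ((b - a + (d - c)) / 1) with (b - a + (d - c)) by field. exact Bad. }
    (* Made total in [p], so that a choice function can be extracted and iterated. *)
    assert (Hch : forall n p, exists q, bad n p -> bad (S n) q /\ nxt n p q).
    { intros n p. destruct (Classical_Prop.classic (bad n p)) as [Hb|Nb].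
      - destruct (step n p Hb) as [q Hq]. now exists q.
      - exists p. tauto. }
    set (F := fun n p => proj1_sig (ClassicalEpsilon.constructive_indefinite_description _ (Hch n p))).
    assert (HF : forall n p, bad n p -> bad (S n) (F n p) /\ nxt n p (F n p)).
    { intros n p. exact (proj2_sig (ClassicalEpsilon.constructive_indefinite_description _ (Hch n p))). }
    set (P := fix P n := match n with O => (a, c) | S n => F n (P n) end).
    assert (HP : forall n, bad n (P n)).
    { induction n as [|n IH]; [exact B0|]. apply HF. exact IH. }
    assert (HN : forall n, nxt n (P n) (P (S n))) by (intros n; apply HF, HP).
    destruct (nested_limit (fun n => fst (P n)) w) as [px Hpx]; [exact Hw0|intros n; apply (HN n)..|].
    destruct (nested_limit (fun n => snd (P n)) h) as [py Hpy]; [exact Hh0|intros n; apply (HN n)..|].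
    set (p := (px, py) : C).
    assert (Hp : in_rect a b c d p).
    { destruct (HP 0%nat) as [Hin _]. specialize (Hpx 0%nat). specialize (Hpy 0%nat). simpl in *. split; simpl; lra. }
    destruct (Hg p Hp) as [e Hde]. destruct (Hde (eps / 2)) as [del [Hdel Hz]]; [lra|].
    assert (Hn : exists n, D n < del).
    { destruct (pow_lt_1_zero (/ 2) ltac:(rewrite Rabs_pos_eq; lra) (del / (W + H + 1)))  as [n Hn].
      - apply Rdiv_lt_0_compat; lra.
      - exists n. specialize (Hn n (Nat.le_refl n)). rewrite pow_inv, Rabs_pos_eq in Hn.
        + unfold D, Rdiv in *. apply Rle_lt_trans with ((W + H + 1) * / 2 ^ n).
          * apply Rmult_le_compat_r; [apply Rlt_le, Rinv_0_lt_compat, H2n|lra].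
          * apply Rmult_lt_compat_l with (r := W + H + 1) in Hn; [|lra].
            replace ((W + H + 1) * (del * / (W + H + 1))) with del in Hn by (field; lra). exact Hn.
        + apply Rlt_le, Rinv_0_lt_compat, H2n. }
    destruct Hn as [n Hn]. destruct (HP n) as [Hin Hb].
    specialize (Hpx n). specialize (Hpy n). destruct (P n) as [x y]. simpl in *.
    apply (Rlt_not_le _ _ Hb).
    set (A := (g p - e * p)%C).
    assert (HCn : CC_rect g x (x + w n) y (y + h n)) by (eapply CC_rect_sub; [exact HC|lra..]).
    replace (bd g x (x + w n) y (y + h n)) with (bd (fun z => g z - (A + e * z))%C x (x + w n) y (y + h n)).
    2:{ rewrite bd_minus.
        - rewrite bd_affine by (generalize (Hw0 n) (Hh0 n); lra). ring.
        - generalize (Hw0 n); lra.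
        - generalize (Hh0 n); lra.
        - exact HCn.
        - intros z _. apply CC_affine. }
    assert (HDn : w n + h n = D n) by (unfold w, h, D; field; generalize (H2n n); lra).
    eapply Rle_trans; [apply bd_bound with (M := eps / 2 * D n)|].
    - generalize (Hw0 n); lra.
    - generalize (Hh0 n); lra.
    - intros z Hzz. apply CC_minus; [now apply HCn|apply CC_affine].
    - intros z [Hz1 Hz2].
      assert (Hzp : Cmod (z - p) <= D n).
      { eapply Rle_trans; [apply Cmod_le_ReIm|]. rewrite <- HDn. apply Rplus_le_compat; apply Rabs_le;
          destruct z as [zx zy]; simpl in *; lra. }
      replace (g z - (A + e * z))%C with (g z - g p - e * (z - p))%C by (unfold A; ring).
      eapply Rle_trans; [apply Hz; lra|]. apply Rmult_le_compat_l; lra.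
    - replace (x + w n - x + (y + h n - y)) with (D n) by lra. simpl. lra. }
  apply Cmod_eq_0. apply Rle_antisym; [|apply Cmod_ge_0].
  apply Rnot_lt_le. intros Hpos.
  set (X := Cmod (bd g a b c d)) in *.
  assert (HX := Key (X / (2 * ((W + H) ^ 2 + 1)))).
  assert (0 <= (W + H) ^ 2) by apply pow2_ge_0.
  specialize (HX ltac:(apply Rdiv_lt_0_compat; lra)).
  assert (X / (2 * ((W + H) ^ 2 + 1)) * (W + H) ^ 2 <= X / 2); [|lra].
  replace (X / 2) with (X / (2 * ((W + H) ^ 2 + 1)) * ((W + H) ^ 2 + 1)) by (field; lra).
  apply Rmult_le_compat_l; [|lra]. apply Rlt_le, Rdiv_lt_0_compat; lra.
Qed.

(** The exceptional point is enclosed in a square of half-side [eta], where continuity bounds [g] by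
    [M] and the integral by [8 M eta]; the four surrounding rectangles contribute nothing. This is
    meant for difference quotients, which are continuous at the base point but not known to be
    differentiable there. *)
Lemma goursat_except (g : C -> C) a b c d p : CC_rect g a b c d ->
  a < Re p < b -> c < Im p < d ->
  (forall z, in_rect a b c d z -> z <> p -> exists e, cderiv g z e) -> bd g a b c d = 0%C.
Proof.
  intros HC Ha Hc Hg. destruct p as [px py]. simpl in Ha, Hc.
  assert (Hp : in_rect a b c d (px, py)) by (split; simpl; lra).
  destruct (HC _ Hp 1 Rlt_0_1) as [del [Hdel Hnear]].
  set (M := Cmod (g (px, py)) + 1).
  assert (HM0 : 0 < M) by (unfold M; generalize (Cmod_ge_0 (g (px, py))); lra).
  assert (Key : forall eta, 0 < eta -> eta < del / 2 -> eta < px - a -> eta < b - px -> eta < py - c -> eta < d - py ->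
    Cmod (bd g a b c d) <= 8 * M * eta).
  { intros eta H0 H1 H2 H3 H4 H5.
    rewrite (bd_split_x g a (px - eta) b) by (trivial; lra).
    rewrite (bd_split_x g (px - eta) (px + eta) b); [|lra|lra|eapply CC_rect_sub; [exact HC|lra..]].
    rewrite (bd_split_y g (px - eta) (px + eta) c (py - eta)); [|lra|lra|eapply CC_rect_sub; [exact HC|lra..]].
    rewrite (bd_split_y g (px - eta) (px + eta) (py - eta) (py + eta)); [|lra|lra|eapply CC_rect_sub; [exact HC|lra..]].
    assert (G : forall a' b' c' d', a <= a' -> a' <= b' -> b' <= b -> c <= c' -> c' <= d' -> d' <= d ->
      (px < a' \/ b' < px \/ py < c' \/ d' < py) -> bd g a' b' c' d' = 0%C).
    { intros a' b' c' d' A1 A2 A3 A4 A5 A6 A7. apply goursat; trivial. intros z [Z1 Z2]. apply Hg; [split; lra|].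
      intros ->. simpl in *. lra. }
    rewrite (G a (px - eta)), (G (px + eta) b), (G (px - eta) (px + eta) c (py - eta)), (G (px - eta) (px + eta) (py + eta) d) by lra.
    replace (0 + (0 + (bd g (px - eta) (px + eta) (py - eta) (py + eta) + 0) + 0))%C
      with (bd g (px - eta) (px + eta) (py - eta) (py + eta)) by ring.
    eapply Rle_trans; [apply bd_bound with (M := M)|].
    - lra.
    - lra.
    - eapply CC_rect_sub; [exact HC|lra..].
    - intros z [Z1 Z2]. unfold M.
      replace (g z) with (g (px, py) + (g z - g (px, py)))%C by ring.
      eapply Rle_trans; [apply Cmod_triangle|]. apply Rplus_le_compat_l, Rlt_le, Hnear.
      eapply Rle_lt_trans; [apply Cmod_le_ReIm|].
      destruct z as [zx zy]; simpl in *.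
      apply Rlt_le_trans with (del / 2 + del / 2); [|lra].
      apply Rplus_lt_compat; apply Rabs_lt_between; lra.
    - nra. }
  apply Cmod_eq_0. apply Rle_antisym; [|apply Cmod_ge_0].
  apply Rnot_lt_le. intros Hpos. set (X := Cmod (bd g a b c d)) in *.
  set (m := Rmin (Rmin (del / 2) (X / (8 * M))) (Rmin (Rmin (px - a) (b - px)) (Rmin (py - c) (d - py)))).
  assert (Hm : 0 < m).
  { unfold m. repeat apply Rmin_pos; try lra. apply Rdiv_lt_0_compat; lra. }
  assert (m <= del / 2 /\ m <= X / (8 * M) /\ m <= px - a /\ m <= b - px /\ m <= py - c /\ m <= d - py).
  { unfold m. set (u1 := Rmin (del / 2) (X / (8 * M))). set (u2 := Rmin (px - a) (b - px)). set (u3 := Rmin (py - c) (d - py)).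
    generalize (Rmin_l u1 (Rmin u2 u3)) (Rmin_r u1 (Rmin u2 u3)) (Rmin_l u2 u3) (Rmin_r u2 u3)
      (Rmin_l (del / 2) (X / (8 * M))) (Rmin_r (del / 2) (X / (8 * M))) (Rmin_l (px - a) (b - px)) (Rmin_r (px - a) (b - px))
      (Rmin_l (py - c) (d - py)) (Rmin_r (py - c) (d - py)). fold u1 u2 u3. lra. }
  specialize (Key (m / 2)).
  assert (X <= 8 * M * (m / 2)) by (apply Key; lra).
  assert (8 * M * (m / 2) <= X / 2); [|lra].
  apply Rle_trans with (8 * M * (X / (8 * M) / 2)); [|apply Req_le; field; lra].
  apply Rmult_le_compat_l; lra.
Qed.

(** * Laurent expansions *)

Definition cdiff (f : C -> C) (z : C) : Prop := exists d, cderiv f z d.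

Lemma cdiff_const a z : cdiff (fun _ => a) z.
Proof. eexists. apply cderiv_const. Qed.
Lemma cdiff_id z : cdiff (fun w => w) z.
Proof. eexists. apply cderiv_id. Qed.
Lemma cdiff_plus f g z : cdiff f z -> cdiff g z -> cdiff (fun w => f w + g w)%C z.
Proof. intros [d Hd] [e He]. eexists. apply cderiv_plus; eassumption. Qed.
Lemma cdiff_minus f g z : cdiff f z -> cdiff g z -> cdiff (fun w => f w - g w)%C z.
Proof. intros [d Hd] [e He]. eexists. apply cderiv_minus; eassumption. Qed.
Lemma cdiff_opp f z : cdiff f z -> cdiff (fun w => - f w)%C z.
Proof. intros [d Hd]. eexists. apply cderiv_opp; eassumption. Qed.
Lemma cdiff_mult f g z : cdiff f z -> cdiff g z -> cdiff (fun w => f w * g w)%C z.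
Proof. intros [d Hd] [e He]. eexists. apply cderiv_mult; eassumption. Qed.
Lemma cdiff_div (f g : C -> C) (z : C) : g z <> 0%C -> cdiff f z -> cdiff g z -> cdiff (fun w => f w / g w)%C z.
Proof. intros H [d Hd] [e He]. eexists. apply cderiv_div; eassumption. Qed.
Lemma cdiff_comp f g z : cdiff f z -> cdiff g (f z) -> cdiff (fun w => g (f w)) z.
Proof. intros [d Hd] [e He]. eexists. apply (cderiv_comp f g); eassumption. Qed.
Lemma cdiff_pow f n z : cdiff f z -> cdiff (fun w => f w ^ n)%C z.
Proof. intros H. apply (cdiff_comp f (fun w => w ^ n)%C); [exact H|]. eexists. apply cderiv_pow. Qed.
Lemma cdiff_CC f z : cdiff f z -> CC f z.
Proof. intros [d Hd]. exact (cderiv_CC f z d Hd). Qed.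

Lemma CC_mult f g z : CC f z -> CC g z -> CC (fun w => f w * g w)%C z.
Proof.
  intros Hf Hg eps He. set (F := Cmod (f z)). set (G := Cmod (g z)).
  assert (HF : 0 <= F) by apply Cmod_ge_0. assert (HG : 0 <= G) by apply Cmod_ge_0.
  set (e := Rmin 1 (eps / (2 * (F + G + 1)))).
  assert (Hep : 0 < e) by (apply Rmin_pos; [lra|apply Rdiv_lt_0_compat; lra]).
  assert (He1 : e <= 1) by apply Rmin_l.
  assert (He2 : e * (F + G + 1) <= eps / 2).
  { apply Rle_trans with (eps / (2 * (F + G + 1)) * (F + G + 1)); [|apply Req_le; field; lra].
    apply Rmult_le_compat_r; [lra|apply Rmin_r]. }
  destruct (Hf e Hep) as [d1 [Hd1 H1]]. destruct (Hg e Hep) as [d2 [Hd2 H2]].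
  exists (Rmin d1 d2); split; [now apply Rmin_pos|]. intros w Hw.
  specialize (H1 w (Rlt_le_trans _ _ _ Hw (Rmin_l _ _))). specialize (H2 w (Rlt_le_trans _ _ _ Hw (Rmin_r _ _))).
  replace (f w * g w - f z * g z)%C with ((f w - f z) * g z + f z * (g w - g z) + (f w - f z) * (g w - g z))%C by ring.
  eapply Rle_lt_trans; [apply Cmod_triangle|].
  eapply Rle_lt_trans; [apply Rplus_le_compat_r, Cmod_triangle|]. rewrite !Cmod_mult. fold F G.
  generalize (Cmod_ge_0 (f w - f z)) (Cmod_ge_0 (g w - g z)). intros.
  assert (Cmod (f w - f z) * Cmod (g w - g z) <= e * 1) by (apply Rmult_le_compat; lra).
  assert (Cmod (f w - f z) * G <= e * G) by (apply Rmult_le_compat_r; lra).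
  assert (F * Cmod (g w - g z) <= e * F) by (rewrite (Rmult_comm e); apply Rmult_le_compat_l; lra).
  lra.
Qed.

Lemma CC_comp f g z : CC f z -> CC g (f z) -> CC (fun w => g (f w)) z.
Proof.
  intros Hf Hg eps He. destruct (Hg eps He) as [d [Hd H]]. destruct (Hf d Hd) as [d' [Hd' H']].
  exists d'; split; trivial. intros w Hw. now apply H, H'.
Qed.

Lemma polar (z : C) : exists t, - PI <= t <= PI /\ z = (RtoC (Cmod z) * cis t)%C.
Proof.
  destruct (Ceq_dec z 0) as [->|N].
  { exists 0. split; [generalize PI_RGT_0; lra|]. rewrite Cmod_0. ring. }
  assert (Hm : 0 < Cmod z) by (apply Cmod_gt_0; exact N).
  set (x := Re z / Cmod z).
  assert (Hx : -1 <= x <= 1).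
  { assert (H := Re_le_Cmod' z). apply Rabs_le_between in H. unfold x. split;
      apply Rmult_le_reg_r with (Cmod z); trivial; unfold Rdiv; rewrite Rmult_assoc, Rinv_l; lra. }
  assert (Hb := acos_bound x). assert (Hc := cos_acos x Hx). assert (Hs := sin_acos x Hx).
  assert (Hy : Cmod z * sqrt (1 - Rsqr x) = Rabs (Im z)).
  { rewrite <- (sqrt_square (Cmod z)) at 1 by lra. rewrite <- sqrt_mult_alt by nra.
    rewrite <- sqrt_Rsqr_abs. f_equal.
    assert (E : Cmod z * Cmod z = Re z * Re z + Im z * Im z).
    { unfold Cmod. rewrite sqrt_sqrt; [simpl; unfold Re, Im; ring|]. simpl. nra. }
    unfold x, Rsqr. replace (Cmod z * Cmod z * (1 - Re z / Cmod z * (Re z / Cmod z))) with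
      (Cmod z * Cmod z - Re z * Re z) by (field; lra). rewrite E. ring. }
  assert (Hxe : Cmod z * x = Re z) by (unfold x; field; lra).
  destruct (Rle_lt_dec 0 (Im z)) as [P|Q].
  - exists (acos x). split; [lra|]. unfold cis. rewrite Hc, Hs. apply C_ext; simpl.
    + change (fst z) with (Re z). lra.
    + rewrite Rabs_pos_eq in Hy by exact P. change (snd z) with (Im z). lra.
  - exists (- acos x). split; [lra|]. unfold cis. rewrite cos_neg, sin_neg, Hc, Hs. apply C_ext; simpl.
    + change (fst z) with (Re z). lra.
    + rewrite Rabs_left in Hy by exact Q. change (snd z) with (Im z). lra.
Qed.

Lemma Cexp_polar s t : Cexp (s, t) = (RtoC (exp s) * cis t)%C.
Proof. unfold Cexp, cis. apply C_ext; simpl; ring. Qed.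

Lemma cis_inj u v : Rabs (u - v) < 2 * PI -> cis u = cis v -> u = v.
Proof.
  intros H E. set (h := (u - v) / 2).
  assert (Hc : cos (2 * h) = 1).
  { replace (2 * h) with (u - v) by (unfold h; field). rewrite cos_minus.
    injection E as E1 E2. rewrite E1, E2. rewrite <- (sin2_cos2 v). unfold Rsqr. ring. }
  rewrite cos_2a_sin in Hc. assert (Hs : sin h = 0) by nra.
  apply Rabs_lt_between in H.
  destruct (Rtotal_order h 0) as [L|[L|L]].
  - assert (0 < sin (- h)) by (apply sin_gt_0; unfold h in *; lra). rewrite sin_neg in H0. lra.
  - unfold h in L. lra.
  - assert (0 < sin h) by (apply sin_gt_0; unfold h in *; lra). lra.
Qed.

Lemma exp_le a b : a <= b -> exp a <= exp b.
Proof. intros [H| ->]; [left; now apply exp_increasing|lra]. Qed.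

Lemma exCI_all f a b : (forall t, ccont f t) -> exCI f a b.
Proof. intros H. split; apply (ex_RInt_continuous (V := R_CompleteNormedModule)); intros z _; apply H. Qed.

Lemma CI_periodic f t0 : (forall t, ccont f t) -> (forall t, f (t + 2 * PI) = f t) ->
  CI f t0 (t0 + 2 * PI) = CI f 0 (2 * PI).
Proof.
  intros H P.
  rewrite (CI_Chasles f t0 0 (t0 + 2 * PI)) by now apply exCI_all.
  rewrite (CI_Chasles f 0 (2 * PI) (t0 + 2 * PI)) by now apply exCI_all.
  assert (E : CI f (2 * PI) (t0 + 2 * PI) = CI f 0 t0).
  { replace (CI f (2 * PI) (t0 + 2 * PI)) with (CI f (0 + 2 * PI) (t0 + 2 * PI)) by (f_equal; ring).
    rewrite <- CI_shift by now apply exCI_all.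
    unfold CI. f_equal; apply RInt_ext; intros x _; now rewrite P. }
  rewrite E.
  assert (E2 : (CI f t0 0 + CI f 0 t0 = 0)%C).
  { rewrite <- CI_Chasles by now apply exCI_all. unfold CI. rewrite !RInt_point. reflexivity. }
  replace (CI f t0 0 + (CI f 0 (2 * PI) + CI f 0 t0))%C with (CI f 0 (2 * PI) + (CI f t0 0 + CI f 0 t0))%C by ring.
  rewrite E2. ring.
Qed.

(** The integral is taken in the angle, so [circ R q / (2 PI)] is the mean of [q] on the circle, and
    the Laurent coefficient of index [n] of [g] is the mean of [g z / z ^ n]. *)
Definition circ (R : R) (q : C -> C) : C := CI (fun t => q (RtoC R * cis t)%C) 0 (2 * PI).

Lemma circle_eps q R : 0 <= R -> (forall z, Cmod z = R -> CC q z) -> forall t eps, 0 < eps ->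
  exists del, 0 < del /\ forall s, Rabs (s - t) < del -> Cmod (q (RtoC R * cis s)%C - q (RtoC R * cis t)%C) < eps.
Proof.
  intros HR H t eps0 He0.
  destruct (H (RtoC R * cis t)%C ltac:(rewrite Cmod_mult, Cmod_R, Cmod_cis, Rabs_pos_eq; lra) eps0 He0) as [eps [He Hq]].
  destruct (cis_cont_eps t (eps / (R + 1))) as [d [Hd Hs]]; [apply Rdiv_lt_0_compat; lra|].
  exists d; split; trivial. intros s Hst. specialize (Hs s Hst). apply Hq.
  replace (RtoC R * cis s - RtoC R * cis t)%C with (RtoC R * (cis s - cis t))%C by ring.
  rewrite Cmod_mult, Cmod_R, Rabs_pos_eq by lra.
  apply Rle_lt_trans with ((R + 1) * Cmod (cis s - cis t)); [apply Rmult_le_compat_r; [apply Cmod_ge_0|lra]|].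
  apply Rmult_lt_compat_l with (r := R + 1) in Hs; [|lra].
  replace ((R + 1) * (eps / (R + 1))) with eps in Hs by (field; lra). exact Hs.
Qed.

Lemma circle_ccont q R : 0 <= R -> (forall z, Cmod z = R -> CC q z) -> forall t, ccont (fun t => q (RtoC R * cis t)%C) t.
Proof.
  intros HR H t. apply ccont_eps. exact (circle_eps q R HR H t).
Qed.

Lemma circle_ex q R a b : 0 <= R -> (forall z, Cmod z = R -> CC q z) -> exCI (fun t => q (RtoC R * cis t)%C) a b.
Proof. intros HR H. apply exCI_all. now apply circle_ccont. Qed.

(** The exponential unfolds the annulus into a rectangle of height [2 PI], whose horizontal sides
    cancel by periodicity. Starting the angle at [t0] puts the only preimage of [p] at mid-height,
    in the interior. *)
Lemma annulus_except q R1 R2 (p : C) t0 : 0 < R1 -> R1 < Cmod p < R2 -> p = (RtoC (Cmod p) * cis (t0 + PI))%C ->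
  (forall z, R1 <= Cmod z <= R2 -> CC q z) ->
  (forall z, R1 <= Cmod z <= R2 -> z <> p -> cdiff q z) ->
  circ R1 q = circ R2 q.
Proof.
  intros H1 Hp Ep HC Hd.
  assert (HPI := PI_RGT_0).
  set (G := fun z => q (Cexp z)).
  assert (Hmod : forall z, ln R1 <= Re z <= ln R2 -> R1 <= Cmod (Cexp z) <= R2).
  { intros z [A B]. rewrite Cmod_Cexp. rewrite <- (exp_ln R1) by lra. rewrite <- (exp_ln R2) by lra.
    split; apply exp_le; assumption. }
  assert (HG0 : bd G (ln R1) (ln R2) t0 (t0 + 2 * PI) = 0%C).
  { apply (goursat_except G _ _ _ _ (ln (Cmod p), t0 + PI)).
    - intros z [Hz _]. apply (CC_comp Cexp q).
      + apply cdiff_CC. eexists; apply cderiv_exp.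
      + apply HC, Hmod, Hz.
    - simpl. split; apply ln_increasing; lra.
    - simpl. lra.
    - intros z [Hz1 Hz2] Hne. apply (cdiff_comp Cexp q).
      + eexists; apply cderiv_exp.
      + apply Hd; [apply Hmod, Hz1|]. intros E. apply Hne.
        assert (Em : exp (Re z) = Cmod p) by (rewrite <- E, Cmod_Cexp; reflexivity).
        destruct z as [x y]. simpl in *. rewrite Cexp_polar, Em in E. rewrite Ep in E at 2.
        f_equal.
        * rewrite <- Em, ln_exp. reflexivity.
        * apply cis_inj; [apply Rabs_lt_between; lra|].
          assert (N : RtoC (Cmod p) <> 0%C) by (apply RtoC_neq0; lra).
          replace (cis y) with (/ RtoC (Cmod p) * (RtoC (Cmod p) * cis y))%C by (field; exact N).
          rewrite E. field. exact N. }
  unfold bd in HG0.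
  replace (hor G (ln R1) (ln R2) (t0 + 2 * PI)) with (hor G (ln R1) (ln R2) t0) in HG0.
  2:{ apply CI_ext; [apply Rlt_le, ln_increasing; lra|]. intros t _. unfold G. rewrite !Cexp_polar, cis_2PI. reflexivity. }
  assert (HV : forall R, R1 <= R <= R2 -> ver G (ln R) t0 (t0 + 2 * PI) = circ R q).
  { intros R HR. unfold ver, circ. rewrite <- (CI_periodic _ t0).
    - apply CI_ext; [lra|]. intros t _. unfold G. rewrite Cexp_polar, exp_ln by lra. reflexivity.
    - apply circle_ccont; [lra|]. intros z Hz. apply HC. lra.
    - intros t. now rewrite cis_2PI. }
  rewrite !HV in HG0 by lra.
  assert (E : (Ci * (circ R2 q - circ R1 q) = 0)%C) by (rewrite <- HG0; ring).
  replace (circ R2 q) with (circ R1 q + (- Ci) * (Ci * (circ R2 q - circ R1 q)))%C by (apply C_ext; simpl; ring).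
  rewrite E. ring.
Qed.

Lemma annulus q R1 R2 : 0 < R1 <= R2 -> (forall z, R1 <= Cmod z <= R2 -> cdiff q z) -> circ R1 q = circ R2 q.
Proof.
  intros H Hd. destruct (Req_dec R1 R2) as [->|N]; [reflexivity|].
  assert (Hm : Cmod (RtoC ((R1 + R2) / 2) * cis (0 + PI))%C = (R1 + R2) / 2).
  { rewrite Cmod_mult, Cmod_R, Cmod_cis, Rabs_pos_eq; lra. }
  apply (annulus_except q R1 R2 (RtoC ((R1 + R2) / 2) * cis (0 + PI))%C 0).
  - lra.
  - rewrite Hm. lra.
  - now rewrite Hm.
  - intros z Hz. apply cdiff_CC. auto.
  - auto.
Qed.

Lemma circle_bound q R : 0 <= R -> (forall z, Cmod z = R -> CC q z) -> exists M, 0 < M /\ forall z, Cmod z = R -> Cmod (q z) <= M.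
Proof.
  intros HR H. assert (HPI := PI_RGT_0).
  destruct (continuity_ab_maj (fun t => Cmod (q (RtoC R * cis t)%C)) (- PI) PI) as [tm [Hm _]]; [lra| |].
  - intros t _. apply continuity_pt_filterlim. intros P [eps HP].
    destruct (circle_eps q R HR H t eps (cond_pos eps)) as [d [Hd Hs]].
    exists (mkposreal d Hd). intros s Hst. apply HP. specialize (Hs s Hst).
    set (y := q (RtoC R * cis s)%C) in *. set (z0 := q (RtoC R * cis t)%C) in *.
    change (Rabs (Cmod y - Cmod z0) < eps).
    assert (Cmod y <= Cmod (y - z0) + Cmod z0).
    { replace y with ((y - z0) + z0)%C at 1 by ring. apply Cmod_triangle. }
    assert (Cmod z0 <= Cmod (y - z0) + Cmod y).
    { replace z0 with (- (y - z0) + y)%C at 1 by ring. eapply Rle_trans; [apply Cmod_triangle|]. rewrite Cmod_opp. lra. }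
    apply Rabs_lt_between. lra.
  - exists (Cmod (q (RtoC R * cis tm)%C) + 1). split; [generalize (Cmod_ge_0 (q (RtoC R * cis tm)%C)); lra|].
    intros z Hz. destruct (polar z) as [t [Ht E]]. rewrite E, Hz. specialize (Hm t Ht). lra.
Qed.

Lemma circ_bound q R M : 0 <= R -> (forall z, Cmod z = R -> CC q z) -> (forall z, Cmod z = R -> Cmod (q z) <= M) ->
  Cmod (circ R q) <= M * (2 * PI).
Proof.
  intros HR H HM. assert (HPI := PI_RGT_0). replace (M * (2 * PI)) with (M * (2 * PI - 0)) by ring.
  apply CI_bound; [lra|now apply circle_ex|]. intros t _. apply HM. rewrite Cmod_mult, Cmod_R, Cmod_cis, Rabs_pos_eq; lra.
Qed.

Lemma circ_plus f g R : 0 <= R -> (forall z, Cmod z = R -> CC f z) -> (forall z, Cmod z = R -> CC g z) ->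
  circ R (fun z => f z + g z)%C = (circ R f + circ R g)%C.
Proof. intros HR Hf Hg. unfold circ. apply (CI_plus (fun t => f (RtoC R * cis t)%C) (fun t => g (RtoC R * cis t)%C)); now apply circle_ex. Qed.

Lemma circ_scal k f R : 0 <= R -> (forall z, Cmod z = R -> CC f z) ->
  circ R (fun z => k * f z)%C = (k * circ R f)%C.
Proof. intros HR Hf. unfold circ. apply (CI_scal k (fun t => f (RtoC R * cis t)%C)); now apply circle_ex. Qed.

Lemma circ_ext f g R : 0 <= R -> (forall z, Cmod z = R -> f z = g z) -> circ R f = circ R g.
Proof.
  intros HR H. assert (HPI := PI_RGT_0). apply CI_ext; [lra|]. intros t _. apply H.
  rewrite Cmod_mult, Cmod_R, Cmod_cis, Rabs_pos_eq; lra.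
Qed.

Lemma circ_const k R : circ R (fun _ => k) = (k * RtoC (2 * PI))%C.
Proof.
  unfold circ, CI. rewrite !RInt_const. apply C_ext; simpl; unfold scal; simpl; unfold mult; simpl;
  unfold Re, Im; ring.
Qed.

Lemma cis_pow t n : (cis t ^ n)%C = cis (INR n * t).
Proof.
  induction n as [|n IH].
  - simpl. unfold cis. rewrite Rmult_0_l, cos_0, sin_0. reflexivity.
  - rewrite S_INR. simpl. rewrite IH, <- cis_plus. f_equal. ring.
Qed.

Lemma CI_cis k : k <> 0 -> cis (k * (2 * PI)) = 1%C -> CI (fun t => cis (k * t)) 0 (2 * PI) = 0%C.
Proof.
  intros Hk E. unfold cis in E. injection E as E1 E2.
  unfold CI, cis, RtoC. f_equal; simpl.
  - replace 0 with (minus ((fun t => sin (k * t) / k) (2 * PI)) ((fun t => sin (k * t) / k) 0)) at 2.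
    + apply is_RInt_unique. apply (is_RInt_derive (fun t => sin (k * t) / k)).
      * intros x _. auto_derive; [trivial|]. field. exact Hk.
      * intros x _. apply (ex_derive_continuous (V := R_NormedModule)). auto_derive. trivial.
    + unfold minus, plus, opp; simpl. rewrite E2, Rmult_0_r, sin_0. field. exact Hk.
  - replace 0 with (minus ((fun t => - cos (k * t) / k) (2 * PI)) ((fun t => - cos (k * t) / k) 0)) at 2.
    + apply is_RInt_unique. apply (is_RInt_derive (fun t => - cos (k * t) / k)).
      * intros x _. auto_derive; [trivial|]. field. exact Hk.
      * intros x _. apply (ex_derive_continuous (V := R_NormedModule)). auto_derive. trivial.
    + unfold minus, plus, opp; simpl. rewrite E1, Rmult_0_r, cos_0. field. exact Hk.
Qed.

Lemma cis_2PI_nat n : cis (INR n * (2 * PI)) = 1%C.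
Proof.
  induction n as [|n IH].
  - simpl. rewrite Rmult_0_l. unfold cis. now rewrite cos_0, sin_0.
  - rewrite S_INR. replace ((INR n + 1) * (2 * PI)) with (INR n * (2 * PI) + 2 * PI) by ring.
    now rewrite cis_2PI.
Qed.

Lemma cis_opp t : cis (- t) = (/ cis t)%C.
Proof.
  assert (H : (cis (- t) * cis t = 1)%C).
  { rewrite <- cis_plus. replace (- t + t) with 0 by ring. unfold cis. now rewrite cos_0, sin_0. }
  replace (/ cis t)%C with ((cis (- t) * cis t) * / cis t)%C by (rewrite H; ring).
  field. apply cis_neq0.
Qed.

Lemma circ_pow n R : 0 < R -> (0 < n)%nat -> circ R (fun z => z ^ n)%C = 0%C.
Proof.
  intros HR Hn. assert (HPI := PI_RGT_0).
  rewrite <- (Cmult_0_r (RtoC R ^ n)%C).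
  assert (E : CI (fun t => cis (INR n * t)) 0 (2 * PI) = 0%C).
  { apply CI_cis; [apply not_0_INR; lia|apply cis_2PI_nat]. }
  rewrite <- E, <- CI_scal.
  - apply CI_ext; [lra|]. intros t _. rewrite <- cis_pow. now rewrite Cpow_mult_l.
  - assert (H1 := circle_ex (fun z => z ^ n)%C 1 0 (2 * PI) ltac:(lra)).
    eapply exCI_ext; [lra| |apply H1; intros z _; apply cdiff_CC, (cdiff_pow (fun w => w)), cdiff_id].
    intros t _. simpl. rewrite Cmult_1_l. apply cis_pow.
Qed.

Lemma circ_inv_pow n R : 0 < R -> (0 < n)%nat -> circ R (fun z => / z ^ n)%C = 0%C.
Proof.
  intros HR Hn. assert (HPI := PI_RGT_0).
  assert (HRn : (RtoC R ^ n)%C <> 0%C) by (apply Cpow_nz, RtoC_neq0; lra).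
  rewrite <- (Cmult_0_r (/ RtoC R ^ n)%C).
  assert (E : CI (fun t => cis (- INR n * t)) 0 (2 * PI) = 0%C).
  { apply CI_cis; [assert (INR n <> 0) by (apply not_0_INR; lia); lra|].
    rewrite Ropp_mult_distr_l_reverse, cis_opp, cis_2PI_nat. field. }
  rewrite <- E, <- CI_scal.
  - apply CI_ext; [lra|]. intros t _. rewrite Ropp_mult_distr_l_reverse, cis_opp, <- cis_pow.
    rewrite Cpow_mult_l. field. split; [apply Cpow_nz, cis_neq0|exact HRn].
  - assert (H1 := circle_ex (fun z => 1 / z ^ n)%C 1 0 (2 * PI) ltac:(lra)).
    eapply exCI_ext; [lra| |apply H1; intros z Hz; apply cdiff_CC, (cdiff_div (fun _ => RtoC 1))].
    + intros t _. simpl. rewrite Cmult_1_l, Ropp_mult_distr_l_reverse, cis_opp, <- cis_pow.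
      unfold Cdiv. ring.
    + apply Cpow_nz, Cmod_gt_0. lra.
    + apply cdiff_const.
    + apply (cdiff_pow (fun w => w)), cdiff_id.
Qed.

Lemma is_series_eps (a : nat -> C) (l : C) :
  cseries a l <->
  forall eps, 0 < eps -> exists N, forall n, (N <= n)%nat -> Cmod (csum a n - l) < eps.
Proof.
  split.
  - intros H eps He.
    assert (HL : locally (T := C_NormedModule) l (fun z : C => Cmod (z - l)%C < eps)).
    { apply locally_le_locally_norm. exists (mkposreal eps He). intros y Hy. exact Hy. }
    destruct (H _ HL) as [N HN]. exists N. intros n Hn. exact (HN n Hn).
  - intros H P HP. apply locally_norm_le_locally in HP. destruct HP as [eps HP].
    destruct (H eps (cond_pos eps)) as [N HN]. exists N. intros n Hn. apply HP. exact (HN n Hn).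
Qed.

Lemma pow_small rho K eps : 0 <= rho < 1 -> 0 < eps -> exists N, forall n, (N <= n)%nat -> K * rho ^ n < eps.
Proof.
  intros Hr He. destruct (pow_lt_1_zero rho ltac:(rewrite Rabs_pos_eq; lra) (eps / (Rabs K + 1))) as [N HN].
  - apply Rdiv_lt_0_compat; [lra|]. generalize (Rabs_pos K); lra.
  - exists N. intros n Hn. specialize (HN n Hn). rewrite Rabs_pos_eq in HN by (apply pow_le; lra).
    assert (HK := Rabs_pos K). assert (HK' := Rle_abs K).
    apply Rle_lt_trans with ((Rabs K + 1) * rho ^ n).
    + apply Rmult_le_compat_r; [apply pow_le; lra|lra].
    + apply Rmult_lt_compat_l with (r := Rabs K + 1) in HN; [|lra].
      replace ((Rabs K + 1) * (eps / (Rabs K + 1))) with eps in HN by (field; lra). exact HN.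
Qed.

Lemma small_eq0 (z : C) K rho : 0 <= rho < 1 -> (forall n : nat, Cmod z <= K * rho ^ n) -> z = 0%C.
Proof.
  intros Hr H. apply Cmod_eq_0. apply Rle_antisym; [|apply Cmod_ge_0].
  apply Rnot_lt_le. intros Hp. destruct (pow_small rho K (Cmod z) Hr Hp) as [N HN].
  specialize (HN N (Nat.le_refl N)). specialize (H N). lra.
Qed.

Lemma is_series_rate (a : nat -> C) (l : C) K rho : 0 <= rho < 1 ->
  (forall n, Cmod (csum a n - l) <= K * rho ^ n) ->
  cseries a l.
Proof.
  intros Hr H. apply is_series_eps. intros eps He. destruct (pow_small rho K eps Hr He) as [N HN].
  exists N. intros n Hn. eapply Rle_lt_trans; [apply H|apply HN, Hn].
Qed.

Lemma sum_n_C_S (a : nat -> C) n : csum a (S n) = (csum a n + a (S n))%C.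
Proof. apply (sum_Sn (G := C_AbelianMonoid)). Qed.
Lemma sum_n_C_0 (a : nat -> C) : csum a 0 = a 0%nat.
Proof. apply (sum_O (G := C_AbelianMonoid)). Qed.

Lemma Cmod_minus_ge (z y : C) : Cmod z - Cmod y <= Cmod (z - y).
Proof.
  assert (Cmod z <= Cmod (z - y) + Cmod y); [|lra].
  replace z with ((z - y) + y)%C at 1 by ring. apply Cmod_triangle.
Qed.

Lemma is_series_C_unique (a : nat -> C) (l l' : C) :
  cseries a l -> cseries a l' -> l = l'.
Proof.
  intros H H'. assert (H1 := proj1 (is_series_eps a l) H). assert (H2 := proj1 (is_series_eps a l') H'). clear H H'. rename H1 into H, H2 into H'.
  destruct (Ceq_dec l l') as [E|N]; [exact E|exfalso].
  assert (Hp : 0 < Cmod (l - l')) by (apply Cmod_gt_0, Cminus_eq_contra, N).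
  destruct (H (Cmod (l - l') / 2)) as [n1 H1]; [lra|]. destruct (H' (Cmod (l - l') / 2)) as [n2 H2]; [lra|].
  specialize (H1 (n1 + n2)%nat ltac:(lia)). specialize (H2 (n1 + n2)%nat ltac:(lia)).
  set (s := csum a (n1 + n2)) in *.
  assert (Cmod (l - l') <= Cmod (s - l) + Cmod (s - l')).
  { replace (l - l')%C with ((s - l') + - (s - l))%C by ring. eapply Rle_trans; [apply Cmod_triangle|]. rewrite Cmod_opp. lra. }
  lra.
Qed.

(** Outside [y], the kernel [z / (z - y)] is a geometric series in [y / z]; [A N] is the remainder
    after [N] terms, of order [(|y| / R)^N]. *)
Lemma circ_outer phi R (y : C) : 0 < R -> Cmod y < R -> (forall z, Cmod z = R -> CC phi z) ->
  cseries (fun n => y ^ n * circ R (fun z => phi z * / z ^ n))%C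
    (circ R (fun z => phi z * (z / (z - y)))%C).
Proof.
  intros HR Hy Hphi. assert (HPI := PI_RGT_0).
  assert (Hz0 : forall z, Cmod z = R -> z <> 0%C) by (intros z Hz; apply Cmod_gt_0; lra).
  assert (Hzy : forall z, Cmod z = R -> (z - y)%C <> 0%C).
  { intros z Hz. apply Cmod_gt_0. generalize (Cmod_minus_ge z y). lra. }
  destruct (circle_bound phi R ltac:(lra) Hphi) as [M [HM0 HM]].
  set (A := fun N => circ R (fun z => phi z * ((y / z) ^ N * (z / (z - y))))%C).
  assert (HCk : forall N z, Cmod z = R -> CC (fun z => (y / z) ^ N * (z / (z - y)))%C z).
  { intros N z Hz. apply cdiff_CC, cdiff_mult.
    - apply (cdiff_pow (fun z => y / z)%C). apply cdiff_div; [auto|apply cdiff_const|apply cdiff_id].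
    - apply cdiff_div; [auto|apply cdiff_id|]. apply cdiff_minus; [apply cdiff_id|apply cdiff_const]. }
  assert (HA : forall N z, Cmod z = R -> CC (fun z => phi z * ((y / z) ^ N * (z / (z - y))))%C z).
  { intros N z Hz. apply CC_mult; [auto|]. now apply HCk. }
  assert (HI : forall n z, Cmod z = R -> CC (fun z => phi z * / z ^ n)%C z).
  { intros n z Hz. apply CC_mult; [auto|]. apply cdiff_CC. destruct (cdiff_div (fun _ => RtoC 1) (fun z => z ^ n)%C z) as [d Hd].
    - apply Cpow_nz; auto.
    - apply cdiff_const.
    - apply (cdiff_pow (fun w => w)), cdiff_id.
    - exists d. revert Hd. apply cderiv_ext. intros w. unfold Cdiv. ring. }
  assert (Hstep : forall N, A N = (y ^ N * circ R (fun z => phi z * / z ^ N) + A (S N))%C).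
  { intros N. unfold A. rewrite <- circ_scal, <- circ_plus; try lra; auto.
    - apply circ_ext; [lra|]. intros z Hz. unfold Cdiv at 1 3. rewrite !Cpow_mult_l, Cpow_inv by auto. simpl.
      rewrite Cpow_inv by auto. field. repeat split; auto. apply Cpow_nz; auto.
    - intros z Hz. apply CC_mult; [apply cdiff_CC, cdiff_const|auto]. }
  assert (Hsum : forall N, A 0%nat = (csum (fun n => y ^ n * circ R (fun z => phi z * / z ^ n))%C N + A (S N))%C).
  { induction N as [|N IH].
    - rewrite sum_n_C_0. apply Hstep.
    - rewrite sum_n_C_S, IH, (Hstep (S N)). ring. }
  assert (HA0 : A 0%nat = circ R (fun z => phi z * (z / (z - y)))%C).
  { unfold A. apply circ_ext; [lra|]. intros z Hz. simpl. ring. }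
  rewrite <- HA0.
  set (rho := Cmod y / R).
  assert (Hrho : 0 <= rho < 1).
  { unfold rho. split.
    - apply Rdiv_le_0_compat; [apply Cmod_ge_0|lra].
    - apply Rmult_lt_reg_r with R; [lra|]. unfold Rdiv. rewrite Rmult_assoc, Rinv_l; lra. }
  apply is_series_rate with (K := M * (R / (R - Cmod y)) * (2 * PI)) (rho := rho); [exact Hrho|].
  intros N. rewrite (Hsum N).
  match goal with |- Cmod (?s - (?s + ?t))%C <= _ => replace (s - (s + t))%C with (- t)%C by ring end.
  rewrite Cmod_opp. unfold A.
  replace (M * (R / (R - Cmod y)) * (2 * PI) * rho ^ N) with (M * (rho ^ N * (R / (R - Cmod y))) * (2 * PI)) by ring.
  apply circ_bound; [lra|apply HA|].
  intros z Hz. rewrite Cmod_mult. apply Rmult_le_compat; try apply Cmod_ge_0; [auto|].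
  rewrite Cmod_mult, Cmod_pow, !Cmod_div by auto. rewrite Hz. fold rho.
  assert (0 <= rho ^ N) by (apply pow_le; lra).
  apply Rmult_le_compat.
  - apply pow_le; lra.
  - apply Rdiv_le_0_compat; [lra|]. apply Cmod_gt_0. auto.
  - simpl. rewrite <- (Rmult_1_l (rho ^ N)) at 2. apply Rmult_le_compat_r; lra.
  - apply Rmult_le_compat_l; [lra|]. apply Rinv_le_contravar; [lra|]. generalize (Cmod_minus_ge z y). lra.
Qed.

(** Inside [y], the kernel is a geometric series in positive powers of [z / y]. The hypothesis
    removes every term, so the integral equals each of its own remainders, which tend to zero. *)
Lemma circ_inner phi R (y : C) : 0 < R < Cmod y -> (forall z, Cmod z = R -> CC phi z) ->
  (forall j, (0 < j)%nat -> circ R (fun z => phi z * z ^ j)%C = 0%C) ->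
  circ R (fun z => phi z * (z / (z - y)))%C = 0%C.
Proof.
  intros HR Hphi Hj. assert (HPI := PI_RGT_0).
  assert (Hy0 : y <> 0%C) by (apply Cmod_gt_0; lra).
  assert (Hzy : forall z, Cmod z = R -> (z - y)%C <> 0%C).
  { intros z Hz. apply Cmod_gt_0. generalize (Cmod_minus_ge y z).
    replace (z - y)%C with (- (y - z))%C by ring. rewrite Cmod_opp. lra. }
  destruct (circle_bound phi R ltac:(lra) Hphi) as [M [HM0 HM]].
  set (A := fun N => circ R (fun z => phi z * ((z / y) ^ N * (z / (z - y))))%C).
  assert (HA : forall N z, Cmod z = R -> CC (fun z => phi z * ((z / y) ^ N * (z / (z - y))))%C z).
  { intros N z Hz. apply CC_mult; [auto|]. apply cdiff_CC, cdiff_mult.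
    - apply (cdiff_pow (fun z => z / y)%C). apply cdiff_div; [auto|apply cdiff_id|apply cdiff_const].
    - apply cdiff_div; [auto|apply cdiff_id|]. apply cdiff_minus; [apply cdiff_id|apply cdiff_const]. }
  assert (HI : forall n z, Cmod z = R -> CC (fun z => phi z * z ^ n)%C z).
  { intros n z Hz. apply CC_mult; [auto|]. apply cdiff_CC, (cdiff_pow (fun w => w)), cdiff_id. }
  assert (Hstep : forall N, A N = A (S N)).
  { intros N. transitivity (A (S N) + (- / y ^ S N) * circ R (fun z => phi z * z ^ S N))%C.
    - unfold A. rewrite <- circ_scal, <- circ_plus; try lra; auto.
      + apply circ_ext; [lra|]. intros z Hz. unfold Cdiv. rewrite !Cpow_mult_l, !Cpow_inv by auto. simpl.
        field. repeat split; auto. apply Cpow_nz; auto.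
      + intros z Hz. apply CC_mult; [apply cdiff_CC, cdiff_const|auto].
    - rewrite Hj by lia. ring. }
  assert (HA0 : A 0%nat = circ R (fun z => phi z * (z / (z - y)))%C).
  { unfold A. apply circ_ext; [lra|]. intros z Hz. simpl. ring. }
  rewrite <- HA0.
  assert (HAN : forall N, A 0%nat = A N) by (induction N as [|N IH]; [reflexivity|now rewrite IH, Hstep]).
  set (rho := R / Cmod y).
  assert (Hrho : 0 <= rho < 1).
  { unfold rho. split.
    - apply Rdiv_le_0_compat; lra.
    - apply Rmult_lt_reg_r with (Cmod y); [lra|]. unfold Rdiv. rewrite Rmult_assoc, Rinv_l; lra. }
  apply small_eq0 with (K := M * (R / (Cmod y - R)) * (2 * PI)) (rho := rho); [exact Hrho|].
  intros N. rewrite (HAN N). unfold A.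
  replace (M * (R / (Cmod y - R)) * (2 * PI) * rho ^ N) with (M * (rho ^ N * (R / (Cmod y - R))) * (2 * PI)) by ring.
  apply circ_bound; [lra|apply HA|].
  intros z Hz. rewrite Cmod_mult. apply Rmult_le_compat; try apply Cmod_ge_0; [auto|].
  rewrite Cmod_mult, Cmod_pow, !Cmod_div by auto. rewrite Hz. fold rho.
  apply Rmult_le_compat_l; [apply pow_le; lra|].
  apply Rmult_le_compat_l; [lra|]. apply Rinv_le_contravar; [lra|].
  replace (z - y)%C with (- (y - z))%C by ring. rewrite Cmod_opp. generalize (Cmod_minus_ge y z). lra.
Qed.

Lemma CC_slope (g : C -> C) (y d : C) : cderiv g y d ->
  CC (fun z => if Ceq_dec z y then d else (g z - g y) / (z - y))%C y.
Proof.
  intros H eps He. destruct (H (eps / 2)) as [del [Hd Hw]]; [lra|]. exists del; split; trivial.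
  intros w Hwy. destruct (Ceq_dec y y) as [_|N]; [|congruence].
  destruct (Ceq_dec w y) as [E|N].
  - replace (d - d)%C with (RtoC 0) by ring. rewrite Cmod_0. exact He.
  - assert (Hn : (w - y)%C <> 0%C) by now apply Cminus_eq_contra.
    replace ((g w - g y) / (w - y) - d)%C with ((g w - g y - d * (w - y)) / (w - y))%C by (field; exact Hn).
    rewrite Cmod_div by exact Hn. specialize (Hw w Hwy).
    assert (0 < Cmod (w - y)) by (apply Cmod_gt_0; exact Hn).
    apply Rle_lt_trans with (eps / 2); [|lra].
    apply Rmult_le_reg_r with (Cmod (w - y)); trivial.
    unfold Rdiv at 1. rewrite Rmult_assoc, Rinv_l; lra.
Qed.

(** Cauchy's formula for the annulus: [z] times the difference quotient of [g] at [y] has the same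
    mean on both circles. The vanishing of the positive moments on the inner circle removes the
    principal part, so [g] is the sum of a power series although nothing is known inside that
    circle. *)
Lemma laurent (g : C -> C) R1 R2 (y : C) : 0 < R1 -> R1 < Cmod y < R2 ->
  (forall z, R1 <= Cmod z <= R2 -> cdiff g z) ->
  (forall j, (0 < j)%nat -> circ R1 (fun z => g z * z ^ j)%C = 0%C) ->
  cseries
    (fun n => (circ R2 (fun z => g z * / z ^ n) / RtoC (2 * PI)) * y ^ n)%C (g y).
Proof.
  intros H1 Hy Hg Hj. assert (HPI := PI_RGT_0).
  destruct (Hg y ltac:(lra)) as [d Hd].
  set (s := (fun z => if Ceq_dec z y then d else (g z - g y) / (z - y))%C).
  set (q := (fun z => s z * z)%C).
  assert (Hs : forall z, R1 <= Cmod z <= R2 -> z <> y -> cdiff s z).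
  { intros z Hz N. assert (Hn : (z - y)%C <> 0%C) by now apply Cminus_eq_contra.
    destruct (cdiff_div (fun z => g z - g y)%C (fun z => z - y)%C z Hn) as [e He].
    - apply cdiff_minus; [auto|apply cdiff_const].
    - apply cdiff_minus; [apply cdiff_id|apply cdiff_const].
    - exists e. revert He. apply cderiv_ext_loc with (Cmod (z - y)); [apply Cmod_gt_0; exact Hn|].
      intros w Hw. unfold s. destruct (Ceq_dec w y) as [E|_]; [|reflexivity].
      subst w. exfalso. replace (y - z)%C with (- (z - y))%C in Hw by ring. rewrite Cmod_opp in Hw. lra. }
  assert (HsC : forall z, R1 <= Cmod z <= R2 -> CC s z).
  { intros z Hz. destruct (Ceq_dec z y) as [->|N]; [now apply CC_slope|]. now apply cdiff_CC, Hs. }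
  destruct (polar y) as [t [_ Et]].
  assert (Hq : circ R1 q = circ R2 q).
  { apply (annulus_except q R1 R2 y (t - PI)); trivial.
    - now replace (t - PI + PI) with t by ring.
    - intros z Hz. apply CC_mult; [auto|apply cdiff_CC, cdiff_id].
    - intros z Hz N. apply cdiff_mult; [auto|apply cdiff_id]. }
  assert (Hexp : forall R, R1 <= R <= R2 -> R <> Cmod y ->
     circ R q = (circ R (fun z => g z * (z / (z - y))) + (- g y) * circ R (fun z => RtoC 1 * (z / (z - y))))%C).
  { intros R HR HN.
    assert (Hzy : forall z, Cmod z = R -> (z - y)%C <> 0%C).
    { intros z Hz. apply Cminus_eq_contra. intros ->. lra. }
    assert (HK : forall z, Cmod z = R -> CC (fun z => z / (z - y))%C z).
    { intros z Hz. apply cdiff_CC, cdiff_div; [auto|apply cdiff_id|apply cdiff_minus; [apply cdiff_id|apply cdiff_const]]. }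
    rewrite <- circ_scal, <- circ_plus.
    - apply circ_ext; [lra|]. intros z Hz. unfold q, s. destruct (Ceq_dec z y) as [E|N]; [subst; lra|].
      field. auto.
    - lra.
    - intros z Hz. apply CC_mult; [apply cdiff_CC, Hg; lra|auto].
    - intros z Hz. apply CC_mult; [apply cdiff_CC, cdiff_const|]. apply CC_mult; [apply cdiff_CC, cdiff_const|auto].
    - lra.
    - intros z Hz. apply CC_mult; [apply cdiff_CC, cdiff_const|auto]. }
  rewrite !Hexp in Hq by lra.
  rewrite (circ_inner g) in Hq; [|lra|intros z Hz; apply cdiff_CC, Hg; lra|exact Hj].
  rewrite (circ_inner (fun _ => RtoC 1)) in Hq; [|lra|intros z Hz; apply cdiff_CC, cdiff_const|].
  2:{ intros j Hj'. rewrite <- (circ_pow j R1) by (lra || exact Hj'). apply circ_ext; [lra|]. intros; ring. }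
  (* The same geometric expansion with [phi = 1]: only the term of index 0 survives. *)
  assert (Hone : circ R2 (fun z => RtoC 1 * (z / (z - y)))%C = RtoC (2 * PI)).
  { assert (S1 := circ_outer (fun _ => RtoC 1) R2 y ltac:(lra) ltac:(lra) ltac:(intros; apply cdiff_CC, cdiff_const)).
    assert (S2 : cseries (fun n => y ^ n * circ R2 (fun z => 1 * / z ^ n))%C (RtoC (2 * PI))).
    { apply is_series_rate with (K := 0) (rho := 0); [lra|]. intros n. rewrite Rmult_0_l.
      replace (csum (fun n0 => y ^ n0 * circ R2 (fun z => 1 * / z ^ n0))%C n) with (RtoC (2 * PI)).
      { replace (RtoC (2 * PI) - RtoC (2 * PI))%C with (RtoC 0) by ring. rewrite Cmod_0. lra. }
      induction n as [|n IH].
      - rewrite sum_n_C_0. simpl. rewrite (circ_ext _ (fun _ => RtoC 1)); [|lra|intros; field].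
        rewrite circ_const. ring.
      - rewrite sum_n_C_S, <- IH. rewrite (circ_ext _ (fun z => / z ^ S n)%C); [|lra|intros; ring].
        rewrite circ_inv_pow by (lra || lia). ring. }
    exact (is_series_C_unique _ _ _ S1 S2). }
  rewrite Hone in Hq.
  assert (HgE : circ R2 (fun z => g z * (z / (z - y)))%C = (g y * RtoC (2 * PI))%C).
  { transitivity ((circ R2 (fun z => g z * (z / (z - y))) + - g y * RtoC (2 * PI)) + g y * RtoC (2 * PI))%C; [ring|].
    rewrite <- Hq. ring. }
  assert (S1 := circ_outer g R2 y ltac:(lra) ltac:(lra) ltac:(intros z Hz; apply cdiff_CC, Hg; lra)).
  rewrite HgE in S1.
  assert (N2 : RtoC (2 * PI) <> 0%C) by (apply RtoC_neq0; lra).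
  assert (S3 := is_series_scal (K := C_AbsRing) (V := C_NormedModule) (/ RtoC (2 * PI))%C _ _ S1).
  replace (g y) with (/ RtoC (2 * PI) * (g y * RtoC (2 * PI)))%C by (field; exact N2).
  eapply is_series_ext; [|exact S3]. intros n. simpl.
  change (/ RtoC (2 * PI) * (y ^ n * circ R2 (fun z => g z * / z ^ n)) = circ R2 (fun z => g z * / z ^ n) / RtoC (2 * PI) * y ^ n)%C.
  unfold Cdiv. ring.
Qed.

(** * Taylor estimates and uniform limits *)

Lemma Rle_geom x y K rho : 0 <= rho < 1 -> (forall n : nat, x <= y + K * rho ^ n) -> x <= y.
Proof.
  intros Hr H. apply Rnot_lt_le. intros Hlt.
  destruct (pow_small rho K (x - y) Hr) as [N HN]; [lra|].
  specialize (HN N (Nat.le_refl N)). specialize (H N). lra.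
Qed.

Lemma is_series_bound (a : nat -> C) (l c : C) n0 B :
  cseries a l ->
  (forall n, (n0 <= n)%nat -> Cmod (csum a n - c) <= B) -> Cmod (l - c) <= B.
Proof.
  intros H HB. apply Rnot_lt_le. intros Hlt.
  destruct (proj1 (is_series_eps a l) H (Cmod (l - c) - B)) as [N HN]; [lra|].
  specialize (HN (n0 + N)%nat ltac:(lia)). specialize (HB (n0 + N)%nat ltac:(lia)).
  set (s := csum a (n0 + N)) in *.
  assert (Cmod (l - c) <= Cmod (s - l) + Cmod (s - c)).
  { replace (l - c)%C with ((s - c) + - (s - l))%C by ring. eapply Rle_trans; [apply Cmod_triangle|]. rewrite Cmod_opp. lra. }
  lra.
Qed.

Lemma sum_tail (a : nat -> C) M rho k : 0 <= rho <= / 2 -> 0 <= M -> (forall n, Cmod (a n) <= M * rho ^ n) ->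
  forall n, (k <= n)%nat -> Cmod (csum a n - csum a k) <= 2 * M * rho ^ (S k).
Proof.
  intros Hr HM Ha n Hn. replace n with (k + (n - k))%nat by lia. generalize (n - k)%nat. clear n Hn. intros j.
  assert (Hk : 0 <= M * rho ^ S k) by (apply Rmult_le_pos; [exact HM|apply pow_le; lra]).
  (* The factor [1 - (/ 2) ^ j] makes the induction on the number of terms close. *)
  apply Rle_trans with (2 * (M * rho ^ S k) * (1 - (/ 2) ^ j)).
  - induction j as [|j IH].
    + rewrite Nat.add_0_r. match goal with |- Cmod (?s - ?s)%C <= _ => replace (s - s)%C with (RtoC 0) by ring end.
      rewrite Cmod_0. simpl. lra.
    + rewrite Nat.add_succ_r, sum_n_C_S.
      match goal with |- Cmod (?s + ?x - ?t)%C <= _ => replace (s + x - t)%C with ((s - t) + x)%C by ring end.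
      eapply Rle_trans; [apply Cmod_triangle|].
      assert (Cmod (a (S (k + j))) <= M * rho ^ S k * (/ 2) ^ j).
      { eapply Rle_trans; [apply Ha|]. replace (S (k + j)) with (S k + j)%nat by lia. rewrite pow_add, <- Rmult_assoc.
        apply Rmult_le_compat_l; [exact Hk|]. apply pow_incr. lra. }
      simpl ((/ 2) ^ S j). lra.
  - assert (0 <= (/ 2) ^ j) by (apply pow_le; lra). nra.
Qed.

Lemma cderiv_quadratic (g : C -> C) (z d : C) K r : 0 < r -> 0 <= K ->
  (forall k, Cmod k <= r -> Cmod (g (z + k) - g z - d * k)%C <= K * Cmod k ^ 2) -> cderiv g z d.
Proof.
  intros Hr HK H eps He. exists (Rmin r (eps / (K + 1))). split.
  { apply Rmin_pos; [lra|]. apply Rdiv_lt_0_compat; lra. }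
  intros w Hw.
  assert (H1 := Rlt_le_trans _ _ _ Hw (Rmin_l _ _)). assert (H2 := Rlt_le_trans _ _ _ Hw (Rmin_r _ _)).
  specialize (H (w - z)%C ltac:(lra)). replace (z + (w - z))%C with w in H by ring.
  eapply Rle_trans; [exact H|]. assert (H0 := Cmod_ge_0 (w - z)). set (n := Cmod (w - z)) in *.
  simpl. rewrite Rmult_1_r, <- Rmult_assoc. apply Rmult_le_compat_r; [exact H0|].
  apply Rle_trans with ((K + 1) * (eps / (K + 1))); [|apply Req_le; field; lra].
  apply Rmult_le_compat; lra.
Qed.

(** First-order Taylor formula with constants depending only on the bound [M] and the radius. This
    uniformity serves for differentiation under the integral and for limits of sequences. *)
Lemma disc_taylor (g : C -> C) R M : 0 < R -> (forall z, Cmod z <= R -> cdiff g z) ->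
  (forall z, Cmod z <= R -> Cmod (g z) <= M) ->
  exists c1 : C, Cmod c1 <= M / R /\ forall y, Cmod y <= R / 2 ->
    Cmod (g y - g 0 - c1 * y)%C <= 2 * M * (Cmod y / R) ^ 2 /\ Cmod (g y - g 0)%C <= 2 * M * (Cmod y / R).
Proof.
  intros HR Hd HM. assert (HPI := PI_RGT_0).
  assert (HM0 : 0 <= M) by (eapply Rle_trans; [apply (Cmod_ge_0 (g 0))|apply HM; rewrite Cmod_0; lra]).
  set (c := fun n => (circ R (fun z => g z * / z ^ n) / RtoC (2 * PI))%C).
  assert (Hz0 : forall z, Cmod z = R -> z <> 0%C) by (intros z Hz; apply Cmod_gt_0; lra).
  assert (Hinv : forall n z, Cmod z = R -> CC (fun z => g z * / z ^ n)%C z).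
  { intros n z Hz. apply CC_mult; [apply cdiff_CC, Hd; lra|]. apply cdiff_CC.
    destruct (cdiff_pow (fun w => w) n z (cdiff_id z)) as [d Hd']. eexists. apply (cderiv_Cinv (fun w => w ^ n)%C).
    - apply Cpow_nz; auto.
    - exact Hd'. }
  assert (Hc : forall n, Cmod (c n) <= M / R ^ n).
  { intros n. unfold c. rewrite Cmod_div by (apply RtoC_neq0; lra). rewrite Cmod_R, Rabs_pos_eq by lra.
    apply Rmult_le_reg_r with (2 * PI); [lra|]. unfold Rdiv at 1. rewrite Rmult_assoc, Rinv_l, Rmult_1_r by lra.
    apply circ_bound; [lra|apply Hinv|]. intros z Hz. rewrite Cmod_mult, Cmod_inv, Cmod_pow, Hz by (apply Cpow_nz; auto).
    apply Rmult_le_compat_r; [|apply HM; lra]. apply Rlt_le, Rinv_0_lt_compat, pow_lt; lra. }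
  assert (Hser : forall y, 0 < Cmod y < R -> cseries (fun n => c n * y ^ n)%C (g y)).
  { intros y Hy. apply (laurent g (Cmod y / 2) R y); [lra|lra|intros; apply Hd; lra|].
    (* The positive moments vanish because the inner circle can be shrunk to the origin, where [g]
       stays bounded and [z ^ j] tends to zero. *)
    intros j Hj. set (R1 := Cmod y / 2). assert (HR1 : 0 < R1) by (unfold R1; lra).
    apply small_eq0 with (K := M * R1 ^ j * (2 * PI)) (rho := / 2); [lra|]. intros n.
    assert (Hn : 0 < (/ 2) ^ n <= 1).
    { split; [apply pow_lt; lra|]. rewrite <- (pow1 n). apply pow_incr. lra. }
    set (r := R1 * (/ 2) ^ n). assert (Hr : 0 < r <= R1) by (unfold r; nra).
    assert (Hdj : forall z, Cmod z <= R1 -> cdiff (fun z => g z * z ^ j)%C z).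
    { intros z Hz. apply cdiff_mult; [apply Hd; unfold R1 in *; lra|apply (cdiff_pow (fun w => w)), cdiff_id]. }
    rewrite <- (annulus _ r R1) by (intros; try apply Hdj; lra).
    replace (M * R1 ^ j * (2 * PI) * (/ 2) ^ n) with (M * (R1 ^ j * (/ 2) ^ n) * (2 * PI)) by ring.
    apply circ_bound; [lra|intros z Hz; apply cdiff_CC, Hdj; lra|].
    intros z Hz. rewrite Cmod_mult, Cmod_pow, Hz. apply Rmult_le_compat.
    - apply Cmod_ge_0.
    - apply pow_le; lra.
    - apply HM. unfold R1 in *; lra.
    - unfold r. rewrite Rpow_mult_distr. apply Rmult_le_compat_l; [apply pow_le; lra|].
      destruct j as [|j]; [lia|]. simpl. rewrite <- (Rmult_1_r ((/ 2) ^ n)) at 3.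
      apply Rmult_le_compat_l; [lra|]. rewrite <- (pow1 j). apply pow_incr. lra. }
  assert (Hterm : forall y n, 0 < Cmod y -> Cmod (c n * y ^ n) <= M * (Cmod y / R) ^ n).
  { intros y n Hy. rewrite Cmod_mult, Cmod_pow. unfold Rdiv. rewrite Rpow_mult_distr, pow_inv.
    replace (M * (Cmod y ^ n * / R ^ n)) with (M / R ^ n * Cmod y ^ n) by (unfold Rdiv; ring).
    apply Rmult_le_compat_r; [apply pow_le; lra|apply Hc]. }
  assert (Hrho : forall y, Cmod y <= R / 2 -> 0 <= Cmod y / R <= / 2).
  { intros y Hy. split; [apply Rdiv_le_0_compat; [apply Cmod_ge_0|lra]|].
    apply Rmult_le_reg_r with R; [lra|]. unfold Rdiv. rewrite Rmult_assoc, Rinv_l; lra. }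
  assert (B0 : forall y, 0 < Cmod y <= R / 2 -> Cmod (g y - c 0%nat) <= 2 * M * (Cmod y / R)).
  { intros y Hy. apply (is_series_bound (fun n => c n * y ^ n)%C _ _ 0); [apply Hser; lra|].
    intros n Hn. assert (T := sum_tail (fun n => c n * y ^ n)%C M (Cmod y / R) 0 (Hrho y ltac:(lra)) HM0 (fun n => Hterm y n ltac:(lra)) n Hn).
    rewrite sum_n_C_0 in T. simpl in T. rewrite Cmult_1_r, Rmult_1_r in T. exact T. }
  (* The Laurent series says nothing at the origin itself; the value there is recovered by
     continuity along positive reals. *)
  assert (E0 : c 0%nat = g 0%C).
  { destruct (Ceq_dec (g 0%C) (c 0%nat)) as [E|N]; [now symmetry|exfalso].
    assert (Hp : 0 < Cmod (g 0%C - c 0%nat)) by (apply Cmod_gt_0, Cminus_eq_contra, N).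
    set (e := Cmod (g 0%C - c 0%nat)) in *.
    destruct (cdiff_CC g 0%C (Hd 0%C ltac:(rewrite Cmod_0; lra)) (e / 2)) as [del [Hdel Hcont]]; [lra|].
    set (s := Rmin (R / 2) (Rmin (del / 2) (e * R / (4 * (M + 1))))).
    assert (Hs : 0 < s). { repeat apply Rmin_pos; try lra. apply Rdiv_lt_0_compat; nra. }
    assert (Hs1 : s <= R / 2) by apply Rmin_l.
    assert (Hs2 : s <= del / 2) by (eapply Rle_trans; [apply Rmin_r|apply Rmin_l]).
    assert (Hs3 : s <= e * R / (4 * (M + 1))) by (eapply Rle_trans; [apply Rmin_r|apply Rmin_r]).
    assert (Hm : Cmod (RtoC s) = s) by (rewrite Cmod_R, Rabs_pos_eq; lra).
    specialize (B0 (RtoC s) ltac:(lra)). rewrite Hm in B0.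
    specialize (Hcont (RtoC s)). replace (s - 0)%C with (RtoC s) in Hcont by ring. specialize (Hcont ltac:(lra)).
    assert (2 * M * (s / R) <= e / 2).
    { apply Rle_trans with (2 * (M + 1) * (e * R / (4 * (M + 1)) / R)); [|apply Req_le; field; lra].
      apply Rmult_le_compat; [lra| |lra|].
      - apply Rdiv_le_0_compat; lra.
      - apply Rmult_le_compat_r; [apply Rlt_le, Rinv_0_lt_compat; lra|exact Hs3]. }
    assert (e <= Cmod (g s - g 0%C) + Cmod (g s - c 0%nat)).
    { unfold e. replace (g 0%C - c 0%nat)%C with (- (g s - g 0%C) + (g s - c 0%nat))%C by ring.
      eapply Rle_trans; [apply Cmod_triangle|]. rewrite Cmod_opp. lra. }
    lra. }
  exists (c 1%nat). split; [generalize (Hc 1%nat); simpl; now rewrite Rmult_1_r|].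
  intros y Hy. destruct (Ceq_dec y 0) as [->|N].
  - rewrite Cmod_0. replace (g 0 - g 0 - c 1%nat * 0)%C with (RtoC 0) by ring.
    replace (g 0 - g 0)%C with (RtoC 0) by ring. rewrite Cmod_0.
    replace (0 / R) with 0 by (field; lra). split; simpl; nra.
  - assert (Hyp : 0 < Cmod y) by (apply Cmod_gt_0; exact N).
    split.
    + replace (g y - g 0 - c 1%nat * y)%C with (g y - (g 0 + c 1%nat * y))%C by ring.
      apply (is_series_bound (fun n => c n * y ^ n)%C _ _ 1); [apply Hser; lra|].
      intros n Hn. assert (T := sum_tail (fun n => c n * y ^ n)%C M (Cmod y / R) 1 (Hrho y Hy) HM0 (fun n => Hterm y n ltac:(lra)) n Hn).
      rewrite (sum_n_C_S _ 0), sum_n_C_0, E0 in T.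
      replace (g 0 * y ^ 0 + c 1%nat * y ^ 1)%C with (g 0 + c 1%nat * y)%C in T by (simpl; ring). exact T.
    + rewrite <- E0. apply B0. lra.
Qed.

Lemma C_cauchy_geom (u : nat -> C) B rho : 0 <= rho < 1 ->
  (forall n m, (n <= m)%nat -> Cmod (u m - u n) <= B * rho ^ n) -> exists l : C, forall n, Cmod (u n - l) <= 2 * B * rho ^ n.
Proof.
  intros Hr H.
  assert (HB : 0 <= B).
  { specialize (H 0%nat 0%nat (Nat.le_refl _)). simpl in H. generalize (Cmod_ge_0 (u 0%nat - u 0%nat)). lra. }
  assert (K : forall h : C -> R, (forall z w, Rabs (h z - h w) <= Cmod (z - w)) -> exists l : R, is_lim_seq (fun n => h (u n)) l).
  { intros h Hh. assert (E : ex_finite_lim_seq (fun n => h (u n))).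
    { apply ex_lim_seq_cauchy_corr. intros eps. destruct (pow_small rho (2 * B) eps Hr (cond_pos eps)) as [N HN].
      exists N. intros n m Hn Hm. specialize (HN N (Nat.le_refl N)).
      eapply Rle_lt_trans; [apply Hh|].
      replace (u n - u m)%C with ((u n - u N) + - (u m - u N))%C by ring.
      eapply Rle_lt_trans; [apply Cmod_triangle|]. rewrite Cmod_opp. generalize (H N n Hn) (H N m Hm). lra. }
    destruct E as [l Hl]. now exists l. }
  destruct (K Re) as [x Hx].
  { intros z w. eapply Rle_trans; [|apply Re_le_Cmod']. apply Req_le. reflexivity. }
  destruct (K Im) as [y Hy].
  { intros z w. eapply Rle_trans; [|apply Im_le_Cmod']. apply Req_le. reflexivity. }
  exists (x, y). intros n.
  assert (L : forall (h : C -> R) (x : R), (forall z w, Rabs (h z - h w) <= Cmod (z - w)) -> is_lim_seq (fun n => h (u n)) x ->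
    Rabs (h (u n) - x) <= B * rho ^ n).
  { intros h x' Hh Hl. apply le_epsilon. intros eps He.
    apply is_lim_seq_spec in Hl. destruct (Hl (mkposreal eps He)) as [N HN]. simpl in HN.
    specialize (HN (n + N)%nat ltac:(lia)). specialize (H n (n + N)%nat ltac:(lia)). specialize (Hh (u (n + N)%nat) (u n)).
    replace (h (u n) - x') with (- (h (u (n + N)%nat) - h (u n)) + (h (u (n + N)%nat) - x')) by ring.
    eapply Rle_trans; [apply Rabs_triang|]. rewrite Rabs_Ropp. lra. }
  eapply Rle_trans; [apply Cmod_le_ReIm|].
  assert (L1 := L Re x). assert (L2 := L Im y).
  change (Rabs (Re (u n) - x) + Rabs (Im (u n) - y) <= 2 * B * rho ^ n).
  specialize (L1 ltac:(intros z w; eapply Rle_trans; [|apply Re_le_Cmod']; apply Req_le; reflexivity) Hx).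
  specialize (L2 ltac:(intros z w; eapply Rle_trans; [|apply Im_le_Cmod']; apply Req_le; reflexivity) Hy).
  lra.
Qed.

(** * Holomorphic functions on normed modules *)

Section NormedDomain.
Context {U : NormedModule C_AbsRing}.

Lemma norm_scal_C (z : C) (k : U) : norm (scal z k) <= Cmod z * norm k.
Proof. exact (norm_scal z k). Qed.

Lemma plus_minus_cancel (p q : U) : plus p (minus q p) = q.
Proof. unfold minus. rewrite (plus_comm q), plus_assoc, (@plus_opp_r U), (@plus_zero_l U). reflexivity. Qed.

Lemma minus_plus_cancel (p k : U) : minus (plus p k) p = k.
Proof. unfold minus. rewrite (plus_comm p), <- plus_assoc, (@plus_opp_r U), (@plus_zero_r U). reflexivity. Qed.

Lemma norm_minus_self (p : U) : norm (minus p p) = 0.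
Proof.
  assert (E : minus p p = zero) by apply (@minus_eq_zero U). rewrite E. apply (@norm_zero _ U).
Qed.

Lemma cderiv_line (f : U -> C) (p k : U) (l : U -> C) (z : C) :
  cfd f (plus p (scal z k)) l -> cderiv (fun w => f (plus p (scal w k))) z (l k).
Proof.
  intros H. apply filterdiff_eps in H. destruct H as [Hl H]. intros eps He.
  set (n := norm k). assert (Hn : 0 <= n) by apply norm_ge_0.
  destruct (H (eps / (n + 1))) as [d [Hd Hq]]; [apply Rdiv_lt_0_compat; lra|].
  exists (d / (n + 1)). split; [apply Rdiv_lt_0_compat; lra|]. intros w Hw.
  assert (E : minus (plus p (scal w k)) (plus p (scal z k)) = scal (w - z)%C k).
  { change (w - z)%C with (minus (G := C_Ring) w z). rewrite (@scal_minus_distr_r _ U). unfold minus.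
    rewrite (@opp_plus U). rewrite (plus_comm p), <- plus_assoc, (plus_assoc p), (@plus_opp_r U), (@plus_zero_l U). reflexivity. }
  assert (Hb := norm_scal_C (w - z) k). fold n in Hb. assert (H0 := Cmod_ge_0 (w - z)).
  specialize (Hq (plus p (scal w k))). rewrite E in Hq.
  assert (Hlt : norm (scal (w - z)%C k) < d).
  { eapply Rle_lt_trans; [exact Hb|]. apply Rle_lt_trans with (Cmod (w - z) * (n + 1)); [apply Rmult_le_compat_l; lra|].
    apply Rmult_lt_compat_r with (r := n + 1) in Hw; [|lra]. replace (d / (n + 1) * (n + 1)) with d in Hw by (field; lra). exact Hw. }
  specialize (Hq Hlt). rewrite (linear_scal _ Hl) in Hq.
  change (Cmod (f (plus p (scal w k)) - f (plus p (scal z k)) - (w - z) * l k)%C <= eps / (n + 1) * norm (scal (w - z)%C k)) in Hq.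
  rewrite (Cmult_comm (l k)). eapply Rle_trans; [exact Hq|].
  apply Rle_trans with (eps / (n + 1) * (Cmod (w - z) * n)).
  - apply Rmult_le_compat_l; [apply Rlt_le, Rdiv_lt_0_compat; lra|exact Hb].
  - apply Rle_trans with (eps / (n + 1) * (Cmod (w - z) * (n + 1))); [|apply Req_le; field; lra].
    apply Rmult_le_compat_l; [apply Rlt_le, Rdiv_lt_0_compat; lra|]. apply Rmult_le_compat_l; lra.
Qed.

(** The one-variable estimate on the complex line [p + z k]. The parameter disc has radius
    [r / (2 |k|)], so that the line stays in the ball; the direction [k = 0] is separate. *)
Lemma line_taylor (f : U -> C) (p : U) (l : U -> C) r M : 0 < r ->
  (forall q, norm (minus q p) < r -> hol f q /\ Cmod (f q) <= M) -> cfd f p l ->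
  (forall k, Cmod (l k) <= 2 * M / r * norm k) /\
  (forall q, norm (minus q p) <= r / 4 -> Cmod (f q - f p - l (minus q p))%C <= 8 * M / r ^ 2 * norm (minus q p) ^ 2).
Proof.
  intros Hr Hf Hl. assert (Hlin : is_linear (V := C_NormedModule) l) by (apply Hl).
  assert (HM : 0 <= M).
  { eapply Rle_trans; [apply (Cmod_ge_0 (f p))|]. apply Hf. rewrite norm_minus_self. exact Hr. }
  assert (Key : forall k, 0 < norm k -> exists c1 : C, c1 = l k /\ Cmod c1 <= 2 * M / r * norm k /\
    (norm k <= r / 4 -> Cmod (f (plus p k) - f p - c1)%C <= 8 * M / r ^ 2 * norm k ^ 2)).
  { intros k Hk. set (n := norm k) in *. set (R := r / (2 * n)).
    assert (HR : 0 < R) by (apply Rdiv_lt_0_compat; lra).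
    set (g := fun z : C => f (plus p (scal z k))).
    assert (Hin : forall z, Cmod z <= R -> norm (minus (plus p (scal z k)) p) < r).
    { intros z Hz. rewrite minus_plus_cancel. eapply Rle_lt_trans; [apply norm_scal_C|]. fold n.
      apply Rle_lt_trans with (R * n); [apply Rmult_le_compat_r; lra|].
      replace (R * n) with (r / 2) by (unfold R; field; lra). lra. }
    destruct (disc_taylor g R M HR) as [c1 [Hc1 Hy]].
    - intros z Hz. destruct (Hf _ (Hin z Hz)) as [[l' Hl'] _]. eexists. apply (cderiv_line f p k l'). exact Hl'.
    - intros z Hz. apply Hf. auto.
    - assert (Ep : plus p (scal (RtoC 0) k) = p).
      { change (RtoC 0) with (zero (G := C_Ring)). rewrite (@scal_zero_l _ U), (@plus_zero_r U). reflexivity. }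
      assert (E1 : plus p (scal (RtoC 1) k) = plus p k).
      { change (RtoC 1) with (one (K := C_Ring)). rewrite (@scal_one _ U). reflexivity. }
      assert (Hc : c1 = l k).
      { apply (cderiv_unique g 0%C).
        - apply cderiv_quadratic with (K := 2 * M / R ^ 2) (r := R / 2); [lra| |].
          + apply Rdiv_le_0_compat; [lra|apply pow_lt; lra].
          + intros z Hz. destruct (Hy z Hz) as [A _]. replace (0 + z)%C with z by ring.
            eapply Rle_trans; [exact A|]. apply Req_le. field. lra.
        - unfold g. apply cderiv_line. rewrite Ep. exact Hl. }
      exists c1. split; [exact Hc|]. split.
      + eapply Rle_trans; [exact Hc1|]. apply Req_le. unfold R. field. lra.
      + intros Hn. destruct (Hy 1%C) as [A _].
        * rewrite Cmod_1. apply Rmult_le_reg_r with (4 * n); [lra|]. unfold R. replace (r / (2 * n) / 2 * (4 * n)) with r by (field; lra). lra.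
        * unfold g in A. rewrite Ep, E1, Cmod_1, Cmult_1_r in A. eapply Rle_trans; [exact A|]. apply Req_le. unfold R. field. lra. }
  split.
  - intros k. destruct (Rle_lt_or_eq_dec 0 (norm k) (norm_ge_0 k)) as [Hk|Hk].
    + destruct (Key k Hk) as [c1 [E [H1 _]]]. rewrite <- E. exact H1.
    + assert (k = zero) by (apply norm_eq_zero; now symmetry). subst k.
      assert (El : l zero = 0%C) by exact (linear_zero l Hlin). rewrite El, <- Hk, Cmod_0. lra.
  - intros q Hq. set (k := minus q p) in *.
    destruct (Rle_lt_or_eq_dec 0 (norm k) (norm_ge_0 k)) as [Hk|Hk].
    + destruct (Key k Hk) as [c1 [E [_ H2]]]. rewrite <- E. unfold k in H2 at 2. rewrite plus_minus_cancel in H2. auto.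
    + assert (Ek : k = zero) by (apply norm_eq_zero; now symmetry).
      assert (Eq : q = p). { rewrite <- (plus_minus_cancel p q). fold k. rewrite Ek, (@plus_zero_r U). reflexivity. }
      assert (El : l k = 0%C) by (rewrite Ek; exact (linear_zero l Hlin)).
      rewrite El, <- Hk, Eq.
      replace (f p - f p - 0)%C with (RtoC 0) by ring. rewrite Cmod_0. simpl. lra.
Qed.

Lemma hol_continuous (f : U -> C) p : hol f p -> forall eps, 0 < eps ->
  exists d, 0 < d /\ forall q, norm (minus q p) < d -> Cmod (f q - f p)%C < eps.
Proof.
  intros [l H] eps He. apply filterdiff_eps in H. destruct H as [Hl H].
  destruct (linear_norm _ Hl) as [A [HA HlA]].
  destruct (H 1 Rlt_0_1) as [d [Hd Hq]].
  exists (Rmin d (eps / (A + 2))). split; [apply Rmin_pos; [lra|apply Rdiv_lt_0_compat; lra]|].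
  intros q Hqp. specialize (Hq q (Rlt_le_trans _ _ _ Hqp (Rmin_l _ _))).
  assert (H2 := Rlt_le_trans _ _ _ Hqp (Rmin_r _ _)).
  change (Cmod (f q - f p - l (minus q p))%C <= 1 * norm (minus q p)) in Hq.
  specialize (HlA (minus q p)). change (Cmod (l (minus q p)) <= A * norm (minus q p)) in HlA.
  replace (f q - f p)%C with ((f q - f p - l (minus q p)) + l (minus q p))%C by ring.
  eapply Rle_lt_trans; [apply Cmod_triangle|].
  apply Rle_lt_trans with ((A + 1) * norm (minus q p)); [lra|].
  assert (H0 := norm_ge_0 (minus q p)).
  apply Rle_lt_trans with ((A + 2) * norm (minus q p)); [nra|].
  apply Rmult_lt_compat_l with (r := A + 2) in H2; [|lra].
  replace ((A + 2) * (eps / (A + 2))) with eps in H2 by (field; lra). exact H2.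
Qed.

Lemma hol_minus (f g : U -> C) p : hol f p -> hol g p -> hol (fun q => f q - g q)%C p.
Proof. intros [l Hl] [m Hm]. eexists. exact (filterdiff_minus_fct (V := C_NormedModule) f g l m Hl Hm). Qed.

(** With a geometric rate, [line_taylor] applied to [f m - f n] makes the differentials a geometric
    Cauchy sequence in every direction. Their limit is the differential of [F], since the quadratic
    remainders are bounded uniformly in [n]. *)
Lemma weierstrass (f : nat -> U -> C) (F : U -> C) (p : U) r K rho : 0 < r -> 0 <= rho < 1 ->
  (forall n q, norm (minus q p) < r -> hol (f n) q) ->
  (forall n q, norm (minus q p) < r -> Cmod (f n q - F q)%C <= K * rho ^ n) -> hol F p.
Proof.
  intros Hr0 Hrho Hf HF0.
  assert (Hpp : norm (minus p p) = 0) by apply norm_minus_self.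
  assert (HK : 0 <= K).
  { specialize (HF0 0%nat p ltac:(lra)). simpl in HF0. generalize (Cmod_ge_0 (f 0%nat p - F p)). lra. }
  (* No compactness is available in a general normed module: boundedness of [f 0] near [p] comes
     from continuity, and the rate extends it to all [f n]. *)
  destruct (hol_continuous (f 0%nat) p (Hf 0%nat p ltac:(lra)) 1 Rlt_0_1) as [d [Hd Hcont]].
  set (r1 := Rmin r d). assert (Hr1 : 0 < r1) by now apply Rmin_pos.
  assert (Hr1r : forall q, norm (minus q p) < r1 -> norm (minus q p) < r).
  { intros q Hq. eapply Rlt_le_trans; [exact Hq|apply Rmin_l]. }
  assert (Hr1d : forall q, norm (minus q p) < r1 -> norm (minus q p) < d).
  { intros q Hq. eapply Rlt_le_trans; [exact Hq|apply Rmin_r]. }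
  assert (Hpow1 : forall n, 0 <= rho ^ n <= 1).
  { intros n. split; [apply pow_le; lra|]. rewrite <- (pow1 n). apply pow_incr. lra. }
  set (M := Cmod (f 0%nat p) + 1 + 2 * K).
  assert (HfM : forall n q, norm (minus q p) < r1 -> Cmod (f n q) <= M).
  { intros n q Hq. assert (A := HF0 n q (Hr1r q Hq)). assert (B := HF0 0%nat q (Hr1r q Hq)). simpl in B.
    assert (Cc := Hcont q (Hr1d q Hq)). destruct (Hpow1 n).
    replace (f n q) with ((f n q - F q) + - (f 0%nat q - F q) + (f 0%nat q - f 0%nat p) + f 0%nat p)%C by ring.
    eapply Rle_trans; [apply Cmod_triangle|]. eapply Rle_trans; [apply Rplus_le_compat_r, Cmod_triangle|].
    eapply Rle_trans; [apply Rplus_le_compat_r, Rplus_le_compat_r, Cmod_triangle|]. rewrite Cmod_opp. unfold M. nra. }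
  set (l := fun n => proj1_sig (constructive_indefinite_description _ (Hf n p ltac:(lra)))).
  assert (Hl : forall n, cfd (f n) p (l n)) by (intros n; exact (proj2_sig (constructive_indefinite_description _ (Hf n p ltac:(lra))))).
  assert (Hlin : forall n, is_linear (V := C_NormedModule) (l n)) by (intros n; apply (Hl n)).
  set (B := 4 * K / r1).
  assert (HB : 0 <= B) by (apply Rdiv_le_0_compat; lra).
  assert (Hdiff : forall n m k, (n <= m)%nat -> Cmod (l m k - l n k)%C <= B * norm k * rho ^ n).
  { intros n m k Hnm.
    assert (Hpm : rho ^ m <= rho ^ n).
    { replace m with (n + (m - n))%nat by lia. rewrite pow_add. generalize (Hpow1 n) (Hpow1 (m - n)%nat). nra. }
    destruct (line_taylor (fun q => f m q - f n q)%C p (fun k => minus (l m k) (l n k)) r1 (2 * K * rho ^ n) Hr1) as [H1 _].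
    - intros q Hq. split; [apply hol_minus; apply Hf; auto|].
      replace (f m q - f n q)%C with ((f m q - F q) + - (f n q - F q))%C by ring.
      eapply Rle_trans; [apply Cmod_triangle|]. rewrite Cmod_opp.
      generalize (HF0 m q (Hr1r q Hq)) (HF0 n q (Hr1r q Hq)). nra.
    - exact (filterdiff_minus_fct (V := C_NormedModule) (f m) (f n) (l m) (l n) (Hl m) (Hl n)).
    - specialize (H1 k). eapply Rle_trans; [exact H1|]. apply Req_le. unfold B. field. lra. }
  assert (HL : forall k, exists z : C, forall n, Cmod (l n k - z) <= 2 * (B * norm k) * rho ^ n).
  { intros k. apply C_cauchy_geom; [exact Hrho|]. intros n m Hnm. now apply Hdiff. }
  set (L := fun k => proj1_sig (constructive_indefinite_description _ (HL k))).
  assert (HLk : forall k n, Cmod (l n k - L k) <= 2 * (B * norm k) * rho ^ n).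
  { intros k. exact (proj2_sig (constructive_indefinite_description _ (HL k))). }
  assert (eqC : forall z w : C, (z - w)%C = 0%C -> z = w).
  { intros z w E. replace z with ((z - w) + w)%C by ring. rewrite E. ring. }
  exists L. apply filterdiff_eps. split; [split|].
  - intros x y. apply eqC.
    apply small_eq0 with (K := 2 * B * (norm (plus x y) + norm x + norm y)) (rho := rho); [exact Hrho|]. intros n.
    assert (E := linear_plus _ (Hlin n) x y). change (l n (plus x y) = (l n x + l n y)%C) in E.
    change (Cmod (L (plus x y) - (L x + L y))%C <= 2 * B * (norm (plus x y) + norm x + norm y) * rho ^ n).
    replace (L (plus x y) - (L x + L y))%C with (- (l n (plus x y) - L (plus x y)) + ((l n x - L x) + (l n y - L y)))%C by (rewrite E; ring).
    eapply Rle_trans; [apply Cmod_triangle|]. rewrite Cmod_opp. eapply Rle_trans; [apply Rplus_le_compat_l, Cmod_triangle|].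
    generalize (HLk (plus x y) n) (HLk x n) (HLk y n). lra.
  - intros a x. apply eqC.
    apply small_eq0 with (K := 2 * B * (norm (scal a x) + Cmod a * norm x)) (rho := rho); [exact Hrho|]. intros n.
    assert (E := linear_scal _ (Hlin n) a x). change (l n (scal a x) = (a * l n x)%C) in E.
    change (Cmod (L (scal a x) - (a * L x))%C <= 2 * B * (norm (scal a x) + Cmod a * norm x) * rho ^ n).
    replace (L (scal a x) - (a * L x))%C with (- (l n (scal a x) - L (scal a x)) + a * (l n x - L x))%C by (rewrite E; ring).
    eapply Rle_trans; [apply Cmod_triangle|]. rewrite Cmod_opp, Cmod_mult.
    generalize (HLk (scal a x) n) (Rmult_le_compat_l _ _ _ (Cmod_ge_0 a) (HLk x n)). lra.
  - destruct (linear_norm _ (Hlin 0%nat)) as [A [HA HlA]].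
    exists (A + 2 * B). split; [lra|]. intros x. specialize (HlA x). specialize (HLk x 0%nat). simpl in HLk.
    change (Cmod (l 0%nat x) <= A * norm x) in HlA. change (Cmod (L x) <= (A + 2 * B) * norm x).
    replace (L x) with (l 0%nat x + - (l 0%nat x - L x))%C by ring.
    eapply Rle_trans; [apply Cmod_triangle|]. rewrite Cmod_opp. lra.
  - assert (HM : 0 <= M) by (unfold M; generalize (Cmod_ge_0 (f 0%nat p)); lra).
    assert (Hquad : forall q, norm (minus q p) <= r1 / 4 -> norm (minus q p) < r1 ->
      Cmod (F q - F p - L (minus q p))%C <= 8 * M / r1 ^ 2 * norm (minus q p) ^ 2).
    { intros q Hq Hq'. apply (Rle_geom _ _ (2 * K + 2 * (B * norm (minus q p))) rho Hrho). intros n.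
      destruct (line_taylor (f n) p (l n) r1 M Hr1) as [_ H2]; [intros q' Hq1; split; [apply Hf; auto|now apply HfM]|apply Hl|].
      specialize (H2 q Hq). set (k := minus q p) in *.
      replace (F q - F p - L k)%C with ((f n q - f n p - l n k) + (- (f n q - F q) + ((f n p - F p) + (l n k - L k))))%C by ring.
      eapply Rle_trans; [apply Cmod_triangle|]. eapply Rle_trans; [apply Rplus_le_compat_l, Cmod_triangle|]. rewrite Cmod_opp.
      eapply Rle_trans; [apply Rplus_le_compat_l, Rplus_le_compat_l, Cmod_triangle|].
      generalize (HF0 n q (Hr1r q Hq')) (HF0 n p ltac:(lra)) (HLk k n). lra. }
    intros eps He. set (Q := 8 * M / r1 ^ 2).
    assert (HQ : 0 <= Q) by (apply Rdiv_le_0_compat; [lra|apply pow_lt; lra]).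
    exists (Rmin (r1 / 4) (eps / (Q + 1))). split; [apply Rmin_pos; [lra|apply Rdiv_lt_0_compat; lra]|].
    intros q Hq. assert (H1 := Rlt_le_trans _ _ _ Hq (Rmin_l _ _)). assert (H2 := Rlt_le_trans _ _ _ Hq (Rmin_r _ _)).
    change (Cmod (F q - F p - L (minus q p))%C <= eps * norm (minus q p)).
    eapply Rle_trans; [apply Hquad; lra|]. fold Q. assert (H0 := norm_ge_0 (minus q p)).
    simpl. rewrite Rmult_1_r, <- Rmult_assoc. apply Rmult_le_compat_r; [exact H0|].
    apply Rle_trans with ((Q + 1) * (eps / (Q + 1))); [|apply Req_le; field; lra].
    apply Rmult_le_compat; lra.
Qed.

End NormedDomain.

(** Nothing is assumed about how the derivative of [h t] depends on [t]. The difference quotients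
    [D k] of the integral satisfy [|D k - D k'| <= B (|k| + |k'|)], because the unknown derivative
    cancels under the integral sign; hence they converge. *)
Lemma param_integral (h : R -> C -> C) a b (w0 : C) r M : a <= b -> 0 < r ->
  (forall t w, a <= t <= b -> Cmod (w - w0) <= r -> cdiff (h t) w /\ Cmod (h t w) <= M) ->
  (forall w, Cmod (w - w0) <= r -> exCI (fun t => h t w) a b) ->
  cdiff (fun w => CI (fun t => h t w) a b) w0.
Proof.
  intros Hab Hr Hh Hex.
  assert (Hw00 : Cmod (w0 - w0) <= r) by (replace (w0 - w0)%C with (RtoC 0) by ring; rewrite Cmod_0; lra).
  assert (HM : 0 <= M) by (eapply Rle_trans; [apply (Cmod_ge_0 (h a w0))|apply Hh; trivial; lra]).
  assert (Ht : forall t, a <= t <= b -> exists c1 : C, forall k, Cmod k <= r / 2 ->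
     Cmod (h t (w0 + k)%C - h t w0 - c1 * k)%C <= 2 * M / r ^ 2 * Cmod k ^ 2).
  { intros t Htab. destruct (disc_taylor (fun z => h t (w0 + z)%C) r M Hr) as [c1 [_ Hc]].
    - intros z Hz. apply (cdiff_comp (fun z => w0 + z)%C (h t)); [apply cdiff_plus; [apply cdiff_const|apply cdiff_id]|].
      apply Hh; trivial. replace (w0 + z - w0)%C with z by ring. exact Hz.
    - intros z Hz. apply Hh; trivial. replace (w0 + z - w0)%C with z by ring. exact Hz.
    - exists c1. intros k Hk. destruct (Hc k Hk) as [H1 _]. replace (w0 + 0)%C with w0 in H1 by ring.
      eapply Rle_trans; [exact H1|]. apply Req_le. field. lra. }
  set (I := fun w => CI (fun t => h t w) a b).
  set (D := fun k => ((I (w0 + k) - I w0) / k)%C).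
  set (B := 2 * M / r ^ 2 * (b - a)).
  assert (HB : 0 <= B) by (apply Rmult_le_pos; [apply Rdiv_le_0_compat; [lra|apply pow_lt; lra]|lra]).
  assert (Hwk : forall k, Cmod k <= r / 2 -> Cmod (w0 + k - w0) <= r).
  { intros k Hk. replace (w0 + k - w0)%C with k by ring. lra. }
  assert (HD : forall k k', 0 < Cmod k <= r / 2 -> 0 < Cmod k' <= r / 2 -> Cmod (D k - D k') <= B * (Cmod k + Cmod k')).
  { intros k k' Hk Hk'.
    assert (N : k <> 0%C) by (apply Cmod_gt_0; lra). assert (N' : k' <> 0%C) by (apply Cmod_gt_0; lra).
    assert (E : (D k - D k')%C = CI (fun t => (/ k * (h t (w0 + k)%C - h t w0) - / k' * (h t (w0 + k')%C - h t w0)))%C a b).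
    { assert (X0 := Hex w0 Hw00). assert (X1 := Hex _ (Hwk k ltac:(lra))). assert (X2 := Hex _ (Hwk k' ltac:(lra))).
      rewrite (CI_minus (fun t => / k * (h t (w0 + k)%C - h t w0))%C (fun t => / k' * (h t (w0 + k')%C - h t w0))%C); trivial.
      - rewrite (CI_scal (/ k)%C (fun t => h t (w0 + k)%C - h t w0)%C), (CI_scal (/ k')%C (fun t => h t (w0 + k')%C - h t w0)%C)
          by (apply exCI_minus; assumption).
        rewrite (CI_minus (fun t => h t (w0 + k)%C)), (CI_minus (fun t => h t (w0 + k')%C)) by assumption.
        unfold D, I. field. split; assumption.
      - apply exCI_scal, exCI_minus; assumption.
      - apply exCI_scal, exCI_minus; assumption. }
    rewrite E. replace (B * (Cmod k + Cmod k')) with (2 * M / r ^ 2 * (Cmod k + Cmod k') * (b - a)) by (unfold B; ring).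
    apply CI_bound; [exact Hab| |].
    - apply exCI_minus; apply exCI_scal, exCI_minus; apply Hex; auto; apply Hwk; lra.
    - intros t Htab. destruct (Ht t Htab) as [c1 Hc].
      replace (/ k * (h t (w0 + k) - h t w0) - / k' * (h t (w0 + k') - h t w0))%C
        with (/ k * (h t (w0 + k) - h t w0 - c1 * k) + - (/ k' * (h t (w0 + k') - h t w0 - c1 * k')))%C by (field; split; assumption).
      eapply Rle_trans; [apply Cmod_triangle|]. rewrite Cmod_opp, !Cmod_mult, !Cmod_inv by assumption.
      assert (St : forall u, 0 < Cmod u <= r / 2 -> / Cmod u * Cmod (h t (w0 + u)%C - h t w0 - c1 * u) <= 2 * M / r ^ 2 * Cmod u).
      { intros u Hu. apply Rmult_le_reg_l with (Cmod u); [lra|]. rewrite <- Rmult_assoc, Rinv_r, Rmult_1_l by lra.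
        eapply Rle_trans; [apply Hc; lra|apply Req_le; ring]. }
      generalize (St k Hk) (St k' Hk'). lra. }
  assert (Hhalf : forall n, 0 < (/ 2) ^ n <= 1).
  { intros n. split; [apply pow_lt; lra|]. rewrite <- (pow1 n). apply pow_incr. lra. }
  set (kk := fun n => RtoC (r / 2 * (/ 2) ^ n)).
  assert (Hkk : forall n, Cmod (kk n) = r / 2 * (/ 2) ^ n).
  { intros n. unfold kk. rewrite Cmod_R, Rabs_pos_eq; [reflexivity|]. specialize (Hhalf n). nra. }
  assert (Hkk' : forall n, 0 < Cmod (kk n) <= r / 2) by (intros n; rewrite Hkk; specialize (Hhalf n); nra).
  destruct (C_cauchy_geom (fun n => D (kk n)) (B * r) (/ 2)) as [d Hd]; [lra| |].
  { intros n m Hnm. eapply Rle_trans; [apply HD; apply Hkk'|]. rewrite !Hkk.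
    assert ((/ 2) ^ m <= (/ 2) ^ n).
    { replace m with (n + (m - n))%nat by lia. rewrite pow_add. generalize (Hhalf n) (Hhalf (m - n)%nat). nra. }
    replace (B * r * (/ 2) ^ n) with (B * (r * (/ 2) ^ n)) by ring. apply Rmult_le_compat_l; [exact HB|]. nra. }
  exists d. apply cderiv_quadratic with (K := B) (r := r / 2); [lra|exact HB|].
  intros k Hk. destruct (Ceq_dec k 0) as [->|N].
  - replace (I (w0 + 0) - I w0 - d * 0)%C with (RtoC 0) by (replace (w0 + 0)%C with w0 by ring; ring).
    rewrite Cmod_0. simpl. lra.
  - assert (Hk0 : 0 < Cmod k) by (apply Cmod_gt_0; exact N).
    assert (HDk : Cmod (D k - d) <= B * Cmod k).
    { apply (Rle_geom _ _ (B * (r / 2) + 2 * (B * r)) (/ 2)); [lra|]. intros n.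
      replace (D k - d)%C with ((D k - D (kk n)) + (D (kk n) - d))%C by ring.
      eapply Rle_trans; [apply Cmod_triangle|].
      assert (A := HD k (kk n) ltac:(lra) (Hkk' n)). rewrite Hkk in A. specialize (Hd n). simpl in Hd. lra. }
    change (Cmod (I (w0 + k) - I w0 - d * k)%C <= B * Cmod k ^ 2).
    replace (I (w0 + k) - I w0 - d * k)%C with ((D k - d) * k)%C by (unfold D; field; exact N).
    rewrite Cmod_mult. simpl. rewrite Rmult_1_r, <- Rmult_assoc. apply Rmult_le_compat_r; lra.
Qed.

(** * Sectors *)

Lemma cis_0 : cis 0 = 1%C.
Proof. unfold cis. now rewrite cos_0, sin_0. Qed.

Definition dir (th : R) (x : C) : R := Re (x * cis (- th))%C.
(** The condition reads [cos (arg x - th) > 1 / (k + 2)]: a convex open cone around the direction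
    [th]. The cones increase with [k] and fill the open half-plane. *)
Definition sec (th : R) (k : nat) (x : C) : Prop := Cmod x < dir th x * (INR k + 2).
(** One radius per opening. These sets belong to [AS th PI] when all [rho k] are positive
    ([Nice_AS]), and every member of [AS th PI] contains one of them ([AS_sectors]). *)
Definition Nice (th : R) (rho : nat -> R) (x : C) : Prop := exists k, Cmod x < rho k /\ sec th k x.

Lemma dir_plus th x y : dir th (x + y) = dir th x + dir th y.
Proof. unfold dir. destruct x, y. simpl. ring. Qed.
Lemma dir_scal th (s : R) (x : C) : dir th (s * x) = s * dir th x.
Proof. unfold dir. destruct x. simpl. ring. Qed.
Lemma dir_le th x : dir th x <= Cmod x.
Proof.
  unfold dir. eapply Rle_trans; [apply Rle_abs|]. eapply Rle_trans; [apply Re_le_Cmod'|].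
  rewrite Cmod_mult, Cmod_cis. lra.
Qed.
Lemma dir_polar th r t : dir th (RtoC r * cis t) = r * cos (t - th).
Proof.
  unfold dir. replace (RtoC r * cis t * cis (- th))%C with (RtoC r * cis (t - th))%C.
  - unfold cis. simpl. ring.
  - unfold Rminus. rewrite cis_plus. ring.
Qed.

Lemma sec_pos th k x : sec th k x -> 0 < dir th x /\ 0 < Cmod x.
Proof.
  unfold sec. intros H. assert (Hk := pos_INR k). assert (H1 := dir_le th x). assert (H0 := Cmod_ge_0 x).
  assert (0 < dir th x) by nra. lra.
Qed.

Lemma sec_mono th k j x : (k <= j)%nat -> sec th k x -> sec th j x.
Proof.
  intros Hkj H. destruct (sec_pos th k x H) as [Hd _]. unfold sec in *. apply le_INR in Hkj. nra.
Qed.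

Lemma sec_scal th k x (s : R) : 0 < s -> sec th k x -> sec th k (s * x).
Proof.
  unfold sec. intros Hs H. rewrite dir_scal, Cmod_mult, Cmod_R, Rabs_pos_eq by lra. nra.
Qed.

Lemma sec_segment th k (x y : C) (s : R) : 0 <= s <= 1 -> sec th k x -> sec th k y -> sec th k (x + s * (y - x)).
Proof.
  intros Hs Hx Hy. destruct (Req_dec s 0) as [->|N0].
  { replace (x + 0%R * (y - x))%C with x by ring. exact Hx. }
  destruct (Req_dec s 1) as [->|N1].
  { replace (x + 1%R * (y - x))%C with y by ring. exact Hy. }
  assert (H1 := sec_scal th k x (1 - s) ltac:(lra) Hx). assert (H2 := sec_scal th k y s ltac:(lra) Hy).
  replace (x + s * (y - x))%C with ((1 - s)%R * x + s * y)%C by (rewrite RtoC_minus; ring).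
  unfold sec in *. rewrite dir_plus. eapply Rle_lt_trans; [apply Cmod_triangle|]. lra.
Qed.

Lemma is_arg_polar t (x : C) : is_arg t x <-> x <> 0%C /\ x = (RtoC (Cmod x) * cis t)%C.
Proof.
  unfold is_arg, cis. replace (RtoC (Cmod x) * (cos t, sin t))%C with (Cmod x * cos t, Cmod x * sin t); [reflexivity|].
  apply C_ext; simpl; ring.
Qed.

Lemma open_C (S : C -> Prop) : (forall x, S x -> exists e, 0 < e /\ forall y, Cmod (y - x) < e -> S y) -> open S.
Proof.
  intros H x Hx. destruct (H x Hx) as [e [He Hy]].
  apply (locally_le_locally_norm (K := C_AbsRing) (V := C_NormedModule)). exists (mkposreal e He). exact Hy.
Qed.

Lemma open_C_eps (S : C -> Prop) x : open S -> S x -> exists e, 0 < e /\ forall y, Cmod (y - x) < e -> S y.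
Proof.
  intros Ho Hx. assert (H := Ho x Hx).
  apply (locally_norm_le_locally (K := C_AbsRing) (V := C_NormedModule)) in H. destruct H as [e He].
  exists e. split; [apply cond_pos|exact He].
Qed.

Lemma Nice_open th rho x : Nice th rho x -> exists e, 0 < e /\ forall y, Cmod (y - x) < e -> Nice th rho y.
Proof.
  intros [k [H1 H2]]. unfold sec in H2. assert (Hk := pos_INR k).
  set (g := dir th x * (INR k + 2) - Cmod x).
  set (e := Rmin (rho k - Cmod x) (g / (INR k + 4))).
  exists e. split.
  { apply Rmin_pos; [lra|]. apply Rdiv_lt_0_compat; unfold g; lra. }
  intros y Hy. assert (Hy1 := Rlt_le_trans _ _ _ Hy (Rmin_l _ _)). assert (Hy2 := Rlt_le_trans _ _ _ Hy (Rmin_r _ _)).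
  assert (Hc : Cmod y <= Cmod x + Cmod (y - x)).
  { replace y with (x + (y - x))%C at 1 by ring. apply Cmod_triangle. }
  assert (Hd : dir th x - Cmod (y - x) <= dir th y).
  { replace y with (x + (y - x))%C at 2 by ring. rewrite dir_plus.
    assert (A := dir_le th (RtoC (-1) * (y - x))). rewrite dir_scal, Cmod_mult, Cmod_R, Rabs_left in A by lra. lra. }
  exists k. split; [lra|]. unfold sec.
  apply Rmult_lt_compat_r with (r := INR k + 4) in Hy2; [|lra].
  replace (g / (INR k + 4) * (INR k + 4)) with g in Hy2 by (field; lra). unfold g in Hy2.
  assert ((dir th x - Cmod (y - x)) * (INR k + 2) <= dir th y * (INR k + 2)) by (apply Rmult_le_compat_r; lra).
  assert (0 <= Cmod (y - x)) by apply Cmod_ge_0. lra.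
Qed.

Lemma Nice_AS th rho : (forall k, 0 < rho k) -> AS th PI (Nice th rho).
Proof.
  intros Hr. split; [apply open_C; intros x; apply Nice_open|].
  (* This [eps] gives the half-opening [phi = (PI + e') / 4], strictly below [PI / 2]. *)
  intros e' He'. set (eps := (PI - e') / 4). set (phi := e' / 2 + eps).
  assert (Hphi : 0 < phi < PI / 2) by (unfold phi, eps; lra).
  assert (Hc : 0 < cos phi) by (apply cos_gt_0; lra).
  destruct (archimed_cor1 (cos phi) Hc) as [k [Hk Hk0]].
  exists (rho k), eps. split; [apply Hr|]. split; [unfold eps; lra|].
  intros x t Ht Hlt Hx. apply is_arg_polar in Ht. destruct Ht as [Hx0 Ex].
  assert (Hm : 0 < Cmod x) by (apply Cmod_gt_0; exact Hx0).
  exists k. split; [exact Hx|]. unfold sec. rewrite Ex at 2. rewrite dir_polar.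
  fold phi in Hlt.
  assert (Hcc : cos phi <= cos (t - th)).
  { destruct (Rle_lt_dec 0 (t - th)) as [P|Q].
    - rewrite Rabs_pos_eq in Hlt by exact P. apply Rlt_le, cos_decreasing_1; lra.
    - rewrite Rabs_left in Hlt by exact Q. rewrite <- (cos_neg (t - th)). apply Rlt_le, cos_decreasing_1; lra. }
  assert (Hk1 : 0 < INR k) by (apply lt_0_INR; exact Hk0).
  assert (H1 : 1 < cos phi * INR k).
  { apply Rmult_lt_compat_r with (r := INR k) in Hk; [|exact Hk1]. rewrite Rinv_l in Hk; lra. }
  rewrite Rmult_assoc. rewrite <- (Rmult_1_r (Cmod x)) at 1. apply Rmult_lt_compat_l; [exact Hm|]. nra.
Qed.

Lemma AS_sectors th S : AS th PI S -> exists rho, (forall k, 0 < rho k) /\ forall k x, sec th k x -> Cmod x < rho k -> S x.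
Proof.
  intros [_ H].
  assert (Hk : forall k : nat, exists r, 0 < r /\ forall x, sec th k x -> Cmod x < r -> S x).
  { intros k. assert (Hk := pos_INR k). set (c := / (INR k + 2)).
    assert (Hc : 0 < c <= / 2).
    { split; [apply Rinv_0_lt_compat; lra|]. apply Rinv_le_contravar; lra. }
    assert (Hb := acos_bound c). assert (Hcos := cos_acos c ltac:(lra)).
    assert (Hlt : acos c < PI / 2).
    { apply Rnot_le_lt. intros L. assert (cos (acos c) <= cos (PI / 2)); [|rewrite cos_PI2 in *; lra].
      destruct L as [L|L]; [apply Rlt_le, cos_decreasing_1; lra|rewrite L; lra]. }
    (* The half-opening of the cone [sec th k] is [acos c], below [PI / 2], so twice that angle is
       an admissible opening. *)
    destruct (H (2 * acos c) ltac:(lra)) as [r [eps [Hr [He Hin]]]].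
    exists r. split; [exact Hr|]. intros x Hx Hxr.
    destruct (sec_pos th k x Hx) as [Hd Hm].
    destruct (polar (x * cis (- th))) as [t [Ht Et]].
    rewrite Cmod_mult, Cmod_cis, Rmult_1_r in Et.
    assert (Ex : x = (RtoC (Cmod x) * cis (t + th))%C).
    { rewrite cis_plus. rewrite Cmult_assoc, <- Et, <- Cmult_assoc, <- cis_plus.
      replace (- th + th) with 0 by ring. rewrite cis_0. ring. }
    apply (Hin x (t + th)); [|replace (2 * acos c / 2) with (acos c) by field|exact Hxr].
    - apply is_arg_polar. split; [apply Cmod_gt_0; exact Hm|exact Ex].
    - replace (t + th - th) with t by ring.
      assert (Hdd : dir th x = Cmod x * cos t). { rewrite Ex at 1. rewrite dir_polar. f_equal. f_equal. ring. }
      unfold sec in Hx. rewrite Hdd in Hx.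
      assert (Hct : c < cos t).
      { unfold c. apply Rmult_lt_reg_r with (INR k + 2); [lra|]. rewrite Rinv_l by lra.
        apply Rmult_lt_reg_l with (Cmod x); [exact Hm|]. lra. }
      apply Rlt_trans with (acos c); [|lra].
      apply Rnot_le_lt. intros L.
      assert (Hca : cos (Rabs t) = cos t).
      { destruct (Rle_lt_dec 0 t); [rewrite Rabs_pos_eq by lra; reflexivity|rewrite Rabs_left by lra; apply cos_neg]. }
      assert (cos (Rabs t) <= c); [|lra].
      rewrite <- Hcos. destruct L as [L|L]; [|rewrite L; lra].
      apply Rlt_le, cos_decreasing_1; try lra; apply Rabs_le; lra. }
  exists (fun k => proj1_sig (constructive_indefinite_description _ (Hk k))).
  split; intros k; apply (proj2_sig (constructive_indefinite_description _ (Hk k))).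
Qed.

(** A property that holds near the origin in each cone, with no uniformity between cones, holds on a
    whole domain [Nice]. *)
Lemma Nice_shrink th (P : C -> Prop) :
  (forall k, exists r, 0 < r /\ forall x, sec th k x -> Cmod x < r -> P x) ->
  exists rho, (forall k, 0 < rho k) /\ forall x, Nice th rho x -> P x.
Proof.
  intros Hk. exists (fun k => proj1_sig (constructive_indefinite_description _ (Hk k))).
  split.
  - intros k. apply (proj2_sig (constructive_indefinite_description _ (Hk k))).
  - intros x [k [H1 H2]]. revert H2 H1. apply (proj2_sig (constructive_indefinite_description _ (Hk k))).
Qed.

Lemma Nice_scal th rho x (s : R) : 0 < s <= 1 -> Nice th rho x -> Nice th rho (s * x).
Proof.
  intros Hs [k [H1 H2]]. exists k. split; [|apply sec_scal; lra || exact H2].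
  rewrite Cmod_mult, Cmod_R, Rabs_pos_eq by lra. generalize (Cmod_ge_0 x). nra.
Qed.

Lemma Nice_neq0 th rho x : Nice th rho x -> 0 < Cmod x.
Proof. intros [k [_ H]]. apply (sec_pos th k x H). Qed.

Lemma Nice_axis th rho (s : R) : 0 < s < rho 0%nat -> Nice th rho (RtoC s * cis th)%C.
Proof.
  intros Hs. exists 0%nat. unfold sec. rewrite dir_polar, Cmod_mult, Cmod_R, Cmod_cis, Rabs_pos_eq by lra.
  replace (th - th) with 0 by ring. rewrite cos_0. simpl. lra.
Qed.

(** * Branches of the logarithm *)

(** A branch is only assumed continuous. With [l = L w - L x] one has [w - x = x (e^l - 1)], and
    [e^l - 1 - l = O(l^2)]; continuity makes [l] small, and then [l] is comparable to
    [(w - x) / x]. *)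
Lemma log_branch_cderiv (S : C -> Prop) (L : C -> C) x : open S -> log_branch S L -> S x -> cderiv L x (/ x)%C.
Proof.
  intros Ho HL Hx. destruct (HL x Hx) as [Hcont Hexp].
  assert (Hx0 : x <> 0%C) by (rewrite <- Hexp; apply Cexp_neq0).
  destruct (open_C_eps S x Ho Hx) as [e0 [He0 HS]].
  assert (HC : CC L x).
  { intros eps He.
    assert (HP : locally (T := C_NormedModule) (L x) (fun z => Cmod (z - L x)%C < eps)).
    { apply locally_le_locally_norm. exists (mkposreal eps He). intros y Hy; exact Hy. }
    assert (HQ := Hcont _ HP).
    apply (locally_norm_le_locally (K := C_AbsRing) (V := C_NormedModule)) in HQ. destruct HQ as [d Hd].
    exists d. split; [apply cond_pos|exact Hd]. }
  intros eps He. set (m := Cmod x). assert (Hm : 0 < m) by (apply Cmod_gt_0; exact Hx0).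
  set (e1 := Rmin (/ 24) (eps * m / 48)).
  assert (He1 : 0 < e1) by (apply Rmin_pos; [lra|]; apply Rdiv_lt_0_compat; nra).
  destruct (HC e1 He1) as [d [Hd Hw]].
  exists (Rmin d e0). split; [now apply Rmin_pos|]. intros w Hwx.
  specialize (Hw w (Rlt_le_trans _ _ _ Hwx (Rmin_l _ _))).
  assert (HSw := HS w (Rlt_le_trans _ _ _ Hwx (Rmin_r _ _))).
  destruct (HL w HSw) as [_ Hexpw].
  set (l := (L w - L x)%C) in *.
  assert (Hl1 : Cmod l < / 24) by (eapply Rlt_le_trans; [exact Hw|apply Rmin_l]).
  assert (Hl2 : Cmod l < eps * m / 48) by (eapply Rlt_le_trans; [exact Hw|apply Rmin_r]).
  assert (Ew : (w - x = x * (Cexp l - 1))%C).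
  { unfold l. rewrite Cexp_minus, Hexp, Hexpw. field. exact Hx0. }
  set (q := (Cexp l - 1 - l)%C). assert (Hq : Cmod q <= 12 * Cmod l ^ 2) by (apply Cexp_taylor2; lra).
  assert (Hl0 := Cmod_ge_0 l).
  replace (l - / x * (w - x))%C with (- q)%C by (rewrite Ew; unfold q; field; exact Hx0).
  rewrite Cmod_opp.
  assert (Hwm : m * (Cmod l / 2) <= Cmod (w - x)).
  { rewrite Ew, Cmod_mult. fold m. apply Rmult_le_compat_l; [lra|].
    replace (Cexp l - 1)%C with (l - (- q))%C by (unfold q; ring).
    eapply Rle_trans; [|apply Cmod_minus_ge]. rewrite Cmod_opp. simpl in Hq. nra. }
  apply Rle_trans with (12 * Cmod l ^ 2); [exact Hq|].
  apply Rle_trans with (eps * (m * (Cmod l / 2))); [|apply Rmult_le_compat_l; lra].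
  simpl. nra.
Qed.

Lemma log_branch_Re (S : C -> Prop) (L : C -> C) x : log_branch S L -> S x -> Re (L x) = ln (Cmod x).
Proof.
  intros HL Hx. destruct (HL x Hx) as [_ E]. rewrite <- E at 2. rewrite Cmod_Cexp, ln_exp. reflexivity.
Qed.

Section LogNice.
Context (S0 : C -> Prop) (L : C -> C) (th : R) (rho : nat -> R).
Context (HS0 : open S0) (HL : log_branch S0 L) (Hsub : forall x, Nice th rho x -> S0 x) (Hrho : forall k, 0 < rho k).

(** [z |-> L (e^z x) - z] has zero derivative. *)
Lemma log_exp_const (x z : C) : (forall s, 0 <= s <= 1 -> Nice th rho (Cexp (s * z) * x)) ->
  L (Cexp z * x)%C = (L x + z)%C.
Proof.
  intros H.
  assert (E := constant_on_segment (fun w => L (Cexp w * x) - w)%C 0%C z).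
  assert (E' : (L (Cexp z * x) - z = L (Cexp 0 * x) - 0)%C).
  { apply E. intros s Hs. specialize (H s Hs).
    replace (0 + s * (z - 0))%C with (s * z)%C by ring.
    assert (N : x <> 0%C).
    { intros ->. apply Nice_neq0 in H. rewrite Cmult_0_r, Cmod_0 in H. lra. }
    eapply cderiv_eq; [|apply cderiv_minus; [|apply cderiv_id]].
    2:{ apply (cderiv_comp (fun w => Cexp w * x)%C L).
        - apply cderiv_mult; [apply cderiv_exp|apply cderiv_const].
        - apply (log_branch_cderiv S0); auto. }
    cfield. split; [exact N|apply Cexp_neq0]. }
  rewrite Cexp_0 in E'. rewrite Cmult_1_l in E'.
  replace (L (Cexp z * x)%C) with (L (Cexp z * x) - z + z)%C by ring. rewrite E'. ring.
Qed.

Lemma Cexp_real (s : R) : Cexp (RtoC s) = RtoC (exp s).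
Proof. unfold Cexp, RtoC. simpl. rewrite cos_0, sin_0. apply C_ext; simpl; ring. Qed.

Lemma log_scal (x : C) (s : R) : 0 < s <= 1 -> Nice th rho x -> L (s * x)%C = (L x + ln s)%C.
Proof.
  intros Hs Hx. rewrite <- (exp_ln s) at 1 by lra. rewrite <- Cexp_real. apply log_exp_const.
  intros t Ht. rewrite <- RtoC_mult, Cexp_real. apply Nice_scal; [|exact Hx]. split; [apply exp_pos|].
  rewrite <- exp_0. apply exp_le. assert (ln s <= 0); [|nra].
  rewrite <- ln_1. destruct (Rle_lt_or_eq_dec s 1 (proj2 Hs)) as [H|H]; [apply Rlt_le, ln_increasing; lra|rewrite H; lra].
Qed.

Lemma log_axis (s t : R) : 0 < s -> 0 < t -> Nice th rho (RtoC s * cis th)%C -> Nice th rho (RtoC t * cis th)%C ->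
  L (RtoC s * cis th)%C = (L (RtoC t * cis th) + ln (s / t))%C.
Proof.
  intros Hs Ht Ns Nt. destruct (Rle_lt_dec s t) as [H|H].
  - replace (RtoC s * cis th)%C with ((s / t)%R * (RtoC t * cis th))%C.
    + apply log_scal; [|exact Nt]. split; [apply Rdiv_lt_0_compat; lra|].
      apply Rmult_le_reg_r with t; [lra|]. unfold Rdiv. rewrite Rmult_assoc, Rinv_l; lra.
    + rewrite RtoC_div by lra. field. apply RtoC_neq0. lra.
  - replace (RtoC t * cis th)%C with ((t / s)%R * (RtoC s * cis th))%C.
    + rewrite (log_scal (RtoC s * cis th)%C (t / s)); [|split|exact Ns].
      * rewrite <- Cplus_assoc, <- RtoC_plus. replace (ln (t / s) + ln (s / t)) with 0; [ring|].
        rewrite <- ln_mult by (apply Rdiv_lt_0_compat; lra). replace (t / s * (s / t)) with 1 by (field; lra). now rewrite ln_1.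
      * apply Rdiv_lt_0_compat; lra.
      * apply Rmult_le_reg_r with s; [lra|]. unfold Rdiv. rewrite Rmult_assoc, Rinv_l; lra.
    + rewrite RtoC_div by lra. field. apply RtoC_neq0. lra.
Qed.

(** Along the axis the imaginary part is constant, by [log_axis]; rotating from the axis to [x]
    changes it by the angle, at most [PI / 2]. *)
Lemma log_Im_bound : exists B, 0 < B /\ forall x, Nice th rho x -> Rabs (Im (L x)) <= B.
Proof.
  set (s0 := rho 0%nat / 2). assert (Hs0 : 0 < s0 < rho 0%nat) by (unfold s0; generalize (Hrho 0%nat); lra).
  exists (Rabs (Im (L (RtoC s0 * cis th)%C)) + PI). split; [generalize (Rabs_pos (Im (L (RtoC s0 * cis th)%C))) PI_RGT_0; lra|].
  intros x [k [Hxr Hx]]. destruct (sec_pos th k x Hx) as [Hd Hm].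
  destruct (polar (x * cis (- th))) as [t [Ht Et]].
  rewrite Cmod_mult, Cmod_cis, Rmult_1_r in Et.
  assert (Ex : x = (RtoC (Cmod x) * cis (t + th))%C).
  { rewrite cis_plus. rewrite Cmult_assoc, <- Et, <- Cmult_assoc, <- cis_plus.
    replace (- th + th) with 0 by ring. rewrite cis_0. ring. }
  assert (Hdd : dir th x = Cmod x * cos t). { rewrite Ex at 1. rewrite dir_polar. f_equal. f_equal. ring. }
  assert (Hct : 0 < cos t) by nra.
  assert (Ht2 : Rabs t < PI / 2).
  { apply Rnot_le_lt. intros Hl. assert (cos t <= 0); [|lra].
    destruct (Rle_lt_dec 0 t).
    - rewrite Rabs_pos_eq in Hl by lra. apply cos_le_0; lra.
    - rewrite Rabs_left in Hl by lra. rewrite <- cos_neg. apply cos_le_0; lra. }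
  set (u := (RtoC (Cmod x) * cis th)%C).
  (* On this arc the angle to the axis is at most [|t|], so its cosine is at least that of [t], and
     the arc stays in the cone of [x] at constant modulus. *)
  assert (Hpath : forall s, 0 <= s <= 1 -> Nice th rho (Cexp (s * (Ci * t)) * u)).
  { intros s Hs.
    assert (E : (Cexp (s * (Ci * t)) * u)%C = (RtoC (Cmod x) * cis (s * t + th))%C).
    { replace (s * (Ci * t))%C with ((0, s * t) : C) by (apply C_ext; simpl; ring).
      rewrite Cexp_polar, exp_0, cis_plus. unfold u. ring. }
    rewrite E. exists k. unfold sec. rewrite dir_polar, Cmod_mult, Cmod_R, Cmod_cis, Rabs_pos_eq, Rmult_1_r by lra.
    split; [exact Hxr|]. replace (s * t + th - th) with (s * t) by ring.
    unfold sec in Hx. rewrite Hdd in Hx. eapply Rlt_le_trans; [exact Hx|].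
    apply Rmult_le_compat_r; [generalize (pos_INR k); lra|]. apply Rmult_le_compat_l; [lra|].
    assert (Hst : forall t', 0 <= t' < PI / 2 -> cos t' <= cos (s * t')).
    { intros t' Ht'. assert (0 <= s * t' <= t') by nra.
      destruct (Rle_lt_or_eq_dec (s * t') t' ltac:(lra)) as [Q|Q]; [apply Rlt_le, cos_decreasing_1; lra|rewrite Q; lra]. }
    destruct (Rle_lt_dec 0 t).
    - rewrite Rabs_pos_eq in Ht2 by lra. apply Hst. lra.
    - rewrite Rabs_left in Ht2 by lra. rewrite <- (cos_neg t), <- (cos_neg (s * t)).
      replace (- (s * t)) with (s * (- t)) by ring. apply Hst. lra. }
  assert (E := log_exp_const u (Ci * t) Hpath).
  assert (Exu : (Cexp (Ci * t) * u)%C = x).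
  { replace (Ci * t)%C with ((0, t) : C) by (apply C_ext; simpl; ring).
    rewrite Cexp_polar, exp_0. transitivity (RtoC (Cmod x) * cis (t + th))%C; [unfold u; rewrite cis_plus; ring|now symmetry]. }
  rewrite Exu in E.
  assert (Nu : Nice th rho u).
  { assert (N0 := Hpath 0 ltac:(lra)). replace (0%R * (Ci * t))%C with (RtoC 0) in N0 by ring.
    rewrite Cexp_0, Cmult_1_l in N0. exact N0. }
  assert (E2 := log_axis (Cmod x) s0 Hm (proj1 Hs0) Nu (Nice_axis th rho s0 Hs0)).
  fold u in E2. rewrite E, E2. simpl.
  apply Rabs_lt_between in Ht2. generalize (Rle_abs (Im (L (RtoC s0 * cis th)%C))) (Rle_abs (- Im (L (RtoC s0 * cis th)%C))).
  rewrite Rabs_Ropp. intros. unfold Im in *. apply Rabs_le. lra.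
Qed.

End LogNice.

Lemma ln_bound s : 0 < s <= 1 -> Rabs (ln s) <= / s.
Proof.
  intros Hs.
  assert (ln s <= 0).
  { rewrite <- ln_1. destruct (Rle_lt_or_eq_dec s 1 (proj2 Hs)) as [H|H]; [apply Rlt_le, ln_increasing; lra|rewrite H; lra]. }
  rewrite Rabs_left1 by lra. rewrite <- ln_Rinv by lra.
  assert (0 < / s) by (apply Rinv_0_lt_compat; lra).
  generalize (exp_ineq1_le (ln (/ s))). rewrite exp_ln by assumption. lra.
Qed.

(** * Power series *)

(** A Cauchy bound with explicit constants, used in place of the radius of convergence in all
    quantitative estimates. *)
Definition geomb (u : nat -> C) (r M : R) : Prop := 0 < r /\ 0 <= M /\ forall k, Cmod (u k) * r ^ k <= M.

Lemma geomb_exists (c : nat -> C) : Rbar_lt 0 (C_CV_radius c) ->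
  exists r M, geomb c r M /\ Rbar_lt r (C_CV_radius c).
Proof.
  intros H.
  assert (Hr : exists r : R, 0 < r /\ Rbar_lt r (C_CV_radius c)).
  { destruct (C_CV_radius c) as [x| |]; simpl in *.
    - exists (x / 2). lra.
    - exists 1. split; [lra|trivial].
    - contradiction. }
  destruct Hr as [r [Hr0 Hr]].
  destruct (CV_radius_bounded (fun k => Cmod (c k))) as [_ Hlub].
  assert (E : exists s, r < s /\ exists M, forall n, Rabs (Cmod (c n) * s ^ n) <= M).
  { apply Classical_Prop.NNPP. intros N.
    assert (Hub : Rbar_le (C_CV_radius c) r).
    { apply Hlub. intros s [M HM]. simpl. apply Rnot_lt_le. intros Hs. apply N. exists s. split; [exact Hs|]. now exists M. }
    apply (Rbar_lt_not_le _ _ Hr). exact Hub. }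
  destruct E as [s [Hs [M HM]]].
  exists r, M. split; [|exact Hr]. split; [exact Hr0|].
  assert (HMk : forall k, Cmod (c k) * r ^ k <= M).
  { intros k. eapply Rle_trans; [|apply (HM k)]. eapply Rle_trans; [|apply Rle_abs].
    apply Rmult_le_compat_l; [apply Cmod_ge_0|]. apply pow_incr. lra. }
  split; [|exact HMk]. specialize (HMk 0%nat). simpl in HMk. generalize (Cmod_ge_0 (c 0%nat)). lra.
Qed.

Lemma geomb_radius (c : nat -> C) (r M s : R) : geomb c r M -> 0 <= s < r -> Rbar_lt s (C_CV_radius c).
Proof.
  intros [Hr [HM H]] Hs. destruct (CV_radius_bounded (fun k => Cmod (c k))) as [Hub _].
  apply Rbar_lt_le_trans with r; [exact (proj2 Hs)|]. apply Hub. exists M. intros n.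
  rewrite Rabs_pos_eq; [apply H|]. apply Rmult_le_pos; [apply Cmod_ge_0|apply pow_le; lra].
Qed.

Lemma geomb_term u r M (v : C) k : geomb u r M -> Cmod (u k * v ^ k) <= M * (Cmod v / r) ^ k.
Proof.
  intros [Hr [HM H]]. rewrite Cmod_mult, Cmod_pow. unfold Rdiv. rewrite Rpow_mult_distr, pow_inv.
  assert (Hp : 0 < r ^ k) by now apply pow_lt.
  apply Rmult_le_reg_r with (r ^ k); [exact Hp|].
  replace (M * (Cmod v ^ k * / r ^ k) * r ^ k) with (M * Cmod v ^ k) by (field; lra).
  replace (Cmod (u k) * Cmod v ^ k * r ^ k) with (Cmod (u k) * r ^ k * Cmod v ^ k) by ring.
  apply Rmult_le_compat_r; [apply pow_le, Cmod_ge_0|apply H].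
Qed.

(** [CSeries] sums real and imaginary parts separately and has a value even without convergence;
    this ties it to convergence in [C]. *)
Lemma C_series_Re_Im (a : nat -> C) (l : C) : cseries a l -> CSeries a = l.
Proof.
  intros H. assert (He := proj1 (is_series_eps a l) H).
  assert (K : forall (h : C -> R), (forall z w, Rabs (h z - h w) <= Cmod (z - w)) -> (forall z w, h (z + w)%C = h z + h w) ->
     Series (fun k => h (a k)) = h l).
  { intros h Hh Hadd. apply is_series_unique. intros P [eps HP]. destruct (He eps (cond_pos eps)) as [N HN].
    exists N. intros n Hn. apply HP.
    assert (E : sum_n (fun k => h (a k)) n = h (csum a n)).
    { clear Hn. induction n as [|n IH]; [now rewrite sum_O, sum_n_C_0|]. rewrite sum_Sn, sum_n_C_S, IH, Hadd. reflexivity. }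
    change (Rabs (sum_n (fun k => h (a k)) n - h l) < eps). rewrite E. eapply Rle_lt_trans; [apply Hh|now apply HN]. }
  unfold CSeries. rewrite (K Re), (K Im).
  - destruct l; reflexivity.
  - intros z w. eapply Rle_trans; [|apply Im_le_Cmod']. apply Req_le. reflexivity.
  - reflexivity.
  - intros z w. eapply Rle_trans; [|apply Re_le_Cmod']. apply Req_le. reflexivity.
  - reflexivity.
Qed.

Definition cps (u : nat -> C) (v : C) (n : nat) : C := csum (fun k => u k * v ^ k)%C n.

Lemma CPSeries_approx u r M (v : C) : geomb u r M -> Cmod v <= r / 2 ->
  cseries (fun k => u k * v ^ k)%C (CPSeries u v) /\
  forall k, Cmod (CPSeries u v - cps u v k) <= 2 * M * (Cmod v / r) ^ S k.
Proof.
  intros Hg Hv. assert (Hr : 0 < r) by apply Hg. assert (HM : 0 <= M) by apply Hg.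
  assert (Hrho : 0 <= Cmod v / r <= / 2).
  { split; [apply Rdiv_le_0_compat; [apply Cmod_ge_0|lra]|].
    apply Rmult_le_reg_r with r; [lra|]. unfold Rdiv. rewrite Rmult_assoc, Rinv_l; lra. }
  assert (T : forall k n, (k <= n)%nat -> Cmod (cps u v n - cps u v k) <= 2 * M * (Cmod v / r) ^ S k).
  { intros k n Hkn. apply sum_tail; trivial. intros j. now apply geomb_term. }
  destruct (C_cauchy_geom (cps u v) (2 * M * (Cmod v / r)) (Cmod v / r)) as [l Hl]; [lra| |].
  { intros n m Hnm. eapply Rle_trans; [apply T, Hnm|]. simpl. apply Req_le. ring. }
  assert (Hs : cseries (fun k => u k * v ^ k)%C l).
  { apply is_series_rate with (K := 2 * (2 * M * (Cmod v / r))) (rho := Cmod v / r); [lra|exact Hl]. }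
  assert (E : CPSeries u v = l) by now apply C_series_Re_Im.
  rewrite E. split; [exact Hs|]. intros k.
  apply (is_series_bound _ _ _ k _ Hs). intros n Hn. now apply T.
Qed.

Lemma CPSeries_bound u r M (v : C) : geomb u r M -> Cmod v <= r / 2 -> Cmod (CPSeries u v) <= 2 * M.
Proof.
  intros Hg Hv. assert (Hr : 0 < r) by apply Hg. assert (HM : 0 <= M) by apply Hg.
  destruct (CPSeries_approx u r M v Hg Hv) as [_ H]. specialize (H 0%nat).
  unfold cps in H. rewrite sum_n_C_0 in H. simpl in H. rewrite Rmult_1_r in H.
  assert (H0 := geomb_term u r M v 0 Hg). simpl in H0.
  assert (Cmod v / r <= / 2).
  { apply Rmult_le_reg_r with r; [lra|]. unfold Rdiv. rewrite Rmult_assoc, Rinv_l; lra. }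
  replace (CPSeries u v) with ((CPSeries u v - u 0%nat * 1) + u 0%nat * 1)%C by ring.
  eapply Rle_trans; [apply Cmod_triangle|]. nra.
Qed.

Lemma CPSeries_small u r M (v : C) : geomb u r M -> u 0%nat = 0%C -> Cmod v <= r / 2 -> Cmod (CPSeries u v) <= 2 * M / r * Cmod v.
Proof.
  intros Hg H0 Hv. assert (Hr : 0 < r) by apply Hg.
  destruct (CPSeries_approx u r M v Hg Hv) as [_ H]. specialize (H 0%nat).
  unfold cps in H. rewrite sum_n_C_0, H0 in H.
  replace (CPSeries u v - 0 * v ^ 0)%C with (CPSeries u v) in H by ring.
  eapply Rle_trans; [exact H|]. apply Req_le. simpl. field. lra.
Qed.

Lemma cauchy_deriv (g : C -> C) (z0 d : C) R M : 0 < R -> (forall z, Cmod (z - z0) <= R -> cdiff g z) ->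
  (forall z, Cmod (z - z0) <= R -> Cmod (g z) <= M) -> cderiv g z0 d -> Cmod d <= M / R.
Proof.
  intros HR Hd HM Hg.
  destruct (disc_taylor (fun z => g (z0 + z)%C) R M HR) as [c1 [H1 Hy]].
  - intros z Hz. apply (cdiff_comp (fun z => z0 + z)%C g); [apply cdiff_plus; [apply cdiff_const|apply cdiff_id]|].
    apply Hd. replace (z0 + z - z0)%C with z by ring. exact Hz.
  - intros z Hz. apply HM. replace (z0 + z - z0)%C with z by ring. exact Hz.
  - replace d with c1; [exact H1|]. apply (cderiv_unique g z0); [|exact Hg].
    assert (HM0 : 0 <= M).
    { eapply Rle_trans; [apply (Cmod_ge_0 (g z0))|apply HM]. replace (z0 - z0)%C with (RtoC 0) by ring. rewrite Cmod_0. lra. }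
    apply cderiv_quadratic with (K := 2 * M / R ^ 2) (r := R / 2); [lra|apply Rdiv_le_0_compat; [lra|apply pow_lt; lra]|].
    intros k Hk. destruct (Hy k Hk) as [A _]. replace (z0 + 0)%C with z0 in A by ring.
    eapply Rle_trans; [exact A|]. apply Req_le. field. lra.
Qed.

Lemma cdiff_hol (f : C -> C) z : cdiff f z <-> ex_filterdiff (K := C_AbsRing) (U := C_NormedModule) (V := C_NormedModule) f (locally (T := C_NormedModule) z).
Proof.
  split.
  - intros [d Hd]. eexists. apply cderiv_cfd, Hd.
  - intros [l Hl]. exists (l (RtoC 1)). apply cderiv_cfd.
    assert (Hlin : is_linear (U := C_NormedModule) (V := C_NormedModule) l) by apply Hl.
    apply (cfd_ext_l (U := C_NormedModule)) with l; [|exact Hl].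
    intros k. assert (E := linear_scal _ Hlin k (RtoC 1)).
    change (l (k * 1)%C = (k * l (RtoC 1))%C) in E. rewrite Cmult_1_r in E. rewrite E. apply Cmult_comm.
Qed.

(** Multiplied by [v], the derivative keeps the exponents: the Euler operator acts on coefficients
    by [k], without a shift of index. The differential equation of [c~] has this form. *)
Lemma cps_cderiv u (v : C) n : exists d, cderiv (fun v => cps u v n) v d /\ (v * d)%C = cps (fun k => INR k * u k)%C v n.
Proof.
  induction n as [|n [d [Hd E]]].
  - exists 0%C. split.
    + apply (cderiv_ext (fun _ => u 0%nat)); [intros w; unfold cps; rewrite sum_n_C_0; simpl; ring|apply cderiv_const].
    + unfold cps. rewrite sum_n_C_0. simpl. ring.
  - exists (d + u (S n) * (INR (S n) * v ^ (S n - 1)))%C. split.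
    + apply (cderiv_ext (fun v => cps u v n + u (S n) * v ^ (S n))%C); [intros w; unfold cps; now rewrite sum_n_C_S|].
      apply cderiv_plus; [exact Hd|]. eapply cderiv_eq; [|apply cderiv_mult; [apply cderiv_const|apply cderiv_pow]]. cring.
    + rewrite Cmult_plus_distr_l, E. unfold cps. rewrite sum_n_C_S. f_equal.
      replace (S n - 1)%nat with n by lia. simpl. ring.
Qed.

Lemma geomb_deriv u r M : geomb u r M -> geomb (fun k => INR k * u k)%C (r / 2) M.
Proof.
  intros [Hr [HM H]]. split; [lra|]. split; [exact HM|]. intros k.
  rewrite Cmod_mult, Cmod_R, Rabs_pos_eq by apply pos_INR.
  unfold Rdiv. rewrite Rpow_mult_distr.
  assert (Hk : INR k * (/ 2) ^ k <= 1).
  { induction k as [|k IH]; [simpl; lra|]. rewrite S_INR. simpl.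
    assert (0 <= (/ 2) ^ k) by (apply pow_le; lra).
    assert ((/ 2) ^ k <= 1) by (rewrite <- (pow1 k); apply pow_incr; lra).
    assert (0 <= INR k) by apply pos_INR. nra. }
  assert (0 <= Cmod (u k) * r ^ k) by (apply Rmult_le_pos; [apply Cmod_ge_0|apply pow_le; lra]).
  assert (0 <= INR k * (/ 2) ^ k) by (apply Rmult_le_pos; [apply pos_INR|apply pow_le; lra]).
  specialize (H k).
  replace (INR k * Cmod (u k) * (r ^ k * (/ 2) ^ k)) with ((INR k * (/ 2) ^ k) * (Cmod (u k) * r ^ k)) by ring. nra.
Qed.

Lemma CPSeries_cderiv u r M (v : C) : geomb u r M -> Cmod v <= r / 4 ->
  exists d, cderiv (CPSeries u) v d /\ (v * d)%C = CPSeries (fun k => INR k * u k)%C v.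
Proof.
  intros Hg Hv. assert (Hr : 0 < r) by apply Hg. assert (HM : 0 <= M) by apply Hg.
  assert (Hball : forall w, Cmod (w - v) <= r / 8 -> Cmod w <= r / 2).
  { intros w Hw. replace w with (v + (w - v))%C by ring. eapply Rle_trans; [apply Cmod_triangle|]. lra. }
  assert (Happ : forall n w, Cmod w <= r / 2 -> Cmod (cps u w n - CPSeries u w) <= 2 * M * (/ 2) ^ n).
  { intros n w Hw. replace (cps u w n - CPSeries u w)%C with (- (CPSeries u w - cps u w n))%C by ring. rewrite Cmod_opp.
    eapply Rle_trans; [apply (CPSeries_approx u r M w Hg Hw)|]. apply Rmult_le_compat_l; [lra|].
    assert (0 <= Cmod w / r <= / 2).
    { split; [apply Rdiv_le_0_compat; [apply Cmod_ge_0|lra]|]. apply Rmult_le_reg_r with r; [lra|]. unfold Rdiv. rewrite Rmult_assoc, Rinv_l; lra. }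
    simpl. assert ((Cmod w / r) ^ n <= (/ 2) ^ n) by (apply pow_incr; lra).
    assert (0 <= (Cmod w / r) ^ n) by (apply pow_le; lra). nra. }
  assert (Hcd : forall n w, cdiff (fun v => cps u v n) w) by (intros n w; destruct (cps_cderiv u w n) as [d [Hd _]]; now exists d).
  assert (HF : forall w, Cmod (w - v) < r / 8 -> cdiff (CPSeries u) w).
  { intros w Hw. apply cdiff_hol.
    apply (weierstrass (U := C_NormedModule) (fun n w => cps u w n) (CPSeries u) w (r / 8 - Cmod (w - v)) (2 * M) (/ 2)); [lra|lra| |].
    - intros n q _. apply cdiff_hol, Hcd.
    - intros n q Hq. change (Cmod (q - w)%C < r / 8 - Cmod (w - v)) in Hq. apply Happ, Hball.
      replace (q - v)%C with ((q - w) + (w - v))%C by ring. eapply Rle_trans; [apply Cmod_triangle|]. lra. }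
  destruct (HF v) as [d Hd]. { replace (v - v)%C with (RtoC 0) by ring. rewrite Cmod_0. lra. }
  exists d. split; [exact Hd|].
  assert (Hlim : cseries (fun k => INR k * u k * v ^ k)%C (v * d)%C).
  (* The partial sums converge geometrically on a disc around [v]; Cauchy's estimate transfers the
     rate to their derivatives. *)
  { apply is_series_rate with (K := Cmod v * (2 * M / (r / 16))) (rho := / 2); [lra|]. intros n.
    destruct (cps_cderiv u v n) as [e [He E]]. unfold cps in E at 1. rewrite <- E.
    replace (v * e - v * d)%C with (v * (e - d))%C by ring. rewrite Cmod_mult, Rmult_assoc.
    apply Rmult_le_compat_l; [apply Cmod_ge_0|].
    replace (2 * M / (r / 16) * (/ 2) ^ n) with ((2 * M * (/ 2) ^ n) / (r / 16)) by (field; lra).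
    apply (cauchy_deriv (fun w => cps u w n - CPSeries u w)%C v); [lra| | |].
    - intros z Hz. apply cdiff_minus; [apply Hcd|apply HF; lra].
    - intros z Hz. apply Happ, Hball. lra.
    - now apply cderiv_minus. }
  symmetry. now apply C_series_Re_Im.
Qed.

Lemma CPSeries_Lipschitz u r M (v v' : C) : geomb u r M -> Cmod v <= r / 4 -> Cmod v' <= r / 4 ->
  Cmod (CPSeries u v - CPSeries u v') <= 16 * M / r * Cmod (v - v').
Proof.
  intros Hg Hv Hv'. assert (Hr : 0 < r) by apply Hg. assert (HM : 0 <= M) by apply Hg.
  assert (Hseg : forall s, 0 <= s <= 1 -> Cmod (v' + s * (v - v')) <= r / 4).
  { intros s Hs. replace (v' + s * (v - v'))%C with ((1 - s)%R * v' + s * v)%C by (rewrite RtoC_minus; ring).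
    eapply Rle_trans; [apply Cmod_triangle|]. rewrite !Cmod_mult, !Cmod_R, !Rabs_pos_eq by lra. nra. }
  assert (Hd : forall w, exists d, Cmod w <= r / 4 -> cderiv (CPSeries u) w d).
  { intros w. destruct (Rle_lt_dec (Cmod w) (r / 4)) as [H|H].
    - destruct (CPSeries_cderiv u r M w Hg H) as [d [Hd _]]. now exists d.
    - exists 0%C. intros; lra. }
  assert (Hd2 : forall w, Cmod w <= r / 2 * (9/10) -> cdiff (CPSeries u) w).
  { intros w Hw. apply cdiff_hol.
    apply (weierstrass (U := C_NormedModule) (fun n w => cps u w n) (CPSeries u) w (r / 20) (2 * M) (/ 2)); [lra|lra| |].
    - intros n q _. apply cdiff_hol. destruct (cps_cderiv u q n) as [d [Hd' _]]. now exists d.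
    - intros n q Hq. change (Cmod (q - w)%C < r / 20) in Hq.
      assert (Hq2 : Cmod q <= r / 2).
      { replace q with (w + (q - w))%C by ring. eapply Rle_trans; [apply Cmod_triangle|]. lra. }
      replace (cps u q n - CPSeries u q)%C with (- (CPSeries u q - cps u q n))%C by ring. rewrite Cmod_opp.
      eapply Rle_trans; [apply (CPSeries_approx u r M q Hg Hq2)|]. apply Rmult_le_compat_l; [lra|].
      assert (0 <= Cmod q / r <= / 2).
      { split; [apply Rdiv_le_0_compat; [apply Cmod_ge_0|lra]|]. apply Rmult_le_reg_r with r; [lra|]. unfold Rdiv. rewrite Rmult_assoc, Rinv_l; lra. }
      simpl. assert ((Cmod q / r) ^ n <= (/ 2) ^ n) by (apply pow_incr; lra).
      assert (0 <= (Cmod q / r) ^ n) by (apply pow_le; lra). nra. }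
  apply (cmvt (CPSeries u) (fun w => proj1_sig (constructive_indefinite_description _ (Hd w)))).
  intros s Hs. specialize (Hseg s Hs). set (w := (v' + s * (v - v'))%C) in *.
  assert (Hw := proj2_sig (constructive_indefinite_description _ (Hd w)) Hseg).
  split; [exact Hw|].
  replace (16 * M / r) with (2 * M / (r / 8)) by (field; lra).
  apply (cauchy_deriv (CPSeries u) w); [lra| | |exact Hw].
  - intros z Hz. apply Hd2. replace z with (w + (z - w))%C by ring. eapply Rle_trans; [apply Cmod_triangle|]. lra.
  - intros z Hz. apply (CPSeries_bound u r M z Hg). replace z with (w + (z - w))%C by ring. eapply Rle_trans; [apply Cmod_triangle|]. lra.
Qed.

(** * The functions [f_1] and [f_2] *)

Lemma hol_const {U : NormedModule C_AbsRing} (z : C) (p : U) : hol (fun _ : U => z) p.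
Proof. eexists. apply cfd_const. Qed.
Lemma hol_plus {U : NormedModule C_AbsRing} (f g : U -> C) p : hol f p -> hol g p -> hol (fun q => f q + g q)%C p.
Proof. intros [l Hl] [m Hm]. eexists. exact (cfd_plus f g p l m Hl Hm). Qed.
Lemma hol_mult {U : NormedModule C_AbsRing} (f g : U -> C) p : hol f p -> hol g p -> hol (fun q => f q * g q)%C p.
Proof. intros [l Hl] [m Hm]. eexists. exact (cfd_mult f g p l m Hl Hm). Qed.
Lemma hol_comp {U : NormedModule C_AbsRing} (g : C -> C) (f : U -> C) p : hol f p -> cdiff g (f p) -> hol (fun q => g (f q)) p.
Proof. intros [l Hl] [d Hd]. eexists. exact (cfd_comp g f p l d Hl Hd). Qed.
Lemma hol_opp {U : NormedModule C_AbsRing} (f : U -> C) p : hol f p -> hol (fun q => - f q)%C p.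
Proof. intros H. apply (hol_comp (fun z => - z)%C f p H). apply cdiff_opp, cdiff_id. Qed.
Lemma hol_sub {U : NormedModule C_AbsRing} (f g : U -> C) p : hol f p -> hol g p -> hol (fun q => f q - g q)%C p.
Proof. intros Hf Hg. apply hol_plus; [exact Hf|now apply hol_opp]. Qed.
Lemma hol_pow {U : NormedModule C_AbsRing} (f : U -> C) n p : hol f p -> hol (fun q => f q ^ n)%C p.
Proof. intros H. apply (hol_comp (fun z => z ^ n)%C f p H). apply (cdiff_pow (fun z => z)), cdiff_id. Qed.
Lemma hol_inv {U : NormedModule C_AbsRing} (f : U -> C) (p : U) : f p <> RtoC 0 -> hol f p -> hol (fun q => / f q)%C p.
Proof. intros N H. apply (hol_comp Cinv f p H). eexists. apply cderiv_inv, N. Qed.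
Lemma hol_div {U : NormedModule C_AbsRing} (f g : U -> C) (p : U) : g p <> RtoC 0 -> hol f p -> hol g p -> hol (fun q => f q / g q)%C p.
Proof. intros N Hf Hg. apply hol_mult; [exact Hf|now apply hol_inv]. Qed.
Lemma hol_exp {U : NormedModule C_AbsRing} (f : U -> C) p : hol f p -> hol (fun q => Cexp (f q)) p.
Proof. intros H. apply (hol_comp Cexp f p H). eexists. apply cderiv_exp. Qed.
Lemma hol_ext_loc {U : NormedModule C_AbsRing} (f g : U -> C) p : locally p (fun q => f q = g q) -> hol f p -> hol g p.
Proof. intros H [l Hl]. exists l. exact (cfd_ext_loc f g p l H Hl). Qed.

Lemma fin_bound (f : nat -> R) N : exists B, forall k, (k < N)%nat -> f k <= B.
Proof.
  induction N as [|N [B HB]]; [exists 0; intros; lia|].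
  exists (Rmax B (f N)). intros k Hk. destruct (Nat.eq_dec k N) as [->|Nk]; [apply Rmax_r|].
  eapply Rle_trans; [apply HB; lia|apply Rmax_l].
Qed.

Lemma Cmod_pow_diff (v v' : C) n : Cmod v <= 1 -> Cmod v' <= 1 -> Cmod (v' ^ n - v ^ n) <= INR n * Cmod (v' - v).
Proof.
  intros H H'. induction n as [|n IH].
  - simpl. replace (1 - 1)%C with (RtoC 0) by ring. rewrite Cmod_0. lra.
  - rewrite S_INR. simpl. replace (v' * v' ^ n - v * v ^ n)%C with (v' * (v' ^ n - v ^ n) + (v' - v) * v ^ n)%C by ring.
    eapply Rle_trans; [apply Cmod_triangle|]. rewrite !Cmod_mult, Cmod_pow.
    assert (Cmod v ^ n <= 1) by (rewrite <- (pow1 n); apply pow_incr; split; [apply Cmod_ge_0|exact H]).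
    generalize (Cmod_ge_0 (v' ^ n - v ^ n)) (Cmod_ge_0 (v' - v)) (Cmod_ge_0 v') . intros. nra.
Qed.

(** Uniform treatment of resonance: if [1 / a] is a positive integer, it is [k0] and [cm = c k0];
    otherwise [cm = 0] and [k0] is arbitrary. The last clause is the coefficient form of the
    equation for [c~]. *)
Lemma resonant_spec (c : nat -> C) (a : C) : a <> 0%C -> c 0%nat = 0%C ->
  exists (k0 : nat) (cm : C),
    (forall w, resonant_term c (/ a) w = (cm * w ^ k0)%C) /\
    (cm = 0%C \/ (INR k0 * a = 1)%C) /\
    (forall k, ((a * INR k - 1) * tilde_coeff c (/ a) k)%C = (c k - (if Nat.eq_dec k k0 then cm else 0))%C).
Proof.
  intros Ha Hc0.
  assert (Ht : forall k, RtoC (INR k) <> (/ a)%C -> ((a * INR k - 1) * tilde_coeff c (/ a) k)%C = c k).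
  { intros k Hk. destruct k as [|k]; [simpl; rewrite Hc0; ring|].
    unfold tilde_coeff. destruct (Ceq_dec (RtoC (INR (S k))) (/ a)) as [E|N]; [contradiction|].
    assert (N' : (INR (S k) - / a)%C <> 0%C) by now apply Cminus_eq_contra.
    assert (N2 : (a * INR (S k) - 1)%C <> 0%C).
    { intros E. apply N'. replace (INR (S k) - / a)%C with (/ a * (a * INR (S k) - 1))%C by (field; exact Ha). rewrite E. ring. }
    set (i := RtoC (INR (S k))) in *.
    assert (E : (i - / a)%C = ((a * i - 1) / a)%C) by (field; exact Ha).
    rewrite E. field. split; assumption. }
  destruct (excluded_middle_informative (exists k : nat, (0 < k)%nat /\ (/ a)%C = RtoC (INR k))) as [H|H].
  - set (k0 := proj1_sig (constructive_indefinite_description _ H)).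
    assert (Hk0 := proj2_sig (constructive_indefinite_description _ H)). fold k0 in Hk0. simpl in Hk0.
    exists k0, (c k0). split; [|split].
    + intros w. unfold resonant_term.
      destruct (excluded_middle_informative (exists k : nat, (0 < k)%nat /\ (/ a)%C = RtoC (INR k))) as [H'|H']; [|contradiction].
      set (k1 := proj1_sig (constructive_indefinite_description _ H')).
      assert (Hk1 := proj2_sig (constructive_indefinite_description _ H')). fold k1 in Hk1. simpl in Hk1.
      (* The index chosen inside [resonant_term] comes from another existence proof; injectivity of
         the embedding of the integers identifies the two. *)
      assert (E : k1 = k0).
      { apply INR_eq. apply RtoC_inj. rewrite <- (proj2 Hk1), <- (proj2 Hk0). reflexivity. }
      now rewrite E.
    + right. rewrite <- (proj2 Hk0). field. exact Ha.
    + intros k. destruct (Nat.eq_dec k k0) as [->|N].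
      * destruct k0 as [|k0]; [lia|]. unfold tilde_coeff.
        destruct (Ceq_dec (RtoC (INR (S k0))) (/ a)) as [E|N]; [ring|]. destruct Hk0 as [_ Hk0]. symmetry in Hk0. contradiction.
      * rewrite Ht; [ring|]. rewrite (proj2 Hk0). intros E. apply N. apply INR_eq. now apply RtoC_inj.
  - exists 0%nat, 0%C. split; [|split].
    + intros w. unfold resonant_term.
      destruct (excluded_middle_informative (exists k : nat, (0 < k)%nat /\ (/ a)%C = RtoC (INR k))) as [H'|H']; [contradiction|ring].
    + now left.
    + intros k. destruct (Nat.eq_dec k 0) as [->|N].
      * simpl. rewrite Hc0. ring.
      * rewrite Ht; [ring|]. intros E. apply H. exists k. split; [lia|now symmetry].
Qed.

(** The factor [m / (k - m)] has modulus at most 1 once [k >= 2 |m|]; only finitely many other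
    indices remain. *)
Lemma tilde_bound (c : nat -> C) (m : C) : exists B, 1 <= B /\ forall k, Cmod (tilde_coeff c m k) <= B * Cmod (c k).
Proof.
  destruct (INR_unbounded (2 * Cmod m)) as [N HN].
  destruct (fin_bound (fun k => Cmod (m / (INR k - m))) N) as [B HB].
  assert (Hall : forall k, Cmod (tilde_coeff c m k) <= Rmax B 1 * Cmod (c k)).
  { intros k. assert (H1 : 1 <= Rmax B 1) by apply Rmax_r. assert (HB1 : B <= Rmax B 1) by apply Rmax_l.
    assert (Hz : Cmod 0 <= Rmax B 1 * Cmod (c k)) by (rewrite Cmod_0; apply Rmult_le_pos; [lra|apply Cmod_ge_0]).
    destruct k as [|k]; [exact Hz|]. unfold tilde_coeff.
    destruct (Ceq_dec (RtoC (INR (S k))) m) as [E|Ne]; [exact Hz|].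
    assert (N' : (INR (S k) - m)%C <> 0%C) by now apply Cminus_eq_contra.
    replace (m * (c (S k) / (INR (S k) - m)))%C with ((m / (INR (S k) - m)) * c (S k))%C by (field; exact N').
    rewrite Cmod_mult. apply Rmult_le_compat_r; [apply Cmod_ge_0|].
    destruct (Nat.lt_ge_cases (S k) N) as [Hlt|Hge]; [specialize (HB _ Hlt); lra|].
    apply Rle_trans with 1; [|exact H1].
    rewrite Cmod_div by exact N'. assert (0 < Cmod (INR (S k) - m)) by (apply Cmod_gt_0; exact N').
    apply Rmult_le_reg_r with (Cmod (INR (S k) - m)); [assumption|]. unfold Rdiv. rewrite Rmult_assoc, Rinv_l, Rmult_1_r, Rmult_1_l by lra.
    apply le_INR in Hge. assert (A := Cmod_minus_ge (INR (S k)) m). rewrite Cmod_R, Rabs_pos_eq in A by apply pos_INR. lra. }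
  exists (Rmax B 1). split; [apply Rmax_r|exact Hall].
Qed.

Lemma Cmod_Cexp_le_1 (z : C) : Cmod z <= 1 -> Cmod (Cexp z - 1) <= 3 * exp 1 * Cmod z.
Proof.
  intros Hz. replace (Cexp z - 1)%C with (Cexp z - Cexp 0)%C by (rewrite Cexp_0; ring).
  replace (Cmod z) with (Cmod (z - 0)) by (f_equal; ring).
  apply Rle_trans with (exp 1 * Cmod (z - 0)).
  - apply (cmvt Cexp Cexp). intros s Hs. split; [apply cderiv_exp|]. rewrite Cmod_Cexp. apply exp_le.
    eapply Rle_trans; [apply Rle_abs|]. eapply Rle_trans; [apply Re_le_Cmod'|].
    replace (0 + s * (z - 0))%C with (s * z)%C by ring. rewrite Cmod_mult, Cmod_R, Rabs_pos_eq by lra.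
    generalize (Cmod_ge_0 z). nra.
  - apply Rmult_le_compat_r; [apply Cmod_ge_0|]. generalize (exp_pos 1). lra.
Qed.

Section Model.
Context (lambda a1 a2 : C) (c : nat -> C) (r0 M0 : R).
Context (Hlambda : lambda <> RtoC 0) (Ha : 0 < Re (a1 + a2)%C) (Hc0 : c 0%nat = RtoC 0) (Hg : geomb c r0 M0).
Context (S0 : C -> Prop) (L : C -> C) (HS0 : open S0) (HL : log_branch S0 L).

Local Notation a := (a1 + a2)%C.
Local Notation X x := (xpow L x (a1 + a2)%C).
Local Notation expo := (f_exponent lambda a1 a2 c L).
Local Notation F1 := (f1 lambda a1 a2 c L).
Local Notation F2 := (f2 lambda a1 a2 c L).
Local Notation Tc := (tilde_coeff c (/ (a1 + a2))%C).

Lemma a_neq0 : a <> RtoC 0.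
Proof. intros E. rewrite E in Ha. simpl in Ha. lra. Qed.

Lemma xpow_neq0 x b : xpow L x b <> RtoC 0.
Proof. apply Cexp_neq0. Qed.

Lemma F1_neq0 x w : F1 x w <> RtoC 0.
Proof. apply Cmult_neq_0; apply Cexp_neq0. Qed.

Lemma F2_neq0 x w : F2 x w <> RtoC 0.
Proof. apply Cmult_neq_0; apply Cexp_neq0. Qed.

Lemma F1_F2 x w : (F1 x w * F2 x w)%C = X x.
Proof.
  unfold f1, f2, xpow. rewrite <- !Cexp_plus. f_equal. ring.
Qed.

(** The inverse is explicit because [h_1 h_2] is the very [w] at which [f_1] and [f_2] are
    evaluated. *)
Definition Hinv (q : C3) : C3 :=
  (fst q, (fst (snd q) * F1 (fst q) (fst (snd q) * snd (snd q)), snd (snd q) * F2 (fst q) (fst (snd q) * snd (snd q))))%C.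

Lemma Hmap_Hinv q : Hmap lambda a1 a2 c L (Hinv q) = q.
Proof.
  destruct q as [x [h1 h2]]. unfold Hmap, Hinv; simpl.
  assert (E : (h1 * F1 x (h1 * h2) * (h2 * F2 x (h1 * h2)) / X x)%C = (h1 * h2)%C).
  { rewrite <- (F1_F2 x (h1 * h2)%C). field. split; [apply F2_neq0|apply F1_neq0]. }
  rewrite E. f_equal. f_equal; field; [apply F1_neq0|apply F2_neq0].
Qed.

Lemma Hinv_Hmap p : Hinv (Hmap lambda a1 a2 c L p) = p.
Proof.
  destruct p as [x [y1 y2]]. unfold Hmap, Hinv; simpl.
  set (w := (y1 * y2 / X x)%C).
  assert (E : (y1 / F1 x w * (y2 / F2 x w))%C = w).
  { unfold w at 3. rewrite <- (F1_F2 x w). field. split; [apply F2_neq0|apply F1_neq0]. }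
  rewrite E. f_equal. f_equal; field; [apply F1_neq0|apply F2_neq0].
Qed.

Lemma tilde_geomb : exists M1, M0 <= M1 /\ geomb Tc r0 M1.
Proof.
  destruct (tilde_bound c (/ a)%C) as [B [HB1 HB]]. destruct Hg as [Hr [HM H]].
  exists (B * M0). split; [nra|]. split; [exact Hr|]. split; [nra|]. intros k.
  apply Rle_trans with (B * Cmod (c k) * r0 ^ k).
  - apply Rmult_le_compat_r; [apply pow_le; lra|apply HB].
  - rewrite Rmult_assoc. apply Rmult_le_compat_l; [lra|apply H].
Qed.

(** [a v c~'(v) - c~(v) = c(v) - c_m v^m]: the coefficients of [c~] are chosen for this. *)
Lemma tilde_ode k0 cm (v : C) : Cmod v <= r0 / 4 ->
  (forall k, ((a * INR k - 1) * Tc k)%C = (c k - (if Nat.eq_dec k k0 then cm else 0))%C) ->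
  (a * CPSeries (fun k => INR k * Tc k) v - CPSeries Tc v)%C = (CPSeries c v - cm * v ^ k0)%C.
Proof.
  intros Hv Hk. destruct tilde_geomb as [M1 [_ Hg1]]. assert (Hr : 0 < r0) by apply Hg.
  assert (Hg2 := geomb_deriv _ _ _ Hg1).
  destruct (CPSeries_approx _ _ _ v Hg1 ltac:(lra)) as [T1 _].
  destruct (CPSeries_approx _ _ _ v Hg2 ltac:(lra)) as [T2 _].
  destruct (CPSeries_approx _ _ _ v Hg ltac:(lra)) as [T3 _].
  assert (T4 : cseries (fun k => (if Nat.eq_dec k k0 then cm else 0) * v ^ k)%C (cm * v ^ k0)%C).
  { apply is_series_eps. intros eps He. exists k0. intros n Hn.
    assert (E : forall n, csum (fun k => (if Nat.eq_dec k k0 then cm else 0) * v ^ k)%C n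
       = if Compare_dec.le_dec k0 n then (cm * v ^ k0)%C else RtoC 0).
    { clear. induction n as [|n IH].
      - rewrite sum_n_C_0. destruct (Nat.eq_dec 0 k0), (Compare_dec.le_dec k0 0); subst; try lia; cring.
      - rewrite sum_n_C_S, IH. destruct (Nat.eq_dec (S n) k0), (Compare_dec.le_dec k0 n), (Compare_dec.le_dec k0 (S n)); subst; try lia; cring. }
    rewrite E. destruct (Compare_dec.le_dec k0 n); [|lia]. replace (cm * v ^ k0 - cm * v ^ k0)%C with (RtoC 0) by ring. rewrite Cmod_0. exact He. }
  assert (S1 := is_series_minus (K := C_AbsRing) (V := C_NormedModule) _ _ _ _ (is_series_scal (K := C_AbsRing) (V := C_NormedModule) a _ _ T2) T1).
  assert (S2 := is_series_minus (K := C_AbsRing) (V := C_NormedModule) _ _ _ _ T3 T4).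
  apply (is_series_C_unique (fun k => (c k - (if Nat.eq_dec k k0 then cm else 0)) * v ^ k)%C).
  - revert S1. apply is_series_ext. intros k.
    change ((a * (INR k * Tc k * v ^ k) - Tc k * v ^ k)%C = ((c k - (if Nat.eq_dec k k0 then cm else 0)) * v ^ k)%C).
    rewrite <- Hk. ring.
  - revert S2. apply is_series_ext. intros k.
    change ((c k * v ^ k - (if Nat.eq_dec k k0 then cm else 0) * v ^ k)%C = ((c k - (if Nat.eq_dec k k0 then cm else 0)) * v ^ k)%C). ring.
Qed.

Lemma S0_neq0 x : S0 x -> x <> RtoC 0.
Proof. intros Hx. destruct (HL x Hx) as [_ E]. rewrite <- E. apply Cexp_neq0. Qed.

Lemma L_cderiv x : S0 x -> cderiv L x (/ x)%C.
Proof. apply log_branch_cderiv; assumption. Qed.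

Lemma xpow_cderiv b x : S0 x -> cderiv (fun z => xpow L z b) x (xpow L x b * b / x)%C.
Proof.
  intros Hx. unfold xpow. eapply cderiv_eq; [|apply cderiv_Cexp, cderiv_mult; [apply cderiv_const|apply L_cderiv, Hx]].
  cfield. now apply S0_neq0.
Qed.

(** At resonance [(x^a)^k0 = x], which turns the resonant monomial in [w] into [v^k0 / x] with
    [v = w x^a]. *)
Lemma xpow_res k0 x : S0 x -> (INR k0 * a = 1)%C -> (X x ^ k0)%C = x.
Proof.
  intros Hx E. unfold xpow. rewrite <- Cexp_nat. rewrite Cmult_assoc, E, Cmult_1_l. apply HL, Hx.
Qed.

(** The logarithmic term contributes the resonant coefficient missing from [c~], so that the full
    [c(v)] appears. The argument [W] is a function with zero derivative at [x], rather than a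
    constant, so that the lemma also applies along integral curves. *)
Lemma exponent_curve (W : C -> C) x : S0 x -> cderiv W x 0%C -> Cmod (W x * X x)%C <= r0 / 4 ->
  cderiv (fun z => expo z (W z)) x ((- lambda - CPSeries c (W x * X x)) / (x * x))%C.
Proof.
  intros Hx HW Hv. assert (Hx0 := S0_neq0 x Hx).
  destruct (resonant_spec c a a_neq0 Hc0) as [k0 [cm [Hres [Hcm Hk]]]].
  destruct tilde_geomb as [M1 [_ Hg1]].
  set (v := (W x * X x)%C) in *.
  destruct (CPSeries_cderiv _ _ _ v Hg1 Hv) as [d [Hd Ed]].
  assert (Hode := tilde_ode k0 cm v Hv Hk).
  assert (HV : cderiv (fun z => W z * X z)%C x (v * a / x)%C).
  { eapply cderiv_eq; [|apply cderiv_mult; [exact HW|apply xpow_cderiv, Hx]]. unfold v. cfield. exact Hx0. }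
  apply (cderiv_ext (fun z => lambda / z - (cm * W z ^ k0) * L z - CPSeries Tc (W z * X z) / z)%C).
  { intros z. unfold f_exponent. now rewrite Hres. }
  eapply cderiv_eq.
  2:{ apply cderiv_minus; [apply cderiv_minus|].
      - apply cderiv_div; [exact Hx0|apply cderiv_const|apply cderiv_id].
      - apply cderiv_mult; [apply cderiv_mult; [apply cderiv_const|apply (cderiv_comp W (fun w => w ^ k0)%C); [exact HW|apply cderiv_pow]]|apply L_cderiv, Hx].
      - apply cderiv_div; [exact Hx0| |apply cderiv_id].
        apply (cderiv_comp (fun z => W z * X z)%C (CPSeries Tc)); [exact HV|exact Hd]. }
  cbv beta. fold v.
  assert (Hr : (cm * W x ^ k0 * / x = cm * v ^ k0 / (x * x))%C).
  { destruct Hcm as [->|E]; [field; exact Hx0|]. unfold v. rewrite Cpow_mult_l, (xpow_res k0 x Hx E). field. exact Hx0. }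
  transitivity (- lambda / (x * x) - (cm * W x ^ k0 * / x) - ((a * (v * d)) - CPSeries Tc v) / (x * x))%C.
  { field. exact Hx0. }
  rewrite Hr, Ed, Hode. field. exact Hx0.
Qed.

Lemma hol_L {U : NormedModule C_AbsRing} (f : U -> C) p : hol f p -> S0 (f p) -> hol (fun q => L (f q)) p.
Proof. intros Hf Hp. apply (hol_comp L f p Hf). eexists. now apply L_cderiv. Qed.

Lemma hol_xpow {U : NormedModule C_AbsRing} (f : U -> C) b p : hol f p -> S0 (f p) -> hol (fun q => xpow L (f q) b) p.
Proof. intros Hf Hp. apply hol_exp, hol_mult; [apply hol_const|now apply hol_L]. Qed.

Lemma hol_expo {U : NormedModule C_AbsRing} (f W : U -> C) p : hol f p -> hol W p -> S0 (f p) ->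
  Cmod (W p * X (f p))%C <= r0 / 4 -> hol (fun q => expo (f q) (W q)) p.
Proof.
  intros Hf HW Hp Hv. destruct (resonant_spec c a a_neq0 Hc0) as [k0 [cm [Hres _]]].
  destruct tilde_geomb as [M1 [_ Hg1]]. assert (Hx0 := S0_neq0 _ Hp).
  apply (hol_ext_loc (fun q => lambda / f q - (cm * W q ^ k0) * L (f q) - CPSeries Tc (W q * X (f q)) / f q)%C).
  { apply filter_forall. intros q. unfold f_exponent. now rewrite Hres. }
  apply hol_sub; [apply hol_sub|].
  - apply hol_div; [exact Hx0|apply hol_const|exact Hf].
  - apply hol_mult; [apply hol_mult; [apply hol_const|now apply hol_pow]|now apply hol_L].
  - apply hol_div; [exact Hx0| |exact Hf].
    apply (hol_comp (CPSeries Tc) (fun q => W q * X (f q))%C); [apply hol_mult; [exact HW|now apply hol_xpow]|].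
    destruct (CPSeries_cderiv _ _ _ _ Hg1 Hv) as [d [Hd _]]. now exists d.
Qed.

Lemma hol_F1 {U : NormedModule C_AbsRing} (f W : U -> C) p : hol f p -> hol W p -> S0 (f p) ->
  Cmod (W p * X (f p))%C <= r0 / 4 -> hol (fun q => F1 (f q) (W q)) p.
Proof. intros. apply hol_mult; [apply hol_exp; now apply hol_expo|now apply hol_xpow]. Qed.

Lemma hol_F2 {U : NormedModule C_AbsRing} (f W : U -> C) p : hol f p -> hol W p -> S0 (f p) ->
  Cmod (W p * X (f p))%C <= r0 / 4 -> hol (fun q => F2 (f q) (W q)) p.
Proof. intros. apply hol_mult; [apply hol_exp, hol_opp; now apply hol_expo|now apply hol_xpow]. Qed.

Lemma F1_curve (W : C -> C) x : S0 x -> cderiv W x 0%C -> Cmod (W x * X x)%C <= r0 / 4 ->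
  cderiv (fun z => F1 z (W z)) x (F1 x (W x) * (- lambda + a1 * x - CPSeries c (W x * X x)) / (x * x))%C.
Proof.
  intros Hx HW Hv. assert (Hx0 := S0_neq0 x Hx).
  eapply cderiv_eq; [|apply cderiv_mult; [apply cderiv_Cexp, exponent_curve; eassumption|apply xpow_cderiv, Hx]].
  unfold f1. cfield. exact Hx0.
Qed.

Lemma F2_curve (W : C -> C) x : S0 x -> cderiv W x 0%C -> Cmod (W x * X x)%C <= r0 / 4 ->
  cderiv (fun z => F2 z (W z)) x (F2 x (W x) * (lambda + a2 * x + CPSeries c (W x * X x)) / (x * x))%C.
Proof.
  intros Hx HW Hv. assert (Hx0 := S0_neq0 x Hx).
  eapply cderiv_eq; [|apply cderiv_mult; [apply cderiv_Cexp, cderiv_opp, exponent_curve; eassumption|apply xpow_cderiv, Hx]].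
  unfold f2. cfield. exact Hx0.
Qed.

(** First [y1 y2 / x^a] has zero derivative, because the contributions of [lambda] and [c] cancel in
    the product; only then can [f_1] and [f_2] be differentiated at constant [w]. *)
Lemma first_integrals (y1 y2 : C -> C) x : S0 x -> Cmod (y1 x * y2 x)%C <= r0 / 4 ->
  cderiv y1 x ((- lambda + a1 * x - CPSeries c (y1 x * y2 x)) * y1 x / (x * x))%C ->
  cderiv y2 x ((lambda + a2 * x + CPSeries c (y1 x * y2 x)) * y2 x / (x * x))%C ->
  cderiv (fun z => y1 z / F1 z (y1 z * y2 z / X z))%C x 0%C /\
  cderiv (fun z => y2 z / F2 z (y1 z * y2 z / X z))%C x 0%C.
Proof.
  intros Hx Hv H1 H2. assert (Hx0 := S0_neq0 x Hx).
  assert (HW : cderiv (fun z => y1 z * y2 z / X z)%C x 0%C).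
  { eapply cderiv_eq; [|apply cderiv_div; [apply xpow_neq0|apply cderiv_mult; eassumption|apply xpow_cderiv, Hx]].
    cfield. repeat split; first [apply xpow_neq0|exact Hx0]. }
  assert (Ev : ((y1 x * y2 x / X x) * X x)%C = (y1 x * y2 x)%C) by (field; apply xpow_neq0).
  split.
  - eapply cderiv_eq; [|apply cderiv_div; [apply F1_neq0|exact H1|apply (F1_curve _ x Hx HW); cbv beta; rewrite Ev; exact Hv]].
    cbv beta. rewrite Ev. cfield. repeat split; first [apply F1_neq0|exact Hx0].
  - eapply cderiv_eq; [|apply cderiv_div; [apply F2_neq0|exact H2|apply (F2_curve _ x Hx HW); cbv beta; rewrite Ev; exact Hv]].
    cbv beta. rewrite Ev. cfield. repeat split; first [apply F2_neq0|exact Hx0].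
Qed.

(** The price for comparing [f_1] or [f_2] at two points of one fibre: as a function of [v = w x^a],
    the exponent is Lipschitz with constant [O((1 + |log x|) / |x|)]. *)
Lemma expo_diff : exists K, 0 < K /\ forall (x v v' : C), S0 x -> Cmod v <= r0 / 4 -> Cmod v' <= r0 / 4 -> Cmod v <= 1 -> Cmod v' <= 1 ->
  Cmod (expo x (v' / X x) - expo x (v / X x))%C <= K * Cmod (v' - v) * (1 + Cmod (L x)) / Cmod x.
Proof.
  destruct (resonant_spec c a a_neq0 Hc0) as [k0 [cm [Hres [Hcm _]]]].
  destruct tilde_geomb as [M1 [_ Hg1]]. assert (Hr : 0 < r0) by apply Hg. assert (HM1 : 0 <= M1) by apply Hg1.
  set (K := Cmod cm * INR k0 + 16 * M1 / r0 + 1).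
  assert (HK1 : 0 <= Cmod cm * INR k0) by (apply Rmult_le_pos; [apply Cmod_ge_0|apply pos_INR]).
  assert (HK2 : 0 <= 16 * M1 / r0) by (apply Rdiv_le_0_compat; lra).
  exists K. split; [unfold K; lra|].
  intros x v v' Hx Hv Hv' Hv1 Hv1'. assert (Hx0 := S0_neq0 x Hx).
  assert (Hm : 0 < Cmod x) by (apply Cmod_gt_0; exact Hx0).
  unfold f_exponent. rewrite !Hres.
  replace (v / X x * X x)%C with v by (field; apply xpow_neq0).
  replace (v' / X x * X x)%C with v' by (field; apply xpow_neq0).
  assert (Er : (cm * (v' / X x) ^ k0 - cm * (v / X x) ^ k0 = cm * (v' ^ k0 - v ^ k0) / x)%C).
  { destruct Hcm as [->|E]; [field; exact Hx0|]. unfold Cdiv. rewrite !Cpow_mult_l, !Cpow_inv by apply xpow_neq0.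
    rewrite (xpow_res k0 x Hx E). ring. }
  match goal with |- Cmod ?e <= _ => replace e with
    (- (cm * (v' / X x) ^ k0 - cm * (v / X x) ^ k0) * L x - (CPSeries Tc v' - CPSeries Tc v) / x)%C by (field; exact Hx0) end.
  rewrite Er.
  replace (- (cm * (v' ^ k0 - v ^ k0) / x) * L x - (CPSeries Tc v' - CPSeries Tc v) / x)%C
    with (- ((cm * (v' ^ k0 - v ^ k0) * L x + (CPSeries Tc v' - CPSeries Tc v)) / x))%C by (field; exact Hx0).
  rewrite Cmod_opp, Cmod_div by exact Hx0. unfold Rdiv. apply Rmult_le_compat_r; [apply Rlt_le, Rinv_0_lt_compat, Hm|].
  eapply Rle_trans; [apply Cmod_triangle|]. rewrite !Cmod_mult.
  assert (A := Cmod_pow_diff v v' k0 Hv1 Hv1'). assert (B := CPSeries_Lipschitz _ _ _ v' v Hg1 Hv' Hv).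
  set (D := Cmod (v' - v)) in *. assert (HD : 0 <= D) by apply Cmod_ge_0.
  assert (HLx : 0 <= Cmod (L x)) by apply Cmod_ge_0.
  assert (Cmod cm * Cmod (v' ^ k0 - v ^ k0) * Cmod (L x) <= Cmod cm * INR k0 * D * Cmod (L x)).
  { apply Rmult_le_compat_r; [exact HLx|]. rewrite Rmult_assoc. apply Rmult_le_compat_l; [apply Cmod_ge_0|exact A]. }
  unfold K. set (A1 := Cmod cm * INR k0) in *. set (A2 := 16 * M1 / r0) in *.
  assert (0 <= D * Cmod (L x)) by now apply Rmult_le_pos.
  replace (A1 * D * Cmod (L x)) with (A1 * (D * Cmod (L x))) in H by ring. nra.
Qed.

Section OnNice.
Context (th : R) (Hth : is_arg th lambda) (rho : nat -> R) (Hrho : forall k, 0 < rho k <= 1)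
  (Hsub : forall x, Nice th rho x -> S0 x).

Lemma Nice_le1 x : Nice th rho x -> Cmod x <= 1.
Proof. intros [k [H _]]. specialize (Hrho k). lra. Qed.

Lemma Cmod_xpow b x : S0 x -> Cmod (xpow L x b) = exp (Re b * ln (Cmod x) - Im b * Im (L x)).
Proof.
  intros Hx. unfold xpow. rewrite Cmod_Cexp. f_equal. rewrite <- (log_branch_Re S0 L x HL Hx). destruct b, (L x). simpl. ring.
Qed.

Lemma xpow_upper : exists K, 0 < K /\ forall x, Nice th rho x -> Cmod (X x) <= K * exp (Re a * ln (Cmod x)).
Proof.
  destruct (log_Im_bound S0 L th rho HS0 HL Hsub ltac:(intros k; apply Hrho)) as [B [HB H]].
  exists (exp (Rabs (Im a) * B)). split; [apply exp_pos|]. intros x Hx. rewrite Cmod_xpow by auto.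
  rewrite <- exp_plus. apply exp_le. specialize (H x Hx).
  assert (- (Im a * Im (L x)) <= Rabs (Im a) * B); [|unfold Rminus; lra].
  eapply Rle_trans; [apply Rle_abs|]. rewrite Rabs_Ropp, Rabs_mult. apply Rmult_le_compat_l; [apply Rabs_pos|exact H].
Qed.

(** The exponent [N] is the number of powers of [x] that flatness has to supply in order to beat
    [|x^a|]. *)
Lemma xpow_lower : exists (N : nat) K, 0 < K /\ forall x, Nice th rho x -> K * Cmod x ^ N <= Cmod (X x).
Proof.
  destruct (log_Im_bound S0 L th rho HS0 HL Hsub ltac:(intros k; apply Hrho)) as [B [HB H]].
  destruct (INR_unbounded (Re a)) as [N HN].
  exists N, (exp (- (Rabs (Im a) * B))). split; [apply exp_pos|]. intros x Hx. rewrite Cmod_xpow by auto.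
  assert (Hm := Nice_neq0 th rho x Hx). assert (H1 := Nice_le1 x Hx).
  rewrite <- (exp_ln (Cmod x)) at 1 by exact Hm. rewrite <- (Rpower_pow N (exp (ln (Cmod x)))) by apply exp_pos.
  unfold Rpower. rewrite ln_exp, <- exp_plus. apply exp_le. specialize (H x Hx).
  assert (Hl : ln (Cmod x) <= 0).
  { rewrite <- ln_1. destruct (Rle_lt_or_eq_dec _ _ H1) as [Q|Q]; [apply Rlt_le, ln_increasing; lra|rewrite Q; lra]. }
  assert (Im a * Im (L x) <= Rabs (Im a) * B).
  { eapply Rle_trans; [apply Rle_abs|]. rewrite Rabs_mult. apply Rmult_le_compat_l; [apply Rabs_pos|exact H]. }
  nra.
Qed.

Lemma xpow_scal x (s : R) : 0 < s <= 1 -> Nice th rho x -> Cmod (X (s * x)%C) <= Cmod (X x).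
Proof.
  intros Hs Hx. assert (Hsx := Nice_scal th rho x s Hs Hx).
  unfold xpow. rewrite (log_scal S0 L th rho HS0 HL Hsub x s Hs Hx), !Cmod_Cexp. apply exp_le.
  assert (ln s <= 0).
  { rewrite <- ln_1. destruct (Rle_lt_or_eq_dec _ _ (proj2 Hs)) as [Q|Q]; [apply Rlt_le, ln_increasing; lra|rewrite Q; lra]. }
  assert (E : Re (a * (L x + ln s))%C = Re (a * L x)%C + Re a * ln s).
  { destruct a1, a2, (L x). simpl. ring. }
  rewrite E. nra.
Qed.

Lemma exp_ln_small al eps : 0 < al -> 0 < eps -> exists s1, 0 < s1 /\ forall s, 0 < s < s1 -> exp (al * ln s) < eps.
Proof.
  intros Hal He. exists (exp (ln eps / al)). split; [apply exp_pos|]. intros s Hs.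
  rewrite <- (exp_ln eps) by exact He. apply exp_increasing.
  assert (ln s < ln eps / al). { rewrite <- (ln_exp (ln eps / al)). apply ln_increasing; lra. }
  apply Rmult_lt_compat_l with (r := al) in H; [|exact Hal]. replace (al * (ln eps / al)) with (ln eps) in H by (field; lra). exact H.
Qed.

Lemma xpow_small eps : 0 < eps -> exists s1, 0 < s1 /\ forall x, Nice th rho x -> Cmod x < s1 -> Cmod (X x) < eps.
Proof.
  intros He. destruct xpow_upper as [K [HK H]].
  destruct (exp_ln_small (Re a) (eps / K) Ha) as [s1 [Hs1 Hs]]; [now apply Rdiv_lt_0_compat|].
  exists s1. split; [exact Hs1|]. intros x Hx Hxs. eapply Rle_lt_trans; [apply H, Hx|].
  specialize (Hs (Cmod x) (conj (Nice_neq0 _ _ _ Hx) Hxs)).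
  apply Rmult_lt_compat_l with (r := K) in Hs; [|exact HK]. replace (K * (eps / K)) with eps in Hs by (field; lra). exact Hs.
Qed.

Lemma L_bound : exists K, 0 < K /\ forall x, Nice th rho x -> 1 + Cmod (L x) <= K / Cmod x.
Proof.
  destruct (log_Im_bound S0 L th rho HS0 HL Hsub ltac:(intros k; apply Hrho)) as [B [HB H]].
  exists (2 + B). split; [lra|]. intros x Hx. assert (Hm := Nice_neq0 th rho x Hx). assert (H1 := Nice_le1 x Hx).
  assert (A := Cmod_le_ReIm (L x)). rewrite (log_branch_Re S0 L x HL (Hsub x Hx)) in A.
  assert (Hl := ln_bound (Cmod x) ltac:(lra)). specialize (H x Hx).
  assert (1 <= / Cmod x) by (rewrite <- Rinv_1; apply Rinv_le_contravar; lra).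
  unfold Rdiv. nra.
Qed.

(** Along the direction of [lambda] the term [lambda / x] dominates. *)
Lemma F1_large (w : C) : exists s1, 0 < s1 <= rho 0%nat /\ forall s, 0 < s < s1 -> 1 <= Cmod (F1 (RtoC s * cis th)%C w).
Proof.
  destruct (resonant_spec c a a_neq0 Hc0) as [k0 [cm [Hres _]]].
  destruct tilde_geomb as [M1 [_ Hg1]]. assert (Hr : 0 < r0) by apply Hg. assert (HM1 : 0 <= M1) by apply Hg1.
  destruct (log_Im_bound S0 L th rho HS0 HL Hsub ltac:(intros k; apply Hrho)) as [B [HB HIm]].
  apply is_arg_polar in Hth. destruct Hth as [_ El].
  set (l := Cmod lambda) in *. assert (Hl : 0 < l) by (apply Cmod_gt_0; exact Hlambda).
  set (W := Cmod w + 1). assert (HW : 0 < W) by (unfold W; generalize (Cmod_ge_0 w); lra).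
  destruct (xpow_small (Rmin (r0 / 2 / W) (l / (4 * (2 * M1 / r0 + 1) * W)))) as [s2 [Hs2 HX]].
  { assert (0 <= 2 * M1 / r0) by (apply Rdiv_le_0_compat; lra).
    apply Rmin_pos; apply Rdiv_lt_0_compat; try lra. apply Rmult_lt_0_compat; lra. }
  set (Q := Cmod (cm * w ^ k0) + Cmod a1). assert (HQ : 0 <= Q) by (unfold Q; generalize (Cmod_ge_0 (cm * w ^ k0)) (Cmod_ge_0 a1); lra).
  set (q := l / (4 * (Q + 1) * (B + 2))). assert (Hq : 0 < q) by (apply Rdiv_lt_0_compat; [lra|]; apply Rmult_lt_0_compat; lra).
  set (s1 := Rmin (Rmin s2 (rho 0%nat)) (q ^ 2)).
  assert (Hs1 : 0 < s1) by (repeat apply Rmin_pos; [lra|apply Hrho|apply pow_lt; lra]).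
  assert (Hs1r : s1 <= rho 0%nat) by (eapply Rle_trans; [apply Rmin_l|apply Rmin_r]).
  assert (Hs12 : s1 <= s2) by (eapply Rle_trans; [apply Rmin_l|apply Rmin_l]).
  assert (Hs1q : s1 <= q ^ 2) by apply Rmin_r.
  exists s1. split; [lra|]. intros s Hs.
  set (x := (RtoC s * cis th)%C).
  assert (Nx : Nice th rho x) by (apply Nice_axis; lra).
  assert (Hmx : Cmod x = s) by (unfold x; rewrite Cmod_mult, Cmod_R, Cmod_cis, Rabs_pos_eq; lra).
  assert (Hx0 : x <> 0%C) by (apply Cmod_gt_0; lra).
  assert (Hs01 : s <= 1) by (specialize (Hrho 0%nat); lra).
  assert (HXx := HX x Nx ltac:(lra)).
  assert (HX1 : Cmod (X x) < r0 / 2 / W) by (eapply Rlt_le_trans; [exact HXx|apply Rmin_l]).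
  assert (HX2 : Cmod (X x) < l / (4 * (2 * M1 / r0 + 1) * W)) by (eapply Rlt_le_trans; [exact HXx|apply Rmin_r]).
  assert (HXp : 0 <= Cmod (X x)) by apply Cmod_ge_0.
  assert (HwW : Cmod w <= W) by (unfold W; lra).
  assert (Hv : Cmod (w * X x) <= r0 / 2).
  { rewrite Cmod_mult. apply Rle_trans with (W * (r0 / 2 / W)); [|apply Req_le; field; lra].
    apply Rmult_le_compat; try apply Cmod_ge_0; lra. }
  assert (HTsm : Cmod (CPSeries Tc (w * X x)) <= l / 4).
  { eapply Rle_trans; [apply (CPSeries_small Tc r0 M1); [exact Hg1|reflexivity|exact Hv]|].
    rewrite Cmod_mult. assert (HA : 0 <= 2 * M1 / r0) by (apply Rdiv_le_0_compat; lra).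
    set (A := 2 * M1 / r0) in *.
    apply Rle_trans with ((A + 1) * (W * (l / (4 * (A + 1) * W)))); [|apply Req_le; field; lra].
    apply Rmult_le_compat; [lra|apply Rmult_le_pos; apply Cmod_ge_0|lra|].
    apply Rmult_le_compat; try apply Cmod_ge_0; lra. }
  (* Bounding the logarithm by [1 / s] would give the same order as [lambda / x]; applied to
     [sqrt s], the same inequality gains half a power. *)
  assert (HLx : Cmod (L x) <= 2 / sqrt s + B).
  { eapply Rle_trans; [apply Cmod_le_ReIm|]. apply Rplus_le_compat; [|now apply HIm].
    rewrite (log_branch_Re S0 L x HL (Hsub x Nx)), Hmx.
    assert (Hsq : 0 < sqrt s) by (apply sqrt_lt_R0; lra).
    assert (sqrt s <= 1) by (rewrite <- sqrt_1; apply sqrt_le_1_alt; lra).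
    replace (ln s) with (2 * ln (sqrt s)).
    - rewrite Rabs_mult, (Rabs_pos_eq 2) by lra. assert (A := ln_bound (sqrt s) ltac:(lra)). unfold Rdiv. lra.
    - rewrite <- (sqrt_sqrt s) at 2 by lra. rewrite ln_mult by lra. ring. }
  unfold f1, xpow. rewrite <- Cexp_plus, Cmod_Cexp. rewrite <- exp_0. apply exp_le.
  unfold f_exponent. rewrite Hres.
  assert (E1 : (lambda / x)%C = RtoC (l / s)).
  { rewrite El. unfold x. rewrite RtoC_div by lra. field. repeat split; first [apply cis_neq0|apply RtoC_neq0; lra]. }
  rewrite E1.
  assert (Hsplit : Re (RtoC (l / s)%R - cm * w ^ k0 * L x - CPSeries Tc (w * X x) / x + a1 * L x)%C
    = l / s - Re (cm * w ^ k0 * L x + - (a1 * L x) + CPSeries Tc (w * X x) / x)%C).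
  { generalize (cm * w ^ k0 * L x)%C (CPSeries Tc (w * X x) / x)%C (a1 * L x)%C. intros [? ?] [? ?] [? ?]. simpl. ring. }
  rewrite Hsplit.
  assert (Hre : Re (cm * w ^ k0 * L x + - (a1 * L x) + CPSeries Tc (w * X x) / x)%C <= Q * (2 / sqrt s + B) + l / 4 / s).
  { eapply Rle_trans; [apply Rle_abs|]. eapply Rle_trans; [apply Re_le_Cmod'|].
    eapply Rle_trans; [apply Cmod_triangle|]. apply Rplus_le_compat.
    - eapply Rle_trans; [apply Cmod_triangle|]. rewrite Cmod_opp, (Cmod_mult (cm * w ^ k0)), (Cmod_mult a1).
      rewrite <- Rmult_plus_distr_r. fold Q. apply Rmult_le_compat_l; [exact HQ|exact HLx].
    - rewrite Cmod_div by exact Hx0. rewrite Hmx. unfold Rdiv at 1 2. apply Rmult_le_compat_r; [apply Rlt_le, Rinv_0_lt_compat; lra|exact HTsm]. }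
  assert (Hfin : Q * (2 / sqrt s + B) <= l / 4 / s).
  { assert (Hsq : 0 < sqrt s) by (apply sqrt_lt_R0; lra).
    assert (Hsq1 : sqrt s <= 1) by (rewrite <- sqrt_1; apply sqrt_le_1_alt; lra).
    assert (Hsqq : sqrt s <= q).
    { rewrite <- (sqrt_pow2 q) by lra. apply sqrt_le_1_alt. lra. }
    assert (Hss : s = sqrt s * sqrt s) by (rewrite sqrt_sqrt; lra).
    set (t := sqrt s) in *. rewrite Hss.
    assert (0 <= 2 / t + B <= (B + 2) / t).
    { split; [assert (0 < 2 / t) by (apply Rdiv_lt_0_compat; lra); lra|].
      apply Rmult_le_reg_r with t; [lra|]. replace ((2 / t + B) * t) with (2 + B * t) by (field; lra).
      replace ((B + 2) / t * t) with (B + 2) by (field; lra). nra. }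
    apply Rle_trans with ((Q + 1) * ((B + 2) / t)); [apply Rmult_le_compat; lra|].
    apply Rmult_le_reg_r with (t * t); [nra|].
    replace ((Q + 1) * ((B + 2) / t) * (t * t)) with ((Q + 1) * (B + 2) * t) by (field; lra).
    replace (l / 4 / (t * t) * (t * t)) with (l / 4) by (field; lra).
    apply Rle_trans with ((Q + 1) * (B + 2) * q); [apply Rmult_le_compat_l; [apply Rmult_le_pos; lra|exact Hsqq]|].
    unfold q. apply Req_le. field. lra. }
  assert (0 < l / 4 / s) by (repeat apply Rdiv_lt_0_compat; lra).
  assert (l / s = 4 * (l / 4 / s)) by (field; lra).
  assert (Hz : forall A B0 : R, A <= B0 -> 0 <= B0 - A) by (intros; lra).
  apply Hz. lra.
Qed.

End OnNice.
End Model.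

(** * Expansion of a first integral *)

Lemma series_shift (a : nat -> C) (l : C) n0 : (forall n, (n < n0)%nat -> a n = 0%C) ->
  cseries a l ->
  cseries (fun k => a (n0 + k)%nat) l.
Proof.
  intros H0 H. assert (He := proj1 (is_series_eps a l) H).
  assert (Z : forall n, (n < n0)%nat -> csum a n = RtoC 0).
  { induction n as [|n IH]; intros Hn; [rewrite sum_n_C_0; auto|]. rewrite sum_n_C_S, IH, H0 by lia. cring. }
  assert (E : forall k, csum (fun k => a (n0 + k)%nat) k = csum a (n0 + k)%nat).
  { induction k as [|k IH].
    - rewrite sum_n_C_0, Nat.add_0_r. destruct n0 as [|n0]; [now rewrite sum_n_C_0|].
      rewrite sum_n_C_S, Z by lia. cring.
    - rewrite sum_n_C_S, IH, Nat.add_succ_r, sum_n_C_S. reflexivity. }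
  apply is_series_eps. intros eps Hep. destruct (He eps Hep) as [N HN]. exists N. intros n Hn.
  rewrite E. apply HN. lia.
Qed.

Section Expansion.
(** [N x w h] stands for the increment of a first integral at the point over [x] with [h_1 = h] and
    [h_1 h_2 = w]; [A] is [|f_1|], [T] is [|x^a|], [Be] bounds [N], and [n0] is the first exponent
    of the expansion. *)
Context (th : R) (rho : nat -> R) (r : R) (n0 : nat) (N : C -> C -> C -> C) (A Be : C -> C -> R) (T : C -> R).
(** The points with [|h_1| = q] and [h_1 h_2 = w] lie in the polydisc of radius [r]: there
    [|y_1| = q A] and [|y_2| = |w| T / (q A)]. *)
Definition valid (x w : C) (q : R) : Prop := Nice th rho x /\ Cmod w * T x / r < q * A x w < r.
Context (Hr : 0 < r) (Hrho : forall k, 0 < rho k) (HA : forall x w, 0 < A x w) (HT : forall x, 0 < T x).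
Context (N1 : forall x w h, valid x w (Cmod h) -> cdiff (N x w) h).
Context (N2 : forall x w h, valid x w (Cmod h) -> cderiv (fun z => N z w h) x 0%C).
Context (N3 : forall x w h, valid x w (Cmod h) -> cdiff (fun w' => N x w' h) w).
Context (N4 : forall x w h, valid x w (Cmod h) -> Cmod (N x w h) <= Be x w).
Context (C0 : forall x, Nice th rho x -> forall eps, 0 < eps -> exists d, 0 < d /\ forall z, Cmod (z - x) < d -> Rabs (T z - T x) < eps).
Context (C1 : forall x w, Nice th rho x -> Cmod w * T x < r ^ 2 ->
  forall eps, 0 < eps -> exists d, 0 < d /\ forall z, Cmod (z - x) < d -> Rabs (A z w - A x w) < eps).
Context (C2 : forall x w, Nice th rho x -> Cmod w * T x < r ^ 2 ->
  forall eps, 0 < eps -> exists d, 0 < d /\ forall w', Cmod (w' - w) < d -> Rabs (A x w' - A x w) < eps).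
Context (C3 : forall x w, Nice th rho x -> Cmod w * T x < r ^ 2 ->
  exists d M, 0 < d /\ forall w', Cmod (w' - w) < d -> Be x w' <= M).
Context (T1 : forall x (s : R), 0 < s <= 1 -> Nice th rho x -> T (s * x)%C <= T x).
Context (T2 : forall eps, 0 < eps -> exists s1, 0 < s1 /\ forall x, Nice th rho x -> Cmod x < s1 -> T x < eps).
(** The source of all vanishing: at a suitable [x] where [A >= 1], the increment on the circle
    [|y_1| = r / 2] is small compared with [A / A^n0]. *)
Context (V : forall w eps, 0 < eps -> exists x, Nice th rho x /\ Cmod w * T x < r ^ 2 / 4 /\ 1 <= A x w /\
  forall h, Cmod h * A x w = r / 2 -> Cmod (N x w h) * A x w ^ n0 <= eps * A x w).

Definition Jint (kap : C -> C) (x w : C) (q : R) : C := circ q (fun h => N x w h * kap h)%C.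

Lemma valid_pos x w q : valid x w q -> 0 < q /\ Cmod w * T x < r ^ 2.
Proof.
  intros [_ [H1 H2]]. assert (Ha := HA x w). assert (Ht := HT x). assert (Hw := Cmod_ge_0 w).
  assert (0 <= Cmod w * T x / r) by (apply Rdiv_le_0_compat; [nra|exact Hr]).
  split; [nra|]. assert (H3 : Cmod w * T x / r < r) by lra.
  apply Rmult_lt_compat_r with (r := r) in H3; [|exact Hr].
  replace (Cmod w * T x / r * r) with (Cmod w * T x) in H3 by (field; lra). simpl. lra.
Qed.

Lemma valid_between x w q1 q2 q : valid x w q1 -> valid x w q2 -> q1 <= q <= q2 -> valid x w q.
Proof. intros [H [H1 _]] [_ [_ H2]] Hq. split; [exact H|]. assert (Ha := HA x w). nra. Qed.

Lemma mean_q kap x w q1 q2 : (forall h : C, h <> RtoC 0 -> cdiff kap h) -> valid x w q1 -> valid x w q2 ->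
  Jint kap x w q1 = Jint kap x w q2.
Proof.
  assert (W : forall q1 q2, (forall h : C, h <> RtoC 0 -> cdiff kap h) -> valid x w q1 -> valid x w q2 -> q1 <= q2 ->
    Jint kap x w q1 = Jint kap x w q2).
  { clear q1 q2. intros q1 q2 Hk V1 V2 Hq. destruct (valid_pos _ _ _ V1) as [Hq1 _].
    apply annulus; [lra|]. intros z Hz. apply cdiff_mult.
    - apply N1. apply (valid_between x w q1 q2); assumption.
    - apply Hk. apply Cmod_gt_0. lra. }
  intros Hk V1 V2. destruct (Rle_lt_dec q1 q2); [now apply W|symmetry; apply W; trivial; lra].
Qed.

Lemma valid_near_x x w q : valid x w q -> exists d, 0 < d /\ forall z, Cmod (z - x) < d -> valid z w q.
Proof.
  intros Hv. destruct (valid_pos _ _ _ Hv) as [Hq Hwt]. destruct Hv as [Hx [H1 H2]].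
  assert (Hw := Cmod_ge_0 w).
  set (g1 := q * A x w - Cmod w * T x / r). set (g2 := r - q * A x w).
  destruct (Nice_open th rho x Hx) as [d0 [Hd0 D0]].
  destruct (C0 x Hx (g1 / 4 / (Cmod w / r + 1))) as [d1 [Hd1 D1]].
  { assert (0 <= Cmod w / r) by (apply Rdiv_le_0_compat; lra). repeat apply Rdiv_lt_0_compat; unfold g1; lra. }
  destruct (C1 x w Hx Hwt (Rmin (g1 / 4 / q) (g2 / q))) as [d2 [Hd2 D2]].
  { apply Rmin_pos; repeat apply Rdiv_lt_0_compat; unfold g1, g2; lra. }
  exists (Rmin d0 (Rmin d1 d2)). split; [repeat apply Rmin_pos; assumption|].
  intros z Hz.
  assert (Z0 : Cmod (z - x) < d0) by (eapply Rlt_le_trans; [exact Hz|apply Rmin_l]).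
  assert (Z1 : Cmod (z - x) < d1) by (eapply Rlt_le_trans; [exact Hz|eapply Rle_trans; [apply Rmin_r|apply Rmin_l]]).
  assert (Z2 : Cmod (z - x) < d2) by (eapply Rlt_le_trans; [exact Hz|eapply Rle_trans; [apply Rmin_r|apply Rmin_r]]).
  split; [now apply D0|].
  specialize (D1 z Z1). specialize (D2 z Z2).
  assert (E1 : Rabs (A z w - A x w) < g1 / 4 / q) by (eapply Rlt_le_trans; [exact D2|apply Rmin_l]).
  assert (E2 : Rabs (A z w - A x w) < g2 / q) by (eapply Rlt_le_trans; [exact D2|apply Rmin_r]).
  apply Rabs_lt_between in E1. apply Rabs_lt_between in E2. apply Rabs_lt_between in D1.
  assert (Q1 : q * (g1 / 4 / q) = g1 / 4) by (field; lra). assert (Q2 : q * (g2 / q) = g2) by (field; lra).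
  assert (q * (A z w - A x w) > - (g1 / 4)) by (rewrite <- Q1; nra).
  assert (q * (A z w - A x w) < g2) by (rewrite <- Q2; nra).
  assert (Hwr : 0 <= Cmod w / r) by (apply Rdiv_le_0_compat; lra).
  assert (Cmod w / r * (T z - T x) <= g1 / 4).
  { set (u := Cmod w / r) in *. apply Rle_trans with ((u + 1) * (g1 / 4 / (u + 1))); [|apply Req_le; field; lra].
    assert (0 <= g1 / 4 / (u + 1)) by (repeat apply Rdiv_le_0_compat; unfold g1; lra). nra. }
  unfold g1, g2 in *. split.
  - replace (Cmod w * T z / r) with (Cmod w * T x / r + Cmod w / r * (T z - T x)) by (field; lra). lra.
  - lra.
Qed.

Lemma valid_near_w x w q : valid x w q -> exists d, 0 < d /\ forall w', Cmod (w' - w) < d -> valid x w' q.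
Proof.
  intros Hv. destruct (valid_pos _ _ _ Hv) as [Hq Hwt]. destruct Hv as [Hx [H1 H2]].
  assert (Hw := Cmod_ge_0 w). assert (Ht := HT x).
  set (g1 := q * A x w - Cmod w * T x / r). set (g2 := r - q * A x w).
  destruct (C2 x w Hx Hwt (Rmin (g1 / 4 / q) (g2 / q))) as [d2 [Hd2 D2]].
  { apply Rmin_pos; repeat apply Rdiv_lt_0_compat; unfold g1, g2; lra. }
  set (d1 := g1 / 4 / (T x / r)).
  assert (Htr : 0 < T x / r) by now apply Rdiv_lt_0_compat.
  assert (Hd1 : 0 < d1) by (repeat apply Rdiv_lt_0_compat; unfold g1; lra).
  exists (Rmin d1 d2). split; [repeat apply Rmin_pos; assumption|].
  intros w' Hz.
  assert (Z1 : Cmod (w' - w) < d1) by (eapply Rlt_le_trans; [exact Hz|apply Rmin_l]).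
  assert (Z2 : Cmod (w' - w) < d2) by (eapply Rlt_le_trans; [exact Hz|apply Rmin_r]).
  split; [exact Hx|].
  specialize (D2 w' Z2).
  assert (E1 : Rabs (A x w' - A x w) < g1 / 4 / q) by (eapply Rlt_le_trans; [exact D2|apply Rmin_l]).
  assert (E2 : Rabs (A x w' - A x w) < g2 / q) by (eapply Rlt_le_trans; [exact D2|apply Rmin_r]).
  apply Rabs_lt_between in E1. apply Rabs_lt_between in E2.
  assert (Q1 : q * (g1 / 4 / q) = g1 / 4) by (field; lra). assert (Q2 : q * (g2 / q) = g2) by (field; lra).
  assert (q * (A x w' - A x w) > - (g1 / 4)) by (rewrite <- Q1; nra).
  assert (q * (A x w' - A x w) < g2) by (rewrite <- Q2; nra).
  assert (Cmod w' - Cmod w < d1) by (generalize (Cmod_minus_ge w' w); lra).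
  assert ((Cmod w' - Cmod w) * (T x / r) < g1 / 4).
  { apply Rlt_le_trans with (d1 * (T x / r)); [now apply Rmult_lt_compat_r|]. unfold d1. apply Req_le. field. split; lra. }
  unfold g1, g2 in *. split.
  - replace (Cmod w' * T x / r) with (Cmod w * T x / r + (Cmod w' - Cmod w) * (T x / r)) by (field; lra). lra.
  - lra.
Qed.

Lemma mean_near_x kap x w q : valid x w q -> exists d, 0 < d /\ forall z, Cmod (z - x) < d ->
  valid z w q /\ Jint kap z w q = Jint kap x w q.
Proof.
  intros Hv. destruct (valid_near_x x w q Hv) as [d [Hd D]]. exists d. split; [exact Hd|].
  intros z Hz. split; [now apply D|]. destruct (valid_pos _ _ _ Hv) as [Hq _].
  apply circ_ext; [lra|]. intros h Hh. f_equal.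
  apply (constant_on_segment (fun z => N z w h) x z). intros s Hs. apply N2. rewrite Hh. apply D.
  replace (x + s * (z - x) - x)%C with (s * (z - x))%C by ring. rewrite Cmod_mult, Cmod_R, Rabs_pos_eq by lra.
  generalize (Cmod_ge_0 (z - x)). nra.
Qed.

(** The radius for which [|y_1|] is halfway between its two bounds [|w| T / r] and [r]. *)
Definition midq (x w : C) : R := (Cmod w * T x / r + r) / 2 / A x w.

Lemma midq_valid x w : Nice th rho x -> Cmod w * T x < r ^ 2 -> valid x w (midq x w).
Proof.
  intros Hx H. split; [exact Hx|]. assert (Ha := HA x w). unfold midq.
  replace ((Cmod w * T x / r + r) / 2 / A x w * A x w) with ((Cmod w * T x / r + r) / 2) by (field; lra).
  assert (Cmod w * T x / r < r); [|lra].
  apply Rmult_lt_reg_r with r; [exact Hr|]. replace (Cmod w * T x / r * r) with (Cmod w * T x) by (field; lra). simpl in H. lra.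
Qed.

(** A direct segment from [x1] to [x2] could leave the domain or violate [|w| T < r^2]. Both points
    are first contracted towards the origin, along which [T] does not increase, and then joined
    inside a common convex cone where [T] is small. *)
Lemma mean_x kap x1 x2 w q1 q2 : (forall h : C, h <> RtoC 0 -> cdiff kap h) -> valid x1 w q1 -> valid x2 w q2 ->
  Jint kap x1 w q1 = Jint kap x2 w q2.
Proof.
  intros Hk V1 V2. destruct (valid_pos _ _ _ V1) as [_ W1]. destruct (valid_pos _ _ _ V2) as [_ W2].
  assert (X1 := proj1 V1). assert (X2 := proj1 V2).
  set (F := fun x => Jint kap x w (midq x w)).
  assert (HF : forall x, Nice th rho x -> Cmod w * T x < r ^ 2 -> cderiv F x 0%C).
  { intros x Hx Hw. assert (Hv := midq_valid x w Hx Hw).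
    destruct (mean_near_x kap x w _ Hv) as [d [Hd D]].
    apply (cderiv_ext_loc (fun _ => F x) F x 0%C d Hd); [|apply cderiv_const].
    intros z Hz. destruct (D z Hz) as [Vz Ez]. unfold F. rewrite <- Ez. apply mean_q; trivial.
    apply midq_valid; [apply Vz|]. apply (valid_pos _ _ _ Vz). }
  rewrite (mean_q kap x1 w q1 (midq x1 w)) by (trivial; now apply midq_valid).
  rewrite (mean_q kap x2 w q2 (midq x2 w)) by (trivial; now apply midq_valid).
  change (F x1 = F x2).
  destruct X1 as [k1 [R1 S1]]. destruct X2 as [k2 [R2 S2]].
  set (k := Nat.max k1 k2).
  assert (S1' := sec_mono th k1 k x1 ltac:(unfold k; lia) S1). assert (S2' := sec_mono th k2 k x2 ltac:(unfold k; lia) S2).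
  assert (Hw := Cmod_ge_0 w).
  destruct (T2 (r ^ 2 / (Cmod w + 1))) as [s1 [Hs1 HTs]].
  { apply Rdiv_lt_0_compat; [apply pow_lt; lra|lra]. }
  set (m := Cmod x1 + Cmod x2 + 1). assert (Hm : 0 < m) by (unfold m; generalize (Cmod_ge_0 x1) (Cmod_ge_0 x2); lra).
  (* So small that the whole joining segment has modulus below both [s1] and [rho k]. *)
  set (s := Rmin 1 (Rmin (s1 / m) (rho k / m))).
  assert (Hs : 0 < s). { repeat apply Rmin_pos; try lra; apply Rdiv_lt_0_compat; auto. }
  assert (Hs1' : s <= 1) by apply Rmin_l.
  assert (Hs2 : s * m <= s1).
  { apply Rle_trans with (s1 / m * m); [|apply Req_le; field; lra]. apply Rmult_le_compat_r; [lra|].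
    eapply Rle_trans; [apply Rmin_r|apply Rmin_l]. }
  assert (Hs3 : s * m <= rho k).
  { apply Rle_trans with (rho k / m * m); [|apply Req_le; field; lra]. apply Rmult_le_compat_r; [lra|].
    eapply Rle_trans; [apply Rmin_r|apply Rmin_r]. }
  assert (Hscale : forall x, Nice th rho x -> Cmod w * T x < r ^ 2 -> F (s * x)%C = F x).
  { intros x Hx Hwx. apply constant_on_segment. intros t Ht.
    replace (x + t * (s * x - x))%C with ((1 - t * (1 - s))%R * x)%C by (rewrite RtoC_minus, RtoC_mult, RtoC_minus; ring).
    assert (Hu : 0 < 1 - t * (1 - s) <= 1) by nra.
    apply HF; [now apply Nice_scal|]. eapply Rle_lt_trans; [|exact Hwx]. apply Rmult_le_compat_l; [exact Hw|now apply T1]. }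
  rewrite <- (Hscale x1) by (trivial; exists k1; now split). rewrite <- (Hscale x2) by (trivial; exists k2; now split).
  symmetry. apply constant_on_segment. intros t Ht.
  assert (Hz : Cmod (s * x1 + t * (s * x2 - s * x1)) < s * m).
  { replace (s * x1 + t * (s * x2 - s * x1))%C with (s * ((1 - t)%R * x1 + t * x2))%C by (rewrite RtoC_minus; ring).
    rewrite Cmod_mult, Cmod_R, Rabs_pos_eq by lra. apply Rmult_lt_compat_l; [exact Hs|].
    eapply Rle_lt_trans; [apply Cmod_triangle|]. rewrite !Cmod_mult, !Cmod_R, !Rabs_pos_eq by lra.
    unfold m. generalize (Cmod_ge_0 x1) (Cmod_ge_0 x2). nra. }
  assert (Nz : Nice th rho (s * x1 + t * (s * x2 - s * x1))%C).
  { exists k. split; [lra|]. apply sec_segment; [exact Ht|now apply sec_scal|now apply sec_scal]. }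
  apply HF; [exact Nz|].
  assert (HTz := HTs _ Nz ltac:(lra)). assert (Htz := HT (s * x1 + t * (s * x2 - s * x1))%C).
  apply Rle_lt_trans with ((Cmod w + 1) * T (s * x1 + t * (s * x2 - s * x1))%C); [nra|].
  apply Rmult_lt_compat_l with (r := Cmod w + 1) in HTz; [|lra].
  replace ((Cmod w + 1) * (r ^ 2 / (Cmod w + 1))) with (r ^ 2) in HTz by (field; lra). exact HTz.
Qed.

Lemma mean_bound kap x w q M : (forall h : C, h <> RtoC 0 -> cdiff kap h) -> valid x w q ->
  (forall h, Cmod h = q -> Cmod (N x w h * kap h)%C <= M) -> Cmod (Jint kap x w q) <= M * (2 * PI).
Proof.
  intros Hk Hv HM. destruct (valid_pos _ _ _ Hv) as [Hq _]. apply circ_bound; [lra| |exact HM].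
  intros h Hh. apply cdiff_CC, cdiff_mult; [apply N1; now rewrite Hh|apply Hk, Cmod_gt_0; lra].
Qed.

Lemma kap_pos j h : cdiff (fun h => h ^ j)%C h.
Proof. apply (cdiff_pow (fun h => h)), cdiff_id. Qed.

Lemma kap_neg n (h : C) : h <> 0%C -> cdiff (fun h => / h ^ n)%C h.
Proof.
  intros Hh. destruct (kap_pos n h) as [d Hd]. eexists. apply (cderiv_Cinv (fun h => h ^ n)%C); [now apply Cpow_nz|exact Hd].
Qed.

(** The integral is moved to the point provided by [V], where it is as small as desired, provided
    that the kernel on [|h| = r / (2 A)] is of order at most [A^n0 / A]. *)
Lemma mean_vanish kap x w q K : (forall h : C, h <> RtoC 0 -> cdiff kap h) -> valid x w q ->
  (forall x' h, 1 <= A x' w -> Cmod h * A x' w = r / 2 -> Cmod (kap h) <= K * (A x' w ^ n0 / A x' w)) ->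
  Jint kap x w q = 0%C.
Proof.
  intros Hk Hv HK.
  assert (HK0 : 0 <= K).
  { destruct (V w 1 Rlt_0_1) as [x' [_ [_ [HA1 _]]]].
    specialize (HK x' (RtoC (r / 2 / A x' w)) HA1).
    assert (Hrr : 0 < r / 2 / A x' w) by (repeat apply Rdiv_lt_0_compat; lra).
    rewrite Cmod_R, Rabs_pos_eq in HK by lra. specialize (HK ltac:(field; lra)).
    assert (0 < A x' w ^ n0 / A x' w) by (apply Rdiv_lt_0_compat; [apply pow_lt|]; lra).
    generalize (Cmod_ge_0 (kap (RtoC (r / 2 / A x' w)))). nra. }
  apply small_eq0 with (K := K * (2 * PI)) (rho := / 2); [lra|]. intros n.
  assert (He : 0 < (/ 2) ^ n) by (apply pow_lt; lra).
  destruct (V w _ He) as [x' [Hx' [Hw' [HA1 HN]]]].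
  set (Q := r / 2 / A x' w).
  assert (Hv' : valid x' w Q).
  { split; [exact Hx'|]. unfold Q. replace (r / 2 / A x' w * A x' w) with (r / 2) by (field; lra). split; [|lra].
    apply Rmult_lt_reg_r with r; [exact Hr|]. replace (Cmod w * T x' / r * r) with (Cmod w * T x') by (field; lra). nra. }
  rewrite (mean_x kap x x' w q Q Hk Hv Hv').
  replace (K * (2 * PI) * (/ 2) ^ n) with (K * (/ 2) ^ n * (2 * PI)) by ring.
  apply mean_bound; [exact Hk|exact Hv'|]. intros h Hh. rewrite Cmod_mult.
  assert (Hh' : Cmod h * A x' w = r / 2) by (rewrite Hh; unfold Q; field; lra).
  specialize (HN h Hh'). specialize (HK x' h HA1 Hh').
  assert (Hp : 0 < A x' w ^ n0) by (apply pow_lt; lra).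
  assert (HNh := Cmod_ge_0 (N x' w h)).
  apply Rle_trans with (Cmod (N x' w h) * (K * (A x' w ^ n0 / A x' w))); [now apply Rmult_le_compat_l|].
  replace (Cmod (N x' w h) * (K * (A x' w ^ n0 / A x' w))) with (K * (Cmod (N x' w h) * A x' w ^ n0 / A x' w)) by (field; lra).
  apply Rmult_le_compat_l; [exact HK0|]. apply Rmult_le_reg_r with (A x' w); [lra|].
  replace (Cmod (N x' w h) * A x' w ^ n0 / A x' w * A x' w) with (Cmod (N x' w h) * A x' w ^ n0) by (field; lra). exact HN.
Qed.

(** On [|h| = r / (2 A)] with [A >= 1], the kernel [h^j] is of order [A^(- j)] and [h^(- n)] of
    order [A^n]. The first is at most [A^n0 / A] up to a constant for every [j >= 1], the second for
    [n < n0]. *)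
Lemma vanish_pos j x w q : (0 < j)%nat -> valid x w q -> Jint (fun h => h ^ j)%C x w q = 0%C.
Proof.
  intros Hj Hv. apply mean_vanish with (K := (r / 2) ^ j); [intros; apply kap_pos|exact Hv|].
  intros x' h HA1 Hh. rewrite Cmod_pow.
  assert (E : Cmod h = r / 2 / A x' w) by (rewrite <- Hh; field; lra). rewrite E.
  unfold Rdiv at 1. rewrite Rpow_mult_distr. apply Rmult_le_compat_l; [apply pow_le; lra|].
  rewrite pow_inv. unfold Rdiv. rewrite <- (Rmult_1_l (/ A x' w ^ j)).
  apply Rmult_le_compat; [lra|apply Rlt_le, Rinv_0_lt_compat, pow_lt; lra|now apply pow_R1_Rle|].
  apply Rinv_le_contravar; [lra|]. rewrite <- (pow_1 (A x' w)) at 1. apply Rle_pow; [exact HA1|lia].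
Qed.

Lemma vanish_neg n x w q : (n < n0)%nat -> valid x w q -> Jint (fun h => / h ^ n)%C x w q = 0%C.
Proof.
  intros Hn Hv. apply mean_vanish with (K := / (r / 2) ^ n); [intros; now apply kap_neg|exact Hv|].
  intros x' h HA1 Hh.
  assert (E : Cmod h = r / 2 / A x' w) by (rewrite <- Hh; field; lra).
  assert (Hh0 : h <> 0%C). { apply Cmod_gt_0. rewrite E. repeat apply Rdiv_lt_0_compat; lra. }
  rewrite Cmod_inv, Cmod_pow, E by now apply Cpow_nz.
  assert (0 < A x' w ^ n) by (apply pow_lt; lra).
  unfold Rdiv at 1. rewrite Rpow_mult_distr, Rinv_mult, pow_inv, Rinv_inv.
  apply Rmult_le_compat_l; [apply Rlt_le, Rinv_0_lt_compat, pow_lt; lra|].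
  apply Rmult_le_reg_r with (A x' w); [lra|].
  replace (A x' w ^ n0 / A x' w * A x' w) with (A x' w ^ n0) by (field; lra).
  replace (A x' w ^ n * A x' w) with (A x' w ^ (S n)) by (simpl; ring). apply Rle_pow; [exact HA1|lia].
Qed.

Definition basex (w : C) : C := proj1_sig (constructive_indefinite_description _ (V w 1 Rlt_0_1)).

Definition coeff (k : nat) (w : C) : C :=
  (Jint (fun h => / h ^ (n0 + k)) (basex w) w (midq (basex w) w) / RtoC (2 * PI))%C.

Lemma base_valid w : valid (basex w) w (midq (basex w) w).
Proof.
  destruct (proj2_sig (constructive_indefinite_description _ (V w 1 Rlt_0_1))) as [H1 [H2 _]]. fold (basex w) in H1, H2.
  apply midq_valid; [exact H1|]. assert (0 < r ^ 2) by (apply pow_lt; lra). lra.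
Qed.

Lemma coeff_eq k x w q : valid x w q -> coeff k w = (Jint (fun h => / h ^ (n0 + k)) x w q / RtoC (2 * PI))%C.
Proof.
  intros Hv. unfold coeff. rewrite (mean_x _ (basex w) x w _ q); trivial; [intros; now apply kap_neg|apply base_valid].
Qed.

Lemma coeff_bound k x w q : valid x w q -> Cmod (coeff k w) <= Be x w / q ^ (n0 + k).
Proof.
  intros Hv. rewrite (coeff_eq k x w q Hv). assert (HPI := PI_RGT_0). destruct (valid_pos _ _ _ Hv) as [Hq _].
  rewrite Cmod_div by (apply RtoC_neq0; lra). rewrite Cmod_R, Rabs_pos_eq by lra.
  apply Rmult_le_reg_r with (2 * PI); [lra|]. unfold Rdiv at 1. rewrite Rmult_assoc, Rinv_l, Rmult_1_r by lra.
  apply mean_bound; [intros; now apply kap_neg|exact Hv|]. intros h Hh.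
  assert (Hh0 : h <> 0%C) by (apply Cmod_gt_0; lra).
  rewrite Cmod_mult, Cmod_inv, Cmod_pow, Hh by now apply Cpow_nz.
  apply Rmult_le_compat_r; [apply Rlt_le, Rinv_0_lt_compat, pow_lt, Hq|]. apply N4. now rewrite Hh.
Qed.

(** Near [w0] the base point and the radius can be frozen: by [coeff_eq], the coefficient is there a
    fixed integral depending on the parameter [w]. *)
Lemma coeff_entire k : entire (coeff k).
Proof.
  intros w0. assert (HPI := PI_RGT_0).
  set (x := basex w0). set (q := midq x w0).
  assert (Hv : valid x w0 q) by apply base_valid.
  destruct (valid_pos _ _ _ Hv) as [Hq Hwt].
  destruct (valid_near_w x w0 q Hv) as [d1 [Hd1 D1]].
  destruct (C3 x w0 (proj1 Hv) Hwt) as [d2 [M [Hd2 D2]]].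
  set (d := Rmin d1 d2 / 2). assert (Hd : 0 < d) by (unfold d; generalize (Rmin_pos _ _ Hd1 Hd2); lra).
  assert (Hdd1 : d < d1) by (unfold d in *; generalize (Rmin_l d1 d2); lra).
  assert (Hdd2 : d < d2) by (unfold d in *; generalize (Rmin_r d1 d2); lra).
  assert (Hpos : 0 < / q ^ (n0 + k)) by (apply Rinv_0_lt_compat, pow_lt, Hq).
  assert (E : cdiff (fun w => Jint (fun h => / h ^ (n0 + k))%C x w q) w0).
  { apply (param_integral (fun t w => N x w (RtoC q * cis t) * / (RtoC q * cis t) ^ (n0 + k))%C 0 (2 * PI) w0 d (M * / q ^ (n0 + k))); [lra|exact Hd| |].
    - intros t w Ht Hw.
      assert (Hh : Cmod (RtoC q * cis t) = q) by (rewrite Cmod_mult, Cmod_R, Cmod_cis, Rabs_pos_eq; lra).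
      assert (Hh0 : (RtoC q * cis t)%C <> 0%C) by (apply Cmod_gt_0; lra).
      assert (Hvw : valid x w (Cmod (RtoC q * cis t))) by (rewrite Hh; apply D1; lra).
      split.
      + apply cdiff_mult; [|apply cdiff_const]. now apply (N3 x w (RtoC q * cis t)%C).
      + rewrite Cmod_mult, Cmod_inv, Cmod_pow, Hh by now apply Cpow_nz.
        apply Rmult_le_compat_r; [lra|]. eapply Rle_trans; [now apply N4|]. apply D2. lra.
    - intros w Hw. apply (circle_ex (fun h => N x w h * / h ^ (n0 + k))%C q); [lra|].
      intros z Hz. apply cdiff_CC, cdiff_mult; [apply N1; rewrite Hz; apply D1; lra|apply kap_neg, Cmod_gt_0; lra]. }
  destruct (cdiff_mult _ _ w0 E (cdiff_const (/ RtoC (2 * PI))%C w0)) as [e He].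
  exists e. apply cderiv_is_derive. apply (cderiv_ext_loc _ (coeff k) w0 e d1 Hd1) in He; [exact He|].
  intros w Hw. rewrite (coeff_eq k x w q) by now apply D1. reflexivity.
Qed.

Lemma coeff_series x w h : valid x w (Cmod h) ->
  cseries (fun k => coeff k w * h ^ (n0 + k))%C (N x w h).
Proof.
  intros Hv. assert (HPI := PI_RGT_0). destruct (valid_pos _ _ _ Hv) as [Hq Hwt].
  assert (Ha := HA x w).
  destruct Hv as [Hx [H1 H2]].
  set (q1 := (Cmod w * T x / r + Cmod h * A x w) / 2 / A x w).
  set (q2 := (r + Cmod h * A x w) / 2 / A x w).
  assert (Q1 : q1 * A x w = (Cmod w * T x / r + Cmod h * A x w) / 2) by (unfold q1; field; lra).
  assert (Q2 : q2 * A x w = (r + Cmod h * A x w) / 2) by (unfold q2; field; lra).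
  assert (V1 : valid x w q1) by (split; [exact Hx|lra]).
  assert (V2 : valid x w q2) by (split; [exact Hx|lra]).
  assert (L1 : q1 < Cmod h) by (apply Rmult_lt_reg_r with (A x w); lra).
  assert (L2 : Cmod h < q2) by (apply Rmult_lt_reg_r with (A x w); lra).
  destruct (valid_pos _ _ _ V1) as [Hq1 _].
  assert (S := laurent (N x w) q1 q2 h Hq1 (conj L1 L2)).
  assert (S1 : cseries
    (fun n => circ q2 (fun z => N x w z * / z ^ n) / RtoC (2 * PI) * h ^ n)%C (N x w h)).
  { apply S.
    - intros z Hz. apply N1. apply (valid_between x w q1 q2); assumption.
    - intros j Hj. now apply (vanish_pos j x w q1). }
  apply (series_shift _ _ n0) in S1.
  - revert S1. apply is_series_ext. intros k. rewrite (coeff_eq k x w q2 V2). reflexivity.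
  - intros n Hn. assert (Z := vanish_neg n x w q2 Hn V2). unfold Jint in Z. rewrite Z. unfold Cdiv. ring.
Qed.

Lemma expansion_exists : exists P : nat -> C -> C,
  (forall k, entire (P k)) /\
  (forall x w h, valid x w (Cmod h) ->
     cseries (fun k => P k w * h ^ (n0 + k))%C (N x w h)) /\
  (forall k x w q, valid x w q -> Cmod (P k w) <= Be x w / q ^ (n0 + k)).
Proof.
  exists coeff. split; [exact coeff_entire|]. split; [exact coeff_series|exact coeff_bound].
Qed.

End Expansion.

Lemma hol_pair3 {U : NormedModule C_AbsRing} {V : NormedModule C_AbsRing} (g : C3 -> V) (f0 f1 f2 : U -> C) p :
  ex_filterdiff g (locally ((f0 p, (f1 p, f2 p)) : C3)) -> hol f0 p -> hol f1 p -> hol f2 p ->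
  ex_filterdiff (fun q => g (f0 q, (f1 q, f2 q))) (locally p).
Proof.
  intros [l Hl] [l0 H0] [l1 H1] [l2 H2]. exists (fun k : U => l ((l0 k, (l1 k, l2 k)) : C3)).
  apply (filterdiff_comp' (V := C3) (fun q => (f0 q, (f1 q, f2 q)) : C3) g p (fun k : U => (l0 k, (l1 k, l2 k)) : C3) l); [|exact Hl].
  exact (pair_filterdiff f0 (fun q => (f1 q, f2 q)) p l0 _ H0 (pair_filterdiff f1 f2 p l1 l2 H1 H2)).
Qed.

Lemma cdiff_curve3 (g : C3 -> C) (f0 f1 f2 : C -> C) (z : C) :
  hol g ((f0 z, (f1 z, f2 z)) : C3) -> cdiff f0 z -> cdiff f1 z -> cdiff f2 z ->
  cdiff (fun w => g (f0 w, (f1 w, f2 w))) z.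
Proof.
  intros Hg H0 H1 H2. apply cdiff_hol in H0. apply cdiff_hol in H1. apply cdiff_hol in H2. apply cdiff_hol.
  exact (hol_pair3 (U := C_NormedModule) (V := C_NormedModule) g f0 f1 f2 z Hg H0 H1 H2).
Qed.

Lemma Rabs_Cmod_minus (u v : C) : Rabs (Cmod u - Cmod v) <= Cmod (u - v).
Proof.
  apply Rabs_le. generalize (Cmod_minus_ge u v) (Cmod_minus_ge v u).
  replace (v - u)%C with (- (u - v))%C by ring. rewrite Cmod_opp. lra.
Qed.

Lemma cdiff_Cmod (f : C -> C) z : cdiff f z -> forall eps, 0 < eps -> exists d, 0 < d /\ forall w, Cmod (w - z) < d -> Rabs (Cmod (f w) - Cmod (f z)) < eps.
Proof.
  intros H eps He. destruct (cdiff_CC f z H eps He) as [d [Hd D]]. exists d. split; [exact Hd|]. intros w Hw.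
  eapply Rle_lt_trans; [apply Rabs_Cmod_minus|now apply D].
Qed.

(** * Expansion of the increments of the first integrals *)

Section Gamma.
Context (lambda a1 a2 : C) (c : nat -> C) (r0 M0 : R).
Context (Hlambda : lambda <> RtoC 0) (Ha : 0 < Re (a1 + a2)%C) (Hc0 : c 0%nat = RtoC 0) (Hg : geomb c r0 M0).
Context (S0 : C -> Prop) (L : C -> C) (HS0 : open S0) (HL : log_branch S0 L).
Context (th : R) (Hth : is_arg th lambda) (rho : nat -> R) (Hrho : forall k, 0 < rho k <= 1)
  (Hsub : forall x, Nice th rho x -> S0 x).
Context (r : R) (Hr : 0 < r) (Hrr : r ^ 2 <= r0 / 4).

Local Notation X x := (xpow L x (a1 + a2)%C).
Local Notation F1 := (f1 lambda a1 a2 c L).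
Local Notation F2 := (f2 lambda a1 a2 c L).
Local Notation D := (sector_polydisc (Nice th rho) r r).

Lemma F1_cdiff_x (w x : C) : Nice th rho x -> Cmod (w * X x)%C <= r0 / 4 -> cdiff (fun z => F1 z w) x.
Proof.
  intros Hx Hv. eexists.
  apply (F1_curve lambda a1 a2 c r0 M0 Ha Hc0 Hg S0 L HS0 HL (fun _ => w) x (Hsub x Hx)); [apply cderiv_const|exact Hv].
Qed.

Lemma F1_cdiff_w (w x : C) : Nice th rho x -> Cmod (w * X x)%C <= r0 / 4 -> cdiff (fun w => F1 x w) w.
Proof.
  intros Hx Hv. apply cdiff_hol.
  apply (hol_F1 lambda a1 a2 c r0 M0 Ha Hc0 Hg S0 L HS0 HL (U := C_NormedModule) (fun _ => x) (fun w => w)); auto.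
  - apply hol_const.
  - apply cdiff_hol, cdiff_id.
Qed.

Lemma F2_cdiff_w (w x : C) : Nice th rho x -> Cmod (w * X x)%C <= r0 / 4 -> cdiff (fun w => F2 x w) w.
Proof.
  intros Hx Hv. apply cdiff_hol.
  apply (hol_F2 lambda a1 a2 c r0 M0 Ha Hc0 Hg S0 L HS0 HL (U := C_NormedModule) (fun _ => x) (fun w => w)); auto.
  - apply hol_const.
  - apply cdiff_hol, cdiff_id.
Qed.

Lemma xpow_cdiff x : Nice th rho x -> cdiff (fun z => X z) x.
Proof. intros Hx. eexists. apply (xpow_cderiv S0); auto. Qed.

(** For the increment of [h_j], [gam] is the increment times [f_j] and [e] is [1 / f_j], with
    [n0 = 2] for [j = 1] and [n0 = 0] for [j = 2]. Keeping the two factors apart gives the bound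
    [|e|] for the product. *)
Context (gam : C3 -> C) (e : C -> C -> C) (n0 : nat).
Context (g1 : forall p, D p -> hol gam p /\ Cmod (gam p) <= 1).
Context (e1 : forall x w, Nice th rho x -> Cmod (w * X x) <= r0 / 4 -> cdiff (e x) w).

Definition Ngam (x w h : C) : C := (gam (x, (h * F1 x w, w / h * F2 x w)) * e x w)%C.
Definition Agam (x w : C) : R := Cmod (F1 x w).
Definition Tgam (x : C) : R := Cmod (X x).
Local Notation val := (valid th rho r Agam Tgam).

Context (g3 : forall x w h, val x w (Cmod h) -> cderiv (fun z => Ngam z w h) x 0%C).
Context (gV : forall x w y1 y2 : C, D (x, (y1, y2)) -> w = (y1 * y2 / X x)%C -> 1 <= Cmod (F1 x w) ->
  Cmod (gam (x, (y1, y2)) * e x w) * Cmod (F1 x w) ^ n0 <= Cmod x * Cmod (F1 x w)).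

Lemma Agam_pos x w : 0 < Agam x w.
Proof. apply Cmod_gt_0, F1_neq0. Qed.
Lemma Tgam_pos x : 0 < Tgam x.
Proof. apply Cmod_gt_0, xpow_neq0. Qed.

Lemma val_D x w h : val x w (Cmod h) ->
  h <> 0%C /\ D (x, (h * F1 x w, w / h * F2 x w))%C /\ Cmod (w * X x) < r ^ 2 /\ (w = h * F1 x w * (w / h * F2 x w) / X x)%C.
Proof.
  intros Hv. destruct (valid_pos th rho r Agam Tgam Hr Agam_pos Tgam_pos x w (Cmod h) Hv) as [Hh Hw].
  destruct Hv as [Hx [H1 H2]].
  assert (Hh0 : h <> 0%C) by (apply Cmod_gt_0; exact Hh).
  split; [exact Hh0|]. split; [|split].
  - split; [exact Hx|]. split; simpl.
    + rewrite Cmod_mult. exact H2.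
    + assert (E : Cmod (w / h * F2 x w) = Cmod w * Tgam x / (Cmod h * Agam x w)).
      { unfold Tgam, Agam. rewrite <- (F1_F2 lambda a1 a2 c L x w). rewrite !Cmod_mult, Cmod_div by exact Hh0.
        field. split; apply Rgt_not_eq; [apply Agam_pos|exact Hh]. }
      rewrite E. assert (Ha1 := Agam_pos x w). assert (0 < Cmod h * Agam x w) by nra.
      apply Rmult_lt_reg_r with (Cmod h * Agam x w); [assumption|].
      unfold Rdiv. rewrite Rmult_assoc, Rinv_l, Rmult_1_r by lra.
      apply Rmult_lt_compat_r with (r := r) in H1; [|exact Hr].
      replace (Cmod w * Tgam x / r * r) with (Cmod w * Tgam x) in H1 by (field; lra). lra.
  - rewrite Cmod_mult. exact Hw.
  - rewrite <- (F1_F2 lambda a1 a2 c L x w). field. repeat split; first [exact Hh0|apply F1_neq0|apply F2_neq0].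
Qed.

Lemma v_small x w : Cmod (w * X x) < r ^ 2 -> Cmod (w * X x) <= r0 / 4.
Proof. lra. Qed.

Lemma gam_expansion : exists P : nat -> C -> C,
  (forall k, entire (P k)) /\
  (forall x w h, val x w (Cmod h) ->
     cseries (fun k => P k w * h ^ (n0 + k))%C (Ngam x w h)) /\
  (forall k x w q, val x w q -> Cmod (P k w) <= Cmod (e x w) / q ^ (n0 + k)).
Proof.
  apply (expansion_exists th rho r n0 Ngam Agam (fun x w => Cmod (e x w)) Tgam); trivial.
  - intros k. apply Hrho.
  - apply Agam_pos.
  - apply Tgam_pos.
  - intros x w h Hv. destruct (val_D x w h Hv) as [Hh [HD [Hw _]]].
    apply cdiff_mult; [|apply cdiff_const].
    apply (cdiff_curve3 gam (fun _ => x) (fun h => h * F1 x w)%C (fun h => w / h * F2 x w)%C).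
    + apply g1, HD.
    + apply cdiff_const.
    + apply cdiff_mult; [apply cdiff_id|apply cdiff_const].
    + apply cdiff_mult; [|apply cdiff_const]. apply cdiff_div; [exact Hh|apply cdiff_const|apply cdiff_id].
  - intros x w h Hv. destruct (val_D x w h Hv) as [Hh [HD [Hw _]]]. apply v_small in Hw. assert (Hx := proj1 HD). simpl in Hx.
    apply cdiff_mult; [|now apply e1].
    apply (cdiff_curve3 gam (fun _ => x) (fun w => h * F1 x w)%C (fun w => w / h * F2 x w)%C).
    + apply g1, HD.
    + apply cdiff_const.
    + apply cdiff_mult; [apply cdiff_const|now apply F1_cdiff_w].
    + apply cdiff_mult; [|now apply F2_cdiff_w]. apply cdiff_div; [exact Hh|apply cdiff_id|apply cdiff_const].
  - intros x w h Hv. destruct (val_D x w h Hv) as [Hh [HD [Hw _]]]. unfold Ngam. rewrite Cmod_mult.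
    rewrite <- (Rmult_1_l (Cmod (e x w))) at 2. apply Rmult_le_compat_r; [apply Cmod_ge_0|]. now apply g1.
  - intros x Hx. apply (cdiff_Cmod (fun z => X z)). now apply xpow_cdiff.
  - intros x w Hx Hw. apply (cdiff_Cmod (fun z => F1 z w)). apply F1_cdiff_x; [exact Hx|]. apply v_small. rewrite Cmod_mult. exact Hw.
  - intros x w Hx Hw. apply (cdiff_Cmod (fun w => F1 x w)). apply F1_cdiff_w; [exact Hx|]. apply v_small. rewrite Cmod_mult. exact Hw.
  - intros x w Hx Hw. destruct (cdiff_Cmod (e x) w) with (eps := 1) as [d [Hd H]]; [apply e1; [exact Hx|apply v_small; rewrite Cmod_mult; exact Hw]|lra|].
    exists d, (Cmod (e x w) + 1). split; [exact Hd|]. intros w' Hw'. specialize (H w' Hw'). apply Rabs_lt_between in H. lra.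
  - intros x s Hs Hx. apply (xpow_scal a1 a2 Ha S0 L HS0 HL th rho Hsub); assumption.
  - intros eps He. apply (xpow_small a1 a2 Ha S0 L HS0 HL th rho Hrho Hsub eps He).
  - intros w eps He.
    destruct (F1_large lambda a1 a2 c r0 M0 Hlambda Ha Hc0 Hg S0 L HS0 HL th Hth rho Hrho Hsub w) as [s1 [Hs1 HF]].
    assert (Hcw := Cmod_ge_0 w).
    destruct (xpow_small a1 a2 Ha S0 L HS0 HL th rho Hrho Hsub (r ^ 2 / 4 / (Cmod w + 1))) as [s2 [Hs2 HX]].
    { assert (0 < r ^ 2) by (apply pow_lt; lra). repeat apply Rdiv_lt_0_compat; lra. }
    (* The condition [s < eps] turns the factor [|x|] of hypothesis [gV] into the required [eps]. *)
    set (s := Rmin (Rmin s1 s2) eps / 2).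
    assert (Hs : 0 < s) by (unfold s; assert (0 < Rmin (Rmin s1 s2) eps) by (repeat apply Rmin_pos; lra); lra).
    assert (Hsm : s < s1 /\ s < s2 /\ s < eps).
    { unfold s in *. generalize (Rmin_l (Rmin s1 s2) eps) (Rmin_r (Rmin s1 s2) eps) (Rmin_l s1 s2) (Rmin_r s1 s2). lra. }
    set (x := (RtoC s * cis th)%C).
    assert (Hx : Nice th rho x) by (apply Nice_axis; lra).
    assert (Hmx : Cmod x = s) by (unfold x; rewrite Cmod_mult, Cmod_R, Cmod_cis, Rabs_pos_eq; lra).
    assert (HXx := HX x Hx ltac:(lra)). fold (Tgam x) in HXx. assert (Htx := Tgam_pos x).
    assert (HwT : Cmod w * Tgam x < r ^ 2 / 4).
    { apply Rle_lt_trans with ((Cmod w + 1) * Tgam x); [nra|].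
      apply Rmult_lt_compat_l with (r := Cmod w + 1) in HXx; [|lra].
      replace ((Cmod w + 1) * (r ^ 2 / 4 / (Cmod w + 1))) with (r ^ 2 / 4) in HXx by (field; lra). exact HXx. }
    exists x. split; [exact Hx|]. split; [exact HwT|]. split; [apply HF; lra|].
    intros h Hh.
    assert (Hv : val x w (Cmod h)).
    { split; [exact Hx|]. rewrite Hh. split; [|lra]. apply Rmult_lt_reg_r with r; [exact Hr|].
      replace (Cmod w * Tgam x / r * r) with (Cmod w * Tgam x) by (field; lra). nra. }
    destruct (val_D x w h Hv) as [Hh0 [HD [_ Ew]]].
    assert (HFx : 1 <= Cmod (F1 x w)) by (apply HF; lra).
    assert (G := gV x w _ _ HD Ew HFx). unfold Ngam, Agam.
    eapply Rle_trans; [exact G|]. apply Rmult_le_compat_r; lra.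
Qed.

(** The power series also represents [gamma e] at [y_1 = 0], by letting [y_1 -> 0]. *)
Lemma gam_expansion_D : exists P : nat -> C -> C,
  (forall k, entire (P k)) /\
  (forall x y1 y2 w : C, D (x, (y1, y2)) -> w = (y1 * y2 / X x)%C ->
     cseries (fun k => P k w * (y1 / F1 x w) ^ (n0 + k))%C (gam (x, (y1, y2)) * e x w)%C) /\
  (forall k x w R, Nice th rho x -> 0 < R < r -> Cmod (w * X x) < R * r ->
     Cmod (P k w) <= Cmod (e x w) * Cmod (F1 x w) ^ (n0 + k) / R ^ (n0 + k)).
Proof.
  destruct gam_expansion as [P [HP [Hser Hb]]]. exists P. split; [exact HP|].
  assert (Hb' : forall k x w R, Nice th rho x -> 0 < R < r -> Cmod (w * X x) < R * r ->
     Cmod (P k w) <= Cmod (e x w) * Cmod (F1 x w) ^ (n0 + k) / R ^ (n0 + k)).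
  { intros k x w R Hx HR Hw. assert (Ha1 := Agam_pos x w).
    assert (Hv : val x w (R / Agam x w)).
    { split; [exact Hx|]. replace (R / Agam x w * Agam x w) with R by (field; lra). split; [|lra].
      rewrite Cmod_mult in Hw. apply Rmult_lt_reg_r with r; [exact Hr|].
      unfold Tgam. replace (Cmod w * Cmod (X x) / r * r) with (Cmod w * Cmod (X x)) by (field; lra). exact Hw. }
    eapply Rle_trans; [apply (Hb k x w _ Hv)|]. apply Req_le. unfold Agam in *.
    unfold Rdiv at 2. rewrite Rpow_mult_distr, pow_inv. field. split; apply pow_nonzero; lra. }
  assert (Hser1 : forall x y1 y2 w : C, y1 <> 0%C -> D (x, (y1, y2)) -> w = (y1 * y2 / X x)%C ->
     cseries (fun k => P k w * (y1 / F1 x w) ^ (n0 + k))%C (gam (x, (y1, y2)) * e x w)%C).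
  { intros x y1 y2 w Hy1 [Hx [H1 H2]] Ew. simpl in Hx, H1, H2.
    assert (Ha1 := Agam_pos x w). assert (Hy : 0 < Cmod y1) by (apply Cmod_gt_0; exact Hy1).
    assert (Hv : val x w (Cmod (y1 / F1 x w))).
    { split; [exact Hx|]. rewrite Cmod_div by apply F1_neq0. fold (Agam x w).
      replace (Cmod y1 / Agam x w * Agam x w) with (Cmod y1) by (field; lra). split; [|exact H1].
      apply Rmult_lt_reg_r with r; [exact Hr|]. unfold Tgam.
      replace (Cmod w * Cmod (X x) / r * r) with (Cmod (w * X x)) by (rewrite Cmod_mult; field; lra).
      replace (w * X x)%C with (y1 * y2)%C by (rewrite Ew; field; apply xpow_neq0).
      rewrite Cmod_mult. apply Rmult_lt_compat_l; assumption. }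
    assert (Sx := Hser x w _ Hv). unfold Ngam in Sx.
    replace (y1 / F1 x w * F1 x w)%C with y1 in Sx by (field; apply F1_neq0).
    replace (w / (y1 / F1 x w) * F2 x w)%C with y2 in Sx; [exact Sx|].
    transitivity (w * (F1 x w * F2 x w) / y1)%C; [|field; repeat split; first [exact Hy1|apply F1_neq0]].
    rewrite F1_F2, Ew. field. repeat split; first [exact Hy1|apply xpow_neq0]. }
  split; [|exact Hb'].
  intros x y1 y2 w HD Ew. destruct (Ceq_dec y1 0) as [E0|N0]; [subst y1|now apply (Hser1 x y1 y2 w)].
  assert (Ew0 : w = 0%C) by (rewrite Ew; field; apply xpow_neq0). clear Ew. subst w.
  replace (0 / F1 x 0)%C with (RtoC 0) by (field; apply F1_neq0).
  destruct HD as [Hx [_ H2]]. simpl in Hx, H2.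
  (* At [y_1 = 0] only a term of exponent [n0 + k = 0] survives, and there is one only if
     [n0 = 0]. *)
  set (s := fun w => if Nat.eq_dec n0 0 then P 0%nat w else RtoC 0).
  assert (Hsum : cseries (fun k => P k 0 * 0 ^ (n0 + k))%C (s 0%C)).
  { apply is_series_rate with (K := 0) (rho := 0); [lra|]. intros n. rewrite Rmult_0_l.
    assert (E : csum (fun k => P k 0 * 0 ^ (n0 + k))%C n = s 0%C).
    { induction n as [|n IH].
      - rewrite sum_n_C_0. unfold s. destruct (Nat.eq_dec n0 0) as [->|Nn]; [simpl; cring|].
        destruct n0 as [|n1]; [lia|]. simpl. cring.
      - rewrite sum_n_C_S, IH, Nat.add_succ_r. simpl. cring. }
    rewrite E. replace (s 0 - s 0)%C with (RtoC 0) by ring. rewrite Cmod_0. lra. }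
  replace (gam (x, (RtoC 0, y2)) * e x 0)%C with (s 0%C); [exact Hsum|].
  set (W := fun t : C => (t * y2 / X x)%C).
  set (G := fun t : C => (gam (x, (t, y2)) * e x (W t) - s (W t))%C).
  assert (HW0 : W 0%C = 0%C) by (unfold W; field; apply xpow_neq0).
  assert (HWd : forall t, cdiff W t).
  { intros t. unfold W. apply cdiff_mult; [apply cdiff_mult; [apply cdiff_id|apply cdiff_const]|apply cdiff_const]. }
  assert (HW0' : Cmod (W 0 * X x) <= r0 / 4).
  { rewrite HW0, Cmult_0_l, Cmod_0. assert (0 < r ^ 2) by (apply pow_lt; lra). lra. }
  assert (Hen : forall k z, cdiff (P k) z).
  { intros k z. destruct (HP k z) as [d Hd]. exists d. now apply cderiv_is_derive. }
  assert (Hed : cdiff (fun t => e x (W t)) 0%C) by (apply (cdiff_comp W (e x)); [apply HWd|now apply e1]).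
  assert (HG : CC G 0%C).
  { apply cdiff_CC, cdiff_minus.
    - apply cdiff_mult; [|exact Hed].
      apply (cdiff_curve3 gam (fun _ => x) (fun t => t) (fun _ => y2)); try apply cdiff_const; [|apply cdiff_id].
      apply g1. split; [exact Hx|]. split; simpl; [rewrite Cmod_0; exact Hr|exact H2].
    - unfold s. destruct (Nat.eq_dec n0 0); [|apply cdiff_const]. apply (cdiff_comp W (P 0%nat)); auto. }
  destruct (cdiff_Cmod (fun t => e x (W t)) 0%C Hed 1 Rlt_0_1) as [d1 [Hd1 D1]].
  set (E0 := Cmod (e x (W 0%C)) + 1).
  assert (HE0 : 0 < E0) by (unfold E0; generalize (Cmod_ge_0 (e x (W 0%C))); lra).
  set (Rd := r / 2).
  (* All terms of positive index contribute [O(t)], and so does the term of index 0 when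
     [n0 > 0]. *)
  assert (Gb : forall t : R, 0 < t -> t < d1 -> t < Rd / 2 -> Cmod (G t) <= 3 * E0 * (t / Rd)).
  { intros t Ht Htd HtR. unfold Rd in *.
    assert (Hmt : Cmod t = t) by (rewrite Cmod_R, Rabs_pos_eq; lra).
    assert (Ht0 : RtoC t <> 0%C) by (apply RtoC_neq0; lra).
    assert (HDt : D (x, (RtoC t, y2))) by (split; [exact Hx|split; simpl; [rewrite Hmt; lra|exact H2]]).
    assert (Sx := Hser1 x t y2 (W t) Ht0 HDt eq_refl).
    specialize (D1 (RtoC t)). replace (t - 0)%C with (RtoC t) in D1 by ring. specialize (D1 ltac:(lra)).
    apply Rabs_lt_between in D1. fold E0 in D1.
    set (w := W (RtoC t)) in *. set (h := (RtoC t / F1 x w)%C) in *.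
    assert (HwX : Cmod (w * X x) < r / 2 * r).
    { unfold w, W. replace (t * y2 / X x * X x)%C with (t * y2)%C by (field; apply xpow_neq0).
      rewrite Cmod_mult, Hmt. generalize (Cmod_ge_0 y2). nra. }
    assert (Hterm : forall k, Cmod (P k w * h ^ (n0 + k)) <= E0 * (t / (r / 2)) ^ n0 * (t / (r / 2)) ^ k).
    { intros k. rewrite Rmult_assoc, <- pow_add. rewrite Cmod_mult, Cmod_pow. unfold h. rewrite Cmod_div, Hmt by apply F1_neq0.
      assert (Ha1 := Agam_pos x w). unfold Agam in Ha1.
      assert (B := Hb' k x w (r / 2) Hx ltac:(lra) HwX).
      apply Rle_trans with (E0 * Cmod (F1 x w) ^ (n0 + k) / (r / 2) ^ (n0 + k) * (t / Cmod (F1 x w)) ^ (n0 + k)).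
      - apply Rmult_le_compat_r; [apply pow_le, Rdiv_le_0_compat; lra|]. eapply Rle_trans; [exact B|].
        unfold Rdiv. apply Rmult_le_compat_r; [apply Rlt_le, Rinv_0_lt_compat, pow_lt; lra|].
        apply Rmult_le_compat_r; [apply pow_le; lra|]. unfold E0. lra.
      - set (qq := r / 2). assert (Hqq : 0 < qq) by (unfold qq; lra). clearbody qq.
        apply Req_le. unfold Rdiv. rewrite !Rpow_mult_distr, !pow_inv. field. repeat split; apply pow_nonzero; lra. }
    assert (Hrt : 0 <= t / (r / 2) <= / 2).
    { split; [apply Rdiv_le_0_compat; lra|]. apply Rmult_le_reg_r with (r / 2); [lra|]. replace (t / (r / 2) * (r / 2)) with t by (field; lra). lra. }
    set (u := t / (r / 2)) in *.
    assert (Hun : 0 <= u ^ n0 <= 1) by (split; [apply pow_le; lra|rewrite <- (pow1 n0); apply pow_incr; lra]).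
    assert (Tl : Cmod (gam (x, (RtoC t, y2)) * e x w - P 0%nat w * h ^ n0) <= 2 * E0 * u).
    { apply (is_series_bound _ _ _ 0%nat _ Sx). intros n Hn.
      assert (Q := sum_tail (fun k => P k w * h ^ (n0 + k))%C (E0 * u ^ n0) u 0 Hrt ltac:(nra) Hterm n Hn).
      rewrite sum_n_C_0, Nat.add_0_r in Q. eapply Rle_trans; [exact Q|]. simpl. rewrite Rmult_1_r.
      apply Rmult_le_compat_r; [lra|]. nra. }
    unfold G. fold w. unfold s. destruct (Nat.eq_dec n0 0) as [E|Nn].
    - rewrite E in Tl. simpl in Tl. rewrite Cmult_1_r in Tl. eapply Rle_trans; [exact Tl|]. nra.
    - assert (T0 := Hterm 0%nat). rewrite Nat.add_0_r in T0. simpl in T0. rewrite Rmult_1_r in T0.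
      assert (u ^ n0 <= u).
      { destruct n0 as [|n1]; [lia|]. simpl. rewrite <- (Rmult_1_r u) at 3. apply Rmult_le_compat_l; [lra|].
        rewrite <- (pow1 n1). apply pow_incr. lra. }
      replace (gam (x, (RtoC t, y2)) * e x w - 0)%C with ((gam (x, (RtoC t, y2)) * e x w - P 0%nat w * h ^ n0) + P 0%nat w * h ^ n0)%C by ring.
      eapply Rle_trans; [apply Cmod_triangle|]. nra. }
  assert (HG0 : G 0%C = 0%C).
  { apply Cmod_eq_0. apply Rle_antisym; [|apply Cmod_ge_0]. apply le_epsilon. intros eps He. rewrite Rplus_0_l.
    destruct (HG (eps / 2)) as [d2 [Hd2 D2]]; [lra|].
    assert (HR : 0 < Rd) by (unfold Rd; lra).
    set (t := Rmin (Rmin d1 (Rd / 2)) (Rmin d2 (eps * Rd / (6 * E0))) / 2).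
    assert (Ht : 0 < t).
    { assert (0 < Rmin (Rmin d1 (Rd / 2)) (Rmin d2 (eps * Rd / (6 * E0)))) by (repeat apply Rmin_pos; try lra; apply Rdiv_lt_0_compat; nra). unfold t; lra. }
    assert (Hts : t < d1 /\ t < Rd / 2 /\ t < d2 /\ t < eps * Rd / (6 * E0)).
    { unfold t in *. generalize (Rmin_l (Rmin d1 (Rd / 2)) (Rmin d2 (eps * Rd / (6 * E0)))) (Rmin_r (Rmin d1 (Rd / 2)) (Rmin d2 (eps * Rd / (6 * E0))))
        (Rmin_l d1 (Rd / 2)) (Rmin_r d1 (Rd / 2)) (Rmin_l d2 (eps * Rd / (6 * E0))) (Rmin_r d2 (eps * Rd / (6 * E0))). lra. }
    specialize (D2 (RtoC t)). replace (t - 0)%C with (RtoC t) in D2 by ring.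
    rewrite Cmod_R, Rabs_pos_eq in D2 by lra. specialize (D2 ltac:(lra)).
    assert (B := Gb t Ht ltac:(lra) ltac:(lra)).
    assert (3 * E0 * (t / Rd) <= eps / 2).
    { apply Rle_trans with (3 * E0 * (eps * Rd / (6 * E0) / Rd)); [|apply Req_le; field; lra].
      apply Rmult_le_compat_l; [lra|]. apply Rmult_le_compat_r; [apply Rlt_le, Rinv_0_lt_compat, HR|lra]. }
    replace (G 0%C) with (G (RtoC t) + - (G (RtoC t) - G 0%C))%C by ring.
    eapply Rle_trans; [apply Cmod_triangle|]. rewrite Cmod_opp. lra. }
  unfold G in HG0. rewrite HW0 in HG0.
  replace (gam (x, (RtoC 0, y2)) * e x 0)%C with ((gam (x, (RtoC 0, y2)) * e x 0 - s 0) + s 0)%C by ring. rewrite HG0. ring.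
Qed.

End Gamma.

(** * Flatness of isotropies *)

Lemma acos_inv_bound k : 0 < acos (/ (INR k + 2)) < PI / 2 /\ cos (acos (/ (INR k + 2))) = / (INR k + 2).
Proof.
  assert (Hk := pos_INR k). set (q := / (INR k + 2)).
  assert (Hc : 0 < q <= / 2).
  { split; [apply Rinv_0_lt_compat; lra|]. apply Rinv_le_contravar; lra. }
  assert (Hb := acos_bound q). assert (Hcos := cos_acos q ltac:(lra)).
  split; [|exact Hcos]. split.
  - destruct (Rle_lt_or_eq_dec 0 _ (proj1 Hb)) as [H|H]; [exact H|]. rewrite <- H, cos_0 in Hcos. lra.
  - apply Rnot_le_lt. intros Hl. assert (cos (acos q) <= cos (PI / 2)); [|rewrite cos_PI2 in *; lra].
    destruct Hl as [Hl|Hl]; [apply Rlt_le, cos_decreasing_1; lra|rewrite Hl; lra].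
Qed.

Lemma sec_arg th k x : sec th k x -> exists t, is_arg t x /\ Rabs (t - th) <= acos (/ (INR k + 2)).
Proof.
  intros Hx. assert (Hk := pos_INR k). destruct (acos_inv_bound k) as [Hb Hcos].
  destruct (sec_pos th k x Hx) as [Hd Hm].
  destruct (polar (x * cis (- th))) as [t [Ht Et]].
  rewrite Cmod_mult, Cmod_cis, Rmult_1_r in Et.
  assert (Ex : x = (RtoC (Cmod x) * cis (t + th))%C).
  { rewrite cis_plus. rewrite Cmult_assoc, <- Et, <- Cmult_assoc, <- cis_plus.
    replace (- th + th) with 0 by ring. rewrite cis_0. ring. }
  exists (t + th). split; [apply is_arg_polar; split; [apply Cmod_gt_0; exact Hm|exact Ex]|].
  replace (t + th - th) with t by ring.
  assert (Hdd : dir th x = Cmod x * cos t). { rewrite Ex at 1. rewrite dir_polar. f_equal. f_equal. ring. }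
  unfold sec in Hx. rewrite Hdd in Hx.
  assert (Hct : / (INR k + 2) < cos t).
  { apply Rmult_lt_reg_r with (INR k + 2); [lra|]. rewrite Rinv_l by lra.
    apply Rmult_lt_reg_l with (Cmod x); [exact Hm|]. lra. }
  apply Rnot_lt_le. intros Hl.
  assert (Hca : cos (Rabs t) = cos t).
  { destruct (Rle_lt_dec 0 t); [rewrite Rabs_pos_eq by lra; reflexivity|rewrite Rabs_left by lra; apply cos_neg]. }
  assert (cos (Rabs t) <= / (INR k + 2)); [|lra].
  rewrite <- Hcos. apply Rlt_le, cos_decreasing_1; try lra; apply Rabs_le; lra.
Qed.

(** The non-strict bound on the angle describes a closed cone, while [sec] is open; passing to [S k]
    makes room for the boundary. *)
Lemma arg_sec th k t x : is_arg t x -> Rabs (t - th) <= acos (/ (INR k + 2)) -> sec th (S k) x.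
Proof.
  intros Hx Ht. assert (Hk := pos_INR k). destruct (acos_inv_bound k) as [Hb Hcos].
  apply is_arg_polar in Hx. destruct Hx as [Hx0 Ex].
  assert (Hm : 0 < Cmod x) by (apply Cmod_gt_0; exact Hx0).
  unfold sec. rewrite Ex at 2. rewrite dir_polar.
  assert (Hca : cos (Rabs (t - th)) = cos (t - th)).
  { destruct (Rle_lt_dec 0 (t - th)); [rewrite Rabs_pos_eq by lra; reflexivity|rewrite Rabs_left by lra; apply cos_neg]. }
  assert (Hcc : / (INR k + 2) <= cos (t - th)).
  { rewrite <- Hca, <- Hcos. assert (H0 := Rabs_pos (t - th)).
    destruct Ht as [Ht|Ht]; [apply Rlt_le, cos_decreasing_1; lra|rewrite Ht; lra]. }
  rewrite S_INR, Rmult_assoc. rewrite <- (Rmult_1_r (Cmod x)) at 1. apply Rmult_lt_compat_l; [exact Hm|].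
  apply Rlt_le_trans with (/ (INR k + 2) * (INR k + 1 + 2)); [|apply Rmult_le_compat_r; lra].
  apply Rmult_lt_reg_l with (INR k + 2); [lra|]. rewrite <- Rmult_assoc, Rinv_r by lra. lra.
Qed.

Lemma Nice_shrink1 th (P : C -> Prop) :
  (forall k, exists r, 0 < r /\ forall x, sec th k x -> Cmod x < r -> P x) ->
  exists rho, (forall k, 0 < rho k <= 1) /\ forall x, Nice th rho x -> P x.
Proof.
  intros H. destruct (Nice_shrink th P H) as [rho [Hr HP]].
  exists (fun k => Rmin 1 (rho k)). split.
  - intros k. split; [apply Rmin_pos; [lra|apply Hr]|apply Rmin_l].
  - intros x [k [H1 H2]]. apply HP. exists k. split; [eapply Rlt_le_trans; [exact H1|apply Rmin_r]|exact H2].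
Qed.

Lemma AS_inter_sectors th S S' : AS th PI S -> AS th PI S' ->
  exists rho, (forall k, 0 < rho k <= 1) /\ forall x, Nice th rho x -> S x /\ S' x.
Proof.
  intros H H'. destruct (AS_sectors th S H) as [r1 [R1 I1]]. destruct (AS_sectors th S' H') as [r2 [R2 I2]].
  apply Nice_shrink1. intros k. exists (Rmin (r1 k) (r2 k)). split; [now apply Rmin_pos|].
  intros x Hx Hm. split.
  - apply (I1 k); [exact Hx|]. eapply Rlt_le_trans; [exact Hm|apply Rmin_l].
  - apply (I2 k); [exact Hx|]. eapply Rlt_le_trans; [exact Hm|apply Rmin_r].
Qed.

Lemma norm_C3 (a b d : C) : Cmod a <= norm ((a, (b, d)) : C3) /\ Cmod b <= norm ((a, (b, d)) : C3) /\ Cmod d <= norm ((a, (b, d)) : C3) /\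
  norm ((a, (b, d)) : C3) <= Cmod a + Cmod b + Cmod d.
Proof.
  assert (P : forall x y, 0 <= x -> 0 <= y -> x <= sqrt (x ^ 2 + y ^ 2) /\ y <= sqrt (x ^ 2 + y ^ 2) /\ sqrt (x ^ 2 + y ^ 2) <= x + y).
  { intros x y Hx Hy. split; [|split].
    - rewrite <- (sqrt_pow2 x) at 1 by exact Hx. apply sqrt_le_1_alt. assert (0 <= y ^ 2) by apply pow2_ge_0. lra.
    - rewrite <- (sqrt_pow2 y) at 1 by exact Hy. apply sqrt_le_1_alt. assert (0 <= x ^ 2) by apply pow2_ge_0. lra.
    - rewrite <- (sqrt_pow2 (x + y)) by lra. apply sqrt_le_1_alt. nra. }
  change (norm ((a, (b, d)) : C3)) with (sqrt (Cmod a ^ 2 + (sqrt (Cmod b ^ 2 + Cmod d ^ 2)) ^ 2)).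
  destruct (P (Cmod b) (Cmod d) (Cmod_ge_0 _) (Cmod_ge_0 _)) as [P1 [P2 P3]].
  destruct (P (Cmod a) (sqrt (Cmod b ^ 2 + Cmod d ^ 2)) (Cmod_ge_0 _) (sqrt_pos _)) as [Q1 [Q2 Q3]]. lra.
Qed.

Lemma C3_eq (a b d a' b' d' : C) : a = a' -> b = b' -> d = d' -> ((a, (b, d)) : C3) = ((a', (b', d')) : C3).
Proof. congruence. Qed.

(** From order 2 on, the Gevrey remainder is therefore [psi - id] itself. *)
Lemma sum_below_identity (x : C) (y : C2) N :
  sum_below (V := C3) (fun k => scal (x ^ k : C)%C (identity_coeff k y)) (S (S N)) = ((x, y) : C3).
Proof.
  assert (E2 : sum_below (V := C3) (fun k => scal (x ^ k : C)%C (identity_coeff k y)) 2 = ((x, y) : C3)).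
  { destruct y as [y1 y2].
    change ((((RtoC 0 + (x ^ 0) * RtoC 0) + (x ^ 1) * RtoC 1, ((RtoC 0 + (x ^ 0) * y1) + (x ^ 1) * RtoC 0, (RtoC 0 + (x ^ 0) * y2) + (x ^ 1) * RtoC 0))%C : C3) = ((x, (y1, y2)) : C3)).
    apply C3_eq; simpl; ring. }
  induction N as [|N IH]; [exact E2|].
  change (plus (sum_below (V := C3) (fun k => scal (x ^ k : C)%C (identity_coeff k y)) (S (S N))) (scal (x ^ S (S N) : C)%C (zero (G := C3))) = ((x, y) : C3)).
  rewrite IH. rewrite (@scal_zero_r _ C3), (@plus_zero_r C3). reflexivity.
Qed.

Lemma hol_proj0 {U : NormedModule C_AbsRing} (f : U -> C3) p : ex_filterdiff f (locally p) -> hol (fun q => fst (f q)) p.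
Proof.
  intros [l Hl]. exists (fun k => fst (l k)).
  apply (filterdiff_comp' (V := C3) (W := C_NormedModule) f (fun q : C3 => fst q) p l (fun q : C3 => fst q) Hl).
  apply filterdiff_linear. apply is_linear_fst.
Qed.

Lemma hol_proj1 {U : NormedModule C_AbsRing} (f : U -> C3) p : ex_filterdiff f (locally p) -> hol (fun q => fst (snd (f q))) p.
Proof.
  intros [l Hl]. exists (fun k => fst (snd (l k))).
  apply (filterdiff_comp' (V := C3) (W := C_NormedModule) f (fun q : C3 => fst (snd q)) p l (fun q : C3 => fst (snd q)) Hl).
  apply filterdiff_linear. apply (is_linear_comp (V := C2) (fun q : C3 => snd q) (fun q : C2 => fst q)); [apply is_linear_snd|apply is_linear_fst].
Qed.

Lemma hol_proj2 {U : NormedModule C_AbsRing} (f : U -> C3) p : ex_filterdiff f (locally p) -> hol (fun q => snd (snd (f q))) p.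
Proof.
  intros [l Hl]. exists (fun k => snd (snd (l k))).
  apply (filterdiff_comp' (V := C3) (W := C_NormedModule) f (fun q : C3 => snd (snd q)) p l (fun q : C3 => snd (snd q)) Hl).
  apply filterdiff_linear. apply (is_linear_comp (V := C2) (fun q : C3 => snd q) (fun q : C2 => snd q)); [apply is_linear_snd|apply is_linear_snd].
Qed.

Lemma id_filterdiff (p : C3) : ex_filterdiff (fun q : C3 => q) (locally p).
Proof. exists (fun q => q). apply filterdiff_id. Qed.

(** Chain rule along a curve parametrised by [x], whose velocity is a multiple [s] of a vector [Y];
    later [s = 1 / x^2], because the field has first component [x^2]. *)
Lemma curve_pushforward (psi : C3 -> C3) (f1 f2 : C -> C) (z d1 d2 : C) (dpsi : C3 -> C3) (s : C) (Y : C3) :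
  filterdiff psi (locally ((z, (f1 z, f2 z)) : C3)) dpsi -> cderiv f1 z d1 -> cderiv f2 z d2 ->
  ((RtoC 1, (d1, d2)) : C3) = scal s Y ->
  cderiv (fun w => fst (snd (psi (w, (f1 w, f2 w))))) z (s * fst (snd (dpsi Y)))%C /\
  cderiv (fun w => snd (snd (psi (w, (f1 w, f2 w))))) z (s * snd (snd (dpsi Y)))%C /\
  cderiv (fun w => fst (psi (w, (f1 w, f2 w)))) z (s * fst (dpsi Y))%C.
Proof.
  intros Hpsi H1 H2 EY. assert (Hlin : is_linear dpsi) by apply Hpsi.
  apply cderiv_cfd in H1. apply cderiv_cfd in H2.
  assert (Hc : filterdiff (U := C_NormedModule) (V := C3) (fun w : C => ((w, (f1 w, f2 w)) : C3)) (locally (T := C_NormedModule) z) (fun k : C => ((k, (d1 * k, d2 * k)%C) : C3))).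
  { apply (pair_filterdiff (T := C_NormedModule) (U := C_NormedModule) (V := C2) (fun w => w) (fun w => (f1 w, f2 w)) z (fun k => k) (fun k => (d1 * k, d2 * k)%C)).
    - apply filterdiff_id.
    - apply (pair_filterdiff (T := C_NormedModule) (U := C_NormedModule) (V := C_NormedModule) f1 f2); assumption. }
  assert (Hcomp := filterdiff_comp' (U := C_NormedModule) (V := C3) (W := C3) _ psi z _ dpsi Hc Hpsi).
  assert (El : forall k : C, dpsi ((k, (d1 * k, d2 * k)%C) : C3) = scal (k * s)%C (dpsi Y)).
  { intros k. rewrite <- (linear_scal _ Hlin). f_equal.
    transitivity (scal k (scal s Y) : C3); [rewrite <- EY|apply (@scal_assoc _ C3)].
    apply (C3_eq k (d1 * k)%C (d2 * k)%C (k * 1)%C (k * d1)%C (k * d2)%C); ring. }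
  split; [|split]; apply cderiv_cfd.
  - apply (cfd_ext_l (U := C_NormedModule)) with (fun k : C => fst (snd (dpsi ((k, (d1 * k, d2 * k)%C) : C3)))).
    + intros k. rewrite El. change ((k * s * fst (snd (dpsi Y)))%C = (s * fst (snd (dpsi Y)) * k)%C). ring.
    + apply (filterdiff_comp' (V := C3) (W := C_NormedModule) _ (fun q : C3 => fst (snd q)) z _ (fun q : C3 => fst (snd q)) Hcomp).
      apply filterdiff_linear. apply (is_linear_comp (V := C2) (fun q : C3 => snd q) (fun q : C2 => fst q)); [apply is_linear_snd|apply is_linear_fst].
  - apply (cfd_ext_l (U := C_NormedModule)) with (fun k : C => snd (snd (dpsi ((k, (d1 * k, d2 * k)%C) : C3)))).
    + intros k. rewrite El. change ((k * s * snd (snd (dpsi Y)))%C = (s * snd (snd (dpsi Y)) * k)%C). ring.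
    + apply (filterdiff_comp' (V := C3) (W := C_NormedModule) _ (fun q : C3 => snd (snd q)) z _ (fun q : C3 => snd (snd q)) Hcomp).
      apply filterdiff_linear. apply (is_linear_comp (V := C2) (fun q : C3 => snd q) (fun q : C2 => snd q)); [apply is_linear_snd|apply is_linear_snd].
  - apply (cfd_ext_l (U := C_NormedModule)) with (fun k : C => fst (dpsi ((k, (d1 * k, d2 * k)%C) : C3))).
    + intros k. rewrite El. change ((k * s * fst (dpsi Y))%C = (s * fst (dpsi Y) * k)%C). ring.
    + apply (filterdiff_comp' (V := C3) (W := C_NormedModule) _ (fun q : C3 => fst q) z _ (fun q : C3 => fst q) Hcomp).
      apply filterdiff_linear, is_linear_fst.
Qed.

Lemma C3_components_le (p q : C3) :
  Cmod (fst (snd p) - fst (snd q)) <= norm (minus p q) /\ Cmod (snd (snd p) - snd (snd q)) <= norm (minus p q).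
Proof.
  destruct p as [x [y1 y2]], q as [x' [y1' y2']].
  change (minus ((x, (y1, y2)) : C3) ((x', (y1', y2')) : C3)) with (((x - x')%C, ((y1 - y1')%C, (y2 - y2')%C)) : C3).
  destruct (norm_C3 (x - x') (y1 - y1') (y2 - y2')) as [_ [H1 [H2 _]]]. simpl. split; assumption.
Qed.

(** * Displacement in a fibre against displacement of the first integrals *)

Section Forward.
Context (lambda a1 a2 : C) (c : nat -> C) (r0 M0 : R).
Context (Hlambda : lambda <> RtoC 0) (Ha : 0 < Re (a1 + a2)%C) (Hc0 : c 0%nat = RtoC 0) (Hg : geomb c r0 M0).
Context (th : R) (Hth : is_arg th lambda) (S0 : C -> Prop) (L : C -> C) (HAS0 : AS th PI S0) (HL : log_branch S0 L).

Local Notation X x := (xpow L x (a1 + a2)%C).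
Local Notation F1 := (f1 lambda a1 a2 c L).
Local Notation F2 := (f2 lambda a1 a2 c L).
Local Notation HS0 := (proj1 HAS0).

(** Closed subsectors see only finitely many terms of the Gevrey expansion; any
    power of [x] is available. *)
Lemma Gevrey_flat (psi : C3 -> C3) (Sd : C -> Prop) (r1 r2 : R) (N : nat) (eps : R) :
  AS th PI Sd -> 0 < eps -> Gevrey1_expansion Sd r1 r2 psi identity_coeff ->
  exists rho, (forall k, 0 < rho k <= 1) /\ forall x, Nice th rho x -> Sd x /\ S0 x /\
    forall y, polydisc r1 r2 y -> norm (minus (psi (x, y)) ((x, y) : C3)) <= eps * Cmod x ^ (S N).
Proof.
  intros HS He [_ HG]. destruct (AS_inter_sectors th Sd S0 HS HAS0) as [rh [Hrh HI]].
  apply Nice_shrink1. intros k.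
  (* By [arg_sec] the closed sector of half-opening [b] lies in the cone of index [S k], so its
     radius has to stay below [rh (S k)] as well as [rh k]. *)
  set (b := acos (/ (INR k + 2))). set (R := Rmin (rh k) (rh (S k) / 2)).
  assert (HR : 0 < R) by (apply Rmin_pos; [apply Hrh|specialize (Hrh (S k)); lra]).
  destruct (HG (th - b) (th + b) R HR) as [A [B [HA [HB Hest]]]].
  { intros x [Hx [t [Ht Hab]]]. apply HI. exists (S k). split.
    - assert (R <= rh (S k) / 2) by apply Rmin_r. specialize (Hrh (S k)). lra.
    - apply (arg_sec th k t x Ht). apply Rabs_le. fold b. lra. }
  (* The expansion is used to order [N + 2], one more than announced; the spare power of [x] is
     traded for the factor [eps]. *)
  set (Q := A * B ^ (S (S N)) * INR (Factorial.fact (S (S N)))).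
  assert (HQ : 0 < Q).
  { unfold Q. apply Rmult_lt_0_compat; [apply Rmult_lt_0_compat; [exact HA|apply pow_lt; exact HB]|apply INR_fact_lt_0]. }
  exists (Rmin R (eps / Q)). split; [apply Rmin_pos; [exact HR|now apply Rdiv_lt_0_compat]|].
  intros x Hx Hxr.
  assert (Hx1 := Rlt_le_trans _ _ _ Hxr (Rmin_l _ _)). assert (Hx2 := Rlt_le_trans _ _ _ Hxr (Rmin_r _ _)).
  destruct (HI x) as [I1 I2].
  { exists k. split; [eapply Rlt_le_trans; [exact Hx1|apply Rmin_l]|exact Hx]. }
  split; [exact I1|]. split; [exact I2|]. intros y Hy.
  destruct (sec_arg th k x Hx) as [t [Ht Htb]]. fold b in Htb. apply Rabs_le_between in Htb.
  assert (E := Hest (S (S N)) x y).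
  rewrite sum_below_identity in E. fold Q in E. eapply Rle_trans; [apply E; [|exact Hy]|].
  - split; [lra|]. exists t. split; [exact Ht|lra].
  - assert (Hm := Cmod_ge_0 x). assert (0 <= Cmod x ^ S N) by (apply pow_le; exact Hm).
    change (Cmod x ^ S (S N)) with (Cmod x * Cmod x ^ S N).
    rewrite <- Rmult_assoc. apply Rmult_le_compat_r; [assumption|].
    apply Rle_trans with (Q * (eps / Q)); [apply Rmult_le_compat_l; lra|apply Req_le; field; lra].
Qed.

Definition first1 (p : C3) : C := (fst (snd p) / F1 (fst p) (fst (snd p) * snd (snd p) / X (fst p)))%C.
Definition first2 (p : C3) : C := (snd (snd p) / F2 (fst p) (fst (snd p) * snd (snd p) / X (fst p)))%C.

Lemma Hmap_h p : Hmap lambda a1 a2 c L p = (fst p, (first1 p, first2 p)).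
Proof. reflexivity. Qed.

Lemma w_X (u v x : C) : (u * v / X x * X x)%C = (u * v)%C.
Proof. field. apply xpow_neq0. Qed.

Lemma hol_h1 {U : NormedModule C_AbsRing} (f : U -> C3) p : ex_filterdiff f (locally p) -> S0 (fst (f p)) ->
  Cmod (fst (snd (f p)) * snd (snd (f p))) <= r0 / 4 -> hol (fun q => first1 (f q)) p.
Proof.
  intros Hf HS Hv. assert (P0 := hol_proj0 f p Hf). assert (P1 := hol_proj1 f p Hf). assert (P2 := hol_proj2 f p Hf).
  apply hol_div; [apply F1_neq0|exact P1|].
  apply (hol_F1 lambda a1 a2 c r0 M0 Ha Hc0 Hg S0 L HS0 HL (fun q => fst (f q)) (fun q => (fst (snd (f q)) * snd (snd (f q)) / X (fst (f q)))%C)); trivial.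
  - apply hol_div; [apply xpow_neq0|now apply hol_mult|now apply (hol_xpow S0 L HS0 HL)].
  - rewrite w_X. exact Hv.
Qed.

Lemma hol_h2 {U : NormedModule C_AbsRing} (f : U -> C3) p : ex_filterdiff f (locally p) -> S0 (fst (f p)) ->
  Cmod (fst (snd (f p)) * snd (snd (f p))) <= r0 / 4 -> hol (fun q => first2 (f q)) p.
Proof.
  intros Hf HS Hv. assert (P0 := hol_proj0 f p Hf). assert (P1 := hol_proj1 f p Hf). assert (P2 := hol_proj2 f p Hf).
  apply hol_div; [apply F2_neq0|exact P2|].
  apply (hol_F2 lambda a1 a2 c r0 M0 Ha Hc0 Hg S0 L HS0 HL (fun q => fst (f q)) (fun q => (fst (snd (f q)) * snd (snd (f q)) / X (fst (f q)))%C)); trivial.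
  - apply hol_div; [apply xpow_neq0|now apply hol_mult|now apply (hol_xpow S0 L HS0 HL)].
  - rewrite w_X. exact Hv.
Qed.

Definition wprod (p : C3) : C := (fst (snd p) * snd (snd p) / X (fst p))%C.

Lemma hol_wof {U : NormedModule C_AbsRing} (f : U -> C3) p : ex_filterdiff f (locally p) -> S0 (fst (f p)) -> hol (fun q => wprod (f q)) p.
Proof.
  intros Hf HS. apply hol_div; [apply xpow_neq0|apply hol_mult; [now apply hol_proj1|now apply hol_proj2]|].
  apply (hol_xpow S0 L HS0 HL (fun q => fst (f q))); [now apply hol_proj0|exact HS].
Qed.

(** Both components change by a relative factor [e^(E(x,w) - E(x,w'))]. *)
Lemma component_shift : exists K, 0 < K /\ forall x y1 y2 z1 z2 : C, S0 x ->
  Cmod y1 <= / 2 -> Cmod y2 <= / 2 -> Cmod z1 <= / 2 -> Cmod z2 <= / 2 ->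
  Cmod (y1 * y2) <= r0 / 4 -> Cmod (z1 * z2) <= r0 / 4 ->
  forall del, Cmod (z1 - y1) <= del -> Cmod (z2 - y2) <= del -> K * del * (1 + Cmod (L x)) / Cmod x <= 1 -> Cmod x <= 1 ->
  Cmod (z1 * (F1 x (y1 * y2 / X x) / F1 x (z1 * z2 / X x)) - y1) <= K * del * (1 + Cmod (L x)) / Cmod x /\
  Cmod (z2 * (F2 x (y1 * y2 / X x) / F2 x (z1 * z2 / X x)) - y2) <= K * del * (1 + Cmod (L x)) / Cmod x.
Proof.
  destruct (expo_diff lambda a1 a2 c r0 M0 Ha Hc0 Hg S0 L HL) as [KE [HKE HE]].
  set (K := KE + 3 * exp 1 * KE + 1). assert (He1 := exp_pos 1).
  assert (HK : KE <= K /\ 3 * exp 1 * KE / 2 + 1 <= K) by (unfold K; split; nra).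
  exists K. split; [unfold K; nra|].
  intros x y1 y2 z1 z2 Hx Hy1 Hy2 Hz1 Hz2 Hv Hv' del H1 H2 Hsm Hx1.
  assert (Hx0 := S0_neq0 S0 L HL x Hx). assert (Hm : 0 < Cmod x) by (apply Cmod_gt_0; exact Hx0).
  assert (Hdel : 0 <= del) by (eapply Rle_trans; [apply Cmod_ge_0|exact H1]).
  assert (HLx := Cmod_ge_0 (L x)).
  set (v := (y1 * y2)%C) in *. set (v' := (z1 * z2)%C) in *.
  set (J := (1 + Cmod (L x)) / Cmod x).
  assert (HJ : 1 <= J).
  { unfold J. apply Rmult_le_reg_r with (Cmod x); [exact Hm|]. unfold Rdiv. rewrite Rmult_assoc, Rinv_l; lra. }
  replace (K * del * (1 + Cmod (L x)) / Cmod x) with (K * del * J) in * by (unfold J; field; lra).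
  assert (Hvv : Cmod (v' - v) <= del).
  { unfold v, v'. replace (z1 * z2 - y1 * y2)%C with (z1 * (z2 - y2) + (z1 - y1) * y2)%C by ring.
    eapply Rle_trans; [apply Cmod_triangle|]. rewrite !Cmod_mult.
    generalize (Cmod_ge_0 z1) (Cmod_ge_0 y2) (Cmod_ge_0 (z2 - y2)) (Cmod_ge_0 (z1 - y1)). intros. nra. }
  assert (Hb : Cmod v <= 1 /\ Cmod v' <= 1).
  { unfold v, v'. rewrite !Cmod_mult. generalize (Cmod_ge_0 z1) (Cmod_ge_0 y2) (Cmod_ge_0 z2) (Cmod_ge_0 y1). intros. split; nra. }
  assert (HEd := HE x v v' Hx Hv Hv' (proj1 Hb) (proj2 Hb)).
  set (D := (f_exponent lambda a1 a2 c L x (v' / X x) - f_exponent lambda a1 a2 c L x (v / X x))%C) in *.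
  assert (HD : Cmod D <= KE * del * J).
  { eapply Rle_trans; [exact HEd|]. replace (KE * Cmod (v' - v) * (1 + Cmod (L x)) / Cmod x) with (KE * Cmod (v' - v) * J) by (unfold J; field; lra).
    apply Rmult_le_compat_r; [lra|]. apply Rmult_le_compat_l; lra. }
  assert (HdJ : 0 <= del * J) by (apply Rmult_le_pos; lra).
  assert (HD1 : Cmod D <= 1).
  { eapply Rle_trans; [exact HD|]. eapply Rle_trans; [|exact Hsm]. rewrite !Rmult_assoc. apply Rmult_le_compat_r; lra. }
  assert (EF1 : (F1 x (v / X x) / F1 x (v' / X x))%C = Cexp (- D)).
  { unfold f1, D.
    replace (- (f_exponent lambda a1 a2 c L x (v' / X x) - f_exponent lambda a1 a2 c L x (v / X x)))%C
      with (f_exponent lambda a1 a2 c L x (v / X x) - f_exponent lambda a1 a2 c L x (v' / X x))%C by ring.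
    rewrite Cexp_minus. field. split; [apply Cexp_neq0|apply xpow_neq0]. }
  assert (EF2 : (F2 x (v / X x) / F2 x (v' / X x))%C = Cexp D).
  { unfold f2, D.
    replace (f_exponent lambda a1 a2 c L x (v' / X x) - f_exponent lambda a1 a2 c L x (v / X x))%C
      with ((- f_exponent lambda a1 a2 c L x (v / X x)) - (- f_exponent lambda a1 a2 c L x (v' / X x)))%C by ring.
    rewrite Cexp_minus. field. split; [apply Cexp_neq0|apply xpow_neq0]. }
  rewrite EF1, EF2.
  assert (Gen : forall y z D' : C, Cmod z <= / 2 -> Cmod (z - y) <= del -> Cmod D' = Cmod D -> Cmod (z * Cexp D' - y) <= K * del * J).
  { intros y z D' Hz Hzy ED. replace (z * Cexp D' - y)%C with (z * (Cexp D' - 1) + (z - y))%C by ring.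
    eapply Rle_trans; [apply Cmod_triangle|]. rewrite Cmod_mult.
    assert (T := Cmod_Cexp_le_1 D' ltac:(lra)). rewrite ED in T.
    assert (Cmod z * Cmod (Cexp D' - 1) <= / 2 * (3 * exp 1 * (KE * del * J))).
    { apply Rmult_le_compat; try apply Cmod_ge_0; [exact Hz|]. eapply Rle_trans; [exact T|]. apply Rmult_le_compat_l; [lra|exact HD]. }
    apply Rle_trans with ((3 * exp 1 * KE / 2 + 1) * (del * J)).
    - assert (del <= del * J) by nra. nra.
    - rewrite (Rmult_assoc K). apply Rmult_le_compat_r; lra. }
  split; apply Gen; trivial. now rewrite Cmod_opp.
Qed.

End Forward.

Lemma Nice_min th rho rho' x : Nice th (fun k => Rmin (rho k) (rho' k)) x -> Nice th rho x /\ Nice th rho' x.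
Proof.
  intros [k [H1 H2]]. split; exists k; (split; [|exact H2]); (eapply Rlt_le_trans; [exact H1|]); [apply Rmin_l|apply Rmin_r].
Qed.

Section ForwardGamma.
Context (lambda a1 a2 : C) (c : nat -> C) (r0 M0 : R).
Context (Hlambda : lambda <> RtoC 0) (Ha : 0 < Re (a1 + a2)%C) (Hc0 : c 0%nat = RtoC 0) (Hg : geomb c r0 M0).
Context (Hr0 : Rbar_lt r0 (C_CV_radius c)).
Context (th : R) (Hth : is_arg th lambda) (S0 : C -> Prop) (L : C -> C) (HAS0 : AS th PI S0) (HL : log_branch S0 L).

Local Notation X x := (xpow L x (a1 + a2)%C).
Local Notation F1 := (f1 lambda a1 a2 c L).
Local Notation F2 := (f2 lambda a1 a2 c L).
Local Notation HS0 := (proj1 HAS0).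
Local Notation h1 := (first1 lambda a1 a2 c L).
Local Notation h2 := (first2 lambda a1 a2 c L).
Local Notation wof := (wprod a1 a2 L).
Local Notation Y := (Ynorm lambda a1 a2 c).

Context (rho : nat -> R) (Hrho : forall k, 0 < rho k <= 1) (Hsub : forall x, Nice th rho x -> S0 x).
Context (r : R) (Hr : 0 < r <= / 4) (Hrr : r <= r0 / 4).
Context (psi : C3 -> C3).
Local Notation D := (sector_polydisc (Nice th rho) r r).
Context (Hpsi : pushforward_eq D psi Y Y) (Hfib : fibered_on D psi).
Context (Hsmall : forall p, D p -> norm (minus (psi p) p) <= r).

(** As [psi] moves points by at most [r], the product of the components of an image is below
    [(2 r)^2], hence within the range [r0 / 4] of the estimates on [c~]. *)
Lemma rr_small : r ^ 2 <= r0 / 16.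
Proof. simpl. nra. Qed.

Lemma D_prod p : D p -> Cmod (fst (snd p) * snd (snd p)) < r ^ 2.
Proof.
  intros [_ [H1 H2]]. rewrite Cmod_mult. replace (r ^ 2) with (r * r) by ring.
  apply Rmult_le_0_lt_compat; try apply Cmod_ge_0; assumption.
Qed.

Lemma D_comp p : D p -> Cmod (fst (snd (psi p))) < 2 * r /\ Cmod (snd (snd (psi p))) < 2 * r /\
  Cmod (fst (snd (psi p)) * snd (snd (psi p))) <= r0 / 4.
Proof.
  intros HD. destruct (C3_components_le (psi p) p) as [H1 H2]. assert (Hs := Hsmall p HD). destruct HD as [_ [Y1 Y2]].
  assert (A1 : Cmod (fst (snd (psi p))) < 2 * r).
  { generalize (Cmod_minus_ge (fst (snd (psi p))) (fst (snd p))). lra. }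
  assert (A2 : Cmod (snd (snd (psi p))) < 2 * r).
  { generalize (Cmod_minus_ge (snd (snd (psi p))) (snd (snd p))). lra. }
  split; [exact A1|]. split; [exact A2|]. rewrite Cmod_mult. assert (Q := rr_small).
  generalize (Cmod_ge_0 (fst (snd (psi p)))) (Cmod_ge_0 (snd (snd (psi p)))). intros. simpl in Q. nra.
Qed.

Lemma psi_ex p : D p -> ex_filterdiff psi (locally p).
Proof. intros HD. destruct (Hpsi p HD) as [d [Hd _]]. now exists d. Qed.

(** The factor [f_1] is taken at the source point, so that [gam1] is a displacement of [y_1]
    corrected by the ratio of [f_1] at source and image. *)
Definition gam1 (p : C3) : C := ((h1 (psi p) - h1 p) * F1 (fst p) (wof p))%C.
Definition gam2 (p : C3) : C := ((h2 (psi p) - h2 p) * F2 (fst p) (wof p))%C.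

Lemma hol_gam1 p : D p -> hol gam1 p.
Proof.
  intros HD. assert (Hx : S0 (fst p)) by apply Hsub, HD. assert (Hv := D_prod p HD). assert (Q := rr_small).
  assert (Hfp := Hfib p HD). destruct (D_comp p HD) as [_ [_ Hz]].
  assert (H4 : Cmod (fst (snd p) * snd (snd p)) <= r0 / 4) by lra.
  apply hol_mult; [apply hol_sub|].
  - apply (hol_h1 lambda a1 a2 c r0 M0 Ha Hc0 Hg th S0 L HAS0 HL psi p (psi_ex p HD)); [now rewrite Hfp|exact Hz].
  - apply (hol_h1 lambda a1 a2 c r0 M0 Ha Hc0 Hg th S0 L HAS0 HL (fun q => q) p (id_filterdiff p)); assumption.
  - apply (hol_F1 lambda a1 a2 c r0 M0 Ha Hc0 Hg S0 L HS0 HL (fun q => fst q) wof p).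
    + apply (hol_proj0 (fun q => q)), id_filterdiff.
    + apply (hol_wof a1 a2 th S0 L HAS0 HL (fun q => q)); [apply id_filterdiff|exact Hx].
    + exact Hx.
    + unfold wprod. rewrite w_X. exact H4.
Qed.

Lemma hol_gam2 p : D p -> hol gam2 p.
Proof.
  intros HD. assert (Hx : S0 (fst p)) by apply Hsub, HD. assert (Hv := D_prod p HD). assert (Q := rr_small).
  assert (Hfp := Hfib p HD). destruct (D_comp p HD) as [_ [_ Hz]].
  assert (H4 : Cmod (fst (snd p) * snd (snd p)) <= r0 / 4) by lra.
  apply hol_mult; [apply hol_sub|].
  - apply (hol_h2 lambda a1 a2 c r0 M0 Ha Hc0 Hg th S0 L HAS0 HL psi p (psi_ex p HD)); [now rewrite Hfp|exact Hz].
  - apply (hol_h2 lambda a1 a2 c r0 M0 Ha Hc0 Hg th S0 L HAS0 HL (fun q => q) p (id_filterdiff p)); assumption.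
  - apply (hol_F2 lambda a1 a2 c r0 M0 Ha Hc0 Hg S0 L HS0 HL (fun q => fst q) wof p).
    + apply (hol_proj0 (fun q => q)), id_filterdiff.
    + apply (hol_wof a1 a2 th S0 L HAS0 HL (fun q => q)); [apply id_filterdiff|exact Hx].
    + exact Hx.
    + unfold wprod. rewrite w_X. exact H4.
Qed.

Local Notation val := (valid th rho r (Agam lambda a1 a2 c L) (Tgam a1 a2 L)).

Lemma val_near x w h : val x w (Cmod h) -> exists d, 0 < d /\ forall z, Cmod (z - x) < d -> val z w (Cmod h).
Proof.
  assert (Q := rr_small).
  apply (valid_near_x th rho r); try lra.
  - apply Agam_pos.
  - apply Tgam_pos.
  - intros z Hz. apply (cdiff_Cmod (fun z => X z)). now apply (xpow_cdiff a1 a2 S0 L HS0 HL th rho Hsub).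
  - intros z w' Hz Hw. apply (cdiff_Cmod (fun z => F1 z w')).
    apply (F1_cdiff_x lambda a1 a2 c r0 M0 Ha Hc0 Hg S0 L HS0 HL th rho Hsub); [exact Hz|]. rewrite Cmod_mult. unfold Tgam in Hw. lra.
Qed.

(** On [H^-1(., h)] the two components of [psi] are integral curves of [Y / x^2]. *)
Lemma psi_curves x w h : val x w (Cmod h) ->
  let f1' := fun z => (h * F1 z w)%C in let f2' := fun z => (w / h * F2 z w)%C in
  cderiv (fun z => h1 (psi (z, (f1' z, f2' z)))) x 0%C /\ cderiv (fun z => h2 (psi (z, (f1' z, f2' z)))) x 0%C.
Proof.
  intros Hv f1' f2'. assert (Q := rr_small).
  destruct (val_D lambda a1 a2 c L th rho r (proj1 Hr) x w h Hv) as [Hh [HD [Hw Ew]]].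
  assert (Hx : S0 x) by apply Hsub, HD. assert (Hx0 := S0_neq0 S0 L HL x Hx).
  set (p := ((x, (f1' x, f2' x)) : C3)). change (D p) in HD.
  destruct (Hpsi p HD) as [dpsi [Hdpsi EY]].
  destruct (D_comp p HD) as [_ [_ Hz]].
  assert (Hfp := Hfib p HD). change (fst p) with x in Hfp.
  assert (Evw : (f1' x * f2' x)%C = (w * X x)%C).
  { transitivity ((h * F1 x w * (w / h * F2 x w) / X x) * X x)%C; [unfold f1', f2'; field; repeat split; first [apply xpow_neq0|exact Hh]|now rewrite <- Ew]. }
  assert (HwX : Cmod (w * X x) <= r0 / 4) by lra.
  assert (D1 : cderiv f1' x ((- lambda + a1 * x - CPSeries c (f1' x * f2' x)) * f1' x / (x * x))%C).
  { eapply cderiv_eq; [|apply cderiv_mult; [apply cderiv_const|apply (F1_curve lambda a1 a2 c r0 M0 Ha Hc0 Hg S0 L HS0 HL (fun _ => w) x Hx (cderiv_const w x) HwX)]].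
    rewrite Evw. unfold f1'. cfield. exact Hx0. }
  assert (D2 : cderiv f2' x ((lambda + a2 * x + CPSeries c (f1' x * f2' x)) * f2' x / (x * x))%C).
  { eapply cderiv_eq; [|apply cderiv_mult; [apply cderiv_const|apply (F2_curve lambda a1 a2 c r0 M0 Ha Hc0 Hg S0 L HS0 HL (fun _ => w) x Hx (cderiv_const w x) HwX)]].
    rewrite Evw. unfold f2'. cfield. repeat split; first [exact Hx0|exact Hh]. }
  destruct (curve_pushforward psi f1' f2' x _ _ dpsi (/ (x * x))%C (Y p) Hdpsi D1 D2) as [C1 [C2 _]].
  { unfold Ynorm, p. simpl fst. simpl snd.
    apply (C3_eq _ _ _ (/ (x * x) * (x ^ 2))%C (/ (x * x) * ((- lambda + a1 * x - CPSeries c (f1' x * f2' x)) * f1' x))%C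
      (/ (x * x) * ((lambda + a2 * x + CPSeries c (f1' x * f2' x)) * f2' x))%C); simpl; field; exact Hx0. }
  rewrite EY in C1, C2.
  set (z1 := fun z : C => fst (snd (psi (z, (f1' z, f2' z))))) in *. set (z2 := fun z : C => snd (snd (psi (z, (f1' z, f2' z))))) in *.
  destruct (first_integrals lambda a1 a2 c r0 M0 Ha Hc0 Hg S0 L HS0 HL z1 z2 x Hx Hz) as [I1 I2].
  { eapply cderiv_eq; [|exact C1].
    change (/ (x * x) * ((- lambda + a1 * fst (psi p) - CPSeries c (z1 x * z2 x)) * z1 x) = (- lambda + a1 * x - CPSeries c (z1 x * z2 x)) * z1 x / (x * x))%C.
    rewrite Hfp. field. exact Hx0. }
  { eapply cderiv_eq; [|exact C2].
    change (/ (x * x) * ((lambda + a2 * fst (psi p) + CPSeries c (z1 x * z2 x)) * z2 x) = (lambda + a2 * x + CPSeries c (z1 x * z2 x)) * z2 x / (x * x))%C.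
    rewrite Hfp. field. exact Hx0. }
  destruct (val_near x w h Hv) as [d [Hd Hnear]].
  assert (Hf : forall z, Cmod (z - x) < d -> fst (psi (z, (f1' z, f2' z))) = z).
  { intros z Hz'. destruct (val_D lambda a1 a2 c L th rho r (proj1 Hr) z w h (Hnear z Hz')) as [_ [HDz _]]. apply (Hfib _ HDz). }
  split.
  - apply (cderiv_ext_loc (fun z => z1 z / F1 z (z1 z * z2 z / X z))%C _ x 0%C d Hd); [|exact I1].
    intros z Hz'. unfold first1. now rewrite (Hf z Hz').
  - apply (cderiv_ext_loc (fun z => z2 z / F2 z (z1 z * z2 z / X z))%C _ x 0%C d Hd); [|exact I2].
    intros z Hz'. unfold first2. now rewrite (Hf z Hz').
Qed.

Lemma h_curve (x w h : C) : h <> 0%C -> wof (x, (h * F1 x w, w / h * F2 x w))%C = w /\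
  h1 (x, (h * F1 x w, w / h * F2 x w))%C = h /\ h2 (x, (h * F1 x w, w / h * F2 x w))%C = (w / h)%C.
Proof.
  intros Hh. assert (E : wof (x, (h * F1 x w, w / h * F2 x w))%C = w).
  { unfold wprod. simpl fst. simpl snd. rewrite <- (F1_F2 lambda a1 a2 c L x w). field.
    repeat split; first [exact Hh|apply F1_neq0|apply F2_neq0]. }
  split; [exact E|]. unfold wprod in E. unfold first1, first2. rewrite E. simpl fst. simpl snd.
  split; field; repeat split; first [exact Hh|apply F1_neq0|apply F2_neq0].
Qed.

(** The factor [|x^a|] for [gam2] compensates [1 / f_2 = f_1 / x^a]: both increments then satisfy
    [gV]. *)
Context (Hgam : forall p, D p -> Cmod (gam1 p) <= Cmod (fst p) /\ Cmod (gam2 p) <= Cmod (fst p) * Cmod (X (fst p)) /\ Cmod (gam2 p) <= 1).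

(** Cauchy's estimate on [|y_1| = R] at an arbitrary [x]. In the second bound [1 / |f_2|] is
    rewritten as [|f_1| / |x^a|], which explains the prefactor in the definition of [E_2]. *)
Lemma forward_coeffs : exists P1 P2 : nat -> C -> C, (forall k, entire (P1 k)) /\ (forall k, entire (P2 k)) /\
  (forall p, D p -> is_expansion 2 P1 (h1 p) (wof p) (h1 p) (h1 (psi p)) /\ is_expansion 0 P2 (h2 p) (wof p) (h1 p) (h2 (psi p))) /\
  (forall k x w R, Nice th rho x -> 0 < R < r -> Cmod (w * X x) < R * r ->
     Cmod (P1 k w) <= Cmod (F1 x w) ^ (1 + k) / R ^ (2 + k) /\
     Cmod (P2 k w) <= / Cmod (X x) * (Cmod (F1 x w) ^ (k + 1) / R ^ k)).
Proof.
  assert (Q := rr_small). assert (Q4 : r ^ 2 <= r0 / 4) by lra.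
  assert (Hinv : forall F : C -> C, forall w, F w <> RtoC 0 -> cdiff F w -> cdiff (fun w => / F w)%C w).
  { intros F w HF [d Hd]. eexists. apply cderiv_Cinv; eassumption. }
  destruct (gam_expansion_D lambda a1 a2 c r0 M0 Hlambda Ha Hc0 Hg S0 L HS0 HL th Hth rho Hrho Hsub r (proj1 Hr) Q4
    gam1 (fun x w => / F1 x w)%C 2) as [P1 [E1 [S1 B1]]].
  { intros p HD. split; [now apply hol_gam1|]. eapply Rle_trans; [apply Hgam, HD|]. apply (Nice_le1 th rho Hrho), HD. }
  { intros x w Hx Hw. apply Hinv; [apply F1_neq0|]. now apply (F1_cdiff_w lambda a1 a2 c r0 M0 Ha Hc0 Hg S0 L HS0 HL th rho Hsub). }
  { intros x w h Hv. destruct (val_D lambda a1 a2 c L th rho r (proj1 Hr) x w h Hv) as [Hh _].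
    destruct (psi_curves x w h Hv) as [C1 _].
    apply (cderiv_ext (fun z => h1 (psi (z, (h * F1 z w, w / h * F2 z w))%C) - h)%C).
    - intros z. unfold Ngam, gam1. destruct (h_curve z w h Hh) as [W1 [W2 _]]. rewrite W1, W2. simpl fst. field. apply F1_neq0.
    - eapply cderiv_eq; [|apply cderiv_minus; [exact C1|apply cderiv_const]]. cring. }
  { intros x w y1 y2 HD Ew HF. rewrite Cmod_mult, Cmod_inv by apply F1_neq0.
    destruct (Hgam _ HD) as [G1 _]. simpl fst in G1. assert (Hp := Agam_pos lambda a1 a2 c L x w). unfold Agam in Hp.
    replace (Cmod (gam1 (x, (y1, y2))) * / Cmod (F1 x w) * Cmod (F1 x w) ^ 2) with (Cmod (gam1 (x, (y1, y2))) * Cmod (F1 x w)) by (field; lra).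
    apply Rmult_le_compat_r; lra. }
  destruct (gam_expansion_D lambda a1 a2 c r0 M0 Hlambda Ha Hc0 Hg S0 L HS0 HL th Hth rho Hrho Hsub r (proj1 Hr) Q4
    gam2 (fun x w => / F2 x w)%C 0) as [P2 [E2 [S2 B2]]].
  { intros p HD. split; [now apply hol_gam2|]. apply Hgam, HD. }
  { intros x w Hx Hw. apply Hinv; [apply F2_neq0|]. now apply (F2_cdiff_w lambda a1 a2 c r0 M0 Ha Hc0 Hg S0 L HS0 HL th rho Hsub). }
  { intros x w h Hv. destruct (val_D lambda a1 a2 c L th rho r (proj1 Hr) x w h Hv) as [Hh _].
    destruct (psi_curves x w h Hv) as [_ C2].
    apply (cderiv_ext (fun z => h2 (psi (z, (h * F1 z w, w / h * F2 z w))%C) - w / h)%C).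
    - intros z. unfold Ngam, gam2. destruct (h_curve z w h Hh) as [W1 [_ W2]]. rewrite W1, W2. simpl fst. field. repeat split; first [exact Hh|apply F2_neq0].
    - eapply cderiv_eq; [|apply cderiv_minus; [exact C2|apply cderiv_const]]. cring. }
  { intros x w y1 y2 HD Ew HF. rewrite Cmod_mult, Cmod_inv by apply F2_neq0.
    destruct (Hgam _ HD) as [_ [G2 _]]. simpl fst in G2. assert (Hp := Agam_pos lambda a1 a2 c L x w). unfold Agam in Hp.
    assert (EX : Cmod (X x) = Cmod (F1 x w) * Cmod (F2 x w)) by (rewrite <- (F1_F2 lambda a1 a2 c L x w), Cmod_mult; reflexivity).
    assert (HF2 : 0 < Cmod (F2 x w)) by (apply Cmod_gt_0, F2_neq0). rewrite EX in G2. rewrite pow_O, Rmult_1_r.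
    apply Rmult_le_reg_r with (Cmod (F2 x w)); [exact HF2|]. rewrite Rmult_assoc, Rinv_l, Rmult_1_r by lra. lra. }
  exists P1, P2. split; [exact E1|]. split; [exact E2|]. split.
  - intros p HD. destruct p as [x [y1 y2]].
    assert (T1 := S1 x y1 y2 _ HD eq_refl). assert (T2 := S2 x y1 y2 _ HD eq_refl).
    change (y1 * y2 / X x)%C with (wof (x, (y1, y2))) in T1, T2. set (p := (x, (y1, y2)) : C3) in *.
    change (y1 / F1 x (wof p))%C with (h1 p) in T1, T2.
    assert (G1 : (h1 (psi p) - h1 p)%C = (gam1 p * / F1 x (wof p))%C) by (unfold gam1; change (fst p) with x; field; apply F1_neq0).
    assert (G2 : (h2 (psi p) - h2 p)%C = (gam2 p * / F2 x (wof p))%C) by (unfold gam2; change (fst p) with x; field; apply F2_neq0).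
    split.
    + change (cseries (fun k => (P1 k (wof p) * h1 p ^ (2 + k))%C) (h1 (psi p) - h1 p)%C).
      rewrite G1. exact T1.
    + change (cseries (fun k => (P2 k (wof p) * h1 p ^ (0 + k))%C) (h2 (psi p) - h2 p)%C).
      rewrite G2. exact T2.
  - intros k x w R Hx HR Hw. assert (Hp := Agam_pos lambda a1 a2 c L x w). unfold Agam in Hp.
    assert (EX : Cmod (X x) = Cmod (F1 x w) * Cmod (F2 x w)) by (rewrite <- (F1_F2 lambda a1 a2 c L x w), Cmod_mult; reflexivity).
    assert (HF2 : 0 < Cmod (F2 x w)) by (apply Cmod_gt_0, F2_neq0).
    assert (HRk : 0 < R ^ k) by (apply pow_lt; lra).
    split.
    + eapply Rle_trans; [apply (B1 k x w R Hx HR Hw)|]. apply Req_le. rewrite Cmod_inv by apply F1_neq0. simpl. field. repeat split; lra.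
    + eapply Rle_trans; [apply (B2 k x w R Hx HR Hw)|]. apply Req_le. rewrite Cmod_inv, EX by apply F2_neq0. rewrite Nat.add_1_r. simpl. field. repeat split; lra.
Qed.

End ForwardGamma.

(** * From isotropies to sequences of coefficients *)

Section PlusCase.
Context (lambda a1 a2 : C) (c : nat -> C) (r0 M0 : R).
Context (Hlambda : lambda <> RtoC 0) (Ha : 0 < Re (a1 + a2)%C) (Hc0 : c 0%nat = RtoC 0) (Hg : geomb c r0 M0).
Context (Hr0 : Rbar_lt r0 (C_CV_radius c)).
Context (th : R) (Hth : is_arg th lambda) (S0 : C -> Prop) (L : C -> C) (HAS0 : AS th PI S0) (HL : log_branch S0 L).

Local Notation X x := (xpow L x (a1 + a2)%C).
Local Notation F1 := (f1 lambda a1 a2 c L).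
Local Notation F2 := (f2 lambda a1 a2 c L).
Local Notation HS0 := (proj1 HAS0).
Local Notation h1 := (first1 lambda a1 a2 c L).
Local Notation h2 := (first2 lambda a1 a2 c L).
Local Notation wof := (wprod a1 a2 L).

Lemma h1_h2 p : (h1 p * h2 p)%C = wof p.
Proof.
  unfold first1, first2. fold (wof p). set (w := wof p).
  replace (fst (snd p) / F1 (fst p) w * (snd (snd p) / F2 (fst p) w))%C with (fst (snd p) * snd (snd p) / (F1 (fst p) w * F2 (fst p) w))%C
    by (field; repeat split; first [apply F1_neq0|apply F2_neq0]).
  rewrite F1_F2. reflexivity.
Qed.

Lemma forward_plus (psi : C3 -> C3) : Lambda th lambda a1 a2 c psi -> exists P : eseq * eseq,
  (E1_plus th lambda a1 a2 c S0 L (fst P) /\ E2_plus th lambda a1 a2 c S0 L (snd P)) /\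
  expansion_of Psi_plus th lambda a1 a2 c S0 L psi P.
Proof.
  intros [Sd [r1 [r2 [HSd [Hr1 [Hr2 [Hdom [_ [Hfib [_ [Hpush HGev]]]]]]]]]]].
  assert (Hrg : 0 < r0) by apply Hg.
  destruct (AS_inter_sectors th Sd S0 HSd HAS0) as [rh [Hrh HI]].
  destruct (L_bound S0 L HS0 HL th rh Hrh (fun x Hx => proj2 (HI x Hx))) as [KL [HKL HLb]].
  destruct (xpow_lower a1 a2 S0 L HS0 HL th rh Hrh (fun x Hx => proj2 (HI x Hx))) as [NX [KX [HKX HXl]]].
  destruct (component_shift lambda a1 a2 c r0 M0 Ha Hc0 Hg S0 L HL) as [K [HK Hshift]].
  set (r := Rmin (Rmin r1 r2 / 2) (Rmin (/ 4) (r0 / 4))).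
  assert (Hrpos : 0 < r) by (unfold r; assert (0 < Rmin r1 r2) by (now apply Rmin_pos); repeat apply Rmin_pos; lra).
  assert (Hr14 : r <= / 4) by (eapply Rle_trans; [apply Rmin_r|apply Rmin_l]).
  assert (Hr04 : r <= r0 / 4) by (eapply Rle_trans; [apply Rmin_r|apply Rmin_r]).
  assert (Hrr1 : r < r1).
  { assert (r <= Rmin r1 r2 / 2) by apply Rmin_l. generalize (Rmin_l r1 r2). lra. }
  assert (Hrr2 : r < r2).
  { assert (r <= Rmin r1 r2 / 2) by apply Rmin_l. generalize (Rmin_r r1 r2). lra. }
  set (kx := Rmin 1 KX). assert (Hkx : 0 < kx) by (apply Rmin_pos; lra).
  (* Absorbs the constants of [component_shift] and [L_bound], and the constant of the lower bound
     for [|x^a|]. *)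
  set (eps := Rmin r (kx / (K * KL))).
  assert (HKKL : 0 < K * KL) by (apply Rmult_lt_0_compat; assumption).
  assert (Heps : 0 < eps) by (apply Rmin_pos; [exact Hrpos|now apply Rdiv_lt_0_compat]).
  assert (Heps1 : eps <= r) by apply Rmin_l.
  assert (Heps2 : K * KL * eps <= kx).
  { apply Rle_trans with (K * KL * (kx / (K * KL))); [apply Rmult_le_compat_l; [lra|apply Rmin_r]|apply Req_le; field; split; lra]. }
  (* This gives [|x|^(NX + 4)]: [NX] powers for [|x^a|], two lost to [(1 + |log x|) / |x|], and two
     left, of which the bounds on [gam1] and [gam2] require one. *)
  destruct (Gevrey_flat th S0 HAS0 psi Sd r1 r2 (NX + 3) eps HSd Heps HGev) as [rho1 [Hrho1 HF]].
  set (rho := fun k => Rmin (rh k) (rho1 k)).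
  assert (Hrho : forall k, 0 < rho k <= 1).
  { intros k. unfold rho. split; [apply Rmin_pos; [apply Hrh|apply Hrho1]|]. eapply Rle_trans; [apply Rmin_l|apply Hrh]. }
  assert (HN : forall x, Nice th rho x -> Nice th rh x /\ Nice th rho1 x) by (intros x; apply Nice_min).
  assert (Hsub : forall x, Nice th rho x -> S0 x) by (intros x Hx; apply HI, HN, Hx).
  set (D := sector_polydisc (Nice th rho) r r).
  assert (HD : forall p, D p -> sector_polydisc Sd r1 r2 p).
  { intros p [Hx [H1 H2]]. split; [apply HI, HN, Hx|]. split; lra. }
  assert (Hnorm : forall p, D p -> norm (minus (psi p) p) <= eps * Cmod (fst p) ^ (NX + 4)).
  { intros [x y] HDp. assert (HDp' := HD _ HDp). destruct HDp as [Hx _]. simpl fst in Hx.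
    destruct (HF x (proj2 (HN x Hx))) as [_ [_ Hf]]. replace (NX + 4)%nat with (S (NX + 3)) by lia. apply Hf. apply HDp'. }
  assert (Hle1 : forall x, Nice th rho x -> 0 < Cmod x <= 1).
  { intros x Hx. split; [apply (Nice_neq0 th rho x Hx)|apply (Nice_le1 th rho Hrho x Hx)]. }
  assert (Hsmall : forall p, D p -> norm (minus (psi p) p) <= r).
  { intros p HDp. eapply Rle_trans; [apply Hnorm, HDp|]. destruct (Hle1 (fst p) (proj1 HDp)) as [A B].
    assert (Cmod (fst p) ^ (NX + 4) <= 1) by (rewrite <- (pow1 (NX + 4)); apply pow_incr; lra).
    assert (0 <= Cmod (fst p) ^ (NX + 4)) by (apply pow_le; lra). nra. }
  assert (Hfib' : fibered_on D psi) by (intros p HDp; apply Hfib, HD, HDp).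
  assert (Hpush' : pushforward_eq D psi (Ynorm lambda a1 a2 c) (Ynorm lambda a1 a2 c)) by (intros p HDp; apply Hpush, HD, HDp).
  assert (Hgam : forall p, D p -> Cmod (gam1 lambda a1 a2 c L psi p) <= Cmod (fst p) /\
     Cmod (gam2 lambda a1 a2 c L psi p) <= Cmod (fst p) * Cmod (X (fst p)) /\ Cmod (gam2 lambda a1 a2 c L psi p) <= 1).
  { intros p HDp. set (x := fst p). assert (Hx : Nice th rho x) by apply HDp. destruct (Hle1 x Hx) as [Hx0 Hx1].
    assert (Hfp := Hfib' p HDp). fold x in Hfp.
    assert (Hn := Hnorm p HDp). fold x in Hn.
    destruct (C3_components_le (psi p) p) as [Q1 Q2].
    destruct (D_comp r0 th rho r (conj Hrpos Hr14) Hr04 psi Hsmall p HDp) as [Z1 [Z2 Z3]].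
    assert (V := D_prod th rho r p HDp).
    set (del := eps * Cmod x ^ (NX + 4)) in *.
    assert (Hdel0 : 0 <= del) by (apply Rmult_le_pos; [lra|apply pow_le; lra]).
    set (y1 := fst (snd p)) in *. set (y2 := snd (snd p)) in *.
    set (z1 := fst (snd (psi p))) in *. set (z2 := snd (snd (psi p))) in *.
    destruct (HDp) as [_ [Hy1 Hy2]]. fold y1 in Hy1. fold y2 in Hy2.
    assert (Hbound : K * del * (1 + Cmod (L x)) / Cmod x <= kx * Cmod x ^ NX * Cmod x * Cmod x).
    { assert (HLx := HLb x (proj1 (HN x Hx))).
      apply Rle_trans with (K * del * (KL / Cmod x) / Cmod x).
      - unfold Rdiv at 1 2. apply Rmult_le_compat_r; [apply Rlt_le, Rinv_0_lt_compat; lra|].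
        apply Rmult_le_compat_l; [apply Rmult_le_pos; lra|exact HLx].
      - unfold del. rewrite pow_add.
        replace (K * (eps * (Cmod x ^ NX * Cmod x ^ 4)) * (KL / Cmod x) / Cmod x) with (K * KL * eps * (Cmod x ^ NX * Cmod x * Cmod x)) by (field; lra).
        replace (kx * Cmod x ^ NX * Cmod x * Cmod x) with (kx * (Cmod x ^ NX * Cmod x * Cmod x)) by ring. apply Rmult_le_compat_r; [|exact Heps2].
        apply Rmult_le_pos; [apply Rmult_le_pos; [apply pow_le; lra|lra]|lra]. }
    assert (Hpn : 0 <= Cmod x ^ NX <= 1) by (split; [apply pow_le; lra|rewrite <- (pow1 NX); apply pow_incr; lra]).
    assert (Hkx1 : kx <= 1) by apply Rmin_l. assert (HkxK : kx <= KX) by apply Rmin_r.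
    set (J := kx * Cmod x ^ NX) in *.
    assert (HJ0 : 0 <= J) by (apply Rmult_le_pos; lra).
    assert (HJ1 : J <= 1) by (unfold J; nra).
    assert (HJX : J <= Cmod (X x)).
    { eapply Rle_trans; [|apply (HXl x (proj1 (HN x Hx)))]. unfold J. apply Rmult_le_compat_r; lra. }
    assert (HJx : J * Cmod x * Cmod x <= J * Cmod x).
    { rewrite <- (Rmult_1_r (J * Cmod x)) at 2. apply Rmult_le_compat_l; [nra|lra]. }
    assert (Q := rr_small r0 r (conj Hrpos Hr14) Hr04).
    assert (V' : Cmod (y1 * y2) <= r0 / 4) by (change (Cmod (y1 * y2) < r ^ 2) in V; lra).
    assert (Hb1 : K * del * (1 + Cmod (L x)) / Cmod x <= 1) by (eapply Rle_trans; [exact Hbound|]; nra).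
    assert (Z1' : Cmod z1 <= / 2) by lra. assert (Z2' : Cmod z2 <= / 2) by lra.
    assert (Y1' : Cmod y1 <= / 2) by lra. assert (Y2' : Cmod y2 <= / 2) by lra.
    destruct (Hshift x y1 y2 z1 z2 (Hsub x Hx) Y1' Y2' Z1' Z2' V' Z3 del) as [T1 T2]; [lra|lra|exact Hb1|lra|].
    assert (E1 : gam1 lambda a1 a2 c L psi p = (z1 * (F1 x (y1 * y2 / X x) / F1 x (z1 * z2 / X x)) - y1)%C).
    { unfold gam1, first1, wprod. rewrite Hfp. fold x y1 y2 z1 z2. field. split; apply F1_neq0. }
    assert (E2 : gam2 lambda a1 a2 c L psi p = (z2 * (F2 x (y1 * y2 / X x) / F2 x (z1 * z2 / X x)) - y2)%C).
    { unfold gam2, first2, wprod. rewrite Hfp. fold x y1 y2 z1 z2. field. split; apply F2_neq0. }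
    rewrite E1, E2. split; [|split].
    - eapply Rle_trans; [exact T1|]. eapply Rle_trans; [exact Hbound|]. nra.
    - eapply Rle_trans; [exact T2|]. eapply Rle_trans; [exact Hbound|]. eapply Rle_trans; [exact HJx|].
      rewrite Rmult_comm. apply Rmult_le_compat_l; lra.
    - eapply Rle_trans; [exact T2|]. eapply Rle_trans; [exact Hbound|]. nra. }
  destruct (forward_coeffs lambda a1 a2 c r0 M0 Hlambda Ha Hc0 Hg th Hth S0 L HAS0 HL rho Hrho Hsub r (conj Hrpos Hr14) Hr04 psi Hpush' Hfib' Hsmall Hgam)
    as [P1 [P2 [En1 [En2 [Hexp Hb]]]]].
  assert (HrR : Rbar_lt (r * r) (C_CV_radius c)).
  { apply (geomb_radius c r0 M0); [exact Hg|]. split; [nra|]. nra. }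
  exists (P1, P2). split; [split|].
  - split; [exact En1|]. exists r, r, (Nice th rho). split; [exact Hrpos|]. split; [exact Hrpos|]. split; [exact HrR|].
    split; [apply Nice_AS; intros k; apply Hrho|]. split; [exact Hsub|].
    (* The circle is [|y_1| = rt1 + delta], admissible since [|w x^a| <= rt1 rt2 < (rt1 + delta) r].
       The constant 2 makes the inequality strict. *)
    intros rt1 rt2 delta Hrt1 Hrt2 Hdel H1 H2. exists 2. split; [lra|]. intros x w Hx Hw k.
    assert (Hww : Cmod (w * X x) < (rt1 + delta) * r) by nra.
    destruct (Hb k x w (rt1 + delta) Hx ltac:(lra) Hww) as [B _].
    assert (Hp := Agam_pos lambda a1 a2 c L x w). unfold Agam in Hp.
    assert (HQ : 0 < Cmod (F1 x w) ^ (1 + k) / (rt1 + delta) ^ (2 + k)) by (apply Rdiv_lt_0_compat; apply pow_lt; lra).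
    replace (2 + k - 1)%nat with (1 + k)%nat by lia. simpl fst. lra.
  - split; [exact En2|]. exists r, r, (Nice th rho). split; [exact Hrpos|]. split; [exact Hrpos|]. split; [exact HrR|].
    split; [apply Nice_AS; intros k; apply Hrho|]. split; [exact Hsub|].
    intros rt1 rt2 delta Hrt1 Hrt2 Hdel H1 H2. exists 2. split; [lra|]. intros x w Hx Hw k.
    assert (Hww : Cmod (w * X x) < (rt1 + delta) * r) by nra.
    destruct (Hb k x w (rt1 + delta) Hx ltac:(lra) Hww) as [_ B].
    assert (Hp := Agam_pos lambda a1 a2 c L x w). unfold Agam in Hp.
    assert (HX0 : 0 < Cmod (X x)) by (apply Cmod_gt_0, xpow_neq0).
    assert (HQ : 0 < / Cmod (X x) * (Cmod (F1 x w) ^ (k + 1) / (rt1 + delta) ^ k)).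
    { apply Rmult_lt_0_compat; [now apply Rinv_0_lt_compat|]. apply Rdiv_lt_0_compat; apply pow_lt; lra. }
    simpl snd. change (0 + k)%nat with k. lra.
  - split; [exact En1|]. split; [exact En2|]. exists (Nice th rho), r, r.
    split; [apply Nice_AS; intros k; apply Hrho|]. split; [exact Hsub|]. split; [exact Hrpos|]. split; [exact Hrpos|].
    intros p HDp. destruct (Hdom p (HD p HDp)) as [Dm1 Dm2]. split; [exact Dm1|]. split; [exact Dm2|].
    intros x h Hh. rewrite Hmap_h in Hh. injection Hh as E0 Eh. subst x h.
    exists (h1 (psi p), h2 (psi p)). destruct (Hexp p HDp) as [X1 X2]. split.
    + unfold Psi_plus. simpl fst. simpl snd. rewrite h1_h2. split; assumption.
    + rewrite Hmap_h. now rewrite (Hfib' p HDp).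
Qed.

(** * Uniqueness of the coefficients *)

(** The mean of a partial sum against [h^(- k)] picks out [a k], and the partial sums tend to 0
    geometrically on [|h| = R] because the coefficients are bounded at radius [2 R]. *)
Lemma circle_unique (a : nat -> C) R M : geomb a (2 * R) M ->
  (forall h, Cmod h = R -> cseries (fun k => a k * h ^ k)%C (RtoC 0)) ->
  forall k, a k = 0%C.
Proof.
  intros Hga Hser k. assert (HPI := PI_RGT_0). assert (HR : 0 < R) by (destruct Hga as [Hg1 _]; lra).
  assert (HM : 0 <= M) by apply Hga. set (s := fun n h => cps a h n).
  assert (Hs : forall n h, Cmod h = R -> Cmod (s n h) <= 2 * M * (/ 2) ^ n).
  { intros n h Hh. destruct (CPSeries_approx a (2 * R) M h Hga) as [S1 S2]; [lra|].
    rewrite (is_series_C_unique _ _ _ S1 (Hser h Hh)) in S2. specialize (S2 n).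
    replace (0 - cps a h n)%C with (- cps a h n)%C in S2 by ring. rewrite Cmod_opp in S2. eapply Rle_trans; [exact S2|].
    rewrite Hh. replace (R / (2 * R)) with (/ 2) by (field; lra). simpl. assert (0 < (/ 2) ^ n) by (apply pow_lt; lra). nra. }
  assert (HC : forall n h, CC (s n) h).
  { intros n h. apply cdiff_CC. destruct (cps_cderiv a h n) as [d [Hd _]]. exists d. exact Hd. }
  assert (Hk0 : forall h, Cmod h = R -> h <> 0%C) by (intros h Hh; apply Cmod_gt_0; lra).
  assert (HI : forall h, Cmod h = R -> CC (fun h => / h ^ k)%C h).
  { intros h Hh. apply cdiff_CC, kap_neg; auto. }
  assert (Hmean : forall n, (k <= n)%nat -> circ R (fun h => s n h * / h ^ k)%C = (a k * RtoC (2 * PI))%C).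
  { assert (Hmono : forall j, circ R (fun h => (a j * h ^ j) * / h ^ k)%C = if Nat.eq_dec j k then (a k * RtoC (2 * PI))%C else 0%C).
    { intros j. destruct (Nat.eq_dec j k) as [->|Nj].
      - rewrite <- circ_const with (R := R). apply circ_ext; [lra|]. intros h Hh. field. apply Cpow_nz; auto.
      - destruct (Nat.lt_ge_cases j k) as [Hl|Hl].
        + transitivity (a j * circ R (fun h => / h ^ (k - j)))%C.
          * rewrite <- circ_scal; [|lra|intros h Hh; apply cdiff_CC, kap_neg; auto].
            apply circ_ext; [lra|]. intros h Hh. replace k with (j + (k - j))%nat at 1 by lia. rewrite Cpow_add_r.
            field. split; apply Cpow_nz; auto.
          * rewrite circ_inv_pow by (lra || lia). ring.
        + transitivity (a j * circ R (fun h => h ^ (j - k)))%C.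
          * rewrite <- circ_scal; [|lra|intros h Hh; apply cdiff_CC, kap_pos].
            apply circ_ext; [lra|]. intros h Hh. replace j with (k + (j - k))%nat at 2 by lia. rewrite Cpow_add_r.
            field. apply Cpow_nz; auto.
          * rewrite circ_pow by (lra || lia). ring. }
    assert (Hind : forall n, circ R (fun h => s n h * / h ^ k)%C = if Compare_dec.le_dec k n then (a k * RtoC (2 * PI))%C else 0%C).
    { induction n as [|n IH].
      - rewrite (circ_ext _ (fun h => (a 0%nat * h ^ 0) * / h ^ k)%C); [|lra|intros h Hh; unfold s, cps; now rewrite sum_n_C_0].
        rewrite Hmono. destruct (Nat.eq_dec 0 k), (Compare_dec.le_dec k 0); try lia; reflexivity.
      - rewrite (circ_ext _ (fun h => s n h * / h ^ k + (a (S n) * h ^ S n) * / h ^ k)%C).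
        + rewrite circ_plus, IH, Hmono; [|lra| |].
          * destruct (Nat.eq_dec (S n) k), (Compare_dec.le_dec k n), (Compare_dec.le_dec k (S n)); try lia; ring.
          * intros h Hh. apply CC_mult; [apply HC|auto].
          * intros h Hh. apply CC_mult; [|auto]. apply cdiff_CC, cdiff_mult; [apply cdiff_const|apply kap_pos].
        + lra.
        + intros h Hh. unfold s, cps. rewrite sum_n_C_S. ring. }
    intros n Hn. rewrite Hind. destruct (Compare_dec.le_dec k n); [reflexivity|lia]. }
  apply small_eq0 with (K := 2 * M * / R ^ k) (rho := / 2); [lra|]. intros n.
  assert (E := Hmean (n + k)%nat ltac:(lia)).
  assert (B : Cmod (circ R (fun h => s (n + k)%nat h * / h ^ k)%C) <= (2 * M * (/ 2) ^ n * / R ^ k) * (2 * PI)).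
  { apply circ_bound; [lra|intros h Hh; apply CC_mult; [apply HC|auto]|].
    intros h Hh. rewrite Cmod_mult, Cmod_inv, Cmod_pow, Hh by (apply Cpow_nz; auto).
    apply Rmult_le_compat_r; [apply Rlt_le, Rinv_0_lt_compat, pow_lt; lra|]. eapply Rle_trans; [now apply Hs|].
    apply Rmult_le_compat_l; [lra|]. rewrite pow_add. rewrite <- (Rmult_1_r ((/ 2) ^ n)) at 2.
    apply Rmult_le_compat_l; [apply pow_le; lra|]. rewrite <- (pow1 k). apply pow_incr. lra. }
  rewrite E, Cmod_mult, Cmod_R, (Rabs_pos_eq (2 * PI)) in B by lra. apply Rmult_le_reg_r in B; [|lra].
  eapply Rle_trans; [exact B|]. apply Req_le. ring.
Qed.

End PlusCase.

Lemma is_series_terms_bounded (a : nat -> C) (l : C) : cseries a l ->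
  exists M, 0 <= M /\ forall k, Cmod (a k) <= M.
Proof.
  intros H. destruct (proj1 (is_series_eps a l) H 1 Rlt_0_1) as [N HN].
  assert (Hfin : forall n, exists M, 0 <= M /\ forall k, (k <= n)%nat -> Cmod (a k) <= M).
  { induction n as [|n [M [HM IH]]].
    - exists (Cmod (a 0%nat)). split; [apply Cmod_ge_0|]. intros k Hk. replace k with 0%nat by lia. lra.
    - exists (Rmax M (Cmod (a (S n)))). split; [eapply Rle_trans; [exact HM|apply Rmax_l]|]. intros k Hk.
      destruct (Nat.eq_dec k (S n)) as [->|Hn]; [apply Rmax_r|]. eapply Rle_trans; [apply IH; lia|apply Rmax_l]. }
  destruct (Hfin N) as [M [HM HMk]]. exists (M + 2). split; [lra|]. intros k.
  destruct (Nat.le_gt_cases k N) as [Hk|Hk]; [specialize (HMk k Hk); lra|].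
  destruct k as [|k]; [lia|]. assert (H1 := HN k ltac:(lia)). assert (H2 := HN (S k) ltac:(lia)).
  rewrite sum_n_C_S in H2. set (s := csum a k) in *.
  replace (a (S k)) with ((s + a (S k) - l) + - (s - l))%C by ring.
  eapply Rle_trans; [apply Cmod_triangle|]. rewrite Cmod_opp. lra.
Qed.

(** Convergence at the outer radius [q / 2] bounds the coefficients; uniqueness is then applied on
    the inner circle of radius [q / 4]. *)
Lemma expansions_agree n0 (P P' : eseq) (w : C) q : 0 < q ->
  (forall h : C, q / 4 <= Cmod h <= q / 2 -> exists b z, is_expansion n0 P b w h z /\ is_expansion n0 P' b w h z) ->
  forall k, P k w = P' k w.
Proof.
  intros Hq H.
  assert (Hd : forall h : C, q / 4 <= Cmod h <= q / 2 ->
    cseries (fun k => (P k w - P' k w) * h ^ k)%C (RtoC 0)).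
  { intros h Hh. destruct (H h Hh) as [b [z [E1 E2]]]. assert (Hh0 : h <> RtoC 0) by (apply Cmod_gt_0; lra).
    assert (E := is_series_scal (K := C_AbsRing) (V := C_NormedModule) (/ h ^ n0)%C _ _ (is_series_minus _ _ _ _ E1 E2)).
    replace (RtoC 0) with (/ h ^ n0 * ((z - b) - (z - b)))%C by ring.
    eapply is_series_ext; [|exact E]. intros k.
    change (/ h ^ n0 * (P k w * h ^ (n0 + k) - P' k w * h ^ (n0 + k)) = (P k w - P' k w) * h ^ k)%C.
    rewrite Cpow_add_r. field. now apply Cpow_nz. }
  assert (E2 : Cmod (RtoC (q / 2)) = q / 2) by (rewrite Cmod_R; apply Rabs_pos_eq; lra).
  destruct (is_series_terms_bounded _ _ (Hd (RtoC (q / 2)) ltac:(lra))) as [M [HM Hb]].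
  assert (Hg : geomb (fun k => P k w - P' k w)%C (2 * (q / 4)) M).
  { split; [lra|]. split; [exact HM|]. intros k. eapply Rle_trans; [|apply (Hb k)].
    rewrite Cmod_mult, Cmod_pow, E2. apply Req_le. do 2 f_equal. lra. }
  intros k. assert (Z := circle_unique _ _ _ Hg (fun h Hh => Hd h ltac:(lra)) k). cbv beta in Z.
  replace (P k w) with ((P k w - P' k w) + P' k w)%C by ring. rewrite Z. ring.
Qed.

Section PlusUnique.
Context (lambda a1 a2 : C) (c : nat -> C).
Context (Ha : 0 < Re (a1 + a2)%C).
Context (th : R) (S0 : C -> Prop) (L : C -> C) (HAS0 : AS th PI S0) (HL : log_branch S0 L).

Local Notation X x := (xpow L x (a1 + a2)%C).
Local Notation F1 := (f1 lambda a1 a2 c L).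
Local Notation F2 := (f2 lambda a1 a2 c L).
Local Notation h1 := (first1 lambda a1 a2 c L).
Local Notation h2 := (first2 lambda a1 a2 c L).
Local Notation wof := (wprod a1 a2 L).
Local Notation expansion := (expansion_of Psi_plus th lambda a1 a2 c S0 L).

Lemma conjugate_common psi psi' P P' : expansion psi P -> expansion psi' P' ->
  exists rho r, (forall k, 0 < rho k <= 1) /\ 0 < r /\ (forall x, Nice th rho x -> S0 x) /\
    forall p, sector_polydisc (Nice th rho) r r p ->
      (fst (psi p) = fst p /\ is_expansion 2 (fst P) (h1 p) (wof p) (h1 p) (h1 (psi p)) /\
        is_expansion 0 (snd P) (h2 p) (wof p) (h1 p) (h2 (psi p))) /\
      (fst (psi' p) = fst p /\ is_expansion 2 (fst P') (h1 p) (wof p) (h1 p) (h1 (psi' p)) /\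
        is_expansion 0 (snd P') (h2 p) (wof p) (h1 p) (h2 (psi' p))).
Proof.
  intros [_ [_ [S [r1 [r2 [HS [HSS [Hr1 [Hr2 H]]]]]]]]] [_ [_ [S' [r1' [r2' [HS' [_ [Hr1' [Hr2' H']]]]]]]]].
  destruct (AS_inter_sectors th S S' HS HS') as [rho [Hrho HN]].
  exists rho, (Rmin (Rmin r1 r2) (Rmin r1' r2')). split; [exact Hrho|]. split; [repeat apply Rmin_pos; assumption|].
  split; [intros x Hx; apply HSS, HN, Hx|]. intros p [Hx [Hy1 Hy2]].
  assert (B1 := Rmin_l (Rmin r1 r2) (Rmin r1' r2')). assert (B2 := Rmin_r (Rmin r1 r2) (Rmin r1' r2')).
  generalize (Rmin_l r1 r2) (Rmin_r r1 r2) (Rmin_l r1' r2') (Rmin_r r1' r2'). intros.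
  destruct (HN _ Hx) as [Hx1 Hx2].
  destruct (H p) as [_ [_ Q]]; [split; [exact Hx1|]; split; lra|].
  destruct (H' p) as [_ [_ Q']]; [split; [exact Hx2|]; split; lra|].
  destruct (Q (fst p) (h1 p, h2 p) (Hmap_h lambda a1 a2 c L p)) as [z [[E1 E2] E3]].
  destruct (Q' (fst p) (h1 p, h2 p) (Hmap_h lambda a1 a2 c L p)) as [z' [[E1' E2'] E3']].
  rewrite Hmap_h in E3, E3'. injection E3 as E0 Ez. injection E3' as E0' Ez'. subst z z'.
  simpl fst in *. simpl snd in *. rewrite h1_h2 in *. repeat split; assumption.
Qed.

(** For a given [w], take [x] on the axis with [|w x^a| < r^2 / 4]. The points with
    [r / 4 <= |y_1| <= r / 2] then have [|y_2| < r], so a whole annulus of values of [h_1] is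
    available. *)
Lemma expansion_unique psi P P' : expansion psi P -> expansion psi P' -> P = P'.
Proof.
  intros H H'. destruct (conjugate_common psi psi P P' H H') as [rho [r [Hrho [Hr [Hsub Hc]]]]].
  assert (Hk : forall k w, fst P k w = fst P' k w /\ snd P k w = snd P' k w).
  { intros k w.
    destruct (xpow_small a1 a2 Ha S0 L (proj1 HAS0) HL th rho Hrho Hsub (r * r / 4 / (Cmod w + 1))) as [s1 [Hs1 Hs]].
    { generalize (Cmod_ge_0 w). intros. apply Rdiv_lt_0_compat; [nra|lra]. }
    set (s := Rmin s1 (rho 0%nat) / 2). assert (H0 : 0 < rho 0%nat) by apply Hrho.
    assert (Hsp : 0 < s < s1 /\ s < rho 0%nat).
    { unfold s. generalize (Rmin_l s1 (rho 0%nat)) (Rmin_r s1 (rho 0%nat)) (Rmin_pos s1 (rho 0%nat) Hs1 H0). lra. }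
    set (x := (RtoC s * cis th)%C). assert (Hx : Nice th rho x) by (apply Nice_axis; lra).
    assert (Hwx : Cmod w * Cmod (X x) < r * r / 4).
    { assert (Hm : Cmod x = s) by (unfold x; rewrite Cmod_mult, Cmod_R, Cmod_cis, Rabs_pos_eq; lra).
      assert (B := Hs x Hx ltac:(lra)). assert (Hw := Cmod_ge_0 w). assert (HX := Cmod_ge_0 (X x)).
      apply Rmult_lt_compat_r with (r := Cmod w + 1) in B; [|lra].
      replace (r * r / 4 / (Cmod w + 1) * (Cmod w + 1)) with (r * r / 4) in B by (field; lra). nra. }
    assert (HA : 0 < Cmod (F1 x w)) by (apply Cmod_gt_0, F1_neq0).
    assert (Hpt : forall h : C, r / Cmod (F1 x w) / 4 <= Cmod h <= r / Cmod (F1 x w) / 2 ->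
      h <> RtoC 0 /\ sector_polydisc (Nice th rho) r r (x, (h * F1 x w, w / h * F2 x w))%C).
    { intros h Hh. assert (Hq : 0 < r / Cmod (F1 x w)) by now apply Rdiv_lt_0_compat.
      assert (Hh0 : 0 < Cmod h) by lra. assert (Hn : h <> RtoC 0) by now apply Cmod_gt_0. split; [exact Hn|].
      assert (B1 : r / 4 <= Cmod h * Cmod (F1 x w) <= r / 2).
      { split.
        - replace (r / 4) with (r / Cmod (F1 x w) / 4 * Cmod (F1 x w)) by (field; lra). apply Rmult_le_compat_r; lra.
        - replace (r / 2) with (r / Cmod (F1 x w) / 2 * Cmod (F1 x w)) by (field; lra). apply Rmult_le_compat_r; lra. }
      split; [exact Hx|]. split.
      - change (Cmod (h * F1 x w) < r). rewrite Cmod_mult. lra.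
      - change (Cmod (w / h * F2 x w) < r). assert (E : Cmod (w / h * F2 x w) * (Cmod h * Cmod (F1 x w)) = Cmod w * Cmod (X x)).
        { rewrite <- (F1_F2 lambda a1 a2 c L x w), <- !Cmod_mult. f_equal. field. exact Hn. }
        assert (P0 := Cmod_ge_0 (w / h * F2 x w)). apply Rnot_le_lt. intros Hge. nra. }
    split; apply (expansions_agree 2 (fst P) (fst P') w (r / Cmod (F1 x w))) || apply (expansions_agree 0 (snd P) (snd P') w (r / Cmod (F1 x w)));
      try (now apply Rdiv_lt_0_compat); intros h Hh; destruct (Hpt h Hh) as [Hn HD];
      destruct (Hc _ HD) as [[_ [A1 A2]] [_ [B1 B2]]];
      destruct (h_curve lambda a1 a2 c L x w h Hn) as [W1 [W2 W3]]; rewrite W1, W2 in *; eauto. }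
  destruct P as [P1 P2], P' as [P1' P2']. f_equal; extensionality k; extensionality w; apply Hk.
Qed.

(** The expansion determines [h_1] and [h_2] of the image, and [Hinv] recovers the image from
    them. *)
Lemma expansion_germ_eq psi psi' P : expansion psi P -> expansion psi' P -> germ_eq th psi psi'.
Proof.
  intros H H'. destruct (conjugate_common psi psi' P P H H') as [rho [r [Hrho [Hr [Hsub Hc]]]]].
  exists (Nice th rho), r, r. split; [apply Nice_AS; intros k; apply Hrho|]. split; [exact Hr|]. split; [exact Hr|].
  intros p HD. destruct (Hc p HD) as [[E0 [A1 A2]] [E0' [B1 B2]]].
  assert (Z1 := is_series_C_unique _ _ _ A1 B1). assert (Z2 := is_series_C_unique _ _ _ A2 B2).
  rewrite <- (Hinv_Hmap lambda a1 a2 c L (psi p)), <- (Hinv_Hmap lambda a1 a2 c L (psi' p)). f_equal.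
  rewrite !Hmap_h, E0, E0'. f_equal. f_equal.
  - replace (h1 (psi p)) with ((h1 (psi p) - h1 p) + h1 p)%C by ring. rewrite Z1. ring.
  - replace (h2 (psi p)) with ((h2 (psi p) - h2 p) + h2 p)%C by ring. rewrite Z2. ring.
Qed.

Lemma expansion_germ_transfer psi psi' P : germ_eq th psi psi' -> expansion psi P -> expansion psi' P.
Proof.
  intros [S [r1 [r2 [HS [Hr1 [Hr2 H]]]]]] [En1 [En2 [S' [r1' [r2' [HS' [HSS [Hr1' [Hr2' H']]]]]]]]].
  split; [exact En1|]. split; [exact En2|].
  destruct (AS_inter_sectors th S S' HS HS') as [rho [Hrho HN]].
  exists (Nice th rho), (Rmin r1 r1'), (Rmin r2 r2'). split; [apply Nice_AS; intros k; apply Hrho|].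
  split; [intros x Hx; apply HSS, HN, Hx|]. split; [now apply Rmin_pos|]. split; [now apply Rmin_pos|].
  intros p [Hx [Hy1 Hy2]]. generalize (Rmin_l r1 r1') (Rmin_r r1 r1') (Rmin_l r2 r2') (Rmin_r r2 r2'). intros.
  rewrite <- (H p); [|split; [apply HN, Hx|split; lra]]. apply H'. split; [apply HN, Hx|split; lra].
Qed.

End PlusUnique.

(** * Displacement along [lambda / x] *)

Lemma dir_inv lambda th (T : C) : is_arg th lambda -> T <> RtoC 0 -> dir th (lambda / T) = Cmod lambda * Re T / Cmod T ^ 2.
Proof.
  intros Hth HT. apply is_arg_polar in Hth. destruct Hth as [_ El].
  assert (HT2 : 0 < Cmod T) by now apply Cmod_gt_0.
  unfold dir. replace (lambda / T * cis (- th))%C with (RtoC (Cmod lambda) * / T)%C.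
  - assert (E : Cmod T ^ 2 = Re T ^ 2 + Im T ^ 2) by (destruct T; unfold Cmod; rewrite pow2_sqrt; [reflexivity|simpl; nra]).
    rewrite E. destruct T as [u v]. unfold Re, Im in *. simpl fst in *. simpl snd in *.
    assert (u ^ 2 + v ^ 2 <> 0) by (rewrite <- E; apply pow_nonzero; lra). simpl. field. simpl in H. lra.
  - rewrite El at 2. assert (E : (cis th * cis (- th))%C = 1%C) by (rewrite <- cis_plus, Rplus_opp_r; apply cis_0).
    replace (RtoC (Cmod lambda) * cis th / T * cis (- th))%C with (RtoC (Cmod lambda) / T * (cis th * cis (- th)))%C by (field; exact HT).
    rewrite E. field. exact HT.
Qed.

(** Inversion [T = lambda / x] carries the cones around [th] to cones around the positive real axis,
    where a displacement by a real number is easy to control. *)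
Lemma sec_inv lambda th k (T : C) : is_arg th lambda -> T <> RtoC 0 -> sec th k (lambda / T) <-> Cmod T < Re T * (INR k + 2).
Proof.
  intros Hth HT. assert (Hl : 0 < Cmod lambda) by (apply Cmod_gt_0, Hth). assert (HT2 : 0 < Cmod T) by now apply Cmod_gt_0.
  unfold sec. rewrite (dir_inv lambda th T Hth HT), Cmod_div by exact HT.
  assert (Hp : 0 < Cmod lambda / Cmod T ^ 2) by (apply Rdiv_lt_0_compat; [lra|apply pow_lt; lra]).
  replace (Cmod lambda / Cmod T) with (Cmod lambda / Cmod T ^ 2 * Cmod T) by (field; lra).
  replace (Cmod lambda * Re T / Cmod T ^ 2 * (INR k + 2)) with (Cmod lambda / Cmod T ^ 2 * (Re T * (INR k + 2))) by (field; lra).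
  split; [apply Rmult_lt_reg_l, Hp|apply Rmult_lt_compat_l, Hp].
Qed.

Section Transport.
Context (lambda a1 a2 : C) (c : nat -> C) (r0 M0 : R).
Context (Hlambda : lambda <> RtoC 0) (Ha : 0 < Re (a1 + a2)%C) (Hc0 : c 0%nat = RtoC 0) (Hg : geomb c r0 M0).
Context (th : R) (Hth : is_arg th lambda) (S0 : C -> Prop) (L : C -> C) (HS0 : open S0) (HL : log_branch S0 L).
Context (rho : nat -> R) (Hrho : forall k, 0 < rho k <= 1) (Hsub : forall x, Nice th rho x -> S0 x).

Local Notation X x := (xpow L x (a1 + a2)%C).
Local Notation F1 := (f1 lambda a1 a2 c L).
Local Notation expo := (f_exponent lambda a1 a2 c L).

Lemma xpow_close (x y b : C) : Cmod (L y - L x) <= 1 -> Cmod (xpow L y b) <= exp (Cmod b) * Cmod (xpow L x b).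
Proof.
  intros H. unfold xpow. rewrite !Cmod_Cexp, <- exp_plus. apply exp_le.
  replace (b * L y)%C with (b * L x + b * (L y - L x))%C by ring. rewrite re_plus.
  assert (Q := Re_le_Cmod' (b * (L y - L x))). rewrite Cmod_mult in Q. apply Rabs_le_between in Q.
  assert (Cmod b * Cmod (L y - L x) <= Cmod b) by (generalize (Cmod_ge_0 b) (Cmod_ge_0 (L y - L x)); nra). lra.
Qed.

(** Moving [lambda / x] against the direction of growth of [f1] divides [f1] by an
    exponential in [1 / |x|]; the step [|lambda / x| / (2 (k + 2))] keeps the point in a sector. *)
Lemma transport V : V <= r0 / 4 -> (forall v, Cmod v <= V -> Cmod (CPSeries c v) <= Cmod lambda / 4) ->
  forall k x, sec th k x -> Cmod x < rho (3 * k + 4)%nat / 2 ->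
  exists x', Nice th rho x' /\ Cmod x' <= 2 * Cmod x /\
    Cmod (X x') <= exp (Cmod (a1 + a2)) * Cmod (X x) /\ Cmod (X x) <= exp (Cmod (a1 + a2)) * Cmod (X x') /\
    forall w, Cmod (w * X x) * exp (Cmod (a1 + a2)) <= V ->
      Cmod (F1 x' w) <= exp (Cmod a1) * exp (- (3 * Cmod lambda / (8 * (INR k + 2))) / Cmod x) * Cmod (F1 x w).
Proof.
  intros HV Hc k x Hsx Hx.
  assert (Hk := pos_INR k). assert (Hl : 0 < Cmod lambda) by (apply Cmod_gt_0; exact Hlambda).
  destruct (sec_pos th k x Hsx) as [_ Hxm]. assert (Hx0 : x <> RtoC 0) by now apply Cmod_gt_0.
  set (t := (lambda / x)%C). assert (Ht0 : t <> RtoC 0).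
  { intros E. apply Hlambda. replace lambda with (t * x)%C by (unfold t; field; exact Hx0). rewrite E. ring. }
  assert (Htm : 0 < Cmod t) by now apply Cmod_gt_0.
  assert (Ext : x = (lambda / t)%C) by (unfold t; field; split; assumption).
  assert (Htx : Cmod x = Cmod lambda / Cmod t) by (rewrite Ext, Cmod_div; [reflexivity|exact Ht0]).
  assert (Hre : Cmod t < Re t * (INR k + 2)) by (apply (sec_inv lambda th k t Hth Ht0); now rewrite <- Ext).
  set (sg := / (2 * (INR k + 2))).
  assert (Hsg : 0 < sg <= / 4) by (unfold sg; split; [apply Rinv_0_lt_compat; lra|apply Rinv_le_contravar; lra]).
  assert (Hsgk : sg * (2 * (INR k + 2)) = 1) by (unfold sg; field; lra).
  set (t' := (t - RtoC (sg * Cmod t))%C).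
  set (T := fun s : R => (t + RtoC s * (t' - t))%C).
  assert (Hd : forall s, 0 <= s -> Cmod (T s - t) = s * (sg * Cmod t)).
  { intros s Hs. unfold T. replace (t + RtoC s * (t' - t) - t)%C with (- RtoC (s * (sg * Cmod t)))%C by (unfold t'; rewrite !RtoC_mult; ring).
    rewrite Cmod_opp, Cmod_R, Rabs_pos_eq; [reflexivity|]. apply Rmult_le_pos; [lra|]. nra. }
  assert (HT : forall s, 0 <= s <= 1 -> 3 / 4 * Cmod t <= Cmod (T s) /\ Nice th rho (lambda / T s)%C /\ Cmod (lambda / T s) <= 2 * Cmod x /\ T s <> RtoC 0).
  { intros s Hs. assert (D := Hd s (proj1 Hs)).
    assert (Dle : s * (sg * Cmod t) <= sg * Cmod t) by (assert (0 <= sg * Cmod t) by nra; nra).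
    assert (B1 : 3 / 4 * Cmod t <= Cmod (T s)).
    { assert (A := Cmod_minus_ge t (T s)). replace (t - T s)%C with (- (T s - t))%C in A by ring. rewrite Cmod_opp, D in A. nra. }
    assert (B2 : Cmod (T s) <= 5 / 4 * Cmod t).
    { assert (A := Cmod_minus_ge (T s) t). rewrite D in A. nra. }
    assert (N : T s <> RtoC 0) by (apply Cmod_gt_0; lra).
    assert (B3 : Re (T s) = Re t - s * (sg * Cmod t)).
    { unfold T, t'. replace (t + RtoC s * (t - RtoC (sg * Cmod t) - t))%C with (t - RtoC (s * (sg * Cmod t)))%C by (rewrite !RtoC_mult; ring).
      destruct t. simpl. ring. }
    assert (Hm : Cmod (lambda / T s) <= 2 * Cmod x).
    { rewrite Cmod_div by exact N. rewrite Htx. unfold Rdiv. rewrite <- Rmult_assoc, (Rmult_comm 2), Rmult_assoc.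
      apply Rmult_le_compat_l; [lra|]. replace (2 * / Cmod t) with (/ (Cmod t / 2)) by (field; lra). apply Rinv_le_contravar; lra. }
    split; [exact B1|]. split; [|split; [exact Hm|exact N]].
    (* Along the step [Re (T s) >= |t| / (2 (k + 2))] and [|T s| <= 5/4 |t|]. The index [3 k + 4]
       gives the factor [3 (k + 2)], and [3/2 > 5/4]. *)
    exists (3 * k + 4)%nat. split; [lra|]. apply (sec_inv lambda th _ (T s) Hth N).
    rewrite plus_INR, mult_INR. replace (INR 3) with 3 by (simpl; ring). replace (INR 4) with 4 by (simpl; ring). rewrite B3.
    assert (2 * (Re t - s * (sg * Cmod t)) * (INR k + 2) >= Cmod t).
    { assert (s * (sg * Cmod t) * (2 * (INR k + 2)) <= Cmod t); [|nra].
      replace (s * (sg * Cmod t) * (2 * (INR k + 2))) with (s * Cmod t * (sg * (2 * (INR k + 2)))) by ring. rewrite Hsgk. nra. }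
    nra. }
  assert (HdL : forall s, 0 <= s <= 1 -> Cmod (L (lambda / T s) - L x) <= 1).
  { intros s Hs. rewrite Ext at 1. apply Rle_trans with (4 / (3 * Cmod t) * Cmod (T s - t)).
    - apply (cmvt (fun u => L (lambda / u)%C) (fun u => - / u)%C). intros u Hu.
      assert (Eu : (t + RtoC u * (T s - t))%C = T (u * s)) by (unfold T; rewrite RtoC_mult; ring). rewrite Eu.
      destruct (HT (u * s)) as [B1 [B2 [_ N]]]; [nra|]. split.
      + eapply cderiv_eq; [|apply (cderiv_comp (fun u => lambda / u)%C L); [apply cderiv_div; [exact N|apply cderiv_const|apply cderiv_id]|apply (L_cderiv S0 L HS0 HL), Hsub, B2]].
        cfield. split; assumption.
      + rewrite Cmod_opp, Cmod_inv by exact N. replace (4 / (3 * Cmod t)) with (/ (3 / 4 * Cmod t)) by (field; lra). apply Rinv_le_contravar; lra.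
    - rewrite Hd by lra. apply Rle_trans with (4 / (3 * Cmod t) * (1 * (/ 4 * Cmod t))).
      + apply Rmult_le_compat_l; [apply Rlt_le, Rdiv_lt_0_compat; lra|]. apply Rmult_le_compat; nra.
      + assert (4 / (3 * Cmod t) * (1 * (/ 4 * Cmod t)) = / 3) by (field; lra). lra. }
  assert (HT1 : T 1 = t') by (unfold T; ring).
  destruct (HT 1 ltac:(lra)) as [_ [N1 [N2 N3]]]. assert (L1 := HdL 1 ltac:(lra)). rewrite HT1 in *.
  assert (L1' : Cmod (L x - L (lambda / t')) <= 1).
  { replace (L x - L (lambda / t'))%C with (- (L (lambda / t') - L x))%C by ring. now rewrite Cmod_opp. }
  exists (lambda / t')%C. split; [exact N1|]. split; [exact N2|]. split; [now apply xpow_close|]. split; [now apply xpow_close|].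
  intros w Hw.
  (* In the variable [u = lambda / x] the exponent minus [u] has derivative [c(v) / lambda], of
     modulus at most [1/4]. So the real part drops by at least three quarters of the step. *)
  assert (Hstep : Cmod ((expo (lambda / t') w - t') - (expo (lambda / t) w - t)) <= / 4 * Cmod (t' - t)).
  { apply (cmvt (fun u => expo (lambda / u) w - u)%C (fun u => CPSeries c (w * X (lambda / u)) / lambda)%C). intros s Hs.
    fold (T s). destruct (HT s Hs) as [B1 [B2 [_ N]]].
    assert (HwV : Cmod (w * X (lambda / T s)) <= V).
    { eapply Rle_trans; [|exact Hw]. rewrite !Cmod_mult, Rmult_assoc. apply Rmult_le_compat_l; [apply Cmod_ge_0|].
      rewrite Rmult_comm. now apply xpow_close, HdL. }
    split.
    - eapply cderiv_eq; [|apply cderiv_minus; [|apply cderiv_id]].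
      2: { apply (cderiv_comp (fun u => lambda / u)%C (fun z => expo z w)); [apply cderiv_div; [exact N|apply cderiv_const|apply cderiv_id]|].
           apply (exponent_curve lambda a1 a2 c r0 M0 Ha Hc0 Hg S0 L HS0 HL (fun _ => w)); [apply Hsub, B2|apply cderiv_const|lra]. }
      cfield. split; assumption.
    - rewrite Cmod_div by exact Hlambda. apply Rmult_le_reg_r with (Cmod lambda); [exact Hl|].
      replace (Cmod (CPSeries c (w * X (lambda / T s))) / Cmod lambda * Cmod lambda) with (Cmod (CPSeries c (w * X (lambda / T s)))) by (field; lra).
      specialize (Hc _ HwV). lra. }
  rewrite <- Ext in Hstep.
  assert (Ed : Cmod (t' - t) = sg * Cmod t) by (rewrite <- HT1, Hd; lra). rewrite Ed in Hstep.
  assert (HRe : Re (expo (lambda / t') w) <= Re (expo x w) - 3 / 4 * (sg * Cmod t)).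
  { assert (Q := Rle_trans _ _ _ (Rle_trans _ _ _ (Rle_abs _) (Re_le_Cmod' _)) Hstep).
    assert (E : Re ((expo (lambda / t') w - t') - (expo x w - t)) = Re (expo (lambda / t') w) - Re (expo x w) + sg * Cmod t).
    { unfold t'. destruct (expo (lambda / (t - RtoC (sg * Cmod t))) w), (expo x w), t. simpl. ring. }
    rewrite E in Q. lra. }
  unfold f1. rewrite !Cmod_mult, !Cmod_Cexp.
  replace (exp (Cmod a1) * exp (- (3 * Cmod lambda / (8 * (INR k + 2))) / Cmod x) * (exp (Re (expo x w)) * Cmod (xpow L x a1)))
    with ((exp (- (3 * Cmod lambda / (8 * (INR k + 2))) / Cmod x) * exp (Re (expo x w))) * (exp (Cmod a1) * Cmod (xpow L x a1))) by ring.
  apply Rmult_le_compat; [apply Rlt_le, exp_pos|apply Cmod_ge_0| |now apply xpow_close].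
  rewrite <- exp_plus. apply exp_le. eapply Rle_trans; [exact HRe|]. apply Req_le. rewrite Htx. unfold sg. field. lra.
Qed.

End Transport.

(** * Perturbations of the identity *)

Lemma CSeries_half (a : nat -> C) q : (forall n, Cmod (a n) <= q * (/ 2) ^ n) ->
  cseries a (CSeries a) /\ Cmod (CSeries a) <= 3 * q /\
  forall n, Cmod (csum a n - CSeries a) <= 2 * q * (/ 2) ^ n.
Proof.
  intros H. assert (H0 := H 0%nat). rewrite pow_O, Rmult_1_r in H0.
  assert (Hq : 0 <= q) by (generalize (Cmod_ge_0 (a 0%nat)); lra).
  destruct (C_cauchy_geom (csum a) q (/ 2)) as [l Hl]; [lra| |].
  { intros n m Hnm. eapply Rle_trans; [apply (sum_tail a q (/ 2) n); [lra|exact Hq|exact H|exact Hnm]|]. simpl. lra. }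
  assert (Hs := is_series_rate a l (2 * q) (/ 2) ltac:(lra) Hl).
  rewrite (C_series_Re_Im a l Hs). split; [exact Hs|]. split; [|exact Hl].
  specialize (Hl 0%nat). rewrite sum_n_C_0, pow_O in Hl.
  replace l with (a 0%nat + - (a 0%nat - l))%C by ring. eapply Rle_trans; [apply Cmod_triangle|]. rewrite Cmod_opp. lra.
Qed.

Lemma hol_CSeries {U : NormedModule C_AbsRing} (t : nat -> U -> C) (p : U) r q : 0 < r ->
  (forall p', norm (minus p' p) < r -> forall n, hol (t n) p' /\ Cmod (t n p') <= q * (/ 2) ^ n) ->
  hol (fun p' => CSeries (fun n => t n p')) p.
Proof.
  intros Hr H. apply (weierstrass (fun m p' => csum (fun n => t n p') m) _ p r (2 * q) (/ 2)); [exact Hr|lra| |].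
  - intros m p' Hp'. induction m as [|m IH].
    + apply (hol_ext_loc (t 0%nat)); [|apply H, Hp']. apply filter_forall. intros y. symmetry. apply sum_n_C_0.
    + apply (hol_ext_loc (fun y => csum (fun n => t n y) m + t (S m) y)%C); [|apply hol_plus; [exact IH|apply H, Hp']].
      apply filter_forall. intros y. symmetry. apply sum_n_C_S.
  - intros m p' Hp'. apply (CSeries_half (fun n => t n p') q). intros n. now apply H.
Qed.

Lemma hol_C3 {U : NormedModule C_AbsRing} (f : U -> C3) p : hol (fun q => fst (f q)) p ->
  hol (fun q => fst (snd (f q))) p -> hol (fun q => snd (snd (f q))) p -> ex_filterdiff f (locally p).
Proof.
  intros H0 H1 H2. replace f with (fun q => ((fst (f q), (fst (snd (f q)), snd (snd (f q)))) : C3)).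
  - apply (hol_pair3 (V := C3) (fun y => y) (fun q => fst (f q)) (fun q => fst (snd (f q))) (fun q => snd (snd (f q))) p); trivial. apply id_filterdiff.
  - extensionality q. destruct (f q) as [x [y1 y2]]. reflexivity.
Qed.

Lemma open_norm {U : NormedModule C_AbsRing} (D : U -> Prop) :
  (forall p, D p -> exists d, 0 < d /\ forall q, norm (minus q p) < d -> D q) -> open D.
Proof.
  intros H p Hp. destruct (H p Hp) as [d [Hd Hq]]. apply locally_le_locally_norm.
  exists (mkposreal d Hd). intros q Hb. apply Hq, Hb.
Qed.

Lemma sector_polydisc_ball (T : C -> Prop) r1 r2 (p : C3) : open T -> sector_polydisc T r1 r2 p ->
  exists d, 0 < d /\ forall q : C3, norm (minus q p) < d -> sector_polydisc T r1 r2 q.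
Proof.
  intros HT [Hx [H1 H2]]. destruct (open_C_eps T (fst p) HT Hx) as [e [He HTe]].
  exists (Rmin e (Rmin (r1 - Cmod (fst (snd p))) (r2 - Cmod (snd (snd p))))).
  split; [repeat apply Rmin_pos; lra|]. intros q Hq.
  assert (A1 := Rlt_le_trans _ _ _ Hq (Rmin_l _ _)). assert (A2 := Rlt_le_trans _ _ _ Hq (Rmin_r _ _)).
  assert (A3 := Rlt_le_trans _ _ _ A2 (Rmin_l _ _)). assert (A4 := Rlt_le_trans _ _ _ A2 (Rmin_r _ _)).
  destruct (C3_components_le q p) as [B1 B2].
  assert (B0 : Cmod (fst q - fst p) <= norm (minus q p)).
  { destruct p as [x [y1 y2]], q as [x' [y1' y2']].
    apply (norm_C3 (x' - x)%C (y1' - y1)%C (y2' - y2)%C). }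
  split; [apply HTe; lra|]. split.
  - generalize (Cmod_minus_ge (fst (snd q)) (fst (snd p))). lra.
  - generalize (Cmod_minus_ge (snd (snd q)) (snd (snd p))). lra.
Qed.

Lemma C_geom_limit (u : nat -> C) B : (forall n, Cmod (u (S n) - u n) <= B * (/ 2) ^ n) ->
  exists l : C, forall n, Cmod (u n - l) <= 4 * B * (/ 2) ^ n.
Proof.
  intros H. assert (H0 := H 0%nat). rewrite pow_O in H0. assert (HB : 0 <= B) by (generalize (Cmod_ge_0 (u 1%nat - u 0%nat)); lra).
  destruct (C_cauchy_geom u (2 * B) (/ 2)) as [l Hl]; [lra| |exists l; intros n; specialize (Hl n); lra].
  intros n m Hnm. replace m with (n + (m - n))%nat by lia. generalize (m - n)%nat. intros j.
  assert (Hn : 0 < (/ 2) ^ n) by (apply pow_lt; lra).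
  assert (A : Cmod (u (n + j)%nat - u n) <= 2 * B * (/ 2) ^ n * (1 - (/ 2) ^ j)).
  { induction j as [|j IH].
    - rewrite Nat.add_0_r. replace (u n - u n)%C with (RtoC 0) by ring. rewrite Cmod_0. simpl. lra.
    - rewrite Nat.add_succ_r. replace (u (S (n + j)) - u n)%C with ((u (S (n + j)) - u (n + j)%nat) + (u (n + j)%nat - u n))%C by ring.
      eapply Rle_trans; [apply Cmod_triangle|]. specialize (H (n + j)%nat). rewrite pow_add in H. simpl. lra. }
  eapply Rle_trans; [exact A|]. assert (0 < (/ 2) ^ j) by (apply pow_lt; lra).
  assert (0 <= 2 * B * (/ 2) ^ n) by (apply Rmult_le_pos; lra). nra.
Qed.

Lemma hol_comp3 {U V W : NormedModule C_AbsRing} (g : V -> W) (f : U -> V) p :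
  ex_filterdiff g (locally (f p)) -> ex_filterdiff f (locally p) -> ex_filterdiff (fun q => g (f q)) (locally p).
Proof. intros [m Hm] [l Hl]. eexists. exact (filterdiff_comp' f g p l m Hl Hm). Qed.

Section Perturbation.
Context (T : C -> Prop) (r : R) (psi : C3 -> C3).
Local Notation DD := (sector_polydisc T r r).
Local Notation D := (sector_polydisc T (r / 16) (r / 16)).
Context (HT : open T) (Hr : 0 < r) (Hfib : fibered_on DD psi) (Hhol : holomorphic_on DD psi).
Context (Hb : forall p, DD p -> norm (minus (psi p) p) <= r / 32).

(** Cauchy's estimate on the complex line through the two points. In the polydisc of radius [r / 16]
    their distance [N] is below [r / 4], so the line stays in the large polydisc for parameters up
    to [r / (2 N) >= 2]. *)
Lemma fiber_Lipschitz (g : C3 -> C) M : (forall p, DD p -> hol g p /\ Cmod (g p) <= M) ->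
  forall p q, D p -> D q -> fst p = fst q ->
  Cmod (g p - g q) <= 4 * M / r * (Cmod (fst (snd p) - fst (snd q)) + Cmod (snd (snd p) - snd (snd q))).
Proof.
  intros H [x [y1 y2]] [x' [z1 z2]] [Hx [Y1 Y2]] [_ [Z1 Z2]] E. simpl in *. subst x'.
  set (N := Cmod (y1 - z1) + Cmod (y2 - z2)).
  assert (N1 := Cmod_ge_0 (y1 - z1)). assert (N2 := Cmod_ge_0 (y2 - z2)).
  assert (HN : N < r / 4).
  { unfold N. generalize (Cmod_triangle y1 (- z1)) (Cmod_triangle y2 (- z2)). rewrite !Cmod_opp. fold (y1 - z1)%C (y2 - z2)%C. lra. }
  destruct (Rle_lt_or_eq_dec 0 N) as [Hp|H0]; [unfold N; lra| |].
  - set (k := (r / (2 * N))). assert (HkN : k * N = r / 2) by (unfold k; field; lra).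
    assert (Hk2 : 2 <= k).
    { apply Rmult_le_reg_r with N; [exact Hp|]. rewrite HkN. lra. }
    set (G := fun s : C => g (x, (z1 + s * (y1 - z1), z2 + s * (y2 - z2)))%C).
    assert (HD : forall s, Cmod s <= k -> DD (x, (z1 + s * (y1 - z1), z2 + s * (y2 - z2)))%C).
    { intros s Hs. assert (S0 := Cmod_ge_0 s). split; [exact Hx|]. split.
      - change (Cmod (z1 + s * (y1 - z1)) < r). eapply Rle_lt_trans; [apply Cmod_triangle|]. rewrite Cmod_mult.
        assert (Cmod s * Cmod (y1 - z1) <= k * N) by (apply Rmult_le_compat; unfold N; lra). lra.
      - change (Cmod (z2 + s * (y2 - z2)) < r). eapply Rle_lt_trans; [apply Cmod_triangle|]. rewrite Cmod_mult.
        assert (Cmod s * Cmod (y2 - z2) <= k * N) by (apply Rmult_le_compat; unfold N; lra). lra. }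
    destruct (disc_taylor G k M) as [c1 [_ Hc]]; [lra| | |].
    + intros s Hs. apply cdiff_curve3; [apply H, HD, Hs|apply cdiff_const| |]; (apply cdiff_plus; [apply cdiff_const|apply cdiff_mult; [apply cdiff_id|apply cdiff_const]]).
    + intros s Hs. apply H, HD, Hs.
    + destruct (Hc 1%C) as [_ Q]; [rewrite Cmod_1; lra|]. rewrite Cmod_1 in Q.
      assert (E1 : G 1%C = g (x, (y1, y2))) by (unfold G; f_equal; apply C3_eq; ring).
      assert (E0 : G 0%C = g (x, (z1, z2))) by (unfold G; f_equal; apply C3_eq; ring).
      rewrite E1, E0 in Q. eapply Rle_trans; [exact Q|]. apply Req_le. unfold k. field. lra.
  - assert (A1 : Cmod (y1 - z1) = 0) by (unfold N in H0; lra). assert (A2 : Cmod (y2 - z2) = 0) by (unfold N in H0; lra).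
    apply Cmod_eq_0 in A1. apply Cmod_eq_0 in A2.
    replace y1 with (z1 + (y1 - z1))%C by ring. replace y2 with (z2 + (y2 - z2))%C by ring. rewrite A1, A2.
    replace (z1 + 0)%C with z1 by ring. replace (z2 + 0)%C with z2 by ring.
    replace (g (x, (z1, z2)) - g (x, (z1, z2)))%C with (RtoC 0) by ring. rewrite Cmod_0. rewrite <- H0. lra.
Qed.

Definition dist2 (p q : C3) : R := Cmod (fst (snd p) - fst (snd q)) + Cmod (snd (snd p) - snd (snd q)).
Definition disp1 (p : C3) : C := (fst (snd (psi p)) - fst (snd p))%C.
Definition disp2 (p : C3) : C := (snd (snd (psi p)) - snd (snd p))%C.

Lemma D_DD p : D p -> DD p.
Proof. intros [Hx [H1 H2]]. split; [exact Hx|]. split; lra. Qed.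

Lemma hol_disp p : DD p -> hol disp1 p /\ hol disp2 p.
Proof.
  intros Hp. split; apply hol_sub.
  - now apply hol_proj1, Hhol.
  - apply (hol_proj1 (fun q => q)), id_filterdiff.
  - now apply hol_proj2, Hhol.
  - apply (hol_proj2 (fun q => q)), id_filterdiff.
Qed.

(** The bound [r / 32] on the displacement makes each component Lipschitz with constant [1/8]. *)
Lemma disp_contract p q : D p -> D q -> fst p = fst q -> Cmod (disp1 p - disp1 q) + Cmod (disp2 p - disp2 q) <= dist2 p q / 4.
Proof.
  intros Hp Hq E.
  assert (L1 := fiber_Lipschitz disp1 (r / 32) (fun z Hz => conj (proj1 (hol_disp z Hz)) (Rle_trans _ _ _ (proj1 (C3_components_le (psi z) z)) (Hb z Hz))) p q Hp Hq E).
  assert (L2 := fiber_Lipschitz disp2 (r / 32) (fun z Hz => conj (proj2 (hol_disp z Hz)) (Rle_trans _ _ _ (proj2 (C3_components_le (psi z) z)) (Hb z Hz))) p q Hp Hq E).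
  fold (dist2 p q) in L1, L2. replace (4 * (r / 32) / r) with (/ 8) in L1, L2 by (field; lra). lra.
Qed.

Lemma dist2_0 p q : fst p = fst q -> dist2 p q <= 0 -> p = q.
Proof.
  destruct p as [x [y1 y2]], q as [x' [z1 z2]]. unfold dist2. simpl. intros -> H.
  assert (N1 := Cmod_ge_0 (y1 - z1)). assert (N2 := Cmod_ge_0 (y2 - z2)).
  assert (A1 : Cmod (y1 - z1) = 0) by lra. assert (A2 : Cmod (y2 - z2) = 0) by lra.
  apply Cmod_eq_0 in A1. apply Cmod_eq_0 in A2.
  replace y1 with ((y1 - z1) + z1)%C by ring. replace y2 with ((y2 - z2) + z2)%C by ring. rewrite A1, A2.
  now rewrite !Cplus_0_l.
Qed.

Lemma psi_injective p q : D p -> D q -> psi p = psi q -> p = q.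
Proof.
  intros Hp Hq E. assert (E0 : fst p = fst q).
  { rewrite <- (Hfib p (D_DD p Hp)), <- (Hfib q (D_DD q Hq)). now rewrite E. }
  apply dist2_0; [exact E0|]. assert (H := disp_contract p q Hp Hq E0). unfold disp1, disp2 in H. rewrite E in H.
  replace (fst (snd (psi q)) - fst (snd p) - (fst (snd (psi q)) - fst (snd q)))%C with (- (fst (snd p) - fst (snd q)))%C in H by ring.
  replace (snd (snd (psi q)) - snd (snd p) - (snd (snd (psi q)) - snd (snd q)))%C with (- (snd (snd p) - snd (snd q)))%C in H by ring.
  rewrite !Cmod_opp in H. fold (dist2 p q) in H. lra.
Qed.

(** Iterates for the equation [y = q - disp (y)] in the fibre of the target [q]. They are kept as
    functions of [q], because holomorphy of the inverse is obtained from theirs by [weierstrass]. *)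
Fixpoint picard (y : C2) (n : nat) (q : C3) : C2 :=
  match n with
  | O => y
  | S n => (fst (snd q) - disp1 (fst q, picard y n q), snd (snd q) - disp2 (fst q, picard y n q))%C
  end.

(** The iteration starts from the fibre coordinates of [p0] and stays within [4 d] of them, where
    [d] leaves a margin [8 d] to the boundary of the small polydisc. *)
Lemma psi_inverse_local p0 : D p0 -> exists e K, 0 < e /\ forall q : C3, norm (minus q (psi p0)) < e ->
  (exists p, D p /\ psi p = q /\ forall n, Cmod (fst (picard (snd p0) n q) - fst (snd p)) <= K * (/ 2) ^ n /\
     Cmod (snd (picard (snd p0) n q) - snd (snd p)) <= K * (/ 2) ^ n) /\
  forall n, hol (fun q => fst (picard (snd p0) n q)) q /\ hol (fun q => snd (picard (snd p0) n q)) q.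
Proof.
  intros HD0. destruct (HD0) as [Hx0 [Ha0 Hb0]]. set (x0 := fst p0) in *. set (y0 := snd p0) in *.
  set (a0 := fst y0) in *. set (b0 := snd y0) in *.
  set (d := Rmin (r / 16 - Cmod a0) (r / 16 - Cmod b0) / 8).
  assert (Hd : 0 < d /\ Cmod a0 + 8 * d <= r / 16 /\ Cmod b0 + 8 * d <= r / 16).
  { unfold d. generalize (Rmin_l (r / 16 - Cmod a0) (r / 16 - Cmod b0)) (Rmin_r (r / 16 - Cmod a0) (r / 16 - Cmod b0)).
    assert (0 < Rmin (r / 16 - Cmod a0) (r / 16 - Cmod b0)) by (apply Rmin_pos; lra). lra. }
  destruct (open_C_eps T x0 HT Hx0) as [e0 [He0 HTe]].
  destruct (hol_disp p0 (D_DD p0 HD0)) as [Hh1 Hh2].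
  destruct (hol_continuous disp1 p0 Hh1 (d / 8)) as [e1 [He1 Hc1]]; [lra|].
  destruct (hol_continuous disp2 p0 Hh2 (d / 8)) as [e2 [He2 Hc2]]; [lra|].
  set (e := Rmin (Rmin e0 (d / 8)) (Rmin e1 e2)).
  assert (He : 0 < e) by (repeat apply Rmin_pos; lra).
  assert (Hee : e <= e0 /\ e <= d / 8 /\ e <= e1 /\ e <= e2).
  { unfold e. generalize (Rmin_l (Rmin e0 (d / 8)) (Rmin e1 e2)) (Rmin_r (Rmin e0 (d / 8)) (Rmin e1 e2))
      (Rmin_l e0 (d / 8)) (Rmin_r e0 (d / 8)) (Rmin_l e1 e2) (Rmin_r e1 e2). lra. }
  exists e, (4 * d). split; [exact He|]. intros q Hq.
  set (x := fst q). set (z1 := fst (snd q)). set (z2 := snd (snd q)).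
  set (It := fun n => ((x, picard y0 n q) : C3)).
  destruct (C3_components_le q (psi p0)) as [Q1 Q2].
  assert (Q0 : Cmod (x - x0) <= norm (minus q (psi p0))).
  { unfold x, x0. rewrite <- (Hfib p0 (D_DD p0 HD0)).
    destruct q as [q0 [q1 q2]], (psi p0) as [s0 [s1 s2]].
    apply (norm_C3 (q0 - s0)%C (q1 - s1)%C (q2 - s2)%C). }
  assert (HTx : T x) by (apply HTe; lra).
  assert (Hmove : Cmod (disp1 p0 - disp1 (It 0%nat)) <= d / 8 /\ Cmod (disp2 p0 - disp2 (It 0%nat)) <= d / 8).
  { assert (HN : norm (minus (It 0%nat) p0) < e).
    { destruct p0 as [u [v1 v2]].
      change (norm (((x - x0)%C, ((v1 - v1)%C, (v2 - v2)%C)) : C3) < e).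
      destruct (norm_C3 (x - x0) (v1 - v1) (v2 - v2)) as [_ [_ [_ N]]].
      assert (Z1 : (v1 - v1)%C = 0%C) by ring. assert (Z2 : (v2 - v2)%C = 0%C) by ring. rewrite Z1, Z2, Cmod_0 in N.
      rewrite Z1, Z2. lra. }
    specialize (Hc1 (It 0%nat) ltac:(lra)). specialize (Hc2 (It 0%nat) ltac:(lra)).
    rewrite <- (Cmod_opp (disp1 p0 - _)), <- (Cmod_opp (disp2 p0 - _)).
    replace (- (disp1 p0 - disp1 (It 0%nat)))%C with (disp1 (It 0%nat) - disp1 p0)%C by ring.
    replace (- (disp2 p0 - disp2 (It 0%nat)))%C with (disp2 (It 0%nat) - disp2 p0)%C by ring. lra. }
  assert (HDd : forall p : C3, fst p = x -> dist2 p (It 0%nat) <= 4 * d -> D p).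
  { intros p Ep Hdp. change (Cmod (fst (snd p) - a0) + Cmod (snd (snd p) - b0) <= 4 * d) in Hdp.
    generalize (Cmod_ge_0 (fst (snd p) - a0)) (Cmod_ge_0 (snd (snd p) - b0)). intros.
    split; [now rewrite Ep|]. split.
    - generalize (Cmod_minus_ge (fst (snd p)) a0). lra.
    - generalize (Cmod_minus_ge (snd (snd p)) b0). lra. }
  assert (H00 : dist2 (It 0%nat) (It 0%nat) = 0).
  { change (Cmod (a0 - a0) + Cmod (b0 - b0) = 0).
    replace (a0 - a0)%C with (RtoC 0) by ring. replace (b0 - b0)%C with (RtoC 0) by ring. rewrite Cmod_0. ring. }
  assert (Hinv : forall n, dist2 (It n) (It 0%nat) <= d).
  { induction n as [|n IH].
    - lra.
    - assert (Dn : D (It n)) by (apply HDd; [reflexivity|lra]). assert (D0 : D (It 0%nat)) by (apply HDd; [reflexivity|rewrite H00; lra]).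
      assert (Hcn := disp_contract (It n) (It 0%nat) Dn D0 eq_refl).
      change (Cmod (z1 - disp1 (It n) - a0) + Cmod (z2 - disp2 (It n) - b0) <= d).
      assert (E1 : (z1 - disp1 (It n) - a0)%C = ((z1 - fst (snd (psi p0))) + ((disp1 p0 - disp1 (It 0%nat)) + - (disp1 (It n) - disp1 (It 0%nat))))%C).
      { unfold disp1 at 2. fold y0 a0. ring. }
      assert (E2 : (z2 - disp2 (It n) - b0)%C = ((z2 - snd (snd (psi p0))) + ((disp2 p0 - disp2 (It 0%nat)) + - (disp2 (It n) - disp2 (It 0%nat))))%C).
      { unfold disp2 at 2. fold y0 b0. ring. }
      rewrite E1, E2.
      assert (T1 := Cmod_triangle (z1 - fst (snd (psi p0))) ((disp1 p0 - disp1 (It 0%nat)) + - (disp1 (It n) - disp1 (It 0%nat)))).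
      assert (T2 := Cmod_triangle (z2 - snd (snd (psi p0))) ((disp2 p0 - disp2 (It 0%nat)) + - (disp2 (It n) - disp2 (It 0%nat)))).
      assert (T3 := Cmod_triangle (disp1 p0 - disp1 (It 0%nat)) (- (disp1 (It n) - disp1 (It 0%nat)))).
      assert (T4 := Cmod_triangle (disp2 p0 - disp2 (It 0%nat)) (- (disp2 (It n) - disp2 (It 0%nat)))).
      rewrite Cmod_opp in T3, T4. fold z1 in Q1. fold z2 in Q2. lra. }
  assert (HDn : forall n, D (It n)) by (intros n; apply HDd; [reflexivity|specialize (Hinv n); lra]).
  assert (Hincr : forall n, dist2 (It (S n)) (It n) <= d * (/ 2) ^ n).
  { induction n as [|n IH]; [rewrite pow_O, Rmult_1_r; apply Hinv|].
    assert (Hcn := disp_contract (It (S n)) (It n) (HDn _) (HDn _) eq_refl).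
    assert (E : dist2 (It (S (S n))) (It (S n)) = Cmod (disp1 (It (S n)) - disp1 (It n)) + Cmod (disp2 (It (S n)) - disp2 (It n))).
    { change (Cmod ((z1 - disp1 (It (S n))) - (z1 - disp1 (It n))) + Cmod ((z2 - disp2 (It (S n))) - (z2 - disp2 (It n))) = Cmod (disp1 (It (S n)) - disp1 (It n)) + Cmod (disp2 (It (S n)) - disp2 (It n))).
      rewrite <- (Cmod_opp (disp1 (It (S n)) - _)), <- (Cmod_opp (disp2 (It (S n)) - _)). f_equal; f_equal; ring. }
    rewrite E. assert (0 < (/ 2) ^ n) by (apply pow_lt; lra). simpl pow. nra. }
  destruct (C_geom_limit (fun n => fst (picard y0 n q)) d) as [l1 Hl1].
  { intros n. specialize (Hincr n). unfold dist2, It in Hincr. cbn [fst snd] in Hincr.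
    generalize (Cmod_ge_0 (snd (picard y0 (S n) q) - snd (picard y0 n q))). lra. }
  destruct (C_geom_limit (fun n => snd (picard y0 n q)) d) as [l2 Hl2].
  { intros n. specialize (Hincr n). unfold dist2, It in Hincr. cbn [fst snd] in Hincr.
    generalize (Cmod_ge_0 (fst (picard y0 (S n) q) - fst (picard y0 n q))). lra. }
  set (p := ((x, (l1, l2)) : C3)).
  assert (HDp : D p).
  { assert (A1 : Cmod (a0 - l1) <= 4 * d) by (generalize (Hl1 0%nat); rewrite pow_O, Rmult_1_r; auto).
    assert (A2 : Cmod (b0 - l2) <= 4 * d) by (generalize (Hl2 0%nat); rewrite pow_O, Rmult_1_r; auto).
    rewrite <- Cmod_opp in A1, A2. replace (- (a0 - l1))%C with (l1 - a0)%C in A1 by ring. replace (- (b0 - l2))%C with (l2 - b0)%C in A2 by ring.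
    split; [exact HTx|]. split.
    - change (Cmod l1 < r / 16). generalize (Cmod_minus_ge l1 a0). lra.
    - change (Cmod l2 < r / 16). generalize (Cmod_minus_ge l2 b0). lra. }
  assert (Hlim : forall n, Cmod (z1 - disp1 p - l1) <= 4 * d * (/ 2) ^ n /\ Cmod (z2 - disp2 p - l2) <= 4 * d * (/ 2) ^ n).
  { intros n. assert (Hcn := disp_contract (It n) p (HDn n) HDp eq_refl).
    assert (A1 := Hl1 n). assert (A2 := Hl2 n). assert (B1 := Hl1 (S n)). assert (B2 := Hl2 (S n)).
    unfold dist2 in Hcn at 1. cbn [fst snd It p] in Hcn.
    change (fst (picard y0 (S n) q)) with (z1 - disp1 (It n))%C in B1. change (snd (picard y0 (S n) q)) with (z2 - disp2 (It n))%C in B2.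
    replace (z1 - disp1 p - l1)%C with ((z1 - disp1 (It n) - l1) + (disp1 (It n) - disp1 p))%C by ring.
    replace (z2 - disp2 p - l2)%C with ((z2 - disp2 (It n) - l2) + (disp2 (It n) - disp2 p))%C by ring.
    assert (T1 := Cmod_triangle (z1 - disp1 (It n) - l1) (disp1 (It n) - disp1 p)).
    assert (T2 := Cmod_triangle (z2 - disp2 (It n) - l2) (disp2 (It n) - disp2 p)).
    generalize (Cmod_ge_0 (disp1 (It n) - disp1 p)) (Cmod_ge_0 (disp2 (It n) - disp2 p)). simpl pow in *. unfold It in *. lra. }
  split.
  - exists p. split; [exact HDp|]. split; [|intros n; split; [apply Hl1|apply Hl2]].
    assert (E1 := small_eq0 _ (4 * d) (/ 2) ltac:(lra) (fun n => proj1 (Hlim n))).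
    assert (E2 := small_eq0 _ (4 * d) (/ 2) ltac:(lra) (fun n => proj2 (Hlim n))).
    assert (E0 := Hfib p (D_DD p HDp)).
    unfold disp1 in E1. unfold disp2 in E2. cbn [fst snd p] in E0, E1, E2.
    destruct (psi p) as [u [v1 v2]]. cbn [fst snd] in E0, E1, E2.
    unfold x, z1, z2 in *. destruct q as [q0 [q1 q2]]. cbn [fst snd] in E0, E1, E2. apply C3_eq; [exact E0| |].
    + replace v1 with (q1 - (q1 - (v1 - l1) - l1))%C by ring. rewrite E1. ring.
    + replace v2 with (q2 - (q2 - (v2 - l2) - l2))%C by ring. rewrite E2. ring.
  - induction n as [|n [I1 I2]]; [split; [exact (hol_const (U := C3) a0 q)|exact (hol_const (U := C3) b0 q)]|].
    assert (HF : ex_filterdiff (fun q : C3 => ((fst q, picard y0 n q) : C3)) (locally q)).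
    { apply hol_C3; [apply (hol_proj0 (fun q => q)), id_filterdiff|exact I1|exact I2]. }
    destruct (hol_disp (It n) (D_DD _ (HDn n))) as [J1 J2]. split; apply hol_sub.
    + apply (hol_proj1 (fun q => q)), id_filterdiff.
    + exact (hol_comp3 (U := C3) (V := C3) (W := C_NormedModule) disp1 (fun q : C3 => ((fst q, picard y0 n q) : C3)) q J1 HF).
    + apply (hol_proj2 (fun q => q)), id_filterdiff.
    + exact (hol_comp3 (U := C3) (V := C3) (W := C_NormedModule) disp2 (fun q : C3 => ((fst q, picard y0 n q) : C3)) q J2 HF).
Qed.

Lemma perturbation_biholomorphic : biholomorphic_onto_image D psi.
Proof.
  split; [intros p Hp; apply Hhol, D_DD, Hp|]. split.
  - apply open_norm. intros q [p0 [Hp0 <-]]. destruct (psi_inverse_local p0 Hp0) as [e [K [He H]]].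
    exists e. split; [exact He|]. intros q Hq. destruct (H q Hq) as [[p [Hp [E _]]] _]. now exists p.
  - set (g := fun q => epsilon (inhabits (zero : C3)) (fun p => D p /\ psi p = q)).
    assert (Hgp : forall p, D p -> g (psi p) = p).
    { intros p Hp. destruct (epsilon_spec (inhabits (zero : C3)) (fun p' => D p' /\ psi p' = psi p)) as [S1 S2]; [now exists p|].
      now apply psi_injective. }
    exists g. split; [|exact Hgp]. intros q0 [p0 [Hp0 <-]]. destruct (psi_inverse_local p0 Hp0) as [e [K [He H]]].
    assert (Hw : forall q, norm (minus q (psi p0)) < e -> fst (g q) = fst q /\ forall n,
      Cmod (fst (picard (snd p0) n q) - fst (snd (g q))) <= K * (/ 2) ^ n /\ Cmod (snd (picard (snd p0) n q) - snd (snd (g q))) <= K * (/ 2) ^ n).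
    { intros q Hq. destruct (H q Hq) as [[p [Hp [E Hn]]] _]. rewrite <- E at 1 2. rewrite (Hgp p Hp). split; [symmetry; apply Hfib, D_DD, Hp|].
      intros n. rewrite <- E. rewrite (Hgp p Hp). rewrite E. apply Hn. }
    apply hol_C3.
    + apply (hol_ext_loc (fun q : C3 => fst q)); [|apply (hol_proj0 (fun q => q)), id_filterdiff].
      apply locally_le_locally_norm. exists (mkposreal e He). intros q Hq. symmetry. apply Hw, Hq.
    + apply (weierstrass (fun n q => fst (picard (snd p0) n q)) _ (psi p0) e K (/ 2)); [exact He|lra| |].
      * intros n q Hq. exact (proj1 (proj2 (H q Hq) n)).
      * intros n q Hq. exact (proj1 (proj2 (Hw q Hq) n)).
    + apply (weierstrass (fun n q => snd (picard (snd p0) n q)) _ (psi p0) e K (/ 2)); [exact He|lra| |].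
      * intros n q Hq. exact (proj2 (proj2 (H q Hq) n)).
      * intros n q Hq. exact (proj2 (proj2 (Hw q Hq) n)).
Qed.

End Perturbation.

(** * Gevrey expansions of flat maps *)

(** With [u = kappa / |x|] this gives [exp (- kappa / |x|) <= kappa^(- N) N! |x|^N], the source of
    the factorials in the Gevrey bounds. *)
Lemma exp_ge_pow u N : 0 <= u -> u ^ N <= INR (Factorial.fact N) * exp u.
Proof.
  intros Hu. assert (Hf := INR_fact_lt_0 N). assert (E := exp_ge_taylor u N Hu).
  assert (Ht : forall n, 0 <= u ^ n / INR (Factorial.fact n)).
  { intros n. apply Rdiv_le_0_compat; [now apply pow_le|apply INR_fact_lt_0]. }
  assert (T : u ^ N / INR (Factorial.fact N) <= sum_f_R0 (fun k => u ^ k / INR (Factorial.fact k)) N).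
  { destruct N as [|N]; [apply Rle_refl|]. rewrite tech5. assert (0 <= sum_f_R0 (fun k => u ^ k / INR (Factorial.fact k)) N); [|lra].
    now apply cond_pos_sum. }
  apply Rmult_le_reg_r with (/ INR (Factorial.fact N)); [now apply Rinv_0_lt_compat|].
  replace (INR (Factorial.fact N) * exp u * / INR (Factorial.fact N)) with (exp u) by (field; lra). unfold Rdiv in T, E. lra.
Qed.

Lemma norm_minus_C3_triangle (p q s : C3) : norm (minus p s) <= norm (minus p q) + norm (minus q s).
Proof.
  replace (minus p s) with (plus (minus p q) (minus q s)); [apply (@norm_triangle _ C3)|].
  destruct p as [p0 [p1 p2]], q as [q0 [q1 q2]], s as [s0 [s1 s2]].
  apply (C3_eq ((p0 - q0) + (q0 - s0))%C ((p1 - q1) + (q1 - s1))%C ((p2 - q2) + (q2 - s2))%C (p0 - s0)%C (p1 - s1)%C (p2 - s2)%C); ring.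
Qed.

(** Compactness of the interval of angles: the cosine has a positive minimum, so one cone suffices
    although [Nice] is a union of infinitely many. *)
Lemma closed_sector_sec th rho alpha beta R : 0 < R ->
  (forall x, closed_sector alpha beta R x -> Nice th rho x) ->
  exists K, forall x, closed_sector alpha beta R x -> sec th K x.
Proof.
  intros HR Hsub. destruct (Rle_lt_dec alpha beta) as [Hab|Hab].
  2: { exists 0%nat. intros x [_ [t [_ Ht]]]. lra. }
  destruct (continuity_ab_min (fun t => cos (t - th)) alpha beta Hab) as [t0 [Hmin Ht0]].
  { intros t _. apply (continuity_pt_comp (fun t => t - th) cos); [|apply continuity_cos].
    apply continuity_pt_minus; [apply derivable_continuous_pt, derivable_pt_id|apply continuity_pt_const; intros u v; reflexivity]. }
  set (m := cos (t0 - th)).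
  assert (Hm : 0 < m).
  { destruct (Hsub (RtoC R * cis t0)%C) as [k [_ Hk]].
    { assert (E : Cmod (RtoC R * cis t0) = R) by (rewrite Cmod_mult, Cmod_R, Cmod_cis, Rabs_pos_eq; lra).
      split; [lra|]. exists t0. split; [|exact Ht0]. apply is_arg_polar. rewrite E. split; [apply Cmod_gt_0; lra|reflexivity]. }
    destruct (sec_pos th k _ Hk) as [Hd _]. rewrite dir_polar in Hd. fold m in Hd. nra. }
  destruct (archimed_cor1 m Hm) as [K [HK1 HK0]]. apply lt_INR in HK0. simpl in HK0.
  exists K. intros x [_ [t [Ht Htab]]]. apply is_arg_polar in Ht. destruct Ht as [Hx0 Ex].
  assert (Hxm : 0 < Cmod x) by now apply Cmod_gt_0.
  unfold sec. rewrite Ex at 2. rewrite dir_polar. specialize (Hmin t Htab). fold m in Hmin.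
  assert (1 < m * (INR K + 2)).
  { apply Rmult_lt_compat_r with (r := INR K) in HK1; [|exact HK0]. rewrite Rinv_l in HK1 by lra. nra. }
  assert (0 <= INR K) by apply pos_INR. rewrite Rmult_assoc. assert (m * (INR K + 2) <= cos (t - th) * (INR K + 2)) by (apply Rmult_le_compat_r; lra). nra.
Qed.

Lemma identity_coeff_hol k (y : C2) : ex_filterdiff (identity_coeff k) (locally y).
Proof.
  destruct k as [|[|k]].
  - apply (hol_C3 (U := C2)); [exact (hol_const (U := C2) (RtoC 0) y)| |].
    + exists (fun k : C2 => fst k). apply filterdiff_linear, is_linear_fst.
    + exists (fun k : C2 => snd k). apply filterdiff_linear, is_linear_snd.
  - eexists. apply (filterdiff_const (U := C2) (V := C3)).
  - eexists. apply (filterdiff_const (U := C2) (V := C3)).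
Qed.

Lemma flat_Gevrey th rho r (psi : C3 -> C3) : (forall k, 0 < rho k <= 1) -> 0 < r ->
  (forall p, sector_polydisc (Nice th rho) r r p -> norm (minus (psi p) p) <= 1) ->
  (forall k, exists A kap d, 0 < A /\ 0 < kap /\ 0 < d /\ forall p, sector_polydisc (Nice th rho) r r p -> sec th k (fst p) -> Cmod (fst p) < d ->
     norm (minus (psi p) p) <= A * exp (- (kap / Cmod (fst p)))) ->
  Gevrey1_expansion (Nice th rho) r r psi identity_coeff.
Proof.
  intros Hrho Hr H1 Hflat. split.
  { intros k y _. apply identity_coeff_hol. }
  intros alpha beta R HR Hsub. destruct (closed_sector_sec th rho alpha beta R HR Hsub) as [K HK].
  destruct (Hflat K) as [A [kap [d [HA [Hkap [Hd HF]]]]]].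
  (* The second summand covers [|x| >= d], where only the bound 1 is known. *)
  set (A' := A + exp (kap / d)). assert (HA' : 0 < A') by (unfold A'; generalize (exp_pos (kap / d)); lra).
  assert (HF' : forall x y, closed_sector alpha beta R x -> polydisc r r y -> norm (minus (psi (x, y)) ((x, y) : C3)) <= A' * exp (- (kap / Cmod x))).
  { intros x y Hx Hy. assert (HD : sector_polydisc (Nice th rho) r r (x, y)) by (split; [apply Hsub, Hx|exact Hy]).
    assert (Hxm : 0 < Cmod x) by apply (Nice_neq0 th rho x (Hsub x Hx)).
    assert (He := exp_pos (- (kap / Cmod x))). assert (He' := exp_pos (kap / d)).
    destruct (Rlt_le_dec (Cmod x) d) as [Hl|Hl].
    - eapply Rle_trans; [apply (HF (x, y) HD (HK x Hx) Hl)|]. simpl fst. unfold A'. nra.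
    - eapply Rle_trans; [apply H1, HD|]. apply Rle_trans with (exp (kap / d) * exp (- (kap / Cmod x))); [|unfold A'; nra].
      rewrite <- exp_plus, <- exp_0. apply exp_le.
      assert (kap / Cmod x <= kap / d) by (apply Rmult_le_compat_l; [lra|apply Rinv_le_contravar; lra]). lra. }
  set (B := / kap + 1). assert (Hik : 0 < / kap) by now apply Rinv_0_lt_compat. assert (HB : 1 <= B) by (unfold B; lra).
  set (AA := A' + 4 + 2 * r).
  exists AA, B. split; [unfold AA; lra|]. split; [lra|]. intros N x y Hx Hy.
  assert (HF2 := HF' x y Hx Hy).
  assert (HNx := Hsub x Hx). assert (Hxm := Nice_neq0 th rho x HNx). assert (Hx1 := Nice_le1 th rho Hrho x HNx).
  assert (HeN : forall n, exp (- (kap / Cmod x)) <= (/ kap) ^ n * INR (Factorial.fact n) * Cmod x ^ n).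
  { intros n. assert (Q := exp_ge_pow (kap / Cmod x) n (Rlt_le _ _ (Rdiv_lt_0_compat _ _ Hkap Hxm))).
    rewrite exp_Ropp. assert (He := exp_pos (kap / Cmod x)).
    apply Rmult_le_reg_r with (exp (kap / Cmod x)); [exact He|]. rewrite Rinv_l by lra.
    assert (Hpp : 0 < (kap / Cmod x) ^ n) by (apply pow_lt, Rdiv_lt_0_compat; assumption).
    apply Rmult_le_reg_r with ((kap / Cmod x) ^ n); [exact Hpp|].
    assert (E : (/ kap) ^ n * Cmod x ^ n * (kap / Cmod x) ^ n = 1).
    { rewrite <- !Rpow_mult_distr. replace (/ kap * Cmod x * (kap / Cmod x)) with 1 by (field; lra). apply pow1. }
    replace ((/ kap) ^ n * INR (Factorial.fact n) * Cmod x ^ n * exp (kap / Cmod x) * (kap / Cmod x) ^ n)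
      with (((/ kap) ^ n * Cmod x ^ n * (kap / Cmod x) ^ n) * (INR (Factorial.fact n) * exp (kap / Cmod x))) by ring.
    rewrite E. lra. }
  assert (Hle : forall n, AA * (/ kap) ^ n * INR (Factorial.fact n) * Cmod x ^ n <= AA * B ^ n * INR (Factorial.fact n) * Cmod x ^ n).
  { intros n. apply Rmult_le_compat_r; [apply pow_le; lra|]. apply Rmult_le_compat_r; [apply pos_INR|].
    apply Rmult_le_compat_l; [unfold AA; lra|]. apply pow_incr. unfold B. lra. }
  (* At orders 0 and 1 the remainder also contains the identity or its part in [x], bounded by
     [1 + 2 r] and [|x|]; the constants [AA] and [B >= 1] allow for them. *)
  destruct N as [|[|N]].
  - eapply Rle_trans; [apply (norm_minus_C3_triangle _ ((x, y) : C3))|].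
    assert (Hn : norm (minus ((x, y) : C3) zero) <= 1 + 2 * r).
    { destruct Hy as [Hy1 Hy2]. destruct y as [y1 y2]. simpl in Hy1, Hy2.
      change (norm (((x - 0)%C, ((y1 - 0)%C, (y2 - 0)%C)) : C3) <= 1 + 2 * r).
      destruct (norm_C3 (x - 0) (y1 - 0) (y2 - 0)) as [_ [_ [_ Q]]].
      assert (Z : forall u : C, (u - 0)%C = u) by (intros u; ring). rewrite !Z in *. lra. }
    change (sum_below (V := C3) (fun k => scal (x ^ k : C)%C (identity_coeff k y)) 0) with (zero : C3).
    assert (Q : exp (- (kap / Cmod x)) <= 1) by (eapply Rle_trans; [apply (HeN 0%nat)|simpl; lra]).
    replace (AA * B ^ 0 * INR (Factorial.fact 0) * Cmod x ^ 0) with AA by (simpl; ring).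
    assert (A' * exp (- (kap / Cmod x)) <= A' * 1) by (apply Rmult_le_compat_l; lra).
    eapply Rle_trans; [exact (Rplus_le_compat _ _ _ _ HF2 Hn)|]. unfold AA. lra.
  - eapply Rle_trans; [apply (norm_minus_C3_triangle _ ((x, y) : C3))|].
    assert (Hn : norm (minus ((x, y) : C3) (sum_below (V := C3) (fun k => scal (x ^ k : C)%C (identity_coeff k y)) 1)) <= Cmod x).
    { destruct y as [y1 y2].
      destruct (norm_C3 (x - (0 + (x ^ 0) * RtoC 0)) (y1 - (0 + (x ^ 0) * y1)) (y2 - (0 + (x ^ 0) * y2))) as [_ [_ [_ Q]]].
      replace (x - (0 + x ^ 0 * 0))%C with x in Q at 2 by (simpl; ring).
      assert (Z : forall u : C, (u - (0 + x ^ 0 * u))%C = RtoC 0) by (intros u; simpl; ring).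
      rewrite (f_equal Cmod (Z y1)), (f_equal Cmod (Z y2)), Cmod_0 in Q. rewrite !Rplus_0_r in Q. exact Q. }
    assert (Q : exp (- (kap / Cmod x)) <= / kap * Cmod x) by (eapply Rle_trans; [apply (HeN 1%nat)|simpl; lra]).
    replace (AA * B ^ 1 * INR (Factorial.fact 1) * Cmod x ^ 1) with (AA * B * Cmod x) by (simpl; ring). unfold AA, B.
    eapply Rle_trans; [exact (Rplus_le_compat _ _ _ _ HF2 Hn)|].
    assert (A' * exp (- (kap / Cmod x)) <= A' * (/ kap * Cmod x)) by (apply Rmult_le_compat_l; lra).
    assert (0 <= / kap * Cmod x) by (apply Rmult_le_pos; lra). nra.
  - rewrite sum_below_identity. eapply Rle_trans; [exact HF2|]. eapply Rle_trans; [|apply Hle].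
    assert (Q := HeN (S (S N))).
    apply Rle_trans with (A' * ((/ kap) ^ S (S N) * INR (Factorial.fact (S (S N))) * Cmod x ^ S (S N))); [apply Rmult_le_compat_l; lra|].
    replace (AA * (/ kap) ^ S (S N) * INR (Factorial.fact (S (S N))) * Cmod x ^ S (S N)) with (AA * ((/ kap) ^ S (S N) * INR (Factorial.fact (S (S N))) * Cmod x ^ S (S N))) by ring.
    apply Rmult_le_compat_r; [|unfold AA; lra]. eapply Rle_trans; [apply Rlt_le, exp_pos|exact Q].
Qed.

(** * Isotropies with prescribed expansions *)

Section Terms.
Context (lambda a1 a2 : C) (c : nat -> C) (r0 M0 : R).
Context (Hlambda : lambda <> RtoC 0) (Ha : 0 < Re (a1 + a2)%C) (Hc0 : c 0%nat = RtoC 0) (Hg : geomb c r0 M0).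
Context (th : R) (Hth : is_arg th lambda) (S0 : C -> Prop) (L : C -> C) (HAS0 : AS th PI S0) (HL : log_branch S0 L).

Local Notation X x := (xpow L x (a1 + a2)%C).
Local Notation F1 := (f1 lambda a1 a2 c L).
Local Notation F2 := (f2 lambda a1 a2 c L).
Local Notation h1 := (first1 lambda a1 a2 c L).
Local Notation wof := (wprod a1 a2 L).
Context (P1 P2 : eseq).

(** A term of [Psi_1 - h_1] multiplied by [f_1], hence measured on the scale of [y_1]. *)
Definition term1 (n : nat) (p : C3) : C := (P1 n (wof p) * h1 p ^ (2 + n) * F1 (fst p) (wof p))%C.
Definition term2 (n : nat) (p : C3) : C := (P2 n (wof p) * h1 p ^ (0 + n) * F2 (fst p) (wof p))%C.

Definition terms_bounded r x Q : Prop := forall p : C3, fst p = x -> polydisc r r (snd p) -> forall n,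
  Cmod (term1 n p) <= Q * (/ 2) ^ n /\ Cmod (term2 n p) <= Q * (/ 2) ^ n.

Lemma Eset_bounds : E1_plus th lambda a1 a2 c S0 L P1 -> E2_plus th lambda a1 a2 c S0 L P2 ->
  exists rho b K, (forall k, 0 < rho k <= 1) /\ 0 < b <= 1 /\ 0 < K /\ forall x, Nice th rho x -> S0 x /\
    forall w, Cmod (w * X x) <= b * b / 4 -> forall k,
      Cmod (P1 k w) <= K * (Cmod (F1 x w) ^ (k + 1) / b ^ (k + 2)) /\
      Cmod (P2 k w) <= K * (/ Cmod (X x) * (Cmod (F1 x w) ^ (k + 1) / b ^ k)).
Proof.
  intros [_ [r1 [r2 [S [Hr1 [Hr2 [_ [HS [HSS H1]]]]]]]]] [_ [r1' [r2' [S' [Hr1' [Hr2' [_ [HS' [_ H2]]]]]]]]].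
  destruct (AS_inter_sectors th S S' HS HS') as [rho [Hrho HN]].
  set (b := Rmin 1 (Rmin (Rmin r1 r2) (Rmin r1' r2')) / 2).
  assert (Hb : 0 < b <= 1 /\ b < r1 /\ b < r2 /\ b < r1' /\ b < r2').
  { assert (0 < Rmin 1 (Rmin (Rmin r1 r2) (Rmin r1' r2'))) by (repeat apply Rmin_pos; lra). unfold b.
    generalize (Rmin_l 1 (Rmin (Rmin r1 r2) (Rmin r1' r2'))) (Rmin_r 1 (Rmin (Rmin r1 r2) (Rmin r1' r2')))
      (Rmin_l (Rmin r1 r2) (Rmin r1' r2')) (Rmin_r (Rmin r1 r2) (Rmin r1' r2')) (Rmin_l r1 r2) (Rmin_r r1 r2) (Rmin_l r1' r2') (Rmin_r r1' r2').
    lra. }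
  (* Here [rt1 = rt2 = delta = b / 2], so that [rt1 + delta = b] and [rt1 rt2 = b^2 / 4]. *)
  destruct (H1 (b / 2) (b / 2) (b / 2)) as [K1 [HK1 B1]]; try lra.
  destruct (H2 (b / 2) (b / 2) (b / 2)) as [K2 [HK2 B2]]; try lra.
  exists rho, b, (K1 + K2). split; [exact Hrho|]. split; [lra|]. split; [lra|].
  intros x Hx. destruct (HN x Hx) as [Hx1 Hx2]. split; [apply HSS, Hx1|]. intros w Hw k.
  assert (Hw' : Cmod (w * X x) <= b / 2 * (b / 2)) by lra.
  assert (T1 := B1 x w Hx1 Hw' k). assert (T2 := B2 x w Hx2 Hw' k).
  replace (b / 2 + b / 2) with b in T1, T2 by field.
  replace (2 + k - 1)%nat with (k + 1)%nat in T1 by lia. replace (2 + k)%nat with (k + 2)%nat in T1 by lia. change (0 + k)%nat with k in T2.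
  assert (Hp1 : 0 <= Cmod (F1 x w) ^ (k + 1) / b ^ (k + 2)) by (apply Rdiv_le_0_compat; [apply pow_le, Cmod_ge_0|apply pow_lt; lra]).
  assert (Hp2 : 0 <= / Cmod (X x) * (Cmod (F1 x w) ^ (k + 1) / b ^ k)).
  { apply Rmult_le_pos; [apply Rlt_le, Rinv_0_lt_compat, Cmod_gt_0, xpow_neq0|].
    apply Rdiv_le_0_compat; [apply pow_le, Cmod_ge_0|apply pow_lt; lra]. }
  split; nra.
Qed.

(** The coefficients are estimated at the displaced point [x'], the rest of the term at [x]. The
    ratio of [|f_1|] at the two points, at most [e1 exp (- kap / |x|)], provides the flatness, and
    [|y_1| / b <= 1/2] the geometric decay. *)
Lemma terms_flat : E1_plus th lambda a1 a2 c S0 L P1 -> E2_plus th lambda a1 a2 c S0 L P2 ->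
  exists r, 0 < r <= / 4 /\ r <= r0 / 16 /\
  forall k, exists A kap d, 0 < A /\ 0 < kap /\ 0 < d /\ forall x, sec th k x -> Cmod x < d ->
    S0 x /\ terms_bounded r x (A * exp (- (kap / Cmod x))).
Proof.
  intros HE1 HE2. destruct (Eset_bounds HE1 HE2) as [rho [b [K [Hrho [Hb [HK HB]]]]]].
  assert (Hr0 : 0 < r0) by apply Hg. assert (HM0 : 0 <= M0) by apply Hg.
  assert (Hl : 0 < Cmod lambda) by (apply Cmod_gt_0; exact Hlambda).
  (* The three bounds serve the coefficient estimates at [x'], the range of [transport], and the
     smallness of [c] required there. *)
  set (V := Rmin (b * b / 4) (Rmin (r0 / 4) (Cmod lambda * r0 / (8 * (M0 + 1))))).
  assert (HV : 0 < V).
  { unfold V. repeat apply Rmin_pos; [nra|lra|]. apply Rdiv_lt_0_compat; nra. }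
  assert (HV1 : V <= b * b / 4) by apply Rmin_l.
  assert (HV2 : V <= r0 / 4) by (eapply Rle_trans; [apply Rmin_r|apply Rmin_l]).
  assert (HV3 : V <= Cmod lambda * r0 / (8 * (M0 + 1))) by (eapply Rle_trans; [apply Rmin_r|apply Rmin_r]).
  assert (Hcv : forall v, Cmod v <= V -> Cmod (CPSeries c v) <= Cmod lambda / 4).
  { intros v Hv. eapply Rle_trans; [apply (CPSeries_small c r0 M0 v Hg Hc0); lra|].
    apply Rle_trans with (2 * M0 / r0 * (Cmod lambda * r0 / (8 * (M0 + 1)))).
    - apply Rmult_le_compat_l; [apply Rdiv_le_0_compat; lra|lra].
    - replace (2 * M0 / r0 * (Cmod lambda * r0 / (8 * (M0 + 1)))) with (Cmod lambda / 4 * (M0 * / (M0 + 1))) by (field; lra).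
      rewrite <- (Rmult_1_r (Cmod lambda / 4)) at 2. apply Rmult_le_compat_l; [lra|].
      apply Rmult_le_reg_r with (M0 + 1); [lra|]. rewrite Rmult_assoc, Rinv_l; lra. }
  set (E := exp (Cmod (a1 + a2))). assert (HE : 1 <= E).
  { unfold E. rewrite <- exp_0. apply exp_le, Cmod_ge_0. }
  (* The bound [b / 2] gives the ratio [1/2] of the series; [V / E] keeps [|w x'^a| <= V], since
     [|x^a|] may grow by the factor [E] on passing to [x']. *)
  set (r := Rmin (Rmin (/ 4) (r0 / 16)) (Rmin (b / 2) (V / E))).
  assert (HVE : 0 < V / E) by (apply Rdiv_lt_0_compat; lra).
  assert (Hr : 0 < r) by (unfold r; repeat apply Rmin_pos; lra).
  assert (Hr1 : r <= / 4 /\ r <= r0 / 16 /\ r <= b / 2 /\ r <= V / E).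
  { unfold r. generalize (Rmin_l (Rmin (/ 4) (r0 / 16)) (Rmin (b / 2) (V / E))) (Rmin_r (Rmin (/ 4) (r0 / 16)) (Rmin (b / 2) (V / E)))
      (Rmin_l (/ 4) (r0 / 16)) (Rmin_r (/ 4) (r0 / 16)) (Rmin_l (b / 2) (V / E)) (Rmin_r (b / 2) (V / E)). lra. }
  exists r. split; [lra|]. split; [lra|]. intros k.
  set (kap := 3 * Cmod lambda / (8 * (INR k + 2))). assert (Hk := pos_INR k).
  assert (Hkap : 0 < kap) by (apply Rdiv_lt_0_compat; lra).
  set (e1 := exp (Cmod a1)). assert (He1 : 0 < e1) by apply exp_pos.
  (* The last bound ensures [q <= 1], the first is the one required by [transport]. *)
  set (d := Rmin (Rmin (rho (3 * k + 4)%nat / 2) (rho k)) (kap / (Cmod a1 + 1))).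
  assert (Hca1 := Cmod_ge_0 a1).
  assert (Hd : 0 < d).
  { unfold d. assert (Z1 := Hrho (3 * k + 4)%nat). assert (Z2 := Hrho k). repeat apply Rmin_pos; [lra|lra|apply Rdiv_lt_0_compat; lra]. }
  exists (K * E * e1), kap, d. split; [apply Rmult_lt_0_compat; [nra|exact He1]|]. split; [exact Hkap|]. split; [exact Hd|].
  intros x Hsx Hxd.
  assert (D1 := Rlt_le_trans _ _ _ Hxd (Rmin_l _ _)). assert (D2 := Rlt_le_trans _ _ _ Hxd (Rmin_r _ _)).
  assert (D3 := Rlt_le_trans _ _ _ D1 (Rmin_l _ _)). assert (D4 := Rlt_le_trans _ _ _ D1 (Rmin_r _ _)).
  assert (HNx : Nice th rho x) by (exists k; split; assumption).
  assert (Hxm := Nice_neq0 th rho x HNx).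
  split; [apply HB, HNx|].
  destruct (transport lambda a1 a2 c r0 M0 Hlambda Ha Hc0 Hg th Hth S0 L (proj1 HAS0) HL rho (fun x Hx => proj1 (HB x Hx)) V HV2 Hcv k x Hsx D3)
    as [x' [HNx' [_ [HX1 [HX2 HF]]]]].
  fold E in HX1, HX2, HF. fold kap e1 in HF.
  set (q := e1 * exp (- kap / Cmod x)) in *.
  assert (Hq : 0 < q <= 1).
  { split; [apply Rmult_lt_0_compat; [exact He1|apply exp_pos]|]. unfold q, e1. rewrite <- exp_plus, <- exp_0. apply exp_le.
    assert (Cmod a1 + 1 <= kap / Cmod x); [|unfold Rdiv in *; lra].
    apply Rmult_le_reg_r with (Cmod x); [exact Hxm|]. replace (kap / Cmod x * Cmod x) with kap by (field; lra).
    apply Rmult_lt_compat_l with (r := Cmod a1 + 1) in D2; [|lra].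
    replace ((Cmod a1 + 1) * (kap / (Cmod a1 + 1))) with kap in D2 by (field; lra). lra. }
  replace (K * E * e1 * exp (- (kap / Cmod x))) with (K * E * q) by (unfold q; replace (- (kap / Cmod x)) with (- kap / Cmod x) by (field; lra); ring).
  intros [x0 [y1 y2]] Ex [Hy1 Hy2] n. simpl in Ex, Hy1, Hy2. subst x0.
  unfold term1, term2, first1. fold (wof (x, (y1, y2))). set (w := wof (x, (y1, y2))). simpl fst.
  assert (Ew : Cmod (w * X x) = Cmod y1 * Cmod y2) by (unfold w, wprod; rewrite w_X, Cmod_mult; reflexivity).
  assert (HA : 0 < Cmod (F1 x w)) by (apply Cmod_gt_0, F1_neq0).
  assert (HA2 : 0 < Cmod (F2 x w)) by (apply Cmod_gt_0, F2_neq0).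
  assert (HXx : 0 < Cmod (X x)) by (apply Cmod_gt_0, xpow_neq0). assert (HXx' : 0 < Cmod (X x')) by (apply Cmod_gt_0, xpow_neq0).
  assert (EX : Cmod (F1 x w) * Cmod (F2 x w) = Cmod (X x)) by (rewrite <- Cmod_mult; now rewrite F1_F2).
  assert (Y1 := Cmod_ge_0 y1). assert (Y2 := Cmod_ge_0 y2).
  assert (HwV : Cmod (w * X x) * E <= V).
  { rewrite Ew. apply Rle_trans with (1 * (V / E) * E); [|apply Req_le; field; lra].
    apply Rmult_le_compat_r; [lra|]. apply Rmult_le_compat; lra. }
  assert (HwX' : Cmod (w * X x') <= b * b / 4).
  { eapply Rle_trans; [|exact HV1]. eapply Rle_trans; [|exact HwV]. rewrite !Cmod_mult, Rmult_assoc. apply Rmult_le_compat_l; [apply Cmod_ge_0|]. lra. }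
  destruct (proj2 (HB x' HNx') w HwX' n) as [B1 B2]. specialize (HF w HwV).
  set (f := Cmod (F1 x w)) in *. set (f' := Cmod (F1 x' w)) in *.
  (* The exponent [n + 1] is at least 1: one factor [q] is kept, the others are bounded by 1. *)
  assert (Hf' : f' ^ (n + 1) <= q * f ^ (n + 1)).
  { eapply Rle_trans; [apply pow_incr; split; [apply Cmod_ge_0|exact HF]|]. rewrite Rpow_mult_distr. apply Rmult_le_compat_r; [apply pow_le; lra|].
    rewrite Nat.add_1_r. simpl. assert (q ^ n <= 1) by (rewrite <- (pow1 n); apply pow_incr; lra). nra. }
  assert (Hyb : forall m, (Cmod y1 / b) ^ m <= (/ 2) ^ m).
  { intros m. apply pow_incr. split; [apply Rdiv_le_0_compat; lra|]. apply Rmult_le_reg_r with b; [lra|]. unfold Rdiv. rewrite Rmult_assoc, Rinv_l; lra. }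
  assert (Hbp : forall m, 0 < b ^ m) by (intros m; apply pow_lt; lra).
  assert (Hfp : forall m, 0 < f ^ m) by (intros m; apply pow_lt; lra).
  assert (H2n : 0 < (/ 2) ^ n) by (apply pow_lt; lra).
  split; rewrite !Cmod_mult, Cmod_pow, Cmod_div by apply F1_neq0; fold f.
  - apply Rle_trans with (K * (q * f ^ (n + 1) / b ^ (n + 2)) * (Cmod y1 / f) ^ (2 + n) * f).
    + apply Rmult_le_compat_r; [lra|]. apply Rmult_le_compat_r; [apply pow_le, Rdiv_le_0_compat; lra|].
      eapply Rle_trans; [exact B1|]. apply Rmult_le_compat_l; [lra|]. apply Rmult_le_compat_r; [apply Rlt_le, Rinv_0_lt_compat, Hbp|exact Hf'].
    + replace (K * (q * f ^ (n + 1) / b ^ (n + 2)) * (Cmod y1 / f) ^ (2 + n) * f) with (K * q * (Cmod y1 / b) ^ (2 + n)).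
      * specialize (Hyb (2 + n)%nat). simpl in Hyb. assert (0 <= K * q) by nra.
        apply Rle_trans with (K * q * (/ 2) ^ n); [apply Rmult_le_compat_l; [assumption|]; simpl; lra|].
        apply Rmult_le_compat_r; [lra|]. nra.
      * unfold Rdiv. rewrite !Rpow_mult_distr, !pow_inv. replace (n + 2)%nat with (2 + n)%nat by lia.
        assert (Ef : f ^ (2 + n) = f * f ^ (n + 1)) by (rewrite Nat.add_1_r; simpl; ring). rewrite Ef. field. repeat split; apply Rgt_not_eq; first [exact HA|apply Hbp|apply Hfp].
  - apply Rle_trans with (K * (/ Cmod (X x') * (q * f ^ (n + 1) / b ^ n)) * (Cmod y1 / f) ^ (0 + n) * Cmod (F2 x w)).
    + apply Rmult_le_compat_r; [lra|]. apply Rmult_le_compat_r; [apply pow_le, Rdiv_le_0_compat; lra|].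
      eapply Rle_trans; [exact B2|]. apply Rmult_le_compat_l; [lra|]. apply Rmult_le_compat_l; [apply Rlt_le, Rinv_0_lt_compat, HXx'|].
      apply Rmult_le_compat_r; [apply Rlt_le, Rinv_0_lt_compat, Hbp|exact Hf'].
    + replace (K * (/ Cmod (X x') * (q * f ^ (n + 1) / b ^ n)) * (Cmod y1 / f) ^ (0 + n) * Cmod (F2 x w)) with (K * (Cmod (X x) / Cmod (X x')) * q * (Cmod y1 / b) ^ n).
      * assert (HR : Cmod (X x) / Cmod (X x') <= E).
        { apply Rmult_le_reg_r with (Cmod (X x')); [exact HXx'|]. unfold Rdiv. rewrite Rmult_assoc, Rinv_l; lra. }
        assert (0 <= Cmod (X x) / Cmod (X x')) by (apply Rdiv_le_0_compat; lra).
        apply Rmult_le_compat; [|apply pow_le, Rdiv_le_0_compat; lra| |apply Hyb].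
        -- apply Rmult_le_pos; [apply Rmult_le_pos|]; lra.
        -- apply Rmult_le_compat_r; [lra|]. apply Rmult_le_compat_l; lra.
      * change (0 + n)%nat with n. rewrite <- EX. unfold Rdiv. rewrite !Rpow_mult_distr, !pow_inv. rewrite Nat.add_1_r. simpl. field.
        repeat split; apply Rgt_not_eq; first [exact HA|apply Hbp|apply Hfp|exact HXx'].
Qed.

End Terms.

Lemma exp_flat_small A kap eps : 0 < A -> 0 < kap -> 0 < eps ->
  exists d, 0 < d <= 1 /\ forall s, 0 < s < d -> A * exp (- (kap / s)) <= eps * s ^ 2.
Proof.
  intros HA Hk He. assert (Hk3 : 0 < kap ^ 3) by now apply pow_lt.
  exists (Rmin 1 (eps * kap ^ 3 / (6 * A))). split.
  { split; [apply Rmin_pos; [lra|apply Rdiv_lt_0_compat; nra]|apply Rmin_l]. }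
  intros s [Hs Hsd]. assert (Hs2 := Rlt_le_trans _ _ _ Hsd (Rmin_r _ _)).
  assert (Hks : 0 < kap / s) by now apply Rdiv_lt_0_compat.
  assert (Q := exp_ge_pow (kap / s) 3 (Rlt_le _ _ Hks)). change (INR (Factorial.fact 3)) with (1 + 1 + 1 + 1 + 1 + 1) in Q.
  rewrite exp_Ropp. assert (Hex := exp_pos (kap / s)).
  apply Rmult_le_reg_r with (exp (kap / s)); [exact Hex|]. rewrite Rmult_assoc, Rinv_l, Rmult_1_r by lra.
  apply Rle_trans with (eps * s ^ 2 * ((kap / s) ^ 3 / 6)).
  - replace (eps * s ^ 2 * ((kap / s) ^ 3 / 6)) with (eps * kap ^ 3 / (6 * A) * (A / s)) by (field; lra).
    apply Rle_trans with (s * (A / s)); [apply Req_le; field; lra|]. apply Rmult_le_compat_r; [apply Rlt_le, Rdiv_lt_0_compat; lra|lra].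
  - apply Rmult_le_compat_l; [apply Rmult_le_pos; [lra|apply pow_le; lra]|]. lra.
Qed.

(** Half of the exponent is spent on the factor [1 / s^2], which comes from
    [(1 + |log x|) / |x|]. *)
Lemma exp_absorb kap s : 0 < kap -> 0 < s -> exp (- (kap / s)) / (s * s) <= 8 / kap ^ 2 * exp (- (kap / 2 / s)).
Proof.
  intros Hk Hs. assert (Hu : 0 < kap / 2 / s) by (repeat apply Rdiv_lt_0_compat; lra).
  assert (Q := exp_ge_pow (kap / 2 / s) 2 (Rlt_le _ _ Hu)). change (INR (Factorial.fact 2)) with (1 + 1) in Q.
  assert (E : exp (- (kap / s)) = exp (- (kap / 2 / s)) * exp (- (kap / 2 / s))) by (rewrite <- exp_plus; f_equal; field; lra).
  rewrite E. assert (Hp := exp_pos (- (kap / 2 / s))). assert (Hpp := exp_pos (kap / 2 / s)).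
  assert (E1 : exp (- (kap / 2 / s)) * exp (kap / 2 / s) = 1) by (rewrite <- exp_plus, Rplus_opp_l; apply exp_0).
  set (m := exp (- (kap / 2 / s))) in *.
  replace (m * m / (s * s)) with (m * (4 / kap ^ 2 * (m * (kap / 2 / s) ^ 2))) by (field; lra).
  rewrite (Rmult_comm (8 / kap ^ 2)). apply Rmult_le_compat_l; [lra|].
  replace (8 / kap ^ 2) with (4 / kap ^ 2 * 2) by (field; lra).
  apply Rmult_le_compat_l; [apply Rlt_le, Rdiv_lt_0_compat; [lra|apply pow_lt; lra]|].
  apply Rle_trans with (m * ((1 + 1) * exp (kap / 2 / s))); [apply Rmult_le_compat_l; lra|]. apply Req_le.
  replace (m * ((1 + 1) * exp (kap / 2 / s))) with (2 * (m * exp (kap / 2 / s))) by ring. rewrite E1. ring.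
Qed.

(** * The map defined by two convergent series *)

Section Build.
Context (lambda a1 a2 : C) (c : nat -> C) (r0 M0 : R).
Context (Hlambda : lambda <> RtoC 0) (Ha : 0 < Re (a1 + a2)%C) (Hc0 : c 0%nat = RtoC 0) (Hg : geomb c r0 M0).
Context (th : R) (Hth : is_arg th lambda) (S0 : C -> Prop) (L : C -> C) (HAS0 : AS th PI S0) (HL : log_branch S0 L).

Local Notation X x := (xpow L x (a1 + a2)%C).
Local Notation F1 := (f1 lambda a1 a2 c L).
Local Notation F2 := (f2 lambda a1 a2 c L).
Local Notation HS0 := (proj1 HAS0).
Local Notation h1 := (first1 lambda a1 a2 c L).
Local Notation h2 := (first2 lambda a1 a2 c L).
Local Notation wof := (wprod a1 a2 L).
Context (P1 P2 : eseq) (En1 : forall k, entire (P1 k)) (En2 : forall k, entire (P2 k)).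
Local Notation t1 := (term1 lambda a1 a2 c L P1).
Local Notation t2 := (term2 lambda a1 a2 c L P2).
Local Notation terms_le := (terms_bounded lambda a1 a2 c L P1 P2).

Definition corr1 (p : C3) : C := CSeries (fun n => t1 n p).
Definition corr2 (p : C3) : C := CSeries (fun n => t2 n p).
Definition comp1 (p : C3) : C := (h1 p + corr1 p / F1 (fst p) (wof p))%C.
Definition comp2 (p : C3) : C := (h2 p + corr2 p / F2 (fst p) (wof p))%C.
Definition psi_of (p : C3)   : C3 := Hinv lambda a1 a2 c L ((fst p, (comp1 p, comp2 p)) : C3).

Context (r : R) (Hr : 0 < r <= / 4) (Hrr : r <= r0 / 16).

Lemma Psi_expansions x Q p : terms_le r x Q -> fst p = x -> polydisc r r (snd p) ->
  is_expansion 2 P1 (h1 p) (wof p) (h1 p) (comp1 p) /\ is_expansion 0 P2 (h2 p) (wof p) (h1 p) (comp2 p).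
Proof.
  intros HQ Ex Hp.
  destruct (CSeries_half (fun n => t1 n p) Q (fun n => proj1 (HQ p Ex Hp n))) as [A1 _].
  destruct (CSeries_half (fun n => t2 n p) Q (fun n => proj2 (HQ p Ex Hp n))) as [A2 _].
  assert (N1 := F1_neq0 lambda a1 a2 c L (fst p) (wof p)). assert (N2 := F2_neq0 lambda a1 a2 c L (fst p) (wof p)).
  split; unfold is_expansion.
  - replace (comp1 p - h1 p)%C with (/ F1 (fst p) (wof p) * corr1 p)%C by (unfold comp1; field; exact N1).
    eapply is_series_ext; [|exact (is_series_scal (K := C_AbsRing) (V := C_NormedModule) (/ F1 (fst p) (wof p))%C _ _ A1)].
    intros n. change (/ F1 (fst p) (wof p) * t1 n p = P1 n (wof p) * h1 p ^ (2 + n))%C. unfold term1. field. exact N1.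
  - replace (comp2 p - h2 p)%C with (/ F2 (fst p) (wof p) * corr2 p)%C by (unfold comp2; field; exact N2).
    eapply is_series_ext; [|exact (is_series_scal (K := C_AbsRing) (V := C_NormedModule) (/ F2 (fst p) (wof p))%C _ _ A2)].
    intros n. change (/ F2 (fst p) (wof p) * t2 n p = P2 n (wof p) * h1 p ^ (0 + n))%C. unfold term2. field. exact N2.
Qed.

(** As [f_1 f_2 = x^a] does not depend on [w], a ratio of values of [f_1] is the inverse ratio for
    [f_2]. This brings the components of [psi_of] to the form treated by [component_shift], with the
    two coordinates exchanged. *)
Lemma psi_of_components x y1 y2 : let p := ((x, (y1, y2)) : C3) in
  let u1 := (y1 + corr1 p)%C in let u2 := (y2 + corr2 p)%C in
  (comp1 p * comp2 p)%C = (u1 * u2 / X x)%C /\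
  fst (snd (psi_of p)) = (u1 * (F2 x (y2 * y1 / X x) / F2 x (u2 * u1 / X x)))%C /\
  snd (snd (psi_of p)) = (u2 * (F1 x (y2 * y1 / X x) / F1 x (u2 * u1 / X x)))%C.
Proof.
  intros p u1 u2. set (w := wof p).
  assert (N1 := F1_neq0 lambda a1 a2 c L x w). assert (N2 := F2_neq0 lambda a1 a2 c L x w).
  assert (Ew : (y2 * y1 / X x)%C = w) by (unfold w, wprod, p; simpl; unfold Cdiv; ring).
  assert (E1 : comp1 p = (u1 / F1 x w)%C).
  { unfold comp1, first1. fold (wof p). fold w. unfold u1. change (fst (snd p)) with y1. change (fst p) with x. field. exact N1. }
  assert (E2 : comp2 p = (u2 / F2 x w)%C).
  { unfold comp2, first2. fold (wof p). fold w. unfold u2. change (snd (snd p)) with y2. change (fst p) with x. field. exact N2. }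
  assert (EW : (comp1 p * comp2 p)%C = (u1 * u2 / X x)%C).
  { rewrite E1, E2, <- (F1_F2 lambda a1 a2 c L x w). field. split; assumption. }
  split; [exact EW|].
  assert (EW' : (u2 * u1 / X x)%C = (comp1 p * comp2 p)%C) by (rewrite EW; unfold Cdiv; ring).
  rewrite EW', Ew. set (W := (comp1 p * comp2 p)%C).
  assert (N1' := F1_neq0 lambda a1 a2 c L x W). assert (N2' := F2_neq0 lambda a1 a2 c L x W).
  assert (EF : (F1 x w * F2 x w)%C = (F1 x W * F2 x W)%C) by now rewrite !F1_F2.
  split.
  - change ((comp1 p * F1 x W)%C = (u1 * (F2 x w / F2 x W))%C). rewrite E1.
    replace (F1 x W) with (F1 x w * F2 x w / F2 x W)%C by (rewrite EF; field; exact N2'). field. split; assumption.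
  - change ((comp2 p * F2 x W)%C = (u2 * (F1 x w / F1 x W))%C). rewrite E2.
    replace (F2 x W) with (F1 x w * F2 x w / F1 x W)%C by (rewrite EF; field; exact N1'). field. split; assumption.
Qed.

Lemma shift_bound x Q p : terms_le r x Q -> fst p = x -> polydisc r r (snd p) -> Cmod (corr1 p) <= 3 * Q /\ Cmod (corr2 p) <= 3 * Q.
Proof.
  intros HQ Ex Hp. split.
  - apply (CSeries_half (fun n => t1 n p) Q (fun n => proj1 (HQ p Ex Hp n))).
  - apply (CSeries_half (fun n => t2 n p) Q (fun n => proj2 (HQ p Ex Hp n))).
Qed.

Lemma u_small x y1 y2 Q : terms_le r x Q -> 3 * Q <= r -> Cmod y1 < r -> Cmod y2 < r ->
  let p := ((x, (y1, y2)) : C3) in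
  Cmod (y1 + corr1 p) <= / 2 /\ Cmod (y2 + corr2 p) <= / 2 /\ Cmod ((y2 + corr2 p) * (y1 + corr1 p)) <= r0 / 4 /\ Cmod (y2 * y1) <= r0 / 4.
Proof.
  intros HQ HQr Hy1 Hy2 p. destruct (shift_bound x Q p HQ eq_refl (conj Hy1 Hy2)) as [B1 B2].
  assert (U1 := Cmod_triangle y1 (corr1 p)). assert (U2 := Cmod_triangle y2 (corr2 p)).
  assert (C1 := Cmod_ge_0 (y1 + corr1 p)). assert (C2 := Cmod_ge_0 (y2 + corr2 p)). assert (C3 := Cmod_ge_0 y1). assert (C4 := Cmod_ge_0 y2).
  split; [lra|]. split; [lra|]. rewrite !Cmod_mult. split.
  - apply Rle_trans with ((2 * r) * (2 * r)); [apply Rmult_le_compat; lra|nra].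
  - apply Rle_trans with (r * r); [apply Rmult_le_compat; lra|nra].
Qed.

Lemma psi_close : exists K, 0 < K /\ forall x Q, S0 x -> Cmod x <= 1 -> terms_le r x Q -> 3 * Q <= r ->
  K * (3 * Q) * (1 + Cmod (L x)) / Cmod x <= 1 -> forall p, fst p = x -> polydisc r r (snd p) ->
  norm (minus (psi_of p) p) <= 2 * (K * (3 * Q) * (1 + Cmod (L x)) / Cmod x).
Proof.
  destruct (component_shift lambda a1 a2 c r0 M0 Ha Hc0 Hg S0 L HL) as [K [HK Hshift]].
  exists K. split; [exact HK|]. intros x Q Hx Hx1 HQ HQr Hsm [x0 [y1 y2]] Ex [Hy1 Hy2]. simpl in Ex, Hy1, Hy2. subst x0.
  set (p := ((x, (y1, y2)) : C3)).
  destruct (shift_bound x Q p HQ eq_refl (conj Hy1 Hy2)) as [B1 B2].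
  destruct (u_small x y1 y2 Q HQ HQr Hy1 Hy2) as [U1 [U2 [U3 U4]]]. fold p in U1, U2, U3.
  destruct (psi_of_components x y1 y2) as [_ [Z1 Z2]].
  destruct (Hshift x y2 y1 (y2 + corr2 p) (y1 + corr1 p) Hx)%C with (del := 3 * Q) as [T1 T2]; try assumption; try lra.
  { replace (y2 + corr2 p - y2)%C with (corr2 p) by ring. exact B2. }
  { replace (y1 + corr1 p - y1)%C with (corr1 p) by ring. exact B1. }
  assert (T1' : Cmod (fst (snd (psi_of p)) - y1) <= K * (3 * Q) * (1 + Cmod (L x)) / Cmod x).
  { eapply Rle_trans; [apply Req_le; exact (f_equal (fun z => Cmod (z - y1)%C) Z1)|exact T2]. }
  assert (T2' : Cmod (snd (snd (psi_of p)) - y2) <= K * (3 * Q) * (1 + Cmod (L x)) / Cmod x).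
  { eapply Rle_trans; [apply Req_le; exact (f_equal (fun z => Cmod (z - y2)%C) Z2)|exact T1]. }
  assert (E0 : fst (psi_of p) = x) by reflexivity.
  change (norm (minus (psi_of p) p) <= 2 * (K * (3 * Q) * (1 + Cmod (L x)) / Cmod x)).
  destruct (psi_of p) as [z0 [z1 z2]]. simpl in E0, T1', T2'. subst z0.
  destruct (norm_C3 (x - x) (z1 - y1) (z2 - y2)) as [_ [_ [_ N]]].
  assert (Zx : Cmod (x - x) = 0) by (replace (x - x)%C with (RtoC 0) by ring; apply Cmod_0). rewrite Zx in N.
  change (norm (((x - x)%C, ((z1 - y1)%C, (z2 - y2)%C)) : C3) <= 2 * (K * (3 * Q) * (1 + Cmod (L x)) / Cmod x)). lra.
Qed.

Context (Hflat : forall k, exists A kap d, 0 < A /\ 0 < kap /\ 0 < d /\ forall x, sec th k x -> Cmod x < d ->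
  S0 x /\ terms_le r x (A * exp (- (kap / Cmod x)))).

Lemma psi_flat k : exists A kap d, 0 < A /\ 0 < kap /\ 0 < d /\ forall x, sec th k x -> Cmod x < d ->
  S0 x /\ (exists Q, terms_le r x Q /\ 3 * Q <= r) /\
  forall p, fst p = x -> polydisc r r (snd p) -> norm (minus (psi_of p) p) <= A * exp (- (kap / Cmod x)).
Proof.
  destruct psi_close as [K [HK Hclose]]. destruct (Hflat k) as [A [kap [d [HA [Hkap [Hd HF]]]]]].
  destruct (AS_inter_sectors th S0 S0 HAS0 HAS0) as [rho [Hrho HN]].
  destruct (L_bound S0 L HS0 HL th rho Hrho (fun x Hx => proj1 (HN x Hx))) as [KL [HKL HLb]].
  set (A2 := K * 3 * A * KL * (8 / kap ^ 2)).
  assert (Hk2 : 0 < 8 / kap ^ 2) by (apply Rdiv_lt_0_compat; [lra|apply pow_lt; lra]).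
  assert (HA2 : 0 < A2) by (unfold A2; repeat apply Rmult_lt_0_compat; lra).
  destruct (exp_flat_small (3 * A) kap r) as [d1 [Hd1 Hs1]]; [lra|exact Hkap|lra|].
  destruct (exp_flat_small A2 (kap / 2) 1) as [d2 [Hd2 Hs2]]; [exact HA2|lra|lra|].
  exists (2 * A2), (kap / 2), (Rmin (Rmin d (rho k)) (Rmin d1 d2)).
  assert (Hrk := Hrho k). split; [lra|]. split; [lra|]. split; [repeat apply Rmin_pos; lra|].
  intros x Hsx Hxd.
  assert (D1 := Rlt_le_trans _ _ _ Hxd (Rmin_l _ _)). assert (D2 := Rlt_le_trans _ _ _ Hxd (Rmin_r _ _)).
  assert (D3 := Rlt_le_trans _ _ _ D1 (Rmin_l _ _)). assert (D4 := Rlt_le_trans _ _ _ D1 (Rmin_r _ _)).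
  assert (D5 := Rlt_le_trans _ _ _ D2 (Rmin_l _ _)). assert (D6 := Rlt_le_trans _ _ _ D2 (Rmin_r _ _)).
  assert (HNx : Nice th rho x) by (exists k; split; assumption). assert (Hxm := Nice_neq0 th rho x HNx).
  destruct (HF x Hsx D3) as [Hx HQ]. set (Q := A * exp (- (kap / Cmod x))) in *.
  assert (HQ0 : 0 < Q) by (apply Rmult_lt_0_compat; [exact HA|apply exp_pos]).
  assert (Hx2 : Cmod x ^ 2 <= 1) by (simpl; nra).
  assert (HQr : 3 * Q <= r).
  { specialize (Hs1 (Cmod x) (conj Hxm D5)). unfold Q. rewrite <- Rmult_assoc. nra. }
  assert (Hbd : K * (3 * Q) * (1 + Cmod (L x)) / Cmod x <= A2 * exp (- (kap / 2 / Cmod x))).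
  { apply Rle_trans with (K * (3 * Q) * (KL / Cmod x) / Cmod x).
    - unfold Rdiv at 1 2. apply Rmult_le_compat_r; [apply Rlt_le, Rinv_0_lt_compat; lra|].
      apply Rmult_le_compat_l; [nra|apply HLb, HNx].
    - unfold Q, A2. replace (K * (3 * (A * exp (- (kap / Cmod x)))) * (KL / Cmod x) / Cmod x) with (K * 3 * A * KL * (exp (- (kap / Cmod x)) / (Cmod x * Cmod x))) by (field; lra).
      rewrite (Rmult_assoc (K * 3 * A * KL)). apply Rmult_le_compat_l; [repeat apply Rmult_le_pos; lra|]. now apply exp_absorb. }
  split; [exact Hx|]. split; [exists Q; split; assumption|]. intros p Ep Hp.
  eapply Rle_trans; [apply (Hclose x Q Hx ltac:(lra) HQ HQr); [|exact Ep|exact Hp]|].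
  - specialize (Hs2 (Cmod x) (conj Hxm D6)). lra.
  - lra.
Qed.

Lemma psi_small eta : 0 < eta -> exists rho, (forall k, 0 < rho k <= 1) /\ forall x, Nice th rho x ->
  S0 x /\ (exists Q, terms_le r x Q /\ 3 * Q <= r) /\
  forall p, fst p = x -> polydisc r r (snd p) -> norm (minus (psi_of p) p) <= eta * Cmod x ^ 2.
Proof.
  intros He. apply Nice_shrink1. intros k. destruct (psi_flat k) as [A [kap [d [HA [Hkap [Hd HF]]]]]].
  destruct (exp_flat_small A kap eta HA Hkap He) as [d1 [Hd1 Hs]].
  exists (Rmin d d1). split; [apply Rmin_pos; lra|]. intros x Hsx Hx.
  assert (D1 := Rlt_le_trans _ _ _ Hx (Rmin_l _ _)). assert (D2 := Rlt_le_trans _ _ _ Hx (Rmin_r _ _)).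
  destruct (HF x Hsx D1) as [A1 [A2 A3]]. split; [exact A1|]. split; [exact A2|]. intros p Ep Hp.
  eapply Rle_trans; [apply A3; assumption|]. apply Hs. split; [apply (sec_pos th k x Hsx)|exact D2].
Qed.

End Build.

Lemma entire_cdiff (f : C -> C) z : entire f -> cdiff f z.
Proof. intros H. destruct (H z) as [d Hd]. exists d. now apply cderiv_is_derive. Qed.

(** * The constructed map is holomorphic and preserves the vector field *)

Section Isotropy.
Context (lambda a1 a2 : C) (c : nat -> C) (r0 M0 : R).
Context (Hlambda : lambda <> RtoC 0) (Ha : 0 < Re (a1 + a2)%C) (Hc0 : c 0%nat = RtoC 0) (Hg : geomb c r0 M0).
Context (th : R) (Hth : is_arg th lambda) (S0 : C -> Prop) (L : C -> C) (HAS0 : AS th PI S0) (HL : log_branch S0 L).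

Local Notation X x := (xpow L x (a1 + a2)%C).
Local Notation F1 := (f1 lambda a1 a2 c L).
Local Notation F2 := (f2 lambda a1 a2 c L).
Local Notation HS0 := (proj1 HAS0).
Local Notation h1 := (first1 lambda a1 a2 c L).
Local Notation h2 := (first2 lambda a1 a2 c L).
Local Notation wof := (wprod a1 a2 L).
Local Notation Y := (Ynorm lambda a1 a2 c).
Context (P1 P2 : eseq) (En1 : forall k, entire (P1 k)) (En2 : forall k, entire (P2 k)).
Local Notation terms_le := (terms_bounded lambda a1 a2 c L P1 P2).
Local Notation shift1 := (corr1 lambda a1 a2 c L P1).
Local Notation shift2 := (corr2 lambda a1 a2 c L P2).
Local Notation Psi1 := (comp1 lambda a1 a2 c L P1).
Local Notation Psi2 := (comp2 lambda a1 a2 c L P2).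
Local Notation psi := (psi_of lambda a1 a2 c L P1 P2).
Context (r : R) (Hr : 0 < r <= / 4) (Hrr : r <= r0 / 16).
Context (rho : nat -> R) (Hrho : forall k, 0 < rho k <= 1).
Context (HN : forall x, Nice th rho x -> S0 x /\ exists Q, terms_le r x Q /\ 3 * Q <= r).
Local Notation D := (sector_polydisc (Nice th rho) r r).

Lemma Nice_is_open : open (Nice th rho).
Proof. exact (proj1 (Nice_AS th rho (fun k => proj1 (Hrho k)))). Qed.

Lemma D_product p : D p -> Cmod (fst (snd p) * snd (snd p)) <= r0 / 4 /\ Cmod (Psi1 p * Psi2 p * X (fst p)) <= r0 / 4.
Proof.
  destruct p as [x [y1 y2]]. intros [Hx [Hy1 Hy2]]. simpl in Hx, Hy1, Hy2. destruct (HN x Hx) as [_ [Q [HQ HQr]]].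
  destruct (u_small lambda a1 a2 c r0 L P1 P2 r Hr Hrr x y1 y2 Q HQ HQr Hy1 Hy2) as [_ [_ [U3 U4]]].
  destruct (psi_of_components lambda a1 a2 c L P1 P2 x y1 y2) as [EW _]. split.
  - change (Cmod (y1 * y2) <= r0 / 4). now rewrite Cmult_comm.
  - eapply Rle_trans; [apply Req_le; exact (f_equal (fun z => Cmod (z * X x)) EW)|]. rewrite w_X, Cmult_comm. exact U3.
Qed.

Lemma hol_id0 (p : C3) : hol (fun q : C3 => fst q) p.
Proof. apply (hol_proj0 (fun q => q)), id_filterdiff. Qed.

Lemma hol_data p : D p -> hol wof p /\ hol h1 p /\ hol h2 p /\ hol (fun q => F1 (fst q) (wof q)) p /\ hol (fun q => F2 (fst q) (wof q)) p.
Proof.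
  intros HD. assert (Hx : S0 (fst p)) by apply (proj1 (HN _ (proj1 HD))). destruct (D_product p HD) as [Hv _].
  assert (W : hol wof p) by exact (hol_wof a1 a2 th S0 L HAS0 HL (fun q => q) p (id_filterdiff p) Hx).
  assert (HwX : Cmod (wof p * X (fst p)) <= r0 / 4) by (unfold wprod; rewrite w_X; exact Hv).
  split; [exact W|].
  split; [exact (hol_h1 lambda a1 a2 c r0 M0 Ha Hc0 Hg th S0 L HAS0 HL (fun q => q) p (id_filterdiff p) Hx Hv)|].
  split; [exact (hol_h2 lambda a1 a2 c r0 M0 Ha Hc0 Hg th S0 L HAS0 HL (fun q => q) p (id_filterdiff p) Hx Hv)|].
  split; [exact (hol_F1 lambda a1 a2 c r0 M0 Ha Hc0 Hg S0 L HS0 HL (fun q : C3 => fst q) wof p (hol_id0 p) W Hx HwX)|].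
  exact (hol_F2 lambda a1 a2 c r0 M0 Ha Hc0 Hg S0 L HS0 HL (fun q : C3 => fst q) wof p (hol_id0 p) W Hx HwX).
Qed.

Lemma hol_shift p : D p -> hol shift1 p /\ hol shift2 p.
Proof.
  intros HD. destruct (sector_polydisc_ball (Nice th rho) r r p Nice_is_open HD) as [d [Hd Hball]].
  assert (HQ1 : forall q : C3, D q -> forall n, Cmod (term1 lambda a1 a2 c L P1 n q) <= 1 * (/ 2) ^ n /\ Cmod (term2 lambda a1 a2 c L P2 n q) <= 1 * (/ 2) ^ n).
  { intros q [Hx Hy] n. destruct (HN _ Hx) as [_ [Q [HQ HQr]]]. destruct (HQ q eq_refl Hy n) as [A1 A2].
    assert (Q * (/ 2) ^ n <= 1 * (/ 2) ^ n) by (apply Rmult_le_compat_r; [apply pow_le|]; lra). lra. }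
  split.
  - apply (hol_CSeries (fun n q => term1 lambda a1 a2 c L P1 n q) p d 1 Hd). intros q Hq n.
    split; [|apply HQ1, Hball, Hq]. destruct (hol_data q (Hball q Hq)) as [W [G1 [G2 [K1 K2]]]].
    apply hol_mult; [apply hol_mult|exact K1]; [exact (hol_comp (P1 n) wof q W (entire_cdiff _ _ (En1 n)))|now apply hol_pow].
  - apply (hol_CSeries (fun n q => term2 lambda a1 a2 c L P2 n q) p d 1 Hd). intros q Hq n.
    split; [|apply HQ1, Hball, Hq]. destruct (hol_data q (Hball q Hq)) as [W [G1 [G2 [K1 K2]]]].
    apply hol_mult; [apply hol_mult|exact K2]; [exact (hol_comp (P2 n) wof q W (entire_cdiff _ _ (En2 n)))|now apply hol_pow].
Qed.

Lemma hol_psi : holomorphic_on D psi.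
Proof.
  intros p HD. assert (Hx : S0 (fst p)) by apply (proj1 (HN _ (proj1 HD))). destruct (D_product p HD) as [_ Hv].
  destruct (hol_data p HD) as [W [G1 [G2 [K1 K2]]]]. destruct (hol_shift p HD) as [T1 T2].
  assert (HP1 : hol Psi1 p) by (apply hol_plus; [exact G1|apply hol_div; [apply F1_neq0|exact T1|exact K1]]).
  assert (HP2 : hol Psi2 p) by (apply hol_plus; [exact G2|apply hol_div; [apply F2_neq0|exact T2|exact K2]]).
  assert (HP := hol_mult Psi1 Psi2 p HP1 HP2).
  apply hol_C3; [exact (hol_id0 p)| |].
  - apply (hol_mult Psi1 (fun q => F1 (fst q) (Psi1 q * Psi2 q)%C) p HP1).
    exact (hol_F1 lambda a1 a2 c r0 M0 Ha Hc0 Hg S0 L HS0 HL (fun q : C3 => fst q) (fun q => Psi1 q * Psi2 q)%C p (hol_id0 p) HP Hx Hv).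
  - apply (hol_mult Psi2 (fun q => F2 (fst q) (Psi1 q * Psi2 q)%C) p HP2).
    exact (hol_F2 lambda a1 a2 c r0 M0 Ha Hc0 Hg S0 L HS0 HL (fun q : C3 => fst q) (fun q => Psi1 q * Psi2 q)%C p (hol_id0 p) HP Hx Hv).
Qed.

(** Both series involve the point only through [h_1], [h_2] and [w], hence their sums are constant
    along integral curves. *)
Lemma Psi_first_integral p q : D p -> D q -> h1 p = h1 q -> h2 p = h2 q -> wof p = wof q -> Psi1 p = Psi1 q /\ Psi2 p = Psi2 q.
Proof.
  intros Hp Hq E1 E2 Ew.
  destruct (HN _ (proj1 Hp)) as [_ [Q [HQ _]]]. destruct (HN _ (proj1 Hq)) as [_ [Q' [HQ' _]]].
  destruct (Psi_expansions lambda a1 a2 c L P1 P2 r _ Q p HQ eq_refl (proj2 Hp)) as [A1 A2].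
  destruct (Psi_expansions lambda a1 a2 c L P1 P2 r _ Q' q HQ' eq_refl (proj2 Hq)) as [B1 B2].
  rewrite E1, Ew in A1. rewrite E2, E1, Ew in A2.
  assert (Z1 := is_series_C_unique _ _ _ A1 B1). assert (Z2 := is_series_C_unique _ _ _ A2 B2). split.
  - replace (Psi1 p) with ((Psi1 p - h1 q) + h1 q)%C by ring. rewrite Z1. ring.
  - replace (Psi2 p) with ((Psi2 p - h2 q) + h2 q)%C by ring. rewrite Z2. ring.
Qed.

Lemma flow_curve (g1 g2 x : C) : S0 x -> Cmod (g1 * g2 * X x) <= r0 / 4 ->
  let f1' := fun z => (g1 * F1 z (g1 * g2))%C in let f2' := fun z => (g2 * F2 z (g1 * g2))%C in
  (f1' x * f2' x)%C = (g1 * g2 * X x)%C /\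
  cderiv f1' x ((- lambda + a1 * x - CPSeries c (f1' x * f2' x)) * f1' x / (x * x))%C /\
  cderiv f2' x ((lambda + a2 * x + CPSeries c (f1' x * f2' x)) * f2' x / (x * x))%C.
Proof.
  intros Hx Hv f1' f2'. assert (Hx0 := S0_neq0 S0 L HL x Hx).
  assert (E : (f1' x * f2' x)%C = (g1 * g2 * X x)%C) by (unfold f1', f2'; rewrite <- (F1_F2 lambda a1 a2 c L x (g1 * g2)); ring).
  split; [exact E|]. rewrite E. split.
  - eapply cderiv_eq; [|apply cderiv_mult; [apply cderiv_const|apply (F1_curve lambda a1 a2 c r0 M0 Ha Hc0 Hg S0 L HS0 HL (fun _ => (g1 * g2)%C) x Hx (cderiv_const _ x) Hv)]].
    unfold f1'. cfield. exact Hx0.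
  - eapply cderiv_eq; [|apply cderiv_mult; [apply cderiv_const|apply (F2_curve lambda a1 a2 c r0 M0 Ha Hc0 Hg S0 L HS0 HL (fun _ => (g1 * g2)%C) x Hx (cderiv_const _ x) Hv)]].
    unfold f2'. cfield. exact Hx0.
Qed.

(** The curve through [p] with constant [h] is sent by [psi] to a curve with constant [h] again.
    Both are integral curves of [Y / x^2]; comparing the chain rule with the explicit velocity of
    the image gives the identity. *)
Lemma psi_pushforward : pushforward_eq D psi Y Y.
Proof.
  intros p HD. destruct (hol_psi p HD) as [dpsi Hd]. exists dpsi. split; [exact Hd|].
  set (x := fst p). assert (Hx : S0 x) by apply (proj1 (HN _ (proj1 HD))). assert (Hx0 := S0_neq0 S0 L HL x Hx).
  destruct (D_product p HD) as [Hv HV]. fold x in HV.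
  set (g1 := h1 p). set (g2 := h2 p).
  assert (Ew : (g1 * g2)%C = wof p) by apply h1_h2.
  assert (Hv1 : Cmod (g1 * g2 * X x) <= r0 / 4) by (rewrite Ew; unfold wprod; rewrite w_X; exact Hv).
  destruct (flow_curve g1 g2 x Hx Hv1) as [E [D1 D2]].
  set (f1' := fun z => (g1 * F1 z (g1 * g2))%C) in *. set (f2' := fun z => (g2 * F2 z (g1 * g2))%C) in *.
  assert (Ep : p = ((x, (f1' x, f2' x)) : C3)) by (symmetry; exact (Hinv_Hmap lambda a1 a2 c L p)).
  assert (EY : ((RtoC 1, ((- lambda + a1 * x - CPSeries c (f1' x * f2' x)) * f1' x / (x * x), (lambda + a2 * x + CPSeries c (f1' x * f2' x)) * f2' x / (x * x))%C) : C3) = scal (/ (x * x))%C (Y p)).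
  { rewrite Ep at 1.
    apply (C3_eq _ _ _ (/ (x * x) * (x ^ 2))%C (/ (x * x) * ((- lambda + a1 * x - CPSeries c (f1' x * f2' x)) * f1' x))%C
      (/ (x * x) * ((lambda + a2 * x + CPSeries c (f1' x * f2' x)) * f2' x))%C); simpl; field; exact Hx0. }
  assert (Hd' : filterdiff psi (locally ((x, (f1' x, f2' x)) : C3)) dpsi) by (rewrite <- Ep; exact Hd).
  destruct (curve_pushforward psi f1' f2' x _ _ dpsi (/ (x * x))%C (Y p) Hd' D1 D2 EY) as [C1 [C2 C0]].
  assert (HV2 : Cmod (Psi1 p * Psi2 p * X x) <= r0 / 4) by exact HV.
  destruct (flow_curve (Psi1 p) (Psi2 p) x Hx HV2) as [_ [G1 G2]].
  set (k1 := fun z => (Psi1 p * F1 z (Psi1 p * Psi2 p))%C) in *. set (k2 := fun z => (Psi2 p * F2 z (Psi1 p * Psi2 p))%C) in *.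
  assert (Epsi : psi p = ((x, (k1 x, k2 x)) : C3)) by reflexivity.
  destruct (sector_polydisc_ball (Nice th rho) r r p Nice_is_open HD) as [d [Hd0 Hball]].
  destruct (cderiv_continuous f1' x _ D1 (d / 3)) as [e1 [He1 HC1]]; [lra|].
  destruct (cderiv_continuous f2' x _ D2 (d / 3)) as [e2 [He2 HC2]]; [lra|].
  set (e := Rmin (d / 3) (Rmin e1 e2)). assert (He : 0 < e) by (repeat apply Rmin_pos; lra).
  assert (Hloc : forall z : C, Cmod (z - x) < e -> psi (z, (f1' z, f2' z)) = ((z, (k1 z, k2 z)) : C3)).
  { intros z Hz. assert (Z1 := Rlt_le_trans _ _ _ Hz (Rmin_l _ _)). assert (Z2 := Rlt_le_trans _ _ _ Hz (Rmin_r _ _)).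
    assert (Z3 := Rlt_le_trans _ _ _ Z2 (Rmin_l _ _)). assert (Z4 := Rlt_le_trans _ _ _ Z2 (Rmin_r _ _)).
    assert (HDz : D (z, (f1' z, f2' z))).
    { apply Hball. rewrite Ep.
      change (norm (((z - x)%C, ((f1' z - f1' x)%C, (f2' z - f2' x)%C)) : C3) < d).
      destruct (norm_C3 (z - x) (f1' z - f1' x) (f2' z - f2' x)) as [_ [_ [_ N]]]. specialize (HC1 z Z3). specialize (HC2 z Z4). lra. }
    assert (EH : Hmap lambda a1 a2 c L (z, (f1' z, f2' z)) = ((z, (g1, g2)) : C3)) by exact (Hmap_Hinv lambda a1 a2 c L ((z, (g1, g2)) : C3)).
    assert (EH1 : h1 (z, (f1' z, f2' z)) = h1 p) by exact (f_equal (fun q : C3 => fst (snd q)) EH).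
    assert (EH2 : h2 (z, (f1' z, f2' z)) = h2 p) by exact (f_equal (fun q : C3 => snd (snd q)) EH).
    destruct (Psi_first_integral (z, (f1' z, f2' z)) p HDz HD EH1 EH2) as [Q1 Q2].
    { rewrite <- (h1_h2 lambda a1 a2 c L), <- (h1_h2 lambda a1 a2 c L p), EH1, EH2. reflexivity. }
    unfold psi_of. rewrite Q1, Q2. reflexivity. }
  assert (U0 : (/ (x * x) * fst (dpsi (Y p)))%C = RtoC 1).
  { apply (cderiv_unique (fun z => z) x); [|apply cderiv_id]. apply (cderiv_ext_loc _ _ x _ e He) with (2 := C0). intros z Hz. now rewrite (Hloc z Hz). }
  assert (U1 := cderiv_unique _ _ _ _ (cderiv_ext_loc _ k1 x _ e He (fun z Hz => f_equal (fun q : C3 => fst (snd q)) (Hloc z Hz)) C1) G1).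
  assert (U2 := cderiv_unique _ _ _ _ (cderiv_ext_loc _ k2 x _ e He (fun z Hz => f_equal (fun q : C3 => snd (snd q)) (Hloc z Hz)) C2) G2).
  assert (Hm : forall u v : C, (/ (x * x) * u)%C = (v / (x * x))%C -> u = v).
  { intros u v Huv. replace u with ((x * x) * (/ (x * x) * u))%C by (field; exact Hx0). rewrite Huv. field. exact Hx0. }
  rewrite Epsi. set (V := dpsi (Y p)) in *. destruct V as [v0 [v1 v2]]. cbn [fst snd] in U0, U1, U2.
  apply C3_eq.
  - apply Hm. rewrite U0. simpl. field. exact Hx0.
  - apply Hm. exact U1.
  - apply Hm. exact U2.
Qed.

End Isotropy.

(** * The bijection for the direction of lambda *)

Section Main.
Context (lambda a1 a2 : C) (c : nat -> C).
Context (Hlambda : lambda <> RtoC 0) (Ha : 0 < Re (a1 + a2)%C) (Hc0 : c 0%nat = RtoC 0).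
Context (th : R) (Hth : is_arg th lambda) (S0 : C -> Prop) (L : C -> C) (HAS0 : AS th PI S0) (HL : log_branch S0 L).

Lemma backward_plus r0 M0 (P : eseq * eseq) : geomb c r0 M0 ->
  E1_plus th lambda a1 a2 c S0 L (fst P) -> E2_plus th lambda a1 a2 c S0 L (snd P) ->
  exists psi, Lambda th lambda a1 a2 c psi /\ expansion_of Psi_plus th lambda a1 a2 c S0 L psi P.
Proof.
  intros Hg HE1 HE2. destruct P as [P1 P2]. simpl in HE1, HE2.
  assert (En1 : forall k, entire (P1 k)) by apply HE1. assert (En2 : forall k, entire (P2 k)) by apply HE2.
  destruct (terms_flat lambda a1 a2 c r0 M0 Hlambda Ha Hc0 Hg th Hth S0 L HAS0 HL P1 P2 HE1 HE2) as [r [Hr [Hrr Hflat]]].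
  destruct (psi_small lambda a1 a2 c r0 M0 Ha Hc0 Hg th S0 L HAS0 HL P1 P2 r Hr Hrr Hflat (r / 32)) as [rho [Hrho HN]]; [lra|].
  assert (HN' : forall x, Nice th rho x -> S0 x /\ exists Q, terms_bounded lambda a1 a2 c L P1 P2 r x Q /\ 3 * Q <= r).
  { intros x Hx. destruct (HN x Hx) as [A [B _]]. now split. }
  set (psi := psi_of lambda a1 a2 c L P1 P2).
  assert (Hdisp : forall p, sector_polydisc (Nice th rho) r r p -> norm (minus (psi p) p) <= r / 32 * Cmod (fst p) ^ 2).
  { intros p [Hx Hy]. apply (HN (fst p) Hx); [reflexivity|exact Hy]. }
  assert (Hx1 : forall x, Nice th rho x -> Cmod x ^ 2 <= 1).
  { intros x Hx. rewrite <- (pow1 2). apply pow_incr. split; [apply Cmod_ge_0|apply (Nice_le1 th rho Hrho x Hx)]. }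
  assert (Hdisp1 : forall p, sector_polydisc (Nice th rho) r r p -> norm (minus (psi p) p) <= r / 32).
  { intros p HD. eapply Rle_trans; [apply Hdisp, HD|]. specialize (Hx1 (fst p) (proj1 HD)). nra. }
  assert (Hsub : forall p, sector_polydisc (Nice th rho) (r / 16) (r / 16) p -> sector_polydisc (Nice th rho) r r p).
  { intros p [Hx [Hy1 Hy2]]. split; [exact Hx|]. split; lra. }
  assert (Hr0 : 0 < r0) by apply Hg.
  assert (Hdom : forall p, sector_polydisc (Nice th rho) (r / 16) (r / 16) p -> Ynorm_domain c p /\ Ynorm_domain c (psi p)).
  { intros p HD. destruct (D_product lambda a1 a2 c r0 th S0 L P1 P2 r Hr Hrr rho HN' p (Hsub p HD)) as [V1 V2]. split.
    - apply (geomb_radius c r0 M0); [exact Hg|]. split; [apply Cmod_ge_0|lra].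
    - apply (geomb_radius c r0 M0); [exact Hg|]. split; [apply Cmod_ge_0|].
      apply Rle_lt_trans with (r0 / 4); [|lra]. eapply Rle_trans; [apply Req_le|exact V2]. f_equal.
      rewrite <- (F1_F2 lambda a1 a2 c L (fst p) (comp1 lambda a1 a2 c L P1 p * comp2 lambda a1 a2 c L P2 p)).
      unfold psi, psi_of, Hinv. cbn [fst snd]. ring. }
  assert (Hhol := hol_psi lambda a1 a2 c r0 M0 Ha Hc0 Hg th S0 L HAS0 HL P1 P2 En1 En2 r Hr Hrr rho Hrho HN').
  assert (Hpush := psi_pushforward lambda a1 a2 c r0 M0 Ha Hc0 Hg th S0 L HAS0 HL P1 P2 En1 En2 r Hr Hrr rho Hrho HN').
  assert (HASN : AS th PI (Nice th rho)) by (apply Nice_AS; intros k; apply Hrho).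
  exists psi. split.
  (* The series are controlled on the polydisc of radius [r]; injectivity and the inverse require
     the radius [r / 16]. *)
  - exists (Nice th rho), (r / 16), (r / 16). split; [exact HASN|]. split; [lra|]. split; [lra|]. cbv zeta.
    split; [exact Hdom|]. split; [|split; [|split; [|split]]].
    + apply perturbation_biholomorphic; [exact (proj1 HASN)|lra|intros p _; reflexivity|exact Hhol|exact Hdisp1].
    + intros p _. reflexivity.
    + exists (r / 32), 1. split; [lra|]. split; [lra|]. intros p HD _. eapply Rle_trans; [apply Hdisp, Hsub, HD|].
      apply Rmult_le_compat_l; [lra|]. apply pow_incr. split; [apply Cmod_ge_0|]. destruct p as [x [y1 y2]]. apply norm_C3.
    + intros p HD. apply Hpush, Hsub, HD.
    + apply flat_Gevrey; [exact Hrho|lra| |].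
      * intros p HD. eapply Rle_trans; [apply Hdisp1, Hsub, HD|]. lra.
      * intros k. destruct (psi_flat lambda a1 a2 c r0 M0 Ha Hc0 Hg th S0 L HAS0 HL P1 P2 r Hr Hrr Hflat k) as [A [kap [d [HA [Hkap [Hd HF]]]]]].
        exists A, kap, d. split; [exact HA|]. split; [exact Hkap|]. split; [exact Hd|]. intros p HD Hs Hx.
        apply (HF (fst p) Hs Hx); [reflexivity|]. apply Hsub, HD.
  - split; [exact En1|]. split; [exact En2|]. exists (Nice th rho), (r / 16), (r / 16). split; [exact HASN|].
    split; [intros x Hx; apply (HN x Hx)|]. split; [lra|]. split; [lra|]. intros p HD. destruct (Hdom p HD) as [Dm1 Dm2].
    split; [exact Dm1|]. split; [exact Dm2|]. intros x h Hh. rewrite Hmap_h in Hh. injection Hh as E0 Eh. subst x h.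
    exists (comp1 lambda a1 a2 c L P1 p, comp2 lambda a1 a2 c L P2 p). split; [|exact (Hmap_Hinv lambda a1 a2 c L _)].
    destruct (HN' (fst p) (proj1 HD)) as [_ [Q [HQ _]]].
    unfold Psi_plus. simpl fst. simpl snd. rewrite h1_h2.
    exact (Psi_expansions lambda a1 a2 c L P1 P2 r (fst p) Q p HQ eq_refl (proj2 (Hsub p HD))).
Qed.

Lemma bijection_plus : Rbar_lt 0 (C_CV_radius c) ->
  induces_bijection (germ_eq th) (Lambda th lambda a1 a2 c)
    (fun P : eseq * eseq => E1_plus th lambda a1 a2 c S0 L (fst P) /\ E2_plus th lambda a1 a2 c S0 L (snd P))
    (expansion_of Psi_plus th lambda a1 a2 c S0 L).
Proof.
  intros Hc. destruct (geomb_exists c Hc) as [r0 [M0 [Hg Hr0]]].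
  (* The inhabitant only makes [epsilon] applicable; on [Lambda] an expansion exists, so [F psi] is
     one. *)
  set (F := fun psi => epsilon (inhabits ((fun _ z => z, fun _ z => z) : eseq * eseq)) (expansion_of Psi_plus th lambda a1 a2 c S0 L psi)).
  assert (HF : forall psi, Lambda th lambda a1 a2 c psi -> expansion_of Psi_plus th lambda a1 a2 c S0 L psi (F psi) /\
    E1_plus th lambda a1 a2 c S0 L (fst (F psi)) /\ E2_plus th lambda a1 a2 c S0 L (snd (F psi))).
  { intros psi Hpsi.
    destruct (forward_plus lambda a1 a2 c r0 M0 Hlambda Ha Hc0 Hg th Hth S0 L HAS0 HL psi Hpsi) as [P [HE HP]].
    assert (HFp : expansion_of Psi_plus th lambda a1 a2 c S0 L psi (F psi)) by (apply epsilon_spec; now exists P).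
    split; [exact HFp|]. now rewrite (expansion_unique lambda a1 a2 c Ha th S0 L HAS0 HL psi (F psi) P HFp HP). }
  exists F. split; [|split; [|split]].
  - intros psi Hpsi P. split.
    + intros HP. exact (expansion_unique lambda a1 a2 c Ha th S0 L HAS0 HL psi P (F psi) HP (proj1 (HF psi Hpsi))).
    + intros ->. exact (proj1 (HF psi Hpsi)).
  - intros psi Hpsi. exact (proj2 (HF psi Hpsi)).
  - intros psi psi' Hpsi Hpsi'. destruct (HF psi Hpsi) as [H _]. destruct (HF psi' Hpsi') as [H' _]. split.
    + intros E. rewrite E in H. exact (expansion_germ_eq lambda a1 a2 c th S0 L psi psi' _ H H').
    + intros HG. assert (H2 := expansion_germ_transfer lambda a1 a2 c th S0 L psi psi' _ HG H).
      exact (expansion_unique lambda a1 a2 c Ha th S0 L HAS0 HL psi' _ _ H2 H').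
  - intros P [HE1 HE2]. destruct (backward_plus r0 M0 P Hg HE1 HE2) as [psi [Hpsi HP]]. exists psi. split; [exact Hpsi|].
    exact (expansion_unique lambda a1 a2 c Ha th S0 L HAS0 HL psi _ _ (proj1 (HF psi Hpsi)) HP).
Qed.

End Main.

(** * Exchange of [y_1] and [y_2] *)

Definition swap2 (y : C2) : C2 := (snd y, fst y).
Definition swap (p : C3) : C3 := (fst p, swap2 (snd p)).
Definition swap_conj (psi : C3 -> C3) (p : C3) : C3 := swap (psi (swap p)).

Lemma swap_swap p : swap (swap p) = p.
Proof. destruct p as [x [y1 y2]]. reflexivity. Qed.

Lemma swap_conj_swap_conj psi : swap_conj (swap_conj psi) = psi.
Proof. extensionality p. unfold swap_conj. now rewrite !swap_swap. Qed.

Lemma norm_swap (p : C3) : norm (swap p) = norm p.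
Proof.
  destruct p as [x [y1 y2]].
  change (sqrt (Cmod x ^ 2 + (sqrt (Cmod y2 ^ 2 + Cmod y1 ^ 2)) ^ 2) = sqrt (Cmod x ^ 2 + (sqrt (Cmod y1 ^ 2 + Cmod y2 ^ 2)) ^ 2)).
  now rewrite (Rplus_comm (Cmod y2 ^ 2)).
Qed.

Lemma norm_minus_swap (p q : C3) : norm (minus (swap p) (swap q)) = norm (minus p q).
Proof. exact (norm_swap (minus p q)). Qed.

Lemma is_linear_swap : is_linear (U := C3) (V := C3) swap.
Proof.
  split.
  - intros p q. reflexivity.
  - intros k p. reflexivity.
  - exists 1. split; [lra|]. intros p. rewrite norm_swap. lra.
Qed.

Lemma swap_filterdiff (p : C3) : filterdiff swap (locally p) swap.
Proof. apply filterdiff_linear, is_linear_swap. Qed.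

Lemma swap_ex_filterdiff psi (p : C3) : ex_filterdiff psi (locally (swap p)) -> ex_filterdiff (swap_conj psi) (locally p).
Proof.
  intros H. apply (hol_comp3 (U := C3) (V := C3) (W := C3) swap (fun q => psi (swap q)) p); [eexists; apply swap_filterdiff|].
  apply (hol_comp3 (U := C3) (V := C3) (W := C3) psi swap p H). eexists. apply swap_filterdiff.
Qed.

Lemma swap_sector S r1 r2 p : sector_polydisc S r2 r1 p -> sector_polydisc S r1 r2 (swap p).
Proof. intros [Hx [H1 H2]]. split; [exact Hx|]. now split. Qed.

Lemma swap_image S r1 r2 psi q : image (sector_polydisc S r2 r1) (swap_conj psi) q <-> image (sector_polydisc S r1 r2) psi (swap q).
Proof.
  split.
  - intros [p [Hp <-]]. exists (swap p). split; [now apply swap_sector|]. unfold swap_conj. now rewrite swap_swap.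
  - intros [p [Hp E]]. exists (swap p). split; [now apply swap_sector|]. unfold swap_conj. rewrite swap_swap, E. apply swap_swap.
Qed.

Lemma open_swap (D : C3 -> Prop) : open D -> open (fun p => D (swap p)).
Proof.
  intros H. apply open_norm. intros p Hp. assert (HL := H _ Hp). apply locally_norm_le_locally in HL. destruct HL as [e He].
  exists e. split; [apply cond_pos|]. intros q Hq. apply He. change (norm (minus (swap q) (swap p)) < e). now rewrite norm_minus_swap.
Qed.

Lemma sum_below_swap (u : nat -> C3) N : swap (sum_below u N) = sum_below (fun k => swap (u k)) N.
Proof. induction N as [|N IH]; [reflexivity|]. simpl. rewrite <- IH. reflexivity. Qed.

Section Symmetry.
Context (lambda a1 a2 : C) (c : nat -> C).
Local Notation c' := (fun k => - c k)%C.

Lemma CSeries_opp (u : nat -> C) : CSeries (fun k => - u k)%C = (- CSeries u)%C.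
Proof. unfold CSeries. simpl. rewrite !Series_opp. reflexivity. Qed.

Lemma CSeries_ext (u v : nat -> C) : (forall k, u k = v k) -> CSeries u = CSeries v.
Proof. intros H. f_equal. now extensionality k. Qed.

Lemma CPSeries_opp (u : nat -> C) v : CPSeries (fun k => - u k)%C v = (- CPSeries u v)%C.
Proof. unfold CPSeries. rewrite <- CSeries_opp. apply CSeries_ext. intros k. ring. Qed.

Lemma C_CV_radius_opp : C_CV_radius c' = C_CV_radius c.
Proof. apply CV_radius_ext. intros k. apply Cmod_opp. Qed.

Lemma tilde_coeff_opp m : tilde_coeff c' m = (fun k => - tilde_coeff c m k)%C.
Proof.
  extensionality k. unfold tilde_coeff. destruct k as [|k]; [ring|].
  destruct (Ceq_dec (INR (S k)) m); [ring|]. unfold Cdiv. ring.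
Qed.

Lemma resonant_term_opp m w : resonant_term c' m w = (- resonant_term c m w)%C.
Proof. unfold resonant_term. destruct (excluded_middle_informative _); ring. Qed.

(** Both [lambda] and [c] change sign while [a] is symmetric in [a1] and [a2]; a change of sign of
    the exponent is what exchanges [f_1] and [f_2]. *)
Lemma f_exponent_swap L x w : f_exponent (- lambda) a2 a1 c' L x w = (- f_exponent lambda a1 a2 c L x w)%C.
Proof.
  unfold f_exponent. rewrite (Cplus_comm a2 a1), tilde_coeff_opp, CPSeries_opp, resonant_term_opp. unfold Cdiv. ring.
Qed.

Lemma f1_swap L x w : f1 (- lambda) a2 a1 c' L x w = f2 lambda a1 a2 c L x w.
Proof. unfold f1, f2. now rewrite f_exponent_swap. Qed.

Lemma f2_swap L x w : f2 (- lambda) a2 a1 c' L x w = f1 lambda a1 a2 c L x w.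
Proof. unfold f1, f2. rewrite f_exponent_swap. do 2 f_equal. ring. Qed.

Lemma Ynorm_swap p : Ynorm (- lambda) a2 a1 c' p = swap (Ynorm lambda a1 a2 c (swap p)).
Proof.
  destruct p as [x [y1 y2]]. unfold Ynorm. simpl. rewrite CPSeries_opp, (Cmult_comm y2 y1).
  apply C3_eq; simpl; ring.
Qed.

Lemma Ynorm_domain_swap p : Ynorm_domain c (swap p) -> Ynorm_domain c' p.
Proof. unfold Ynorm_domain. rewrite C_CV_radius_opp. destruct p as [x [y1 y2]]. simpl. now rewrite Cmult_comm. Qed.

Lemma Hmap_swap L p : Hmap (- lambda) a2 a1 c' L p = swap (Hmap lambda a1 a2 c L (swap p)).
Proof.
  destruct p as [x [y1 y2]]. unfold Hmap. simpl. rewrite f1_swap, f2_swap, (Cplus_comm a2 a1), (Cmult_comm y2 y1). reflexivity.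
Qed.

Lemma Lambda_swap th psi : Lambda th lambda a1 a2 c psi -> Lambda th (- lambda) a2 a1 c' (swap_conj psi).
Proof.
  intros [S [r1 [r2 [HS [Hr1 [Hr2 [Hdom [[Hhol [Hop [g [Hg1 Hg2]]]] [Hfib [Htan [Hpush [_ HGev]]]]]]]]]]]].
  exists S, r2, r1. split; [exact HS|]. split; [exact Hr2|]. split; [exact Hr1|]. cbv zeta.
  split; [|split; [|split; [|split; [|split]]]].
  - intros p Hp. destruct (Hdom _ (swap_sector _ _ _ _ Hp)) as [D1 D2]. split; apply Ynorm_domain_swap; [exact D1|].
    unfold swap_conj. now rewrite swap_swap.
  - split; [intros p Hp; apply swap_ex_filterdiff, Hhol, swap_sector, Hp|]. split.
    + apply (open_ext (fun q => image (sector_polydisc S r1 r2) psi (swap q))); [intros q; symmetry; apply swap_image|]. now apply open_swap.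
    + exists (swap_conj g). split.
      * intros q Hq. apply swap_ex_filterdiff, Hg1. now apply swap_image.
      * intros p Hp. unfold swap_conj. rewrite swap_swap, Hg2 by now apply swap_sector. apply swap_swap.
  - intros p Hp. exact (Hfib (swap p) (swap_sector _ _ _ _ Hp)).
  - destruct Htan as [K [d [HK [Hd HT]]]]. exists K, d. split; [exact HK|]. split; [exact Hd|]. intros p Hp Hpd.
    rewrite <- (swap_swap p) at 2. unfold swap_conj. rewrite norm_minus_swap, <- (norm_swap p).
    apply HT; [now apply swap_sector|now rewrite norm_swap].
  - intros p Hp. destruct (Hpush _ (swap_sector _ _ _ _ Hp)) as [dpsi [Hd E]]. exists (swap_conj dpsi). split.
    + assert (H1 := filterdiff_comp' (U := C3) (V := C3) (W := C3) swap psi p swap dpsi (swap_filterdiff p) Hd).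
      exact (filterdiff_comp' (U := C3) (V := C3) (W := C3) (fun q => psi (swap q)) swap p (fun q => dpsi (swap q)) swap H1 (swap_filterdiff _)).
    + unfold swap_conj. rewrite Ynorm_swap, swap_swap, E, Ynorm_swap, swap_swap. reflexivity.
  - split; [intros k y _; apply identity_coeff_hol|]. intros alpha beta rho Hrho Hsub.
    destruct (HGev alpha beta rho Hrho Hsub) as [A [B [HA [HB HE]]]]. exists A, B. split; [exact HA|]. split; [exact HB|].
    intros N x y Hx [Hy1 Hy2]. eapply Rle_trans; [apply Req_le|exact (HE N x (swap2 y) Hx (conj Hy2 Hy1))].
    assert (ES : sum_below (V := C3) (fun k => scal (x ^ k : C)%C (identity_coeff k y)) N
      = swap (sum_below (V := C3) (fun k => scal (x ^ k : C)%C (identity_coeff k (swap2 y))) N)).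
    { rewrite sum_below_swap. f_equal. extensionality k. destruct y as [y1 y2]. destruct k as [|[|k]]; reflexivity. }
    rewrite ES. exact (norm_minus_swap (psi (x, swap2 y)) _).
Qed.

Lemma conjugate_swap th S0 L psi Psi : conjugate_is th lambda a1 a2 c S0 L psi Psi ->
  conjugate_is th (- lambda) a2 a1 c' S0 L (swap_conj psi) (fun h z => Psi (swap2 h) (swap2 z)).
Proof.
  intros [S [r1 [r2 [HS [HSS [Hr1 [Hr2 H]]]]]]]. exists S, r2, r1.
  split; [exact HS|]. split; [exact HSS|]. split; [exact Hr2|]. split; [exact Hr1|]. intros p Hp.
  destruct (H _ (swap_sector _ _ _ _ Hp)) as [D1 [D2 HH]]. split; [now apply Ynorm_domain_swap|].
  split; [apply Ynorm_domain_swap; unfold swap_conj; now rewrite swap_swap|]. intros x h Hh.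
  rewrite Hmap_swap in Hh. destruct (HH x (swap2 h)) as [z [Hz1 Hz2]].
  { rewrite <- (swap_swap (Hmap lambda a1 a2 c L (swap p))), Hh. reflexivity. }
  exists (swap2 z). split; [destruct z; exact Hz1|]. rewrite Hmap_swap. unfold swap_conj. rewrite swap_swap, Hz2. reflexivity.
Qed.

End Symmetry.

Lemma germ_eq_swap th psi psi' : germ_eq th psi psi' -> germ_eq th (swap_conj psi) (swap_conj psi').
Proof.
  intros [S [r1 [r2 [HS [Hr1 [Hr2 H]]]]]]. exists S, r2, r1. split; [exact HS|]. split; [exact Hr2|]. split; [exact Hr1|].
  intros p Hp. unfold swap_conj. now rewrite (H _ (swap_sector _ _ _ _ Hp)).
Qed.

Lemma conjugate_is_ext th lambda a1 a2 c S0 L psi (Psi Psi' : C2 -> C2 -> Prop) : (forall h z, Psi h z -> Psi' h z) ->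
  conjugate_is th lambda a1 a2 c S0 L psi Psi -> conjugate_is th lambda a1 a2 c S0 L psi Psi'.
Proof.
  intros HPP [S [r1 [r2 [HS [HSS [Hr1 [Hr2 H]]]]]]]. exists S, r1, r2. repeat (split; [assumption|]). intros p Hp.
  destruct (H p Hp) as [D1 [D2 HH]]. split; [exact D1|]. split; [exact D2|]. intros x h Hh.
  destruct (HH x h Hh) as [z [Hz1 Hz2]]. exists z. split; [now apply HPP|exact Hz2].
Qed.

Lemma Eset_swap th a a' c c' S0 L n0 bound bound' P : a = a' -> C_CV_radius c = C_CV_radius c' ->
  (forall x w rt1 rt2 delta n, bound x w rt1 rt2 delta n = bound' x w rt2 rt1 delta n) ->
  Eset th a c S0 L n0 bound P -> Eset th a' c' S0 L n0 bound' P.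
Proof.
  intros <- Hc Hb [He [r1 [r2 [S [Hr1 [Hr2 [Hrr [HS [HSS H]]]]]]]]]. split; [exact He|]. exists r2, r1, S.
  split; [exact Hr2|]. split; [exact Hr1|]. split; [rewrite <- Hc, Rmult_comm; exact Hrr|]. split; [exact HS|]. split; [exact HSS|].
  intros rt1 rt2 delta H1 H2 H3 H4 H5. destruct (H rt2 rt1 delta H2 H1 H3 H5 H4) as [K [HK HB]]. exists K. split; [exact HK|].
  intros x w Hx Hw k. rewrite <- Hb. apply HB; [exact Hx|]. rewrite Rmult_comm. exact Hw.
Qed.

(** * The bijection for the direction of - lambda *)

Section Minus.
Context (lambda a1 a2 : C) (c : nat -> C) (th : R) (S0 : C -> Prop) (L : C -> C).
Local Notation c' := (fun k => - c k)%C.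

(** The exchange also reverses the order of the two components, so the first set for [- lambda]
    corresponds to the second set for [lambda]. *)
Lemma E1_swap P : E1_minus th lambda a1 a2 c S0 L P <-> E2_plus th (- lambda) a2 a1 c' S0 L P.
Proof.
  split; apply Eset_swap; try (apply Cplus_comm); try apply C_CV_radius_opp; try (symmetry; apply C_CV_radius_opp);
  intros x w rt1 rt2 delta n; rewrite f1_swap, (Cplus_comm a2 a1); reflexivity.
Qed.

Lemma E2_swap P : E2_minus th lambda a1 a2 c S0 L P <-> E1_plus th (- lambda) a2 a1 c' S0 L P.
Proof.
  split; apply Eset_swap; try (apply Cplus_comm); try apply C_CV_radius_opp; try (symmetry; apply C_CV_radius_opp);
  intros x w rt1 rt2 delta n; rewrite f1_swap; reflexivity.
Qed.

Lemma opp_opp_c : (fun k => - - c k)%C = c.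
Proof. extensionality k. ring. Qed.

Lemma Psi_swap P h z : Psi_minus P h z <-> Psi_plus (snd P, fst P) (swap2 h) (swap2 z).
Proof.
  destruct h as [h1 h2], z as [z1 z2]. unfold Psi_minus, Psi_plus. simpl. rewrite (Cmult_comm h2 h1). tauto.
Qed.

Lemma expansion_swap psi P : expansion_of Psi_minus th lambda a1 a2 c S0 L psi P <->
  expansion_of Psi_plus th (- lambda) a2 a1 c' S0 L (swap_conj psi) (snd P, fst P).
Proof.
  split; intros [E1 [E2 H]]; (split; [exact E2|split; [exact E1|]]); apply conjugate_swap in H.
  - eapply conjugate_is_ext; [|exact H]. intros h z Hz. apply Psi_swap in Hz. destruct h, z. exact Hz.
  - rewrite swap_conj_swap_conj, opp_opp_c in H. replace (- - lambda)%C with lambda in H by ring. eapply conjugate_is_ext; [|exact H].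
    intros h z Hz. now apply Psi_swap.
Qed.

Lemma Lambda_swap_iff psi : Lambda th lambda a1 a2 c psi <-> Lambda th (- lambda) a2 a1 c' (swap_conj psi).
Proof.
  split; intros H; apply Lambda_swap in H; [exact H|].
  rewrite swap_conj_swap_conj, opp_opp_c in H. replace (- - lambda)%C with lambda in H by ring. exact H.
Qed.

Lemma bijection_swap :
  induces_bijection (germ_eq th) (Lambda th (- lambda) a2 a1 c')
    (fun P : eseq * eseq => E1_plus th (- lambda) a2 a1 c' S0 L (fst P) /\ E2_plus th (- lambda) a2 a1 c' S0 L (snd P))
    (expansion_of Psi_plus th (- lambda) a2 a1 c' S0 L) ->
  induces_bijection (germ_eq th) (Lambda th lambda a1 a2 c)
    (fun P : eseq * eseq => E1_minus th lambda a1 a2 c S0 L (fst P) /\ E2_minus th lambda a1 a2 c S0 L (snd P))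
    (expansion_of Psi_minus th lambda a1 a2 c S0 L).
Proof.
  intros [F [G1 [G2 [G3 G4]]]]. exists (fun psi => (snd (F (swap_conj psi)), fst (F (swap_conj psi)))). split; [|split; [|split]].
  - intros psi Hpsi P. apply Lambda_swap_iff in Hpsi. rewrite expansion_swap, (G1 _ Hpsi).
    destruct P as [P1 P2], (F (swap_conj psi)) as [Q1 Q2]. simpl. split; intros E; injection E as -> ->; reflexivity.
  - intros psi Hpsi. apply Lambda_swap_iff in Hpsi. destruct (G2 _ Hpsi) as [A B]. simpl. rewrite E1_swap, E2_swap. now split.
  - intros psi psi' Hpsi Hpsi'. apply Lambda_swap_iff in Hpsi. apply Lambda_swap_iff in Hpsi'. specialize (G3 _ _ Hpsi Hpsi').
    split.
    + intros E. rewrite <- (swap_conj_swap_conj psi), <- (swap_conj_swap_conj psi'). apply germ_eq_swap, G3.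
      destruct (F (swap_conj psi)), (F (swap_conj psi')). simpl in E. injection E as -> ->. reflexivity.
    + intros E. apply germ_eq_swap, G3 in E. now rewrite E.
  - intros [P1 P2] [H1 H2]. simpl in H1, H2. rewrite E1_swap in H1. rewrite E2_swap in H2.
    destruct (G4 (P2, P1) (conj H2 H1)) as [psi [Hpsi E]]. exists (swap_conj psi). split.
    + apply Lambda_swap_iff. now rewrite swap_conj_swap_conj.
    + rewrite swap_conj_swap_conj, E. reflexivity.
Qed.

End Minus.

Theorem proposition5p24
    (lambda a1 a2 : C) (c : nat -> C)
    (hlambda : lambda <> 0%C)
    (ha : 0 < Re (a1 + a2)%C)
    (hc0 : c 0%nat = 0%C)
    (hc : Rbar_lt 0 (C_CV_radius c))
    (theta_p theta_m : R)
    (htheta_p : is_arg theta_p lambda)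
    (htheta_m : is_arg theta_m (- lambda)%C)
    (S_p S_m : C -> Prop)
    (hS_p : AS theta_p PI S_p)
    (hS_m : AS theta_m PI S_m)
    (L_p L_m : C -> C)
    (hL_p : log_branch S_p L_p)
    (hL_m : log_branch S_m L_m) :
  induces_bijection (germ_eq theta_p)
    (Lambda theta_p lambda a1 a2 c)
    (fun P : eseq * eseq =>
       E1_plus theta_p lambda a1 a2 c S_p L_p (fst P) /\
       E2_plus theta_p lambda a1 a2 c S_p L_p (snd P))
    (expansion_of Psi_plus theta_p lambda a1 a2 c S_p L_p)
  /\
  induces_bijection (germ_eq theta_m)
    (Lambda theta_m lambda a1 a2 c)
    (fun P : eseq * eseq =>
       E1_minus theta_m lambda a1 a2 c S_m L_m (fst P) /\
       E2_minus theta_m lambda a1 a2 c S_m L_m (snd P))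
    (expansion_of Psi_minus theta_m lambda a1 a2 c S_m L_m).
Proof.
  split.
  - now apply bijection_plus.
  - apply bijection_swap, bijection_plus; [apply htheta_m|now rewrite Cplus_comm|rewrite hc0; ring|exact htheta_m|exact hS_m|exact hL_m|now rewrite C_CV_radius_opp].
Qed.
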